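(* The systems $\mathbf{TTL}$ and $\mathbf{ITTL}$ are decidable: there is an algorithm which, given a classical (respectively, intuitionistic) tensor sequent, decides whether it is derivable in $\mathbf{TTL}$ (respectively, in $\mathbf{ITTL}$).
   Context: Classical tensor language. Fix an infinite set $\mathit{Ind}$ of indices and a set $\mathit{Lit}_+$ of positive literals, each $p\in\mathit{Lit}_+$ having a valency $v(p)\in\mathbb N^2$. Put $\mathit{Lit}_-=\{\overline p\mid p\in\mathit{Lit}_+\}$, $\overline{\overline p}=p$, $\mathit{Lit}=\mathit{Lit}_+\cup\mathit{Lit}_-$, $\mathit{Prop}=\mathit{Lit}\cup\{\mathbf 1,\bot\}$, with $v(\overline p)=(m,n)$ if $v(p)=(n,m)$, $v(\mathbf 1)=v(\bot)=(1,1)$, $\overline{\mathbf 1}=\bot$, $\overline{\bot}=\mathbf 1$. Atomic formulas are the expressions $p^{i_1\ldots i_m}_{j_1\ldots j_n}$ with $p\in\mathit{Prop}$, $v(p)=(m,n)$ and pairwise distinct indices. (Classical tensor) formulas are built from atomic ones by the binary connectives $\otimes,\wp$, subject to the condition that any index has at most one upper and at most one lower occurrence in the formula. Duality: $\overline{p^{i_1\ldots i_m}_{j_1\ldots j_n}}=\overline p^{\,j_n\ldots j_1}_{\,i_m\ldots i_1}$, $\overline{A\otimes B}=\overline B\wp\overline A$, $\overline{A\wp B}=\overline B\otimes\overline A$. An index of a formula is free if it occurs exactly once, otherwise bound. $FI^\bullet(A)$, $FI_\bullet(A)$ are the sets of free upper, respectively lower, indices of $A$. $A^{[i/j]}$ (respectively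 $A_{[i/j]}$) is $A$ with $i$ substituted for the free upper (respectively lower) occurrence of $j$; it is implicitly assumed that $i$ does not occur in $A$. A (classical tensor) context is a finite unordered multiset $\Gamma$ of formulas such that $FI^\bullet(A)\cap FI^\bullet(B)=FI_\bullet(A)\cap FI_\bullet(B)=\emptyset$ for any two distinct occurrences $A,B$ in $\Gamma$; $FI^\bullet(\Gamma)$, $FI_\bullet(\Gamma)$ are the unions over formulas of $\Gamma$. A (classical tensor) sequent is $\vdash\Gamma$ where $\Gamma$ is a context with $FI^\bullet(\Gamma)=FI_\bullet(\Gamma)$. Rules of $\mathbf{TTL}$ (all expressions are required to be well-formed sequents): (Id) $\vdash\overline A,A$ for $A$ atomic; (Cut) from $\vdash\Gamma,A$ and $\vdash\overline A,\Delta$ infer $\vdash\Gamma,\Delta$; ($\otimes$) from $\vdash\Gamma,A$ and $\vdash B,\Delta$ infer $\vdash\Gamma,A\otimes B,\Delta$; ($\wp$) from $\vdash\Gamma,A,B$ infer $\vdash\Gamma,A\wp B$; ($\bot^\to$) from $\vdash\Gamma,A$ with $j\in FI^\bullet(A)$ infer $\vdash\Gamma,\bot^j_i,A^{[i/j]}$; ($\bot_\leftarrow$) from $\vdash\Gamma,A,\bot^j_i$ with $j\in FI_\bullet(A)$ infer $\vdash\Gamma,A_{[i/j]}$; in the last two rules $i\notin FI^\bullet(A)\cup FI_\bullet(A)$. Intuitionistic tensor language over a set $\mathit{Lit}$ of literals with valencies. Formulas are built from atomic formulas $p^{i_1\ldots i_m}_{j_1\ldots j_n}$, $p\in\mathit{Lit}\cup\{\mathbf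 1\}$, $v(p)=(m,n)$, $v(\mathbf 1)=(1,1)$ (indices pairwise distinct), by $\otimes$ and $\multimap$. Polarity of index occurrences: in atomic formulas upper indices have upper polarity and lower indices lower polarity; $\otimes$ preserves polarities; in $A\multimap B$ polarities of occurrences in $B$ are preserved and those in $A$ are reversed. A formula must have at most one upper polarity and at most one lower polarity occurrence of any index. An index of an intuitionistic formula is free if it occurs exactly once, otherwise bound; $FI^\bullet(A)$, $FI_\bullet(A)$ are the sets of free indices of $A$ whose occurrence has upper, respectively lower, polarity; $A^{[i/j]}$ (respectively $A_{[i/j]}$) is $A$ with $i$ substituted for the free upper polarity (respectively lower polarity) occurrence of $j$, where it is implicitly assumed that $i$ does not occur in $A$. Intuitionistic contexts are finite multisets $\Gamma$ of intuitionistic formulas such that $FI^\bullet(A)\cap FI^\bullet(B)=FI_\bullet(A)\cap FI_\bullet(B)=\emptyset$ for any two distinct occurrences $A,B$ in $\Gamma$; $FI^\bullet(\Gamma)$, $FI_\bullet(\Gamma)$ are the unions over formulas of $\Gamma$. An intuitionistic sequent is $\Gamma\vdash A$ with $FI^\bullet(\Gamma)\cap FI_\bullet(A)=FI_\bullet(\Gamma)\cap FI^\bullet(A)=\emptyset$ and $FI^\bullet(\Gamma)\cup FI_\bullet(A)=FI_\bullet(\Gamma)\cup FI^\bullet(A)$. Rules of $\mathbf{ITTL}$ (all expressions are required to be well-formed sequents): (Id) $A\vdash A$ for $A$ atomic; (Cut) from $\Gamma\vdash A$ and $A,\Delta\vdash B$ infer $\Gamma,\Delta\vdash B$; (L$\multimap$)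 from $\Gamma\vdash A$ and $B,\Delta\vdash C$ infer $\Gamma,A\multimap B,\Delta\vdash C$; (R$\multimap$) from $\Gamma,A\vdash B$ infer $\Gamma\vdash A\multimap B$; (L$\otimes$) from $\Gamma,A,B\vdash C$ infer $\Gamma,A\otimes B\vdash C$; (R$\otimes$) from $\Gamma\vdash A$ and $\Delta\vdash B$ infer $\Gamma,\Delta\vdash A\otimes B$; (L$1_\to$) from $\Gamma,A\vdash B$, $j\in FI_\bullet(A)$, infer $\Gamma,A_{[i/j]},\mathbf 1^i_j\vdash B$; (R$1^\to$) from $\Gamma\vdash A$, $j\in FI^\bullet(A)$, infer $\mathbf 1^i_j,\Gamma\vdash A^{[i/j]}$; (L$1^\leftarrow$) from $\Gamma,\mathbf 1^i_j,A\vdash B$, $j\in FI^\bullet(A)$, infer $\Gamma,A^{[i/j]}\vdash B$; (R$1_\leftarrow$) from $\Gamma,\mathbf 1^i_j\vdash A$, $j\in FI_\bullet(A)$, infer $\Gamma\vdash A_{[i/j]}$; in the last four rules $i\notin FI^\bullet(A)\cup FI_\bullet(A)$. *)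

(* Defs.v *)
From HB Require Import structures.
From mathcomp Require Import all_boot.

Set Implicit Arguments.
Unset Strict Implicit.
Unset Printing Implicit Defensive.

Definition infinite_eqType (T : eqType) : Prop :=
  forall s : seq T, exists x : T, x \notin s.

Definition disjoint_seq (T : eqType) (s t : seq T) : bool :=
  ~~ has (mem s) t.

(** * Algorithms: the weak call-by-value lambda-calculus

    The metatheory admits classical choice, so decidability cannot be expressed
    by a boolean-valued Rocq function. An algorithm is a closed term of the
    pure lambda-calculus (de Bruijn indices) under weak call-by-value
    evaluation, a Turing-complete model; data are Scott-encoded. *)

Inductive lterm : Type :=
| LVar of nat
| LApp of lterm & lterm
| LLam of lterm.

Fixpoint lbound (k : nat) (t : lterm) : bool :=
  match t with
  | LVar n => n < k
  | LApp t1 t2 => lbound k t1 && lbound k t2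
  | LLam t1 => lbound k.+1 t1
  end.

Definition lclosed (t : lterm) : bool := lbound 0 t.

(* No index is shifted: this is substitution only for closed u, the only case
   that arises when a closed term is evaluated. *)
Fixpoint lsubst (t : lterm) (k : nat) (u : lterm) : lterm :=
  match t with
  | LVar n => if n == k then u else LVar n
  | LApp t1 t2 => LApp (lsubst t1 k u) (lsubst t2 k u)
  | LLam t1 => LLam (lsubst t1 k.+1 u)
  end.

Inductive leval : lterm -> lterm -> Prop :=
| leval_lam t : leval (LLam t) (LLam t)
| leval_app t1 t2 b u w :
    leval t1 (LLam b) -> leval t2 u -> leval (lsubst b 0 u) w ->
    leval (LApp t1 t2) w.

(* The c-th of k constructors, applied to the closed terms args:
   fun x_0 ... x_(k-1) => x_c args. *)
Definition scott (k c : nat) (args : seq lterm) : lterm :=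
  iter k LLam (foldl LApp (LVar (k - c.+1)) args).

Definition enc_bool (b : bool) : lterm :=
  if b then scott 2 0 [::] else scott 2 1 [::].

Fixpoint enc_nat (n : nat) : lterm :=
  if n is n'.+1 then scott 2 1 [:: enc_nat n'] else scott 2 0 [::].

Fixpoint enc_seq (T : Type) (enc : T -> lterm) (s : seq T) : lterm :=
  if s is x :: s' then scott 2 1 [:: enc x; enc_seq enc s']
  else scott 2 0 [::].

(* One closed term decides P for all inputs x satisfying D; codes x c says that
   c is a code of x, and the answer must be correct for every code. *)
Definition L_decidable (X : Type) (codes : X -> lterm -> Prop)
    (D P : X -> Prop) : Prop :=
  exists2 t : lterm, lclosed t &
    forall (x : X) (c : lterm), D x -> codes x c ->
      exists2 b : bool, P x <-> b & leval (LApp t c) (enc_bool b).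

(** * Classical tensor language *)

Inductive cprop (Lp : Type) : Type :=
| CPos of Lp
| CNeg of Lp
| COne
| CBot.

Arguments COne {Lp}.
Arguments CBot {Lp}.

(* CAtom p u l: upper indices u, lower indices l. These are raw formulas; the
   conditions on indices are in cform_wf. *)
Inductive cform (Ind Lp : Type) : Type :=
| CAtom of cprop Lp & seq Ind & seq Ind
| CTens of cform Ind Lp & cform Ind Lp
| CPar of cform Ind Lp & cform Ind Lp.

Arguments CAtom {Ind Lp}.

Lemma cform_comparable (Ind Lp : eqType) : comparable (cform Ind Lp).
Proof.
move=> A B; rewrite /decidable; decide equality; try exact: eq_comparable.
by decide equality; exact: eq_comparable.
Qed.

HB.instance Definition _ (Ind Lp : eqType) : hasDecEq (cform Ind Lp) :=
  comparableMixin (@cform_comparable Ind Lp).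

Definition cval (Lp : Type) (v : Lp -> nat * nat) (p : cprop Lp) : nat * nat :=
  match p with
  | CPos q => v q
  | CNeg q => ((v q).2, (v q).1)
  | COne | CBot => (1, 1)
  end.

Definition cprop_dual (Lp : Type) (p : cprop Lp) : cprop Lp :=
  match p with
  | CPos q => CNeg q
  | CNeg q => CPos q
  | COne => CBot
  | CBot => COne
  end.

Fixpoint cdual (Ind Lp : Type) (A : cform Ind Lp) : cform Ind Lp :=
  match A with
  | CAtom p u l => CAtom (cprop_dual p) (rev l) (rev u)
  | CTens A B => CPar (cdual B) (cdual A)
  | CPar A B => CTens (cdual B) (cdual A)
  end.

Definition is_catom (Ind Lp : Type) (A : cform Ind Lp) : bool :=
  if A is CAtom _ _ _ then true else false.

(* All upper (b = true) or lower (b = false) index occurrences. *)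
Fixpoint coccs (Ind Lp : Type) (b : bool) (A : cform Ind Lp) : seq Ind :=
  match A with
  | CAtom _ u l => if b then u else l
  | CTens A B | CPar A B => coccs b A ++ coccs b B
  end.

Definition cindices (Ind Lp : Type) (A : cform Ind Lp) : seq Ind :=
  coccs true A ++ coccs false A.

Fixpoint catoms_wf (Ind : eqType) (Lp : Type) (v : Lp -> nat * nat)
    (A : cform Ind Lp) : bool :=
  match A with
  | CAtom p u l => ((size u, size l) == cval v p) && uniq (u ++ l)
  | CTens A B | CPar A B => catoms_wf v A && catoms_wf v B
  end.

Definition cform_wf (Ind : eqType) (Lp : Type) (v : Lp -> nat * nat)
    (A : cform Ind Lp) : bool :=
  [&& catoms_wf v A, uniq (coccs true A) & uniq (coccs false A)].

(* Free upper (b = true) or lower (b = false) indices; in a well-formed formula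
   an index occurs exactly once iff it occurs on one side only. *)
Definition cfree (Ind : eqType) (Lp : Type) (b : bool) (A : cform Ind Lp) :
    seq Ind :=
  [seq i <- coccs b A | i \notin coccs (~~ b) A].

(* csubst true i j A is A^[i/j]; csubst false i j A is A_[i/j]. *)
Fixpoint csubst (Ind : eqType) (Lp : Type) (b : bool) (i j : Ind)
    (A : cform Ind Lp) : cform Ind Lp :=
  let f k := if k == j then i else k in
  match A with
  | CAtom p u l => if b then CAtom p (map f u) l else CAtom p u (map f l)
  | CTens A B => CTens (csubst b i j A) (csubst b i j B)
  | CPar A B => CPar (csubst b i j A) (csubst b i j B)
  end.

(* Contexts are multisets: lists, with derivability closed under perm_eq. *)
Definition ccontext (Ind : eqType) (Lp : Type) (v : Lp -> nat * nat)
    (G : seq (cform Ind Lp)) : bool :=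
  all (cform_wf v) G &&
  pairwise (fun A B => disjoint_seq (cfree true A) (cfree true B) &&
                       disjoint_seq (cfree false A) (cfree false B)) G.

Definition cfree_ctx (Ind : eqType) (Lp : Type) (b : bool)
    (G : seq (cform Ind Lp)) : seq Ind :=
  flatten (map (cfree b) G).

Definition csequent (Ind : eqType) (Lp : Type) (v : Lp -> nat * nat)
    (G : seq (cform Ind Lp)) : Prop :=
  ccontext v G /\ cfree_ctx true G =i cfree_ctx false G.

(* In the last two rules, i \notin cindices A covers both the proviso that i is
   not free in A and the convention that i does not occur in A. *)
Inductive TTL (Ind Lp : eqType) (v : Lp -> nat * nat) :
    seq (cform Ind Lp) -> Prop :=
| TTL_perm G D : perm_eq G D -> TTL v G -> TTL v D
| TTL_id A :
    is_catom A -> csequent v [:: cdual A; A] -> TTL v [:: cdual A; A]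
| TTL_cut G D A :
    TTL v (A :: G) -> TTL v (cdual A :: D) ->
    csequent v (G ++ D) -> TTL v (G ++ D)
| TTL_tens G D A B :
    TTL v (A :: G) -> TTL v (B :: D) ->
    csequent v (CTens A B :: G ++ D) -> TTL v (CTens A B :: G ++ D)
| TTL_par G A B :
    TTL v [:: A, B & G] ->
    csequent v (CPar A B :: G) -> TTL v (CPar A B :: G)
| TTL_bot_up G A i j :
    TTL v (A :: G) -> j \in cfree true A -> i \notin cindices A ->
    csequent v [:: CAtom CBot [:: j] [:: i], csubst true i j A & G] ->
    TTL v [:: CAtom CBot [:: j] [:: i], csubst true i j A & G]
| TTL_bot_down G A i j :
    TTL v [:: CAtom CBot [:: j] [:: i], A & G] ->
    j \in cfree false A -> i \notin cindices A ->
    csequent v (csubst false i j A :: G) -> TTL v (csubst false i j A :: G).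

Fixpoint clits (Ind Lp : Type) (A : cform Ind Lp) : seq Lp :=
  match A with
  | CAtom (CPos q) _ _ | CAtom (CNeg q) _ _ => [:: q]
  | CAtom COne _ _ | CAtom CBot _ _ => [::]
  | CTens A B | CPar A B => clits A ++ clits B
  end.

Definition enc_cprop (Lp : Type) (nL : Lp -> nat) (p : cprop Lp) : lterm :=
  match p with
  | CPos q => scott 4 0 [:: enc_nat (nL q)]
  | CNeg q => scott 4 1 [:: enc_nat (nL q)]
  | COne => scott 4 2 [::]
  | CBot => scott 4 3 [::]
  end.

Fixpoint enc_cform (Ind Lp : Type) (nI : Ind -> nat) (nL : Lp -> nat)
    (A : cform Ind Lp) : lterm :=
  let ind k := enc_nat (nI k) in
  match A with
  | CAtom p u l =>
      scott 3 0 [:: enc_cprop nL p; enc_seq ind u; enc_seq ind l]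
  | CTens A B => scott 3 1 [:: enc_cform nI nL A; enc_cform nI nL B]
  | CPar A B => scott 3 2 [:: enc_cform nI nL A; enc_cform nI nL B]
  end.

(* Ind and Lp are arbitrary, possibly uncountable, sets: a sequent is presented
   by naming the indices and the literals occurring in it by numerals, distinct
   symbols receiving distinct names. *)
Definition ccodes (Ind Lp : eqType) (G : seq (cform Ind Lp)) (c : lterm) :
    Prop :=
  exists (nI : Ind -> nat) (nL : Lp -> nat),
    [/\ {in flatten (map (@cindices Ind Lp) G) &, injective nI},
        {in flatten (map (@clits Ind Lp) G) &, injective nL} &
        c = enc_seq (enc_cform nI nL) G].

(** * Intuitionistic tensor language *)

Inductive iprop (L : Type) : Type :=
| ILit of L
| IOne.

Arguments IOne {L}.

Inductive iform (Ind L : Type) : Type :=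
| IAtom of iprop L & seq Ind & seq Ind
| ITens of iform Ind L & iform Ind L
| ILolli of iform Ind L & iform Ind L.

Arguments IAtom {Ind L}.

Lemma iform_comparable (Ind L : eqType) : comparable (iform Ind L).
Proof.
move=> A B; rewrite /decidable; decide equality; try exact: eq_comparable.
by decide equality; exact: eq_comparable.
Qed.

HB.instance Definition _ (Ind L : eqType) : hasDecEq (iform Ind L) :=
  comparableMixin (@iform_comparable Ind L).

Definition ival (L : Type) (v : L -> nat * nat) (p : iprop L) : nat * nat :=
  if p is ILit q then v q else (1, 1).

Definition is_iatom (Ind L : Type) (A : iform Ind L) : bool :=
  if A is IAtom _ _ _ then true else false.

(* All index occurrences of upper (b = true) or lower (b = false) polarity. *)
Fixpoint ioccs (Ind L : Type) (b : bool) (A : iform Ind L) : seq Ind :=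
  match A with
  | IAtom _ u l => if b then u else l
  | ITens A B => ioccs b A ++ ioccs b B
  | ILolli A B => ioccs (~~ b) A ++ ioccs b B
  end.

Definition iindices (Ind L : Type) (A : iform Ind L) : seq Ind :=
  ioccs true A ++ ioccs false A.

Fixpoint iatoms_wf (Ind : eqType) (L : Type) (v : L -> nat * nat)
    (A : iform Ind L) : bool :=
  match A with
  | IAtom p u l => ((size u, size l) == ival v p) && uniq (u ++ l)
  | ITens A B | ILolli A B => iatoms_wf v A && iatoms_wf v B
  end.

Definition iform_wf (Ind : eqType) (L : Type) (v : L -> nat * nat)
    (A : iform Ind L) : bool :=
  [&& iatoms_wf v A, uniq (ioccs true A) & uniq (ioccs false A)].

Definition ifree (Ind : eqType) (L : Type) (b : bool) (A : iform Ind L) :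
    seq Ind :=
  [seq i <- ioccs b A | i \notin ioccs (~~ b) A].

(* The flag b is a polarity, hence it flips on the left of ILolli. *)
Fixpoint isubst (Ind : eqType) (L : Type) (b : bool) (i j : Ind)
    (A : iform Ind L) : iform Ind L :=
  let f k := if k == j then i else k in
  match A with
  | IAtom p u l => if b then IAtom p (map f u) l else IAtom p u (map f l)
  | ITens A B => ITens (isubst b i j A) (isubst b i j B)
  | ILolli A B => ILolli (isubst (~~ b) i j A) (isubst b i j B)
  end.

Definition icontext (Ind : eqType) (L : Type) (v : L -> nat * nat)
    (G : seq (iform Ind L)) : bool :=
  all (iform_wf v) G &&
  pairwise (fun A B => disjoint_seq (ifree true A) (ifree true B) &&
                       disjoint_seq (ifree false A) (ifree false B)) G.

Definition ifree_ctx (Ind : eqType) (L : Type) (b : bool)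
    (G : seq (iform Ind L)) : seq Ind :=
  flatten (map (ifree b) G).

Definition isequent (Ind : eqType) (L : Type) (v : L -> nat * nat)
    (G : seq (iform Ind L)) (A : iform Ind L) : Prop :=
  [/\ icontext v G, iform_wf v A,
      disjoint_seq (ifree_ctx true G) (ifree false A),
      disjoint_seq (ifree_ctx false G) (ifree true A) &
      ifree_ctx true G ++ ifree false A =i ifree_ctx false G ++ ifree true A].

Inductive ITTL (Ind L : eqType) (v : L -> nat * nat) :
    seq (iform Ind L) -> iform Ind L -> Prop :=
| ITTL_perm G D A : perm_eq G D -> ITTL v G A -> ITTL v D A
| ITTL_id A : is_iatom A -> isequent v [:: A] A -> ITTL v [:: A] A
| ITTL_cut G D A B :
    ITTL v G A -> ITTL v (A :: D) B ->
    isequent v (G ++ D) B -> ITTL v (G ++ D) B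
| ITTL_lolliL G D A B C :
    ITTL v G A -> ITTL v (B :: D) C ->
    isequent v (ILolli A B :: G ++ D) C -> ITTL v (ILolli A B :: G ++ D) C
| ITTL_lolliR G A B :
    ITTL v (A :: G) B ->
    isequent v G (ILolli A B) -> ITTL v G (ILolli A B)
| ITTL_tensL G A B C :
    ITTL v [:: A, B & G] C ->
    isequent v (ITens A B :: G) C -> ITTL v (ITens A B :: G) C
| ITTL_tensR G D A B :
    ITTL v G A -> ITTL v D B ->
    isequent v (G ++ D) (ITens A B) -> ITTL v (G ++ D) (ITens A B)
| ITTL_oneL_in G A B i j :
    ITTL v (A :: G) B -> j \in ifree false A -> i \notin iindices A ->
    isequent v [:: isubst false i j A, IAtom IOne [:: i] [:: j] & G] B ->
    ITTL v [:: isubst false i j A, IAtom IOne [:: i] [:: j] & G] B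
| ITTL_oneR_in G A i j :
    ITTL v G A -> j \in ifree true A -> i \notin iindices A ->
    isequent v (IAtom IOne [:: i] [:: j] :: G) (isubst true i j A) ->
    ITTL v (IAtom IOne [:: i] [:: j] :: G) (isubst true i j A)
| ITTL_oneL_out G A B i j :
    ITTL v [:: IAtom IOne [:: i] [:: j], A & G] B ->
    j \in ifree true A -> i \notin iindices A ->
    isequent v (isubst true i j A :: G) B ->
    ITTL v (isubst true i j A :: G) B
| ITTL_oneR_out G A i j :
    ITTL v (IAtom IOne [:: i] [:: j] :: G) A ->
    j \in ifree false A -> i \notin iindices A ->
    isequent v G (isubst false i j A) -> ITTL v G (isubst false i j A).

Fixpoint ilits (Ind L : Type) (A : iform Ind L) : seq L :=
  match A with
  | IAtom (ILit q) _ _ => [:: q]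
  | IAtom IOne _ _ => [::]
  | ITens A B | ILolli A B => ilits A ++ ilits B
  end.

Definition enc_iprop (L : Type) (nL : L -> nat) (p : iprop L) : lterm :=
  if p is ILit q then scott 2 0 [:: enc_nat (nL q)] else scott 2 1 [::].

Fixpoint enc_iform (Ind L : Type) (nI : Ind -> nat) (nL : L -> nat)
    (A : iform Ind L) : lterm :=
  let ind k := enc_nat (nI k) in
  match A with
  | IAtom p u l =>
      scott 3 0 [:: enc_iprop nL p; enc_seq ind u; enc_seq ind l]
  | ITens A B => scott 3 1 [:: enc_iform nI nL A; enc_iform nI nL B]
  | ILolli A B => scott 3 2 [:: enc_iform nI nL A; enc_iform nI nL B]
  end.

(* Sequents as single inputs: the pair (G, A) stands for G |- A. *)
Definition icodes (Ind L : eqType) (S : seq (iform Ind L) * iform Ind L)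
    (c : lterm) : Prop :=
  exists (nI : Ind -> nat) (nL : L -> nat),
    [/\ {in flatten (map (@iindices Ind L) (S.2 :: S.1)) &, injective nI},
        {in flatten (map (@ilits Ind L) (S.2 :: S.1)) &, injective nL} &
        c = scott 1 0 [:: enc_seq (enc_iform nI nL) S.1;
                          enc_iform nI nL S.2]].

(* Main.v *)
Require Import Defs.
From HB Require Import structures.
From mathcomp Require Import all_boot zify.
From mathcomp Require Import boolp.

Set Implicit Arguments.
Unset Strict Implicit.
Unset Printing Implicit Defensive.

(* Derivability is reduced to a cut-free calculus without the rules for bot that
   rename indices. Tag the formulas of a sequent by numbers, so that an index
   occurrence becomes a port; a sequent of TTL is then a list of tagged formulas
   together with a wiring that joins its free upper ports to its free lower ports.
   In this calculus an atom bot^j_i is a piece of wire, removed by joining its two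
   ends, tensor joins the wires of the indices it binds, and every rule read upwards
   decreases the formulas while leaving finitely many wirings to try.
   That TTL is contained in the wired calculus is cut elimination, obtained by
   interpreting a formula by the lists of formulas orthogonal to their duals, where
   orthogonal means derivable in the wired calculus. Conversely, a wired derivation
   is read back in TTL by giving every port a fresh name and every edge the formula
   bot that connects the two names; this uses only rules that preserve polarities,
   so on the image of ITTL it stays in ITTL, and ITTL is a conservative fragment.
   Search in the wired calculus depends on the indices only up to injective
   renaming, hence may be run on numerals; it is a composition of lambda-definable
   functions. *)

(** Backward search in TTL itself is unbounded even without Cut: read upwards, the rule that removes
    a bot invents a formula and an index, so two occurrences of one index may be separated by chains
    of bots of any length. A wiring forgets that length. It must not forget a chain that closes up:
    joining the two ends of one wire leaves a loop, which corresponds to a cyclic pair of bots, and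
    no rule discards it. Hence the value [None] of wires, and the counting of loops when a
    derivation is read back.

    Cut elimination is semantic because a syntactic one would have to compose wirings inside
    derivations. Orthogonality asks of the wired calculus only its rules and the invertibility of
    [D_bot]. The price is that interpretations must not depend on names, whence closures, in which
    indices are sent to wires, and the lemmas on renaming indices and wires.

    Decidability is a statement about a lambda-term, so its correctness proof may use classical
    principles and extensionality freely. *)

Ltac perm_counts a :=
  repeat match goal with
  | H : is_true (perm_eq _ _) |- _ =>
      move: (permP H a); clear H; rewrite ?count_cat /= ?count_cat /= ?count_cat /= ?count_cat /=
  end.

(** Two lists are permutations of each other when every predicate has the same count on both, so
    multiset goals become linear arithmetic over the counts supplied by the hypotheses. *)
Ltac perm_lia :=
  let a := fresh "a" in apply/permP => a; rewrite ?count_cat /= ?count_cat /= ?count_cat /= ?count_cat /=;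
  perm_counts a; clear;
  repeat match goal with
  | |- context [nat_of_bool (a ?x)] => move: (nat_of_bool (a x)) => ?
  | |- context [count a ?x] => move: (count a x) => ?
  end; clear a; lia.

Lemma perm_cons_mem (T : eqType) (x : T) s :
  x \in s -> exists s', perm_eq s (x :: s').
Proof. by move=> xs; exists (rem x s); apply: perm_to_rem. Qed.

Lemma perm_cons2 (T : eqType) (x y : T) s t :
  perm_eq (x :: s) (y :: t) -> x != y ->
  exists2 r, perm_eq s (y :: r) & perm_eq t (x :: r).
Proof.
move=> p xy.
have : y \in x :: s by rewrite (perm_mem p) mem_head.
rewrite inE eq_sym (negbTE xy) /= => /perm_cons_mem[r pr].
exists r => //.
have q : perm_eq (y :: t) (x :: y :: r).
  by rewrite perm_sym in p; apply: (perm_trans p); rewrite perm_cons.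
by rewrite -(perm_cons y); apply: (perm_trans q); perm_lia.
Qed.

Lemma perm_cat_cons (T : eqType) (x : T) s a b :
  perm_eq (a ++ b) (x :: s) ->
  (exists2 a', perm_eq a (x :: a') & perm_eq s (a' ++ b)) \/
  (exists2 b', perm_eq b (x :: b') & perm_eq s (a ++ b')).
Proof.
move=> p.
have : x \in a ++ b by rewrite (perm_mem p) mem_head.
rewrite mem_cat => /orP[] /perm_cons_mem[r pr]; [left|right]; exists r => //;
  rewrite -(perm_cons x); rewrite perm_sym in p; apply: (perm_trans p); perm_lia.
Qed.

(** * Wirings *)

Section Wiring.
Variable P : eqType.
Implicit Types (p q u l : P) (E F G R : seq (option (P * P))).

Definition ends (b : bool) E : seq P :=
  pmap (omap (fun e : P * P => if b then e.1 else e.2)) E.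

Lemma ends_cat b E F : ends b (E ++ F) = ends b E ++ ends b F.
Proof. exact: pmap_cat. Qed.

Lemma perm_ends b E F : perm_eq E F -> perm_eq (ends b E) (ends b F).
Proof. exact: perm_pmap. Qed.

(* Joins the upper end p to the lower end q; a wire whose two ends are joined
   becomes the loop None. *)
Inductive conn p q E F : Prop :=
| conn_loop R : perm_eq E (Some (p, q) :: R) -> perm_eq F (None :: R) ->
    conn p q E F
| conn_edge u l R :
    perm_eq E [:: Some (p, l), Some (u, q) & R] ->
    perm_eq F (Some (u, l) :: R) -> conn p q E F.

(** The intended ports are those bound by a tensor: each is an upper end in one half and a lower end
    in the other, and joining the two makes it internal. *)
Fixpoint conns (ps : seq P) E F : Prop :=
  if ps is p :: ps' then exists2 G, conn p p E G & conns ps' G F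
  else perm_eq E F.

Lemma conn_perm p q E E' F F' :
  perm_eq E E' -> perm_eq F F' -> conn p q E F -> conn p q E' F'.
Proof.
move=> pE pF [R|u l R] p1 p2.
  by apply: (@conn_loop _ _ _ _ R); perm_lia.
by apply: (@conn_edge _ _ _ _ u l R); perm_lia.
Qed.

Lemma conns_perm ps E E' F F' :
  perm_eq E E' -> perm_eq F F' -> conns ps E F -> conns ps E' F'.
Proof.
elim: ps E E' => [|p ps IH] E E' pE pF /=; first by move=> ?; perm_lia.
case=> G c cs; exists G; first exact: conn_perm c.
exact: IH cs.
Qed.

Lemma conn_frame p q G E F : conn p q E F -> conn p q (G ++ E) (G ++ F).
Proof.
case=> [R|u l R] p1 p2.
  by apply: (@conn_loop _ _ _ _ (G ++ R)); perm_lia.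
by apply: (@conn_edge _ _ _ _ u l (G ++ R)); perm_lia.
Qed.

Lemma conns_frame ps G E F : conns ps E F -> conns ps (G ++ E) (G ++ F).
Proof.
elim: ps E => [|p ps IH] E /=; first by move=> ?; rewrite perm_cat2l.
by case=> H c cs; exists (G ++ H); [exact: conn_frame|exact: IH].
Qed.

Lemma conn_ends b p q E F : conn p q E F ->
  perm_eq (ends b E) ((if b then p else q) :: ends b F).
Proof.
by case=> [R|u l R] /(perm_ends b) p1 /(perm_ends b); rewrite /= in p1 *;
  case: b p1 => p1 p2; perm_lia.
Qed.

Lemma conns_ends b ps E F : conns ps E F -> perm_eq (ends b E) (ps ++ ends b F).
Proof.
elim: ps E => [|p ps IH] E /=; first exact: perm_ends.
case=> G /(conn_ends b) c /IH cs; rewrite if_same in c; perm_lia.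
Qed.

Lemma mem_ends b p E : p \in ends b E ->
  exists q, Some (if b then (p, q) else (q, p)) \in E.
Proof.
elim: E => //= -[[u l]|] E IH /=; last first.
  by case/IH=> q ?; exists q; rewrite inE orbC; apply/orP; left.
rewrite inE => /orP[/eqP ->|/IH[q qE]]; last first.
  by exists q; rewrite inE qE orbT.
by case: b {IH}; [exists l|exists u]; rewrite mem_head.
Qed.

Lemma conn_exists p q E : p \in ends true E -> q \in ends false E ->
  exists F, conn p q E F.
Proof.
move=> /mem_ends[l pl] /mem_ends[u uq].
have [R pR] := perm_cons_mem pl.
move: uq; rewrite (perm_mem pR) inE => /orP[/eqP[ep eq]|].
  by exists (None :: R); apply: (@conn_loop _ _ _ _ R) => //; rewrite eq.
case/perm_cons_mem=> S pS; exists (Some (u, l) :: S).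
apply: (@conn_edge _ _ _ _ u l S) => //.
by apply: (perm_trans pR); rewrite perm_cons.
Qed.

Definition simple E := uniq (ends true E) && uniq (ends false E).

Lemma simple_perm E F : perm_eq E F -> simple E = simple F.
Proof. by move=> p; rewrite /simple !(perm_uniq (perm_ends _ p)). Qed.

Lemma simpleP u l u' l' E : simple (Some (u, l) :: E) -> Some (u', l') \in E ->
  (u != u') /\ (l != l').
Proof.
move=> s /perm_cons_mem[R pR].
have := s; rewrite (@simple_perm _ [:: Some (u, l), Some (u', l') & R]); last first.
  by rewrite perm_cons.
case/andP => /= /andP[+ _] /andP[+ _].
by rewrite !inE !negb_or => /andP[-> _] /andP[-> _].
Qed.

Lemma perm_edge u l u' l' E R : simple E ->
  perm_eq E (Some (u, l) :: R) -> Some (u', l') \in E ->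
  (u = u' \/ l = l') -> u = u' /\ l = l'.
Proof.
move=> s p; rewrite (perm_mem p) inE => /orP[/eqP[-> ->] //|].
rewrite (simple_perm p) in s => /(simpleP s)[/eqP n1 /eqP n2].
by case.
Qed.

Lemma conn_simple p q E F : conn p q E F -> simple E -> simple F.
Proof.
move=> c /andP[]; rewrite (perm_uniq (conn_ends true c)).
rewrite (perm_uniq (conn_ends false c)) /= => /andP[_ ?] /andP[_ ?].
exact/andP.
Qed.

(** When no port is used twice, the edge leaving [p] and the edge reaching [q] are determined; so
    the loop case and the edge case exclude each other and the remainders agree. *)
Lemma conn_det p q E F G : simple E -> conn p q E F -> conn p q E G ->
  perm_eq F G.
Proof.
have loop_edge R u l R' : simple E -> perm_eq E (Some (p, q) :: R) ->
    perm_eq E [:: Some (p, l), Some (u, q) & R'] -> False.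
  move=> s p1 p2.
  have m1 : Some (p, l) \in E by rewrite (perm_mem p2) mem_head.
  have [_ e1] := perm_edge s p1 m1 (or_introl erefl).
  have m2 : Some (u, q) \in E by rewrite (perm_mem p2) !inE eqxx orbT.
  have [e2 _] := perm_edge s p1 m2 (or_intror erefl).
  subst; have := s; rewrite (simple_perm p2) => s'.
  by have [/eqP] := simpleP s' (mem_head _ _).
move=> s [R|u l R] p1 p2 [R'|u' l' R'] p3 p4.
- by perm_lia.
- by case: (loop_edge _ _ _ _ s p1 p3).
- by case: (loop_edge _ _ _ _ s p3 p1).
have m1 : Some (p, l') \in E by rewrite (perm_mem p3) mem_head.
have [_ e1] := perm_edge s p1 m1 (or_introl erefl).
have m2 : Some (u', q) \in E by rewrite (perm_mem p3) !inE eqxx orbT.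
have p1' : perm_eq E [:: Some (u, q), Some (p, l) & R] by perm_lia.
have [e2 _] := perm_edge s p1' m2 (or_intror erefl).
by subst; perm_lia.
Qed.

(** The two joins touch at most four edges, and the cases differ in how many of these coincide. If
    they share one edge, both orders leave a single edge running through all of them. If they share
    both, either join leaves one edge whose ends are the other pair, and the second join closes the
    loop. *)
Lemma conn_diamond p q p' q' E F G : simple E -> p != p' -> q != q' ->
  conn p q E F -> conn p' q' E G ->
  exists2 H, conn p' q' F H & conn p q G H.
Proof.
have sym E1 F1 G1 a b c d (D := fun H => conn c d F1 H /\ conn a b G1 H) :
    (exists2 H, conn a b G1 H & conn c d F1 H) ->
    exists2 H, conn c d F1 H & conn a b G1 H.
  by case=> H; exists H.
have mixed E1 F1 G1 R a b c d u l R' : simple E1 -> a != c -> b != d ->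
    perm_eq E1 (Some (a, b) :: R) -> perm_eq F1 (None :: R) ->
    perm_eq E1 [:: Some (c, l), Some (u, d) & R'] ->
    perm_eq G1 (Some (u, l) :: R') ->
    exists2 H, conn c d F1 H & conn a b G1 H.
  move=> s nac nbd p1 p2 p3 p4.
  have m : Some (a, b) \in E1 by rewrite (perm_mem p1) mem_head.
  have [S pS] : exists S, perm_eq R' (Some (a, b) :: S).
    move: m; rewrite (perm_mem p3) !inE => /orP[/eqP[ac _]|/orP[/eqP[_ bd]|]].
    - by rewrite ac eqxx in nac.
    - by rewrite bd eqxx in nbd.
    - exact: perm_cons_mem.
  have pR : perm_eq R [:: Some (c, l), Some (u, d) & S].
    by rewrite -(perm_cons (Some (a, b))); perm_lia.
  exists [:: None, Some (u, l) & S].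
    by apply: (@conn_edge _ _ _ _ u l (None :: S)); perm_lia.
  by apply: (@conn_loop _ _ _ _ (Some (u, l) :: S)); perm_lia.
move=> s np nq [R|u l R] p1 p2 [R'|u' l' R'] p3 p4.
- have [S pS pS'] : exists2 S, perm_eq R (Some (p', q') :: S) &
      perm_eq R' (Some (p, q) :: S).
    apply: perm_cons2; first by rewrite perm_sym in p1; apply: perm_trans p3.
    by apply: contra np => /eqP[-> _].
  exists [:: None, None & S]; first by apply: (@conn_loop _ _ _ _ (None :: S)); perm_lia.
  by apply: (@conn_loop _ _ _ _ (None :: S)); perm_lia.
- exact: (mixed E F G R p q p' q' u' l' R').
- apply: (sym E); apply: (mixed E G F R' p' q' p q u l R); rewrite // eq_sym //.
have m1 : Some (p', l') \in E by rewrite (perm_mem p3) mem_head.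
have m2 : Some (u', q') \in E by rewrite (perm_mem p3) !inE eqxx orbT.
have ne : Some (p', l') != Some (u', q').
  by have := s; rewrite (simple_perm p3) => s'; case: (simpleP s' (mem_head _ _))
    => n _; apply: contra n => /eqP[->].
have npl : Some (p, l) != Some (p', l') by apply: contra np => /eqP[->].
have nuq : Some (u, q) != Some (u', q') by apply: contra nq => /eqP[_ ->].
move: m1; rewrite (perm_mem p1) !inE eq_sym (negbTE npl) /= => m1.
move: m2; rewrite (perm_mem p1) !inE orbC -orbA eq_sym => m2.
case/orP: m1 => [/eqP[e1 e2]|m1].
  subst p' l'.
  have [e3|n3] := eqVneq (Some (p, l)) (Some (u', q')).
    case: e3 => *; subst u' q'.
    have pR : perm_eq R R' by rewrite -(perm_cons (Some (p, l))) -(perm_cons (Some (u, q))); perm_lia.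
    exists (None :: R); first by apply: (@conn_loop _ _ _ _ R); perm_lia.
    by apply: (@conn_loop _ _ _ _ R); perm_lia.
  have {m2} m2 : Some (u', q') \in R.
    by move: m2; rewrite [_ == Some (p, l)]eq_sym (negbTE n3) (negbTE nuq) !orbF.
  have [S pS] := perm_cons_mem m2.
  have pR : perm_eq R' (Some (p, l) :: S).
    by rewrite -(perm_cons (Some (u', q'))) -(perm_cons (Some (u, q))); perm_lia.
  exists (Some (u', l) :: S).
    by apply: (@conn_edge _ _ _ _ u' l S); perm_lia.
  by apply: (@conn_edge _ _ _ _ u' l S); perm_lia.
have [S pS] := perm_cons_mem m1.
have [e3|n3] := eqVneq (Some (p, l)) (Some (u', q')).
  case: e3 => *; subst u' q'.
  have pR : perm_eq R' (Some (u, q) :: S).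
    by rewrite -(perm_cons (Some (p, l))) -(perm_cons (Some (p', l'))); perm_lia.
  exists (Some (u, l') :: S).
    by apply: (@conn_edge _ _ _ _ u l' S); perm_lia.
  by apply: (@conn_edge _ _ _ _ u l' S); perm_lia.
have {m2} m2 : Some (u', q') \in S.
  move: m2; rewrite [_ == Some (p, l)]eq_sym (negbTE n3) (negbTE nuq) !orbF.
  by rewrite (perm_mem pS) inE eq_sym (negbTE ne).
have [S' pS'] := perm_cons_mem m2.
have pR : perm_eq R' [:: Some (p, l), Some (u, q) & S'].
  by rewrite -(perm_cons (Some (u', q'))) -(perm_cons (Some (p', l'))); perm_lia.
exists [:: Some (u, l), Some (u', l') & S'].
  by apply: (@conn_edge _ _ _ _ u' l' (Some (u, l) :: S')); perm_lia.
by apply: (@conn_edge _ _ _ _ u l (Some (u', l') :: S')); perm_lia.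
Qed.

Lemma conns_diamond ps p q E F G : simple E -> p \notin ps -> q \notin ps ->
  conn p q E F -> conns ps E G ->
  exists2 H, conns ps F H & conn p q G H.
Proof.
elim: ps E F => [|p' ps IH] E F s /=.
  by move=> _ _ c pE; exists F => //; apply: conn_perm c.
rewrite !inE !negb_or => /andP[n1 n1'] /andP[n2 n2'] c [E1 c1 cs].
have [H cH cH'] := conn_diamond s n1 n2 c c1.
have [K cK cK'] := IH E1 H (conn_simple c1 s) n1' n2' cH' cs.
by exists K => //; exists H.
Qed.

Lemma conns_simple ps E F : conns ps E F -> simple E -> simple F.
Proof.
elim: ps E => [|p ps IH] E /=; first by move=> pE; rewrite (simple_perm pE).
by case=> G c cs /(conn_simple c); apply: IH.
Qed.

End Wiring.

(** * The wired calculus *)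

Section Derivability.
Variables (I L : eqType).
Local Notation form := (cform I L).
Local Notation port := (nat * I)%type.
Local Notation item := (nat * form)%type.
Local Notation wiring := (seq (option (port * port))).
Implicit Types (A B : form) (X Y : item) (G : seq item) (E F : wiring).

(** Occurrences are enough, without asking for freeness: in a well-formed compound, an index with an
    upper occurrence in one half and a lower one in the other is free in both ([bound_sides]). *)
Definition bound A B : seq I :=
  [seq x <- coccs true A | x \in coccs false B] ++
  [seq x <- coccs true B | x \in coccs false A].

Definition tag_ports (k : nat) (s : seq I) : seq port := [seq (k, x) | x <- s].

(** The reversal matches [cdual], which lists the indices of the dual atom backwards. *)
Definition axiom_edges k u k' l : wiring :=
  [seq Some e | e <- zip (tag_ports k u) (tag_ports k' (rev l))].

(* A port (k, x) is the free index x of the formula tagged k; an edge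
   Some (upper, lower) stands for the two occurrences of one name, or for a chain
   of formulas bot between two names. *)
Inductive derivable : seq item -> wiring -> Prop :=
| D_perm G G' E E' : perm_eq G G' -> perm_eq E E' -> derivable G E ->
    derivable G' E'
| D_ax k k' q u l u' l' : size u = size l' -> size u' = size l ->
    derivable [:: (k, CAtom (CPos q) u l); (k', CAtom (CNeg q) u' l')]
      (axiom_edges k u k' l' ++ axiom_edges k' u' k l)
| D_one k i j :
    derivable [:: (k, CAtom COne [:: i] [:: j])] [:: Some ((k, i), (k, j))]
| D_bot k i j G E F : conn (k, j) (k, i) E F -> derivable G F ->
    derivable ((k, CAtom CBot [:: j] [:: i]) :: G) E
| D_par k A B G E :
    derivable [:: (k, A), (k, B) & G]
      ([seq Some (p, p) | p <- tag_ports k (bound A B)] ++ E) ->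
    derivable ((k, CPar A B) :: G) E
| D_tens k A B G1 G2 E1 E2 E :
    derivable ((k, A) :: G1) E1 -> derivable ((k, B) :: G2) E2 ->
    conns (tag_ports k (bound A B)) (E1 ++ E2) E ->
    derivable ((k, CTens A B) :: G1 ++ G2) E.

Definition occs b (G : seq item) : seq port :=
  flatten [seq tag_ports X.1 (coccs b X.2) | X <- G].

Definition frees b (G : seq item) : seq port :=
  flatten [seq tag_ports X.1 (cfree b X.2) | X <- G].

Variable v : L -> nat * nat.

(** Formulas obtained by splitting one formula keep its tag; hence ports, and not tags, are required
    to be distinct. *)
Definition linear G :=
  [&& all (fun X => cform_wf v X.2) G, uniq (occs true G) & uniq (occs false G)].

Lemma perm_flatmap (T U : eqType) (f : T -> seq U) (s t : seq T) :
  perm_eq s t -> perm_eq (flatten (map f s)) (flatten (map f t)).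
Proof. by move=> p; apply/perm_flatten/perm_map. Qed.

Lemma linear_perm G G' : perm_eq G G' -> linear G = linear G'.
Proof.
move=> p; rewrite /linear (perm_all _ p).
by rewrite /occs !(perm_uniq (perm_flatmap _ p)).
Qed.

Lemma occs_cons b X G : occs b (X :: G) = tag_ports X.1 (coccs b X.2) ++ occs b G.
Proof. by []. Qed.

Lemma occs_cat b G1 G2 : occs b (G1 ++ G2) = occs b G1 ++ occs b G2.
Proof. by rewrite /occs map_cat flatten_cat. Qed.

Lemma frees_cons b X G : frees b (X :: G) = tag_ports X.1 (cfree b X.2) ++ frees b G.
Proof. by []. Qed.

Lemma frees_cat b G1 G2 : frees b (G1 ++ G2) = frees b G1 ++ frees b G2.
Proof. by rewrite /frees map_cat flatten_cat. Qed.

Lemma tag_ports_cat k s t : tag_ports k (s ++ t) = tag_ports k s ++ tag_ports k t.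
Proof. exact: map_cat. Qed.

Lemma mem_tag_ports k s x : ((k, x) \in tag_ports k s) = (x \in s).
Proof. by rewrite mem_map // => y z []. Qed.

Lemma tag_ports_uniq k s : uniq (tag_ports k s) = uniq s.
Proof. by rewrite map_inj_uniq // => y z []. Qed.

Lemma wf_uniq b A : cform_wf v A -> uniq (coccs b A).
Proof. by case/and3P; case: b. Qed.

Lemma bound_uniq A B : uniq (coccs true A ++ coccs true B) -> uniq (bound A B).
Proof.
rewrite !cat_uniq => /and3P[u /hasPn d u']; rewrite !filter_uniq //= andbT.
apply/hasPn => x; rewrite mem_filter => /andP[_ /d] /=.
by rewrite mem_filter negb_and => ->; rewrite orbT.
Qed.

Lemma mem_bound A B x :
  (x \in bound A B) = (x \in coccs true A) && (x \in coccs false B) ||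
                      (x \in coccs true B) && (x \in coccs false A).
Proof. by rewrite mem_cat !mem_filter; congr orb; rewrite andbC. Qed.

Lemma free_uniq b A : cform_wf v A -> uniq (cfree b A).
Proof. by move=> /(wf_uniq b); apply: filter_uniq. Qed.

Lemma mem_free b A x :
  (x \in cfree b A) = (x \in coccs b A) && (x \notin coccs (~~ b) A).
Proof. by rewrite mem_filter andbC. Qed.

(** A bound index is free in both halves on opposite sides, so for either value of [b] it accounts
    for exactly one free occurrence in the halves that the compound no longer has. *)
Lemma perm_free_bound b A B :
  uniq (coccs true A ++ coccs true B) -> uniq (coccs false A ++ coccs false B) ->
  perm_eq (cfree b A ++ cfree b B) (cfree b (CTens A B) ++ bound A B).
Proof.
move=> u1 u2; have := u1; have := u2.
rewrite !cat_uniq => /and3P[uA /hasPn d uB] /and3P[uA' /hasPn d' uB'].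
have N x : ~~ ((x \in coccs true A) && (x \in coccs true B)).
  by apply/negP => /andP[h /d']; rewrite /= h.
have N' x : ~~ ((x \in coccs false A) && (x \in coccs false B)).
  by apply/negP => /andP[h /d]; rewrite /= h.
have M x : [/\ ~~ ((x \in coccs true A) && (x \in coccs true B)) &
    ~~ ((x \in coccs false A) && (x \in coccs false B))] by split.
have wfu c : uniq (coccs c A) /\ uniq (coccs c B) by case: c.
apply: uniq_perm.
- rewrite cat_uniq !filter_uniq ?(wfu b).1 ?(wfu b).2 //= andbT.
  apply/hasPn => x; rewrite /= !mem_free; case: (M x).
  by case: b; do 4! case: (x \in coccs _ _).
- rewrite cat_uniq bound_uniq // filter_uniq; last by case: b.
  rewrite andbT; apply/hasPn => x; rewrite mem_bound /= mem_free /= !mem_cat.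
  by case: b; do 4! case: (x \in coccs _ _).
- move=> x; rewrite !(mem_cat x (cfree _ _)) mem_bound !mem_free /= !mem_cat.
  case: (M x).
  by case: b; do 4! case: (x \in coccs _ _).
Qed.

Lemma wf_sub A B : cform_wf v (CTens A B) ->
  [/\ cform_wf v A, cform_wf v B, uniq (coccs true A ++ coccs true B) &
      uniq (coccs false A ++ coccs false B)].
Proof.
rewrite /cform_wf /= => /and3P[/andP[-> ->] u1 u2]; rewrite u1 u2.
by move: u1 u2; rewrite !cat_uniq => /and3P[-> _ ->] /and3P[-> _ ->].
Qed.

Lemma bound_free A B x : cform_wf v (CTens A B) -> x \in bound A B ->
  x \in cfree true A ++ cfree false A.
Proof.
move=> /wf_sub[_ _]; rewrite !cat_uniq mem_bound mem_cat !mem_free /=.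
move=> /and3P[_ /hasPn d1 _] /and3P[_ /hasPn d2 _] /orP[] /andP[h1 h2].
  by rewrite h1 (d2 x h2).
by rewrite h2 (d1 x h1) orbT.
Qed.

Lemma bound_sides A B x : cform_wf v (CTens A B) -> x \in bound A B ->
  exists c, x \in cfree c A /\ x \in cfree (~~ c) B.
Proof.
move=> /wf_sub[_ _]; rewrite !cat_uniq mem_bound.
move=> /and3P[_ /hasPn d1 _] /and3P[_ /hasPn d2 _] /orP[] /andP[h1 h2].
  exists true; rewrite !mem_free h1 h2 /=; split; first exact: d2 h2.
  by apply/negP => /d1; rewrite /= h1.
exists false; rewrite !mem_free h1 h2 /=; split; first exact: d1 h1.
by apply/negP => /d2; rewrite /= h2.
Qed.

Lemma perm_axiom_ends k u k' l b : size u = size l ->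
  perm_eq (ends b (axiom_edges k u k' l)) (if b then tag_ports k u else tag_ports k' l).
Proof.
move=> e; have s : size (tag_ports k u) = size (tag_ports k' (rev l)).
  by rewrite !size_map size_rev.
have -> : ends b (axiom_edges k u k' l) =
    if b then tag_ports k u else tag_ports k' (rev l).
  rewrite /axiom_edges /ends; elim: (tag_ports k u) (tag_ports k' (rev l)) s =>
    [|x t IH] [|y t'] //=; first by case: b.
  by case=> /IH; case: (b) => ->.
by case: b => //; rewrite perm_map // perm_rev.
Qed.

Lemma catom_free (p : cprop L) (u l : seq I) b : cform_wf v (CAtom p u l) ->
  cfree b (CAtom p u l) = if b then u else l.
Proof.
case/and3P => /= /andP[_]; rewrite cat_uniq => /and3P[_ /hasPn d _] _ _.
case: b; apply/all_filterP/allP => x /= xu; last exact: d.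
by apply/negP => xl; move: (d _ xl); rewrite /= xu.
Qed.

Lemma linear_par k A B G : linear ((k, CPar A B) :: G) ->
  linear [:: (k, A), (k, B) & G].
Proof.
rewrite /linear !occs_cons /= !tag_ports_cat !catA.
by case/and3P=> /andP[/wf_sub[-> -> _ _] ->] -> ->.
Qed.

Lemma linear_tens k A B G1 G2 : linear ((k, CTens A B) :: G1 ++ G2) ->
  linear ((k, A) :: G1) /\ linear ((k, B) :: G2).
Proof.
rewrite /linear !occs_cons /= !occs_cat !tag_ports_cat all_cat.
case/and3P=> /andP[/wf_sub[-> -> _ _] /andP[-> ->]] u1 u2 /=.
have p (a b c d : seq port) : uniq ((a ++ b) ++ c ++ d) -> uniq (a ++ c) /\ uniq (b ++ d).
  move=> u; have : uniq ((a ++ c) ++ (b ++ d)).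
    by rewrite -(perm_uniq (permEl (perm_catACA a b c d))).
  by rewrite cat_uniq => /and3P[].
by have [-> ->] := p _ _ _ _ u1; have [-> ->] := p _ _ _ _ u2.
Qed.

Lemma linear_cons X G : linear (X :: G) -> linear G.
Proof.
rewrite /linear !occs_cons /= => /and3P[/andP[_ ->]].
by rewrite !cat_uniq => /and3P[_ _ ->] /and3P[_ _ ->].
Qed.

Lemma perm_tag_ports k s t : perm_eq s t -> perm_eq (tag_ports k s) (tag_ports k t).
Proof. exact: perm_map. Qed.

Lemma ends_refl b (s : seq port) : ends b [seq Some (p, p) | p <- s] = s.
Proof. by elim: s => //= p s ->; case: b. Qed.

(** The invariant that makes wirings meaningful. In the tensor case the joins delete one upper and
    one lower copy of each bound port, which by [perm_free_bound] is what the compound loses. *)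
Lemma derivable_ends b G E : derivable G E -> linear G ->
  perm_eq (ends b E) (frees b G).
Proof.
elim=> {G E} [G G' E E' pG pE _ IH|k k' q u l u' l' e1 e2|k i j|
    k i j G E F c _ IH|k A B G E _ IH|k A B G1 G2 E1 E2 E _ IH1 _ IH2 c] lin.
- rewrite -(linear_perm pG) in lin.
  apply: perm_trans (perm_trans (IH lin) _); last exact: perm_flatmap.
  by rewrite perm_sym perm_ends.
- case/and3P: lin => /= /and3P[w w' _] _ _.
  rewrite /frees /= !catom_free // cats0 ends_cat.
  have p1 := perm_axiom_ends k k' b e1; have p2 := perm_axiom_ends k' k b e2.
  by case: (b) p1 p2 => p1 p2; perm_lia.
- by case/and3P: lin => /= /andP[w _] _ _; rewrite /frees /= catom_free //; case: (b).
- have := lin; case/and3P=> /andP[w _] _ _.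
  rewrite frees_cons catom_free //; have := IH (linear_cons lin).
  by move: (conn_ends b c); case: (b) => /= p1 p2; perm_lia.
- have := lin; case/and3P=> /andP[/wf_sub[w w' u1 u2] _] _ _.
  have := perm_tag_ports k (perm_free_bound b u1 u2); have := IH (linear_par lin).
  rewrite !frees_cons /= ends_cat ends_refl !tag_ports_cat => p1 p2; perm_lia.
- have := lin; case/and3P=> /andP[/wf_sub[w w' u1 u2] _] _ _.
  have [l1 l2] := linear_tens lin.
  have := perm_tag_ports k (perm_free_bound b u1 u2); have := conns_ends b c.
  move: (IH1 l1) (IH2 l2).
  rewrite !frees_cons /= ends_cat frees_cat !tag_ports_cat => *; perm_lia.
Qed.

Lemma occs_frees_uniq b G : linear G -> uniq (frees b G).
Proof.
case/and3P=> _ u1 u2; have : uniq (occs b G) by case: b.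
elim: G {u1 u2} => //= X G IH; rewrite occs_cons frees_cons !cat_uniq.
case/and3P=> u1 /hasPn d /IH ->; rewrite andbT.
apply/andP; split; first by move: u1; rewrite !tag_ports_uniq; apply: filter_uniq.
have sub Y : {subset tag_ports Y.1 (cfree b Y.2) <= tag_ports Y.1 (coccs b Y.2)}.
  by move=> p /mapP[x]; rewrite mem_free => /andP[xb _ ->]; apply: map_f.
apply/hasPn => p pG; apply: contra (d p _); first exact: sub.
move: pG => /flatten_mapP[Y YG /sub pY]; apply/flatten_mapP; by exists Y.
Qed.

Lemma derivable_simple G E : derivable G E -> linear G -> simple E.
Proof.
move=> d lin; rewrite /simple !(perm_uniq (derivable_ends _ d lin)).
by rewrite !occs_frees_uniq.
Qed.

Lemma notin_bound b k A B G p : linear ((k, CTens A B) :: G) ->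
  p \in frees b G -> p \notin tag_ports k (bound A B).
Proof.
case/and3P=> _ u1 u2.
have : uniq (occs b ((k, CTens A B) :: G)) by case: b.
rewrite occs_cons cat_uniq => /and3P[_ /hasPn d _] /flatten_mapP[Y YG /mapP[x xY ->]].
have /d : (Y.1, x) \in occs b G.
  by apply/flatten_mapP; exists Y => //; apply: map_f;
    move: xY; rewrite mem_free => /andP[].
apply: contra => /mapP[y yb [-> ->]]; apply: map_f.
move: yb; rewrite mem_bound /= mem_cat.
by case: (b) => /orP[] /andP[h1 h2]; rewrite ?h1 ?h2 ?orbT.
Qed.

(* Commuting the contraction past every other rule uses the diamond property. *)
Lemma bot_inv G0 E0 : derivable G0 E0 -> linear G0 -> forall k i j G E,
  perm_eq G0 ((k, CAtom CBot [:: j] [:: i]) :: G) -> conn (k, j) (k, i) E0 E ->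
  derivable G E.
Proof.
elim=> {G0 E0} [G G' E E' pG pE _ IH|k k' q u l u' l' e1 e2|k i j|
    k i j G E F c d IH|k A B G E d IH|k A B G1 G2 E1 E2 E d1 IH1 d2 IH2 c] lin
    k0 i0 j0 G0 E0 p0 c0.
- rewrite -(linear_perm pG) in lin; have p1 : perm_eq G ((k0, CAtom CBot [:: j0] [:: i0]) :: G0).
    exact: perm_trans pG _.
  apply: (IH lin _ _ _ _ _ p1).
  by apply: conn_perm c0 => //; rewrite perm_sym.
- have := perm_mem p0 (k0, CAtom CBot [:: j0] [:: i0]).
  by rewrite mem_head !inE => /orP[] /eqP.
- have := perm_mem p0 (k0, CAtom CBot [:: j0] [:: i0]).
  by rewrite mem_head inE => /eqP.
- have lin' := linear_cons lin.
  have sE : simple E.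
    by apply: (derivable_simple (D_bot c d)).
  (* Either the last rule contracted this very bot, and [conn_det] identifies the two results, or it
     contracted another one and the two contractions commute. *)
  have [[ek ej ei]|ne] := eqVneq ((k, CAtom CBot [:: j] [:: i]) : item)
      (k0, CAtom CBot [:: j0] [:: i0]).
    subst k0 j0 i0; rewrite perm_cons in p0.
    by apply: D_perm d => //; apply: conn_det c c0.
  have [H pH pH'] := perm_cons2 p0 ne.
  have npq : (k, j) != (k0, j0) /\ (k, i) != (k0, i0).
    have l : linear [:: (k, CAtom CBot [:: j] [:: i]), (k0, CAtom CBot [:: j0] [:: i0]) & H].
      by rewrite -(linear_perm (G := (k, CAtom CBot [:: j] [:: i]) :: G)) // perm_cons.
    by case/and3P: l => _ /= /andP[+ _] /andP[+ _]; rewrite !inE !negb_or => /andP[-> _] /andP[-> _].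
  have [K cK cK'] := conn_diamond sE npq.1 npq.2 c c0.
  apply: (D_perm (G := (k, CAtom CBot [:: j] [:: i]) :: H) (E := E0)) => //.
    by rewrite perm_sym.
  by apply: D_bot cK' _; apply: IH cK.
- have [H pH pH'] : exists2 H, perm_eq G ((k0, CAtom CBot [:: j0] [:: i0]) :: H) &
      perm_eq G0 ((k, CPar A B) :: H).
    by apply: perm_cons2 p0 _; apply/eqP; case.
  apply: (D_perm (G := (k, CPar A B) :: H) (E := E0)) => //; first by rewrite perm_sym.
  apply: D_par; apply: (IH (linear_par lin) k0 i0 j0); last exact: conn_frame.
  by perm_lia.
have [H pH pH'] : exists2 H, perm_eq (G1 ++ G2) ((k0, CAtom CBot [:: j0] [:: i0]) :: H) &
    perm_eq G0 ((k, CTens A B) :: H).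
  by apply: perm_cons2 p0 _; apply/eqP; case.
have [l1 l2] := linear_tens lin.
have s12 : simple (E1 ++ E2).
  move: (derivable_simple (D_tens d1 d2 c) lin) => /andP[].
  have lin2 : uniq (occs true ((k, CTens A B) :: G1 ++ G2)) /\
      uniq (occs false ((k, CTens A B) :: G1 ++ G2)) by case/and3P: lin.
  have u b : uniq (frees b ((k, A) :: G1) ++ frees b ((k, B) :: G2)).
    have lin3 : linear [:: (k, A), (k, B) & G1 ++ G2] by apply: linear_par.
    rewrite (perm_uniq (_ : perm_eq _ (frees b [:: (k, A), (k, B) & G1 ++ G2]))).
      exact: occs_frees_uniq.
    by rewrite !frees_cons frees_cat; perm_lia.
  move=> _ _; rewrite /simple !ends_cat.
  rewrite !(perm_uniq (perm_cat (derivable_ends _ d1 l1) (derivable_ends _ d2 l2))).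
  by rewrite !u.
have wb : cform_wf v (CAtom CBot [:: j0] [:: i0] : form).
  have /and3P[/allP w _ _] := lin.
  have := w (k0, CAtom CBot [:: j0] [:: i0]); rewrite inE orbC.
  by rewrite (perm_mem pH) mem_head => ->.
have fr b G' H' : perm_eq G' ((k0, CAtom CBot [:: j0] [:: i0]) :: H') ->
    (k0, if b then j0 else i0) \in frees b G'.
  move=> pG'; rewrite (perm_mem (perm_flatmap _ pG')) -/(frees b _) frees_cons.
  by rewrite catom_free // mem_cat; case: b; rewrite mem_head.
have nb b : (k0, if b then j0 else i0) \notin tag_ports k (bound A B).
  by apply: notin_bound lin _; apply: fr pH.
have [nb1 nb2] := (nb true, nb false).
have lin' : linear ((k, CTens A B) :: H).
  have q : perm_eq ((k, CTens A B) :: G1 ++ G2)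
      ((k0, CAtom CBot [:: j0] [:: i0]) :: (k, CTens A B) :: H) by perm_lia.
  by move: lin; rewrite (linear_perm q) => /linear_cons.
apply: (D_perm (G := (k, CTens A B) :: H) (E := E0)) => //; first by rewrite perm_sym.
(* The bot belongs to one premise. Its contraction is carried out there, ahead of the joins of the
   tensor; the diamond exchanges the two, since the ports of the bot are not among the bound
   ports. *)
case: (perm_cat_cons pH) => -[K pK pK'].
- have pK2 : perm_eq ((k, A) :: G1) ((k0, CAtom CBot [:: j0] [:: i0]) :: (k, A) :: K).
    by perm_lia.
  have [F1 cF1] : exists F1, conn (k0, j0) (k0, i0) E1 F1.
    apply: conn_exists; rewrite (perm_mem (derivable_ends _ d1 l1)).
      exact: (fr true _ _ pK2).
    exact: (fr false _ _ pK2).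
  have d1' := IH1 l1 _ _ _ _ _ pK2 cF1.
  have cF : conn (k0, j0) (k0, i0) (E1 ++ E2) (F1 ++ E2).
    by apply: conn_perm (conn_frame E2 cF1); rewrite perm_catC.
  have [M cM cM'] := conns_diamond s12 nb1 nb2 cF c.
  apply: (D_perm (G := (k, CTens A B) :: K ++ G2) (E := M)).
  + by perm_lia.
  + by apply: conn_det cM' c0; apply: conns_simple c s12.
  + exact: D_tens d1' d2 cM.
- have pK2 : perm_eq ((k, B) :: G2) ((k0, CAtom CBot [:: j0] [:: i0]) :: (k, B) :: K).
    by perm_lia.
  have [F1 cF1] : exists F1, conn (k0, j0) (k0, i0) E2 F1.
    apply: conn_exists; rewrite (perm_mem (derivable_ends _ d2 l2)).
      exact: (fr true _ _ pK2).
    exact: (fr false _ _ pK2).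
  have d2' := IH2 l2 _ _ _ _ _ pK2 cF1.
  have [M cM cM'] := conns_diamond s12 nb1 nb2 (conn_frame E1 cF1) c.
  apply: (D_perm (G := (k, CTens A B) :: G1 ++ K) (E := M)).
  + by perm_lia.
  + by apply: conn_det cM' c0; apply: conns_simple c s12.
  + exact: D_tens d1 d2' cM.
Qed.

End Derivability.

(** * Wirings computed from named ends *)

Section Join.
Variables (P W : eqType).
Implicit Types (U V X : seq (P * W)).

(** [U] and [V] list upper and lower ends together with the wire each carries. The result is a
    wiring in the intended sense when every wire occurs once in each list. *)
Definition join U V : seq (option (P * P)) :=
  flatten [seq [seq Some (u.1, l.1) | l <- V & l.2 == u.2] | u <- U].

Definition wmap (f : W -> W) U := [seq (u.1, f u.2) | u <- U].

Lemma join_cat U1 U2 V : join (U1 ++ U2) V = join U1 V ++ join U2 V.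
Proof. by rewrite /join map_cat flatten_cat. Qed.

Lemma join_catr U V1 V2 : perm_eq (join U (V1 ++ V2)) (join U V1 ++ join U V2).
Proof.
elim: U => //= u U IH; rewrite /join /= -!/(join _ _) filter_cat map_cat; perm_lia.
Qed.

Lemma join_perm U U' V V' : perm_eq U U' -> perm_eq V V' ->
  perm_eq (join U V) (join U' V').
Proof.
move=> pU pV; apply: (@perm_trans _ (join U V')); last exact: perm_flatmap.
elim: U {pU} => //= u U IH; rewrite /join /= -!/(join _ _).
by apply: perm_cat => //; apply/perm_map/perm_filter.
Qed.

Lemma join_nil U V : (forall w, w \in map snd U -> w \in map snd V -> false) ->
  join U V = [::].
Proof.
elim: U => //= u U IH d; rewrite /join /= -!/(join _ _) IH; last first.
  by move=> w wU; apply: d; rewrite inE wU orbT.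
rewrite cats0; have -> // : [seq l <- V | l.2 == u.2] = [::].
apply/eqP; rewrite -(negbK (_ == _)) -has_filter; apply/hasPn => l lV.
apply/negP => /eqP e; move: (d u.2); rewrite mem_head -e map_f // => d'.
by have := d' isT isT.
Qed.

Lemma join_cons p q w U V : w \notin map snd U -> w \notin map snd V ->
  perm_eq (join ((p, w) :: U) ((q, w) :: V)) (Some (p, q) :: join U V).
Proof.
move=> wU wV; rewrite -cat1s join_cat.
have e1 : perm_eq (join U ((q, w) :: V)) (join U V).
  rewrite -cat1s; apply: (perm_trans (join_catr _ _ _)).
  rewrite [join U [:: _]]join_nil // => x xU; rewrite inE /= => /eqP e.
  by move: wU; rewrite -e xU.
have e2 : join [:: (p, w)] ((q, w) :: V) = [:: Some (p, q)].
  rewrite /join /= eqxx cats0 /=; congr cons.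
  have -> // : [seq l <- V | l.2 == w] = [::].
  apply/eqP; rewrite -(negbK (_ == _)) -has_filter; apply/hasPn => l lV.
  by apply: contra wV => /eqP <-; apply: map_f.
by rewrite e2 /=; perm_lia.
Qed.

(** Wires used by nothing but the two ends of one port contribute the edge from that port to itself,
    the shape in the premise of [D_par]. *)
Lemma join_diag X U V : uniq (map snd X) ->
  (forall w, w \in map snd X -> w \notin map snd U) ->
  (forall w, w \in map snd X -> w \notin map snd V) ->
  perm_eq (join (X ++ U) (X ++ V))
    ([seq Some (p, p) | p <- map fst X] ++ join U V).
Proof.
elim: X => //= -[p w] X IH /= /andP[wX uX] dU dV.
have {}IH : perm_eq (join (X ++ U) (X ++ V))
    ([seq Some (p, p) | p <- map fst X] ++ join U V).
  by apply: IH => // x xX; [apply: dU|apply: dV]; rewrite inE xX orbT.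
have : perm_eq (join ((p, w) :: (X ++ U)) ((p, w) :: (X ++ V)))
    (Some (p, p) :: join (X ++ U) (X ++ V)).
  by apply: join_cons; rewrite map_cat mem_cat negb_or wX /= ?dU ?dV ?mem_head.
by move=> *; perm_lia.
Qed.

Lemma map_snd_mem w U : w \in map snd U -> exists p, (p, w) \in U.
Proof. by case/mapP=> -[p x] pU ->; exists p. Qed.

(** By induction on [X]. The wire [w] of a bound port [p] labels one edge in each half, say from [p]
    to [q] and from [r] to [p]. Joining at [p] leaves the edge from [r] to [q], and these are
    exactly the two remaining ends that carry [w]. The last two hypotheses place the upper and the
    lower end of a bound port in different halves. *)
Lemma conns_join X U1 V1 U2 V2 U V :
  perm_eq (U1 ++ U2) (X ++ U) -> perm_eq (V1 ++ V2) (X ++ V) ->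
  uniq (map snd U1) -> uniq (map snd U2) ->
  perm_eq (map snd U1) (map snd V1) -> perm_eq (map snd U2) (map snd V2) ->
  uniq (map snd U) -> uniq (map snd X) ->
  (forall x, x \in X -> ~~ ((x \in U1) && (x \in V1))) ->
  (forall x, x \in X -> ~~ ((x \in U2) && (x \in V2))) ->
  conns (map fst X) (join U1 V1 ++ join U2 V2) (join U V).
Proof.
elim: X U1 V1 U2 V2 U V => [|[p w] X IH] U1 V1 U2 V2 U V /=.
  move=> pU pV _ _ e1 e2 uU _ _ _.
  have := join_perm pU pV; rewrite join_cat.
  have := join_catr U1 V1 V2; have := join_catr U2 V1 V2.
  have D (w : W) : w \in map snd U1 -> w \in map snd U2 -> false.
    move: uU; rewrite -(perm_uniq (perm_map snd pU)) map_cat cat_uniq.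
    by case/and3P=> _ /hasPn d _ w1 /d; rewrite /= w1.
  have -> : join U1 V2 = [::].
    by apply: join_nil => w; rewrite -(perm_mem e2); apply: D.
  have -> : join U2 V1 = [::].
    by apply: join_nil => w w2; rewrite -(perm_mem e1) => w1; apply: D w1 w2.
  by move=> *; perm_lia.
move=> pU pV u1 u2 e1 e2 uU /andP[wX uX] n1 n2.
(* The two halves play symmetric roles, so the upper end of [p] may be taken in the first. *)
wlog xU1 : U1 V1 U2 V2 pU pV u1 u2 e1 e2 n1 n2 / (p, w) \in U1.
  move=> H; have : (p, w) \in U1 ++ U2 by rewrite (perm_mem pU) mem_head.
  rewrite mem_cat => /orP[|xU2]; first exact: H.
  have [G c cs] := H U2 V2 U1 V1 (perm_trans (permEl (perm_catC _ _)) pU)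
    (perm_trans (permEl (perm_catC _ _)) pV) u2 u1 e2 e1 n2 n1 xU2.
  exists G => //; apply: conn_perm c => //; exact: permEl (perm_catC _ _).
have [U1' pU1] := perm_cons_mem xU1.
have xV2 : (p, w) \in V2.
  have : (p, w) \in V1 ++ V2 by rewrite (perm_mem pV) mem_head.
  rewrite mem_cat => /orP[xV1|//].
  by have := n1 (p, w) (mem_head _ _); rewrite xU1 xV1.
have [V2' pV2] := perm_cons_mem xV2.
have /map_snd_mem[q /perm_cons_mem[V1' pV1]] : w \in map snd V1.
  by rewrite -(perm_mem e1) (map_f snd xU1).
have /map_snd_mem[r /perm_cons_mem[U2' pU2]] : w \in map snd U2.
  by rewrite (perm_mem e2) (map_f snd xV2).
have NX s (q' : P) : s = X -> (q', w) \notin s.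
  by move=> ->; apply: contra wX => h; apply: (map_f snd h).
have [U' pU'] : exists U', perm_eq U ((r, w) :: U').
  apply: perm_cons_mem; have : (r, w) \in X ++ U.
    have q1 : perm_eq (U1' ++ U2) (X ++ U).
      by rewrite -(perm_cons (p, w)); perm_lia.
    by rewrite -(perm_mem q1) mem_cat (perm_mem pU2) mem_head orbT.
  by rewrite mem_cat (negbTE (NX _ _ erefl)).
have [V' pV'] : exists V', perm_eq V ((q, w) :: V').
  apply: perm_cons_mem; have : (q, w) \in X ++ V.
    have q1 : perm_eq (V1 ++ V2') (X ++ V).
      by rewrite -(perm_cons (p, w)); perm_lia.
    by rewrite -(perm_mem q1) mem_cat (perm_mem pV1) mem_head.
  by rewrite mem_cat (negbTE (NX _ _ erefl)).
have U1u : w \notin map snd U1' /\ uniq (map snd U1').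
  by move: u1; rewrite (perm_uniq (perm_map snd pU1)) /= => /andP.
have U2u : w \notin map snd U2' /\ uniq (map snd U2').
  by move: u2; rewrite (perm_uniq (perm_map snd pU2)) /= => /andP.
have Uu : w \notin map snd U' /\ uniq (map snd U').
  by move: uU; rewrite (perm_uniq (perm_map snd pU')) /= => /andP.
have e1' : perm_eq (map snd U1') (map snd V1').
  have := perm_map snd pU1; have := perm_map snd pV1 => /= a b.
  by rewrite -(perm_cons w); perm_lia.
have e2' : perm_eq (map snd U2') (map snd V2').
  have := perm_map snd pU2; have := perm_map snd pV2 => /= a b.
  by rewrite -(perm_cons w); perm_lia.
have qU : perm_eq (U1' ++ U2') (X ++ U').
  by rewrite -(perm_cons (p, w)) -(perm_cons (r, w)); perm_lia.
have qV : perm_eq (V1' ++ V2') (X ++ V').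
  by rewrite -(perm_cons (p, w)) -(perm_cons (q, w)); perm_lia.
have wV' : w \notin map snd V'.
  have : w \notin map snd (X ++ V').
    rewrite -(perm_mem (perm_map snd qV)) map_cat mem_cat -(perm_mem e1').
    by rewrite -(perm_mem e2') negb_or U1u.1 U2u.1.
  by rewrite map_cat mem_cat negb_or => /andP[].
exists (Some (r, q) :: (join U1' V1' ++ join U2' V2')).
  apply: (@conn_edge _ _ _ _ _ r q (join U1' V1' ++ join U2' V2')) => //.
  have j1 := join_perm pU1 pV1; have j2 := join_perm pU2 pV2.
  have wV1 : w \notin map snd V1' by rewrite -(perm_mem e1'); exact: U1u.1.
  have wV2 : w \notin map snd V2' by rewrite -(perm_mem e2'); exact: U2u.1.
  have c1 := join_cons p q U1u.1 wV1; have c2 := join_cons r p U2u.1 wV2.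
  by clear -j1 j2 c1 c2; perm_lia.
have j := join_perm pU' pV'; have c := join_cons r q Uu.1 wV'.
apply: conns_perm (conns_frame [:: Some (r, q)] (IH _ _ _ _ _ _ qU qV U1u.2 U2u.2 e1' e2' Uu.2 uX _ _)) => //.
- by clear -j c; perm_lia.
- move=> x xX; have := n1 x; rewrite inE xX orbT => /(_ isT).
  apply: contra => /andP[a b].
  by rewrite (perm_mem pU1) (perm_mem pV1) !inE a b !orbT.
- move=> x xX; have := n2 x; rewrite inE xX orbT => /(_ isT).
  apply: contra => /andP[a b].
  by rewrite (perm_mem pU2) (perm_mem pV2) !inE a b !orbT.
Qed.

Lemma join_wmap f U V : {in map snd U & map snd V, injective f} ->
  join (wmap f U) (wmap f V) = join U V.
Proof.
move=> inj; rewrite /join /wmap -map_comp.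
congr flatten; apply/eq_in_map => u uU /=.
rewrite filter_map -map_comp /=; congr map.
apply/eq_in_filter => l lV /=; apply/eqP/eqP => [e|-> //].
by apply/esym/inj => //; apply: map_f.
Qed.

End Join.

(** * Semantic cut elimination *)

Section Semantics.
Variables (I L : eqType) (v : L -> nat * nat).
Hypothesis I_inf : infinite_eqType I.
Local Notation form := (cform I L).
Local Notation clo := (form * (I -> I))%type.
Implicit Types (A B : form) (s r : I -> I) (c : clo) (g d e : seq clo) (w x : I)
  (t : seq (nat * clo)).

(* A closure is a formula whose free indices are sent to wires, so that the
   occurrences of one index in different formulas need not share their name. *)
Definition wires b c : seq I := map c.2 (cfree b c.1).

(** Distinct free indices of one formula must be on distinct wires, as in a formula where they have
    distinct names. *)
Definition ok c := cform_wf v c.1 && uniq (wires true c ++ wires false c).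

Definition wcount b w g := count_mem w (flatten (map (wires b) g)).

Definition balanced g :=
  all ok g /\
  forall w, (wcount true w g == wcount false w g) && (wcount true w g <= 1).

Definition item_of (p : nat * clo) : nat * form := (p.1, p.2.1).

Definition ports b t : seq (nat * I * I) :=
  flatten [seq [seq ((p.1, x), p.2.2 x) | x <- cfree b p.2.1] | p <- t].

(** All taggings that keep ports apart are quantified over, so tags can be chosen at will and never
    have to be compared. *)
Definition provable g := forall t, map snd t = g -> linear v (map item_of t) ->
  derivable (map item_of t) (join (ports true t) (ports false t)).

(** Lists that are not balanced belong to the pole vacuously; orthogonality thus never has to guard
    against clashes of wires between two lists. *)
Definition pole g := balanced g -> provable g.

Lemma wcount_cat b w g e : wcount b w (g ++ e) = wcount b w g + wcount b w e.
Proof. by rewrite /wcount map_cat flatten_cat count_cat. Qed.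

Lemma wcount_cons b w c g :
  wcount b w (c :: g) = count_mem w (wires b c) + wcount b w g.
Proof. by rewrite /wcount /= count_cat. Qed.

Lemma wcount_nil b w : wcount b w [::] = 0. Proof. by []. Qed.

Lemma wcount_perm b w g e : perm_eq g e -> wcount b w g = wcount b w e.
Proof. by move=> p; apply/permP/perm_flatmap. Qed.

Lemma balanced_perm g e : perm_eq g e -> balanced g -> balanced e.
Proof.
move=> p [okg cg]; split; first by rewrite -(perm_all _ p).
by move=> w; rewrite -!(wcount_perm _ _ p).
Qed.

Lemma perm_mapP (T U : eqType) (f : T -> U) (m : seq U) (t : seq T) :
  perm_eq m (map f t) -> exists2 t', perm_eq t' t & map f t' = m.
Proof.
elim: m t => [|y m IH] t.
  by rewrite perm_sym => /perm_nilP; case: t => // _; exists [::].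
move=> p; have : y \in map f t by rewrite -(perm_mem p) mem_head.
case/mapP=> x xt ey; have q := perm_to_rem xt.
have /IH[t' pt' <-] : perm_eq m (map f (rem x t)).
  by rewrite -(perm_cons y); apply: (perm_trans p); rewrite ey; exact: (perm_map f q).
exists (x :: t'); last by rewrite /= ey.
by rewrite perm_sym; apply: (perm_trans q); rewrite perm_cons perm_sym.
Qed.

Lemma provable_perm g e : perm_eq g e -> provable g -> provable e.
Proof.
move=> p Pg t et; rewrite -et in p; have [t' pt' et'] := perm_mapP p.
move=> lin; have pl : perm_eq (map item_of t') (map item_of t) by exact: perm_map.
apply: (D_perm pl _ (Pg t' et' _)); last by rewrite (linear_perm v pl).
by apply: join_perm; apply: perm_flatmap.
Qed.

Lemma pole_perm g e : perm_eq g e -> pole g -> pole e.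
Proof.
move=> p Pg ce; apply: (provable_perm p); apply: Pg; apply: balanced_perm ce.
by rewrite perm_sym.
Qed.

Definition ren r g : seq clo := [seq (c.1, r \o c.2) | c <- g].

Lemma ren_cat r g e : ren r (g ++ e) = ren r g ++ ren r e.
Proof. exact: map_cat. Qed.

Lemma wires_ren r b c : wires b (c.1, r \o c.2) = map r (wires b c).
Proof. by rewrite /wires /= map_comp. Qed.

Definition all_wires g := flatten [seq wires true c ++ wires false c | c <- g].

Definition tren r t : seq (nat * clo) := [seq (p.1, (p.2.1, r \o p.2.2)) | p <- t].

Lemma ports_tren r b t : ports b (tren r t) = wmap r (ports b t).
Proof.
rewrite /ports /wmap map_flatten -!map_comp; congr flatten; apply: eq_map => p /=.
by rewrite -map_comp.
Qed.

Lemma item_tren r t : map item_of (tren r t) = map item_of t.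
Proof. by rewrite -map_comp; apply: eq_map. Qed.

Lemma snd_tren r t : map snd (tren r t) = ren r (map snd t).
Proof. by rewrite /ren -!map_comp. Qed.

Lemma tren_of r g t : map snd t = ren r g ->
  exists2 t', map snd t' = g & t = tren r t'.
Proof.
elim: t g => [|[k c] t IH] [|[A s] g] //=; first by exists [::].
by case=> -> /IH[t' <- ->]; exists ((k, (A, s)) :: t').
Qed.

Lemma provable_ren r g : provable (ren r g) <->
  forall t, map snd t = g -> linear v (map item_of t) ->
    derivable (map item_of t) (join (wmap r (ports true t)) (wmap r (ports false t))).
Proof.
split=> Pg t.
  move=> et lin; have := Pg (tren r t).
  by rewrite snd_tren et item_tren !ports_tren; apply.
by case/tren_of=> t' et' ->; rewrite item_tren !ports_tren; apply: Pg.
Qed.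

Lemma wires_ports b t : map snd (ports b t) = flatten (map (wires b) (map snd t)).
Proof.
rewrite /ports map_flatten -!map_comp; congr flatten; apply: eq_map => p /=.
by rewrite -map_comp.
Qed.

Lemma mem_all_wires b w g : w \in flatten (map (wires b) g) -> w \in all_wires g.
Proof.
case/flatten_mapP=> c cg wc; apply/flatten_mapP; exists c => //.
by rewrite mem_cat; case: b wc => ->; rewrite ?orbT.
Qed.

Lemma wmap_ext b r s t : {in all_wires (map snd t), r =1 s} ->
  wmap r (ports b t) = wmap s (ports b t).
Proof.
move=> e; apply/eq_in_map => -[p w] pw /=; congr pair; apply: e.
by apply: (@mem_all_wires b); rewrite -wires_ports; apply: (map_f snd pw).
Qed.

Lemma provable_ren_ext r s g : {in all_wires g, r =1 s} ->
  provable (ren r g) -> provable (ren s g).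
Proof.
move=> e /provable_ren Pg; apply/provable_ren => t et lin.
by rewrite -!(@wmap_ext _ r s) ?et //; apply: Pg.
Qed.

(** Wires enter [join] only through the question whether two of them are equal. *)
Lemma provable_ren_inj r g : {in all_wires g &, injective r} ->
  provable (ren r g) <-> provable g.
Proof.
move=> inj; rewrite provable_ren; split=> Pg t et lin.
  have := Pg t et lin; rewrite join_wmap // => x y xt yt.
  by apply: inj; rewrite -et; [apply: (@mem_all_wires true)|apply: (@mem_all_wires false)];
    rewrite -wires_ports.
rewrite join_wmap; first exact: Pg.
move=> x y xt yt.
by apply: inj; rewrite -et; [apply: (@mem_all_wires true)|apply: (@mem_all_wires false)];
  rewrite -wires_ports.
Qed.

Lemma count_map_inj r b w g : injective r ->
  wcount b (r w) (ren r g) = wcount b w g.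
Proof.
move=> inj; elim: g => //= c g IH; rewrite !wcount_cons IH wires_ren.
by rewrite count_map; congr addn; apply: eq_count => x /=; rewrite (inj_eq inj).
Qed.

Lemma ok_ren r c : injective r -> ok (c.1, r \o c.2) = ok c.
Proof. by move=> inj; rewrite /ok /= !wires_ren -map_cat map_inj_uniq. Qed.

Lemma all_ok_ren r g : injective r -> all ok (ren r g) = all ok g.
Proof. by move=> inj; rewrite all_map; apply: eq_all => c; apply: ok_ren. Qed.

Lemma balanced_ren r g : injective r -> balanced (ren r g) -> balanced g.
Proof.
move=> inj [okg cg]; split; first by rewrite all_ok_ren in okg.
by move=> w; have := cg (r w); rewrite !count_map_inj.
Qed.

Lemma ren_comp r s g : ren r (ren s g) = ren (r \o s) g.
Proof. by rewrite /ren -map_comp. Qed.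

Lemma ren_id g : ren id g = g.
Proof. by rewrite -[RHS]map_id; apply: eq_map => -[]. Qed.

Lemma pole_ren r g : injective r -> pole g -> pole (ren r g).
Proof.
move=> inj Pg cg; apply/provable_ren_inj; first by move=> x y _ _; apply: inj.
exact: Pg (balanced_ren inj cg).
Qed.

Definition fuse (i j : I) (w : I) := if w == i then j else w.

Lemma wcount_mem b w g : (w \in flatten (map (wires b) g)) = (0 < wcount b w g).
Proof. by rewrite -has_count has_pred1. Qed.

Lemma balanced_uniq b g : balanced g -> uniq (flatten (map (wires b) g)).
Proof.
move=> [_ cg]; have {cg} : forall w, wcount b w g <= 1.
  by move=> w; have /andP[/eqP e l] := cg w; case: b; rewrite // -e.
rewrite /wcount; elim: (flatten _) => //= x m IH c.
rewrite IH ?andbT; last by move=> w; have := c w; lia.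
by have := c x; rewrite eqxx -has_pred1 has_count; lia.
Qed.

Lemma balanced_mem g w : balanced g ->
  (w \in flatten (map (wires true) g)) = (w \in flatten (map (wires false) g)).
Proof. by move=> [_ cg]; have /andP[/eqP e _] := cg w; rewrite !wcount_mem e. Qed.

Lemma bot_ports (k : nat) (j i : I) s : cform_wf v (CAtom CBot [:: j] [:: i] : form) ->
  forall b, [seq ((k, x), s x) | x <- cfree b (CAtom CBot [:: j] [:: i] : form)] =
  if b then [:: ((k, j), s j)] else [:: ((k, i), s i)].
Proof. by move=> wf b; rewrite (catom_free b wf); case: b. Qed.

(** The upper end of the bot lies on the wire [wj], its lower end on [wi]. Joining them merges the
    two edges into one between the other ends, which is what identifying the two wires produces. As
    the wires differ, no loop arises. *)
Lemma bot_edge_core (U V : seq (nat * I * I)) pu pl wi wj :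
  wi != wj -> uniq (map snd ((pu, wj) :: U)) -> uniq (map snd ((pl, wi) :: V)) ->
  map snd ((pu, wj) :: U) =i map snd ((pl, wi) :: V) ->
  conn pu pl (join ((pu, wj) :: U) ((pl, wi) :: V))
    (join (wmap (fuse wi wj) U) (wmap (fuse wi wj) V)).
Proof.
move=> nij uU uV m.
have /map_snd_mem[u] : wi \in map snd U.
  by have := m wi; rewrite !inE eqxx /= (negbTE nij).
move=> /perm_cons_mem[U' pU].
have /map_snd_mem[l] : wj \in map snd V.
  by have := m wj; rewrite !inE eqxx eq_sym /= (negbTE nij).
move=> /perm_cons_mem[V' pV].
move: uU uV => /= /andP[]; rewrite (perm_mem (perm_map snd pU)) (perm_uniq (perm_map snd pU)) /=.
rewrite inE negb_or => /andP[_ njU] /andP[niU uU].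
case/andP; rewrite (perm_mem (perm_map snd pV)) (perm_uniq (perm_map snd pV)) /=.
rewrite inE negb_or => /andP[_ niV] /andP[njV uV].
have wm (Z : seq (nat * I * I)) : wi \notin map snd Z -> wmap (fuse wi wj) Z = Z.
  move=> nZ; rewrite -[RHS]map_id; apply/eq_in_map => -[p w] pw /=.
  by rewrite /fuse; case: eqP => // e; move: nZ; rewrite -e (map_f snd pw).
apply: (@conn_edge _ _ _ _ _ u l (join U' V')).
  have a1 : perm_eq ((pu, wj) :: U) ((pu, wj) :: (u, wi) :: U') by rewrite perm_cons.
  have a2 : perm_eq ((pl, wi) :: V) ((l, wj) :: (pl, wi) :: V') by perm_lia.
  have a3 := join_perm a1 a2.
  have a4 : perm_eq (join ((pu, wj) :: (u, wi) :: U') ((l, wj) :: (pl, wi) :: V'))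
      (Some (pu, l) :: join ((u, wi) :: U') ((pl, wi) :: V')).
    by apply: join_cons; rewrite /= inE negb_or ?njU ?njV // eq_sym nij.
  have a5 := join_cons u pl niU niV.
  by clear -a3 a4 a5; perm_lia.
have b1 := perm_map (fun q : nat * I * I => (q.1, fuse wi wj q.2)) pU.
have b2 := perm_map (fun q : nat * I * I => (q.1, fuse wi wj q.2)) pV.
have b3 := join_perm b1 b2.
apply: (perm_trans b3); rewrite /= -!/(wmap _ _) !wm // /fuse eqxx eq_sym (negbTE nij).
exact: join_cons.
Qed.

Lemma bot_wires (s : I -> I) i j (c := (CAtom CBot [:: j] [:: i] : form, s)) t k :
  balanced (c :: map snd t) ->
  conn (k, j) (k, i) (join (ports true ((k, c) :: t)) (ports false ((k, c) :: t)))
    (join (wmap (fuse (s i) (s j)) (ports true t))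
       (wmap (fuse (s i) (s j)) (ports false t))).
Proof.
move=> cl; have /andP[/andP[wf uc] _] := cl.1.
have e b : ports b ((k, c) :: t) =
    (if b then ((k, j), s j) else ((k, i), s i)) :: ports b t.
  by rewrite /ports /= (bot_ports _ _ wf); case: b.
have u b : uniq (map snd (ports b ((k, c) :: t))) by rewrite wires_ports; apply: balanced_uniq.
have m : map snd (ports true ((k, c) :: t)) =i map snd (ports false ((k, c) :: t)).
  by move=> w; rewrite !wires_ports balanced_mem.
move: (u true) (u false) m; rewrite !e; apply: bot_edge_core.
move: uc; rewrite /wires /= (catom_free true wf) (catom_free false wf) /= inE eq_sym.
by case/andP.
Qed.

Lemma bot_expand (s : I -> I) i j g (c := (CAtom CBot [:: j] [:: i] : form, s)) :
  balanced (c :: g) -> provable (ren (fuse (s i) (s j)) g) -> provable (c :: g).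
Proof.
move=> cl /provable_ren Pg [//|[k c'] t] [ec et]; subst c'.
rewrite -et in cl => lin; apply: D_bot (bot_wires k cl) _.
by apply: Pg => //; apply: linear_cons lin.
Qed.

(** Converse of [bot_expand], and the place where inversion of [D_bot] enters the semantics. *)
Lemma bot_contract (s : I -> I) i j g (c := (CAtom CBot [:: j] [:: i] : form, s)) :
  balanced (c :: g) -> provable (c :: g) -> provable (ren (fuse (s i) (s j)) g).
Proof.
move=> cl Pg; apply/provable_ren => t et lin.
(* A tag above all tags in use makes the ports of the added bot new. *)
pose k := (foldr maxn 0 (map fst t)).+1.
have fresh b x : (k, x) \notin occs b (map item_of t).
  apply/negP => /flatten_mapP[_ /mapP[[k' c'] kt ->] /mapP[y _ [ek _]]].
  suff : k' <= foldr maxn 0 (map fst t) by rewrite /= in ek; lia.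
  elim: (t) kt => //= p t' IH; rewrite inE => /orP[/eqP <-|/IH] /=; lia.
have wf : cform_wf v c.1 by case/andP: cl.1 => /andP[].
have lin' : linear v (map item_of ((k, c) :: t)).
  case/and3P: lin => w u1 u2.
  have -> : map item_of ((k, c) :: t) = (k, c.1) :: map item_of t by [].
  rewrite /linear !occs_cons [all _ _]/= wf w /= u1 u2.
  by rewrite (fresh true j) (fresh false i).
rewrite -et in cl.
have := Pg ((k, c) :: t); rewrite /= et => /(_ erefl lin') der.
exact: (bot_inv der lin' (perm_refl _) (bot_wires k cl)).
Qed.

End Semantics.

(** * Interpretation of formulas by orthogonality *)

Section Interpretation.
Variables (I L : eqType) (v : L -> nat * nat).
Local Notation form := (cform I L).
Local Notation clo := (form * (I -> I))%type.
Implicit Types (A B : form) (s r : I -> I) (c : clo) (g d e : seq clo) (w x : I)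
  (b : bool) (S : seq clo -> Prop).
Local Notation ok := (ok v).
Local Notation balanced := (balanced v).
Local Notation pole := (pole v).
Local Notation provable := (provable v).

Definition fcount b w A s := count_mem w (map s (cfree b A)).

(* For b = true, g completes the formula A into a balanced sequent; for b = false,
   g has the same interface as A and may replace it. *)
Definition typed b A s g :=
  all ok g /\ forall w, [&& wcount true w g + fcount b w A s ==
    wcount false w g + fcount (~~ b) w A s,
    wcount true w g <= 1 & wcount false w g <= 1].

Definition orth b A s S d := typed b A s d /\ forall g, S g -> pole (g ++ d).

(** Duality must reverse the value ([positive_dual]); for literals the choice is a convention. *)
Definition positive A : bool :=
  match A with
  | CAtom (CPos _) _ _ | CAtom CBot _ _ | CPar _ _ => false
  | CAtom (CNeg _) _ _ | CAtom COne _ _ | CTens _ _ => true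
  end.

(* The generators of A lie on the side positive A: the two sides of a formula are
   their bi-orthogonal and their orthogonal. *)
Definition side b A s S :=
  if b == positive A then orth b A s (orth (~~ b) A s S) else orth b A s S.

Definition agree A s s' := forall b x, x \in cfree b A -> s' x = s x.

(* Only the wires reached by an atom matter, hence every closure representing
   them is a generator. *)
Definition atom_gen p (u l : seq I) s g := exists u' l' s',
  [/\ g = [:: (CAtom p u' l', s')], map s' u' = map s u & map s' l' = map s l].

(** [s'] has to follow [s] on the free indices of the compound but may choose any wires for the
    indices it binds. With [b] true the two lists are contexts for the halves of a tensor, with [b]
    false they replace the halves of a par. *)
Definition pair_gen b A B (SA SB : (I -> I) -> seq clo -> Prop) s g :=
  exists s' g1 g2, [/\ agree (CTens A B) s s' /\ perm_eq g (g1 ++ g2),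
    ok (A, s'), ok (B, s'), side b A s' (SA s') g1 & side b B s' (SB s') g2].

Fixpoint gen A s g : Prop :=
  typed (positive A) A s g /\
  match A with
  | CAtom p u l =>
    match p with
    | CPos _ | CBot => atom_gen p u l s g
    | CNeg _ | COne => atom_gen (cprop_dual p) (rev l) (rev u) s g
    end
  | CTens A B => pair_gen true A B (gen A) (gen B) s g
  | CPar A B => pair_gen false A B (gen A) (gen B) s g
  end.

(** [sem true] contains the contexts that go with the formula, [sem false] the lists that may stand
    in its place. By [sem_orth] they are orthogonal to each other, which is what makes Cut sound. *)
Definition sem b A s := side b A s (gen A s).

Lemma gen_typed A s g : gen A s g -> typed (positive A) A s g.
Proof. by case: A => [p u l|A B|A B] []. Qed.

Lemma orth_sub b A s S g :
  (forall g, S g -> typed (~~ b) A s g) -> S g -> orth (~~ b) A s (orth b A s S) g.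
Proof.
move=> St Sg; split; first exact: St.
by move=> d [_ /(_ g Sg)]; apply: pole_perm; rewrite perm_catC.
Qed.

Lemma sem_typed b A s g : sem b A s g -> typed b A s g.
Proof. by rewrite /sem /side; case: ifP => _ []. Qed.

Lemma sem_gen A s g : gen A s g -> sem (positive A) A s g.
Proof.
move=> Ag; rewrite /sem /side eqxx -{1}[positive A]negbK; apply: orth_sub => // h.
by rewrite negbK; apply: gen_typed.
Qed.

Lemma sem_orth A s g d : sem true A s g -> sem false A s d -> pole (g ++ d).
Proof.
rewrite /sem /side; case: (positive A) => /=.
  move=> [_ H] dA; apply: (pole_perm (g := d ++ g)); last exact: H.
  by rewrite perm_catC.
by move=> gA [_ H]; apply: H.
Qed.

(** Whether a side was defined as an orthogonal or as a bi-orthogonal, it is closed, so that testing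
    against the opposite side is enough; in the first case only the generators, which lie there, are
    needed. *)
Lemma sem_intro b A s g : typed b A s g ->
  (forall d, sem (~~ b) A s d -> pole (d ++ g)) -> sem b A s g.
Proof.
move=> tg H; rewrite /sem /side; case: eqP => [e|/eqP n]; split=> // d.
  by move=> dA; apply: H; rewrite /sem /side -e; case: (b) dA.
move=> Ad; apply: H; have -> : ~~ b = positive A by case: (b) n; case: positive.
exact: sem_gen.
Qed.

Lemma perm_coccs_dual b A : perm_eq (coccs b (cdual A)) (coccs (~~ b) A).
Proof.
elim: A => [p u l|A IHA B IHB|A IHA B IHB] /=.
- by case: b; rewrite perm_rev.
- by rewrite perm_catC; apply: perm_cat.
- by rewrite perm_catC; apply: perm_cat.
Qed.

Lemma perm_cfree_dual b A : perm_eq (cfree b (cdual A)) (cfree (~~ b) A).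
Proof.
rewrite /cfree; apply: (@perm_trans _ [seq i <- coccs b (cdual A) | i \notin coccs b A]).
  have -> // : [seq i <- coccs b (cdual A) | i \notin coccs (~~ b) (cdual A)] =
      [seq i <- coccs b (cdual A) | i \notin coccs b A].
  by apply/eq_filter => i; rewrite (perm_mem (perm_coccs_dual _ _)) negbK.
by rewrite negbK; apply/perm_filter/perm_coccs_dual.
Qed.

Lemma wf_dual A : cform_wf v (cdual A) = cform_wf v A.
Proof.
rewrite /cform_wf !(perm_uniq (perm_coccs_dual _ A)) /= [uniq _ && _]andbC.
congr andb; elim: A => [p u l|A IHA B IHB|A IHA B IHB] /=; last 2 first.
- by rewrite IHA IHB andbC.
- by rewrite IHA IHB andbC.
have -> : uniq (rev l ++ rev u) = uniq (u ++ l) by rewrite -rev_cat rev_uniq.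
rewrite !size_rev; congr andb; case: p => [q|q||] /=; [case: (v q) => m n|case: (v q) => m n| | ];
  by rewrite !xpair_eqE andbC.
Qed.

Lemma cdualK : involutive (@cdual I L).
Proof.
elim=> [p u l|A IHA B IHB|A IHA B IHB] /=; rewrite ?IHA ?IHB //.
by rewrite !revK; case: p.
Qed.

Lemma fcount_dual b w A s : fcount b w (cdual A) s = fcount (~~ b) w A s.
Proof. by apply/permP/perm_map/perm_cfree_dual. Qed.

Lemma typed_dual b A s g : typed b (cdual A) s g <-> typed (~~ b) A s g.
Proof.
rewrite /typed; split=> -[okg H]; split=> // w; have := H w;
  by rewrite !fcount_dual.
Qed.

Lemma orth_dual b A s S S' d : (forall g, S g <-> S' g) ->
  orth b (cdual A) s S d <-> orth (~~ b) A s S' d.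
Proof.
move=> e; rewrite /orth typed_dual; split=> -[td H]; split=> // g /e; exact: H.
Qed.

Lemma positive_dual A : positive (cdual A) = ~~ positive A.
Proof. by case: A => [[q|q||] u l|A B|A B]. Qed.

Lemma side_dual b A s S S' d : (forall g, S g <-> S' g) ->
  side b (cdual A) s S d <-> side (~~ b) A s S' d.
Proof.
move=> e; rewrite /side positive_dual; case: (b); case: (positive A) => /=;
  by apply: orth_dual => // g; apply: orth_dual.
Qed.

Lemma ok_dual A s : ok (cdual A, s) = ok (A, s).
Proof.
rewrite /ok /= wf_dual; congr andb; apply: perm_uniq; rewrite /wires /=.
rewrite perm_catC; apply: perm_cat; apply/perm_map;
  exact: perm_cfree_dual.
Qed.

Lemma pair_gen_dual b A B SA SB SA' SB' s g :
  (forall s g, SA s g <-> SA' s g) -> (forall s g, SB s g <-> SB' s g) ->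
  pair_gen b (cdual B) (cdual A) SB SA s g <-> pair_gen (~~ b) A B SA' SB' s g.
Proof.
move=> eA eB.
have ag s' : agree (CTens (cdual B) (cdual A)) s s' <-> agree (CTens A B) s s'.
  have fr (c : bool) : perm_eq (cfree c (CTens (cdual B) (cdual A))) (cfree (~~ c) (CTens A B)).
    exact: (perm_cfree_dual c (CPar A B)).
  split=> H c x xc; first by apply: (H (~~ c)); rewrite (perm_mem (fr _)) negbK.
  by apply: (H (~~ c)); rewrite -(perm_mem (fr _)).
split=> -[s' [g1 [g2 [[/ag sa p] ok1 ok2 v1 v2]]]]; exists s', g2, g1.
  rewrite -(ok_dual A) -(ok_dual B) ok1 ok2; split=> //; first by split=> //; apply: (perm_trans p); rewrite perm_catC.
    by apply/(side_dual _ _ _ _ (eA s')).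
  by apply/(side_dual _ _ _ _ (eB s')).
rewrite !ok_dual ok1 ok2; split=> //; first by split=> //; apply: (perm_trans p); rewrite perm_catC.
  by apply/(side_dual _ _ _ _ (eB s')).
by apply/(side_dual _ _ _ _ (eA s')).
Qed.

(** A formula and its dual have the same generators, on opposite sides: duality flips both
    [positive] and the flag in [pair_gen]. *)
Lemma gen_dual A s g : gen (cdual A) s g <-> gen A s g.
Proof.
elim: A s g => [p u l|A IHA B IHB|A IHA B IHB] s g.
- have := typed_dual (positive (cdual (CAtom p u l))) (CAtom p u l) s g.
  rewrite positive_dual negbK => tE.
  by case: p tE => [q|q||] tE /=; rewrite ?revK; split=> -[/tE t h]; split.
- have := typed_dual false (CTens A B) s g; rewrite /= => ->.
  by split=> -[t /(pair_gen_dual false _ _ _ _ IHA IHB) h]; split.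
have := typed_dual true (CPar A B) s g; rewrite /= => ->.
by split=> -[t /(pair_gen_dual true _ _ _ _ IHA IHB) h]; split.
Qed.

Lemma sem_dual b A s g : sem b (cdual A) s g <-> sem (~~ b) A s g.
Proof. by apply: side_dual => d; apply: gen_dual. Qed.

Fixpoint cmap (h : I -> I) A : form :=
  match A with
  | CAtom p u l => CAtom p (map h u) (map h l)
  | CTens A B => CTens (cmap h A) (cmap h B)
  | CPar A B => CPar (cmap h A) (cmap h B)
  end.

Lemma coccs_cmap b h A : coccs b (cmap h A) = map h (coccs b A).
Proof. by elim: A => [p u l|A IHA B IHB|A IHA B IHB] /=; rewrite ?map_cat ?IHA ?IHB //; case: b. Qed.

Lemma mem_cindices b A x : x \in coccs b A -> x \in cindices A.
Proof. by rewrite mem_cat; case: b => ->; rewrite ?orbT. Qed.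

Lemma cfree_cmap b h A : {in cindices A &, injective h} ->
  cfree b (cmap h A) = map h (cfree b A).
Proof.
move=> inj; rewrite /cfree !coccs_cmap filter_map; congr map.
apply/eq_in_filter => x xA /=; congr negb; apply/mapP/idP => [[y yA]|xA'].
  by move/(inj _ _ (mem_cindices xA) (mem_cindices yA)) ->.
by exists x.
Qed.

Lemma cindices_sub A B x : x \in cindices A \/ x \in cindices B ->
  x \in cindices (CTens A B).
Proof.
by rewrite /cindices /= !mem_cat => -[] /orP[] ->; rewrite ?orbT.
Qed.

Lemma wf_cmap h A : {in cindices A &, injective h} ->
  cform_wf v (cmap h A) = cform_wf v A.
Proof.
move=> inj; rewrite /cform_wf !coccs_cmap.
rewrite !map_inj_in_uniq; try by move=> x y xA yA; apply: inj;
  apply: mem_cindices; eassumption.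
congr andb; elim: A inj => [p u l|A IHA B IHB|A IHA B IHB] inj /=; last 2 first.
- rewrite IHA ?IHB // => x y xA yA; apply: inj; apply: cindices_sub;
    by [left|right].
- rewrite IHA ?IHB // => x y xA yA; apply: inj; apply: cindices_sub;
    by [left|right].
by rewrite !size_map -map_cat map_inj_in_uniq.
Qed.

Lemma positive_cmap h A : positive (cmap h A) = positive A.
Proof. by case: A => [[]|A B|A B]. Qed.

Lemma mem_cfree_cindices b A x : x \in cfree b A -> x \in cindices A.
Proof. by rewrite mem_free => /andP[/mem_cindices]. Qed.

Definition represents h A s s' :=
  {in cindices A &, injective h} /\ forall b x, x \in cfree b A -> s' (h x) = s x.

Lemma represents_wires h A s s' b : represents h A s s' ->
  map s' (cfree b (cmap h A)) = map s (cfree b A).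
Proof.
move=> [inj e]; rewrite cfree_cmap // -map_comp.
by apply/eq_in_map => x; apply: e.
Qed.

Lemma typed_cmap h A s s' b g : represents h A s s' ->
  typed b (cmap h A) s' g <-> typed b A s g.
Proof.
move=> R; rewrite /typed /fcount !(represents_wires _ R).
by split=> -[okg H]; split=> // w; have := H w; rewrite !(represents_wires _ R).
Qed.

Lemma ok_cmap h A s s' : represents h A s s' -> ok (cmap h A, s') = ok (A, s).
Proof.
move=> R; rewrite /ok /wires /= !(represents_wires _ R) wf_cmap //.
by case: R.
Qed.

Lemma side_cmap h A s s' S S' b g : represents h A s s' ->
  (forall g, S' g <-> S g) -> side b (cmap h A) s' S' g <-> side b A s S g.
Proof.
move=> R e; rewrite /side positive_cmap.
have oE (c : bool) T T' f : (forall g, T' g <-> T g) ->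
    orth c (cmap h A) s' T' f <-> orth c A s T f.
  by move=> eT; rewrite /orth (typed_cmap _ _ R); split=> -[t H]; split=> // d /eT;
    apply: H.
by case: eqP => _; apply: (oE) => // f; apply: (oE).
Qed.

(** The [nth] and [index] expression inverts [h] on the indices of [A]. *)
Definition pullback h A (s1 s' : I -> I) y : I :=
  if y \in map h (cindices A) then s1 (nth y (cindices A) (index y (map h (cindices A))))
  else s' y.

Lemma pullbackE h A s1 s' x : {in cindices A &, injective h} -> x \in cindices A ->
  pullback h A s1 s' (h x) = s1 x.
Proof.
move=> inj xA; rewrite /pullback map_f //; congr s1.
set i := index _ _; have li : i < size (cindices A).
  by rewrite -(size_map h) index_mem map_f.
apply: inj => //; first exact: mem_nth.
by rewrite -(nth_map _ (h x)) // nth_index // map_f.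
Qed.

Lemma pair_gen_cmap b h A B SA SB SA' SB' s s' g :
  represents h (CTens A B) s s' ->
  (forall s s' g, represents h A s s' -> SA' s' g <-> SA s g) ->
  (forall s s' g, represents h B s s' -> SB' s' g <-> SB s g) ->
  pair_gen b (cmap h A) (cmap h B) SA' SB' s' g <-> pair_gen b A B SA SB s g.
Proof.
move=> R eA eB; have [inj e] := R.
have injA : {in cindices A &, injective h}.
  by move=> x y xA yA; apply: inj; apply: cindices_sub; left.
have injB : {in cindices B &, injective h}.
  by move=> x y xA yA; apply: inj; apply: cindices_sub; right.
have fr (c : bool) : cfree c (CTens (cmap h A) (cmap h B)) = map h (cfree c (CTens A B)).
  by rewrite -cfree_cmap.
split=> -[s1 [g1 [g2 [[ag p] ok1 ok2 v1 v2]]]].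
  have RA : represents h A (s1 \o h) s1 by [].
  have RB : represents h B (s1 \o h) s1 by [].
  exists (s1 \o h), g1, g2; rewrite -(ok_cmap RA) -(ok_cmap RB); split=> //.
  - split=> // c x xc /=; rewrite -(e c x xc); apply: (ag c).
    by rewrite fr map_f.
  - exact: (side_cmap _ _ RA (fun f => eA _ _ f RA)).1 v1.
  - exact: (side_cmap _ _ RB (fun f => eB _ _ f RB)).1 v2.
pose s2 := pullback h (CTens A B) s1 s'.
have s2E x : x \in cindices (CTens A B) -> s2 (h x) = s1 x by apply: pullbackE.
have RA : represents h A s1 s2.
  split=> // c x /mem_cfree_cindices xA; apply: s2E; apply: cindices_sub; by left.
have RB : represents h B s1 s2.
  split=> // c x /mem_cfree_cindices xA; apply: s2E; apply: cindices_sub; by right.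
exists s2, g1, g2; rewrite (ok_cmap RA) (ok_cmap RB); split=> //.
- split=> // c y; rewrite fr => /mapP[x xc ->].
  rewrite (e c x xc) s2E; last exact: (mem_cfree_cindices xc).
  exact: ag xc.
- exact: (side_cmap _ _ RA (fun f => eA _ _ f RA)).2 v1.
- exact: (side_cmap _ _ RB (fun f => eB _ _ f RB)).2 v2.
Qed.

(** The interpretation sees index names only through the wires of the free indices. For bound
    indices, the wires chosen on one side of the renaming are carried to the other by composition
    with [h] or by [pullback]. *)
Lemma gen_cmap h A s s' g : cform_wf v A -> represents h A s s' ->
  gen (cmap h A) s' g <-> gen A s g.
Proof.
elim: A s s' g => [p u l|A IHA B IHB|A IHA B IHB] s s' g wf R.
- have := typed_cmap (positive (CAtom p u l)) g R.
  move=> tE.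
  have [_ e] := R; have := e true; have := e false; rewrite !(catom_free _ wf) => el eu.
  have eU : map s' (map h u) = map s u.
    by rewrite -map_comp; apply/eq_in_map => x; apply: eu.
  have eL : map s' (map h l) = map s l.
    by rewrite -map_comp; apply/eq_in_map => x; apply: el.
  have aE q : atom_gen q (map h u) (map h l) s' g <-> atom_gen q u l s g.
    by rewrite /atom_gen eU eL.
  have aE' q : atom_gen q (rev (map h l)) (rev (map h u)) s' g <->
      atom_gen q (rev l) (rev u) s g.
    by rewrite /atom_gen !map_rev eU eL.
  by case: p tE {wf R e} => [q|q||] tE; split=> -[/tE t h1];
    split=> //; first [exact/aE|exact/aE'].
- have [wA wB _ _] := wf_sub wf.
  have := typed_cmap true g R => tE.
  have pE : pair_gen true (cmap h A) (cmap h B) (gen (cmap h A)) (gen (cmap h B)) s' g <->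
      pair_gen true A B (gen A) (gen B) s g.
    by apply: pair_gen_cmap R _ _ => s1 s2 f R1; [apply: IHA|apply: IHB].
  by split=> -[/tE t /pE].
have [wA wB _ _] := wf_sub (wf : cform_wf v (CTens A B)).
have := typed_cmap false g R => tE.
have pE : pair_gen false (cmap h A) (cmap h B) (gen (cmap h A)) (gen (cmap h B)) s' g <->
    pair_gen false A B (gen A) (gen B) s g.
  by apply: pair_gen_cmap R _ _ => s1 s2 f R1; [apply: IHA|apply: IHB].
by split=> -[/tE t /pE].
Qed.

Lemma sem_cmap b h A s s' g : cform_wf v A -> represents h A s s' ->
  sem b (cmap h A) s' g <-> sem b A s g.
Proof. by move=> wf R; apply: side_cmap => // d; apply: gen_cmap. Qed.

Lemma wires_swapK r g : involutive r -> ren r (ren r g) = g.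
Proof. by move=> rK; rewrite ren_comp -[RHS]ren_id; congr ren; apply/funext. Qed.

Lemma typed_ren r b A s g : injective r -> involutive r -> typed b A s g ->
  typed b A (r \o s) (ren r g).
Proof.
move=> inj rK [okg H]; split; first by rewrite all_ok_ren.
move=> w; have := H (r w); rewrite -!(count_map_inj _ (r w) _ inj) !rK /fcount.
have e (c : bool) : count_mem w (map (r \o s) (cfree c A)) = count_mem (r w) (map s (cfree c A)).
  by rewrite map_comp count_map; apply: eq_count => x /=; rewrite (inv_eq rK).
by rewrite !e.
Qed.

(** Orthogonals are contravariant, so tests must be moved back along the renaming. Requiring an
    involution lets [r] serve in both directions; only swaps of two wires are needed later. *)
Lemma orth_ren r b A s S S' d : injective r -> involutive r ->
  (forall g, S' g -> S (ren r g)) -> orth b A s S d ->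
  orth b A (r \o s) S' (ren r d).
Proof.
move=> inj rK e [td H]; split; first exact: typed_ren.
move=> g /e /H Pg; have -> : g ++ ren r d = ren r (ren r g ++ d).
  by rewrite ren_cat wires_swapK.
exact: pole_ren.
Qed.

Lemma side_ren r b A s S S' d : injective r -> involutive r ->
  (forall g, S' g -> S (ren r g)) -> (forall g, S g -> S' (ren r g)) ->
  side b A s S d -> side b A (r \o s) S' (ren r d).
Proof.
move=> inj rK e e'; rewrite /side; case: eqP => _; apply: orth_ren => // g.
have rrs : r \o (r \o s) = s by apply/funext => x /=; rewrite rK.
by move/(orth_ren inj rK e'); rewrite rrs.
Qed.

Lemma pair_gen_ren r b A B SA SB s g : injective r -> involutive r ->
  (forall s g, SA s g -> SA (r \o s) (ren r g)) ->
  (forall s g, SB s g -> SB (r \o s) (ren r g)) ->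
  pair_gen b A B SA SB s g -> pair_gen b A B SA SB (r \o s) (ren r g).
Proof.
move=> inj rK eA eB [s1 [g1 [g2 [[ag p] ok1 ok2 v1 v2]]]].
have rrs : r \o (r \o s1) = s1 by apply/funext => x /=; rewrite rK.
exists (r \o s1), (ren r g1), (ren r g2); split.
- split; first by move=> c x /ag /= ->.
  by rewrite -ren_cat; apply: perm_map.
- by rewrite (ok_ren v (A, s1) inj).
- by rewrite (ok_ren v (B, s1) inj).
- by apply: (side_ren inj rK) v1 => f; last exact: eA; move/eA; rewrite rrs.
- by apply: (side_ren inj rK) v2 => f; last exact: eB; move/eB; rewrite rrs.
Qed.

Lemma gen_ren r A s g : injective r -> involutive r -> gen A s g ->
  gen A (r \o s) (ren r g).
Proof.
move=> inj rK; elim: A s g => [p u l|A IHA B IHB|A IHA B IHB] s g.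
- have aE q u0 l0 : atom_gen q u0 l0 s g -> atom_gen q u0 l0 (r \o s) (ren r g).
    case=> u' [l' [s' [-> eu el]]]; exists u', l', (r \o s').
    by rewrite (map_comp r s' u') (map_comp r s' l') eu el -!map_comp.
  by case: p => [q|q||] [t /aE a]; split=> //; apply: typed_ren.
- by case=> t h; split; [exact: typed_ren|exact: pair_gen_ren].
- by case=> t h; split; [exact: typed_ren|exact: pair_gen_ren].
Qed.

Lemma sem_ren r b A s g : injective r -> involutive r -> sem b A s g ->
  sem b A (r \o s) (ren r g).
Proof.
move=> inj rK; apply: side_ren => // f; last exact: gen_ren.
have rrs : r \o (r \o s) = s by apply/funext => x /=; rewrite rK.
by move/(gen_ren inj rK); rewrite rrs.
Qed.

End Interpretation.

(** * Sequents by counting, fresh names *)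

Lemma uniq_map_in (T U : eqType) (f : T -> U) (s : seq T) : uniq (map f s) ->
  {in s &, injective f}.
Proof.
elim: s => //= x s IH /andP[nx /IH inj] y z; rewrite !inE.
move=> /orP[/eqP ->|ys] /orP[/eqP ->|zs] // e; last exact: inj.
- by move: nx; rewrite e map_f.
- by move: nx; rewrite -e map_f.
Qed.

Lemma count_le1 (T : eqType) (a : T) (s : seq T) : uniq s -> count_mem a s <= 1.
Proof. by move=> u; rewrite count_uniq_mem // leq_b1. Qed.

Lemma uniq_flatten (T U : eqType) (f : T -> seq U) (s : seq T) :
  uniq (flatten (map f s)) =
  all (uniq \o f) s && pairwise (fun a b => disjoint_seq (f a) (f b)) s.
Proof.
elim: s => //= a s IH; rewrite cat_uniq IH.
have -> : ~~ has (mem (f a)) (flatten (map f s)) =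
    all (fun b => disjoint_seq (f a) (f b)) s.
  by elim: s {IH} => //= b s IH; rewrite has_cat negb_or IH.
by case: (uniq (f a)); case: (all _ s); rewrite ?andbT ?andbF.
Qed.

Lemma pairwise_and (T : Type) (r1 r2 : rel T) (s : seq T) :
  pairwise (fun a b => r1 a b && r2 a b) s = pairwise r1 s && pairwise r2 s.
Proof.
elim: s => //= a s ->; rewrite all_predI; rewrite !andbA; congr andb.
by rewrite -!andbA; congr andb; rewrite andbC.
Qed.

Lemma ccontextE (I L : eqType) (v : L -> nat * nat) (G : seq (cform I L)) :
  ccontext v G = [&& all (cform_wf v) G, uniq (cfree_ctx true G) &
    uniq (cfree_ctx false G)].
Proof.
rewrite /ccontext pairwise_and /cfree_ctx !uniq_flatten.
case w: (all _ G) => //=.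
have u b : all (uniq \o cfree b) G.
  by apply/allP => A /(allP w)/(free_uniq b).
by rewrite !u.
Qed.

(** In this form the well-formedness of a conclusion follows from that of the premises by arithmetic
    on counts. *)
Lemma csequentP (I L : eqType) (v : L -> nat * nat) (G : seq (cform I L)) :
  csequent v G <-> all (cform_wf v) G /\ forall w,
    (count_mem w (cfree_ctx true G) == count_mem w (cfree_ctx false G)) &&
    (count_mem w (cfree_ctx true G) <= 1).
Proof.
rewrite /csequent ccontextE; split=> [[/and3P[wf u1 u2] e]|[wf H]].
  split=> // w; rewrite !count_uniq_mem // -(e w) eqxx; exact: leq_b1.
have u (s : seq I) : (forall w, count_mem w s <= 1) -> uniq s.
  elim: s => //= x s IH c; rewrite IH ?andbT; last by move=> w; have := c w; lia.
  by have := c x; rewrite eqxx -has_pred1 has_count; lia.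
split.
  by rewrite wf !u // => w; have /andP[/eqP e l] := H w; rewrite -?e.
by move=> w; have /andP[/eqP e _] := H w; rewrite -!has_pred1 !has_count e.
Qed.

Lemma csequent_perm (I L : eqType) (v : L -> nat * nat) (G D : seq (cform I L)) :
  perm_eq G D -> csequent v G -> csequent v D.
Proof.
move=> p /csequentP[wf H]; apply/csequentP; split; first by rewrite -(perm_all _ p).
move=> w; have := H w; have q b := perm_flatmap (cfree b) p.
by rewrite /cfree_ctx !(permP (q _)).
Qed.

Lemma TTL_csequent (I L : eqType) (v : L -> nat * nat) (G : seq (cform I L)) :
  TTL v G -> csequent v G.
Proof. by elim=> // G' D p _; apply: csequent_perm. Qed.

Lemma fresh_fun (T I : eqType) (s : seq T) (avoid : seq I) : infinite_eqType I ->
  uniq s -> exists f : T -> I, {in s &, injective f} /\ {in s, forall x, f x \notin avoid}.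
Proof.
move=> inf; elim: s => [|x s IH] /=; first by case: (inf [::]) => y _; exists (fun=> y).
case/andP=> xs /IH[f [injf avf]].
have [y] := inf (map f s ++ avoid); rewrite mem_cat negb_or => /andP[ys yav].
have nx z : z \in s -> z == x = false by move=> zs; apply/eqP => e; move: xs; rewrite -e zs.
exists (fun z => if z == x then y else f z); split=> [z1 z2|z]; last first.
  by rewrite inE => /orP[/eqP ->|zs]; rewrite ?eqxx // nx // avf.
rewrite !inE => /orP[/eqP ->|h1] /orP[/eqP ->|h2] //; rewrite ?eqxx ?nx //.
- by move=> e; move: ys; rewrite e map_f.
- by move=> e; move: ys; rewrite -e map_f.
- exact: injf.
Qed.

Lemma join_zip (P W : eqType) (ps qs : seq P) (ws : seq W) : uniq ws ->
  size ps = size ws -> size qs = size ws ->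
  perm_eq (join (zip ps ws) (zip qs ws)) [seq Some e | e <- zip ps qs].
Proof.
elim: ws ps qs => [|w ws IH] [|p ps] [|q qs] //= /andP[nw uw] [ep] [eq].
have := IH _ _ uw ep eq.
have m (rs : seq P) : size rs = size ws -> map snd (zip rs ws) = ws.
  by move=> e; apply: unzip2_zip; rewrite e.
have := @join_cons _ _ p q w (zip ps ws) (zip qs ws).
rewrite !m // => /(_ nw nw) p1 p2; perm_lia.
Qed.

Lemma map_cat_inv (T U : Type) (f : T -> U) t a b : map f t = a ++ b ->
  exists t1 t2, [/\ t = t1 ++ t2, map f t1 = a & map f t2 = b].
Proof.
move=> e; exists (take (size a) t), (drop (size a) t); rewrite cat_take_drop.
by rewrite map_take map_drop e take_size_cat // drop_size_cat.
Qed.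

(** * Axioms and connectives on closures *)

Section Provability.
Variables (I L : eqType) (v : L -> nat * nat).
Hypothesis I_inf : infinite_eqType I.
Local Notation form := (cform I L).
Local Notation clo := (form * (I -> I))%type.
Implicit Types (A B : form) (s r : I -> I) (g d e : seq clo) (w x : I)
  (b : bool).
Local Notation ok := (ok v).
Local Notation balanced := (balanced v).
Local Notation pole := (pole v).
Local Notation provable := (provable v).
Local Notation typed := (typed v).
Local Notation gen := (gen v).
Local Notation sem := (sem v).

Lemma ok_count A s w : ok (A, s) -> fcount true w A s + fcount false w A s <= 1.
Proof. by case/andP=> _ u; rewrite -count_cat; apply: count_le1. Qed.

Lemma wcount_cons1 b w A s g :
  wcount b w ((A, s) :: g) = fcount b w A s + wcount b w g.
Proof. exact: wcount_cons. Qed.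

Lemma wcount1 b w A s : wcount b w [:: (A, s)] = fcount b w A s.
Proof. by rewrite wcount_cons addn0. Qed.

Lemma typed_self A s : ok (A, s) -> typed false A s [:: (A, s)].
Proof.
move=> o; split; first by rewrite /= o.
by move=> w; have := ok_count w o; rewrite !wcount1 /=; lia.
Qed.

Lemma typed_balanced A s g : ok (A, s) -> typed true A s g ->
  balanced ((A, s) :: g).
Proof.
move=> o [okg H]; split; first by rewrite /= o.
move=> w; have := ok_count w o; have := H w; rewrite !wcount_cons1 /=.
by move: (fcount _ _ _ _) (fcount _ _ _ _) (wcount _ _ _) (wcount _ _ _); lia.
Qed.

Lemma ports_cons b k A s t : ports b ((k, (A, s)) :: t) =
  [seq ((k, x), s x) | x <- cfree b A] ++ ports b t.
Proof. by []. Qed.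

Lemma ports_cat b (t t' : seq (nat * clo)) : ports b (t ++ t') = ports b t ++ ports b t'.
Proof. by rewrite /ports map_cat flatten_cat. Qed.

Lemma zip_map_tag (k : nat) (u : seq I) s :
  [seq ((k, x), s x) | x <- u] = zip (tag_ports k u) (map s u).
Proof. by elim: u => //= x u ->. Qed.

(** The two atoms carry the same wires in reversed order, so their joins are the edges of [D_ax];
    since a closure has distinct wires, no edge stays within one atom ([n1], [n2]). *)
Lemma pole_axiom q (u l u' l' : seq I) s s' :
  map s' u' = map s (rev l) -> map s' l' = map s (rev u) ->
  pole [:: (CAtom (CPos q) u' l', s'); (CAtom (CNeg q) u l, s)].
Proof.
move=> eu el [/and3P[/= ok1 ok2 _] _] [|[k c] [|[k' c'] [|]]] //= [-> ->] lin.
have /andP[wf1 u1] := ok1; have /andP[wf2 u2] := ok2.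
have s1 : size u' = size l by rewrite -(size_map s') eu size_map size_rev.
have s2 : size l' = size u by rewrite -(size_map s') el size_map size_rev.
apply: D_perm (perm_refl _) _ (D_ax _ _ _ s1 (esym s2)).
rewrite /axiom_edges !ports_cons !(catom_free _ wf1) !(catom_free _ wf2) !cats0.
move: u1 u2; rewrite /wires /= !(catom_free _ wf1) !(catom_free _ wf2) => u1 u2.
have rv (h : nat) (z : seq I) r : perm_eq [seq ((h, x), r x) | x <- rev z]
  [seq ((h, x), r x) | x <- z] by rewrite perm_map // perm_rev.
have j1 : perm_eq (join [seq ((k, x), s' x) | x <- u'] [seq ((k', x), s x) | x <- l])
    [seq Some p | p <- zip (tag_ports k u') (tag_ports k' (rev l))].
  have := join_perm (perm_refl [seq ((k, x), s' x) | x <- u']) (rv k' l s).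
  rewrite perm_sym !zip_map_tag eu => /perm_trans; apply.
  apply: join_zip; rewrite ?size_map ?size_rev //.
  by move: u2; rewrite cat_uniq map_rev rev_uniq => /and3P[].
have j2 : perm_eq (join [seq ((k', x), s x) | x <- u] [seq ((k, x), s' x) | x <- l'])
    [seq Some p | p <- zip (tag_ports k' u) (tag_ports k (rev l'))].
  have := join_perm (perm_refl [seq ((k', x), s x) | x <- u]) (rv k l' s').
  have el' : map s' (rev l') = map s u by rewrite map_rev el map_rev revK.
  rewrite perm_sym !zip_map_tag el' => /perm_trans; apply.
  apply: join_zip; rewrite ?size_map ?size_rev //.
  by move: u2; rewrite cat_uniq => /and3P[].
have wm (h : nat) (z : seq I) r : map snd [seq ((h, x), r x) | x <- z] = map r z.
  by rewrite -map_comp.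
have n1 : join [seq ((k, x), s' x) | x <- u'] [seq ((k, x), s' x) | x <- l'] = [::].
  apply: join_nil => w; rewrite !wm => a b.
  by move: u1; rewrite cat_uniq => /and3P[_ /hasPn/(_ w b)]; rewrite /= a.
have n2 : join [seq ((k', x), s x) | x <- u] [seq ((k', x), s x) | x <- l] = [::].
  apply: join_nil => w; rewrite !wm => a b.
  by move: u2; rewrite cat_uniq => /and3P[_ /hasPn/(_ w b)]; rewrite /= a.
rewrite join_cat.
have c1 := join_catr [seq ((k, x), s' x) | x <- u'] [seq ((k, x), s' x) | x <- l']
  [seq ((k', x), s x) | x <- l].
have c2 := join_catr [seq ((k', x), s x) | x <- u] [seq ((k, x), s' x) | x <- l']
  [seq ((k', x), s x) | x <- l].
rewrite n1 in c1; rewrite n2 in c2.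
clear -c1 c2 j1 j2; perm_lia.
Qed.

(** Contracting the bot identifies the two wires of [1], and what remains is the axiom [D_one]. *)
Lemma pole_one (u l u' l' : seq I) s s' :
  map s' u' = map s (rev l) -> map s' l' = map s (rev u) ->
  pole [:: (CAtom CBot u' l', s'); (CAtom COne u l, s)].
Proof.
move=> eu el bal; have /and3P[/= ok1 ok2 _] := bal.1.
have /andP[wf1 u1] := ok1; have /andP[wf2 u2] := ok2.
have [i eU] : exists i, u = [:: i].
  by case/and3P: wf2 => /= /andP[/eqP[]]; case: (u) => [|i []] // _ _ _ _ _; exists i.
have [j eL] : exists j, l = [:: j].
  by case/and3P: wf2 => /= /andP[/eqP[_]]; case: (l) => [|j []] // _ _ _ _; exists j.
have [j' eU'] : exists i, u' = [:: i].
  by case/and3P: wf1 => /= /andP[/eqP[]]; case: (u') => [|j' []] // _ _ _ _ _; exists j'.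
have [i' eL'] : exists j, l' = [:: j].
  by case/and3P: wf1 => /= /andP[/eqP[_]]; case: (l') => [|i' []] // _ _ _ _; exists i'.
subst u l u' l'; case: eu el => ej [ei].
apply: bot_expand bal _; apply/provable_ren => -[|[k c] [|]] // [->] lin.
rewrite !ports_cons !(catom_free _ wf2) /= /wmap /= ei ej /fuse eqxx if_same.
by rewrite /join /= eqxx; apply: D_one.
Qed.

Lemma ports_occs b (t : seq (nat * clo)) p : p \in ports b t -> p.1 \in occs b (map (@item_of I L) t).
Proof.
case/flatten_mapP=> -[k [A s]] kt /mapP[x] /= xA ->.
apply/flatten_mapP; exists (k, A); first by apply/mapP; exists (k, (A, s)).
by rewrite mem_tag_ports; move: xA; rewrite mem_free => /andP[].
Qed.

Lemma perm_ports_bound b (k : nat) A B s s' (t : seq (nat * I * I)) : cform_wf v (CTens A B) ->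
  agree (CTens A B) s s' ->
  perm_eq ([seq ((k, x), s' x) | x <- cfree b A] ++ [seq ((k, x), s' x) | x <- cfree b B] ++ t)
    ([seq ((k, x), s' x) | x <- bound A B] ++
     [seq ((k, x), s x) | x <- cfree b (CTens A B)] ++ t).
Proof.
move=> /wf_sub[_ _ u1 u2] ag.
have := perm_map (fun x => ((k, x), s' x)) (perm_free_bound b u1 u2).
rewrite !map_cat.
have -> : [seq ((k, x), s' x) | x <- cfree b (CTens A B)] =
    [seq ((k, x), s x) | x <- cfree b (CTens A B)].
  by apply/eq_in_map => x /ag ->.
by move=> p; perm_lia.
Qed.

Lemma balanced_wires (t : seq (nat * clo)) : balanced (map snd t) ->
  [/\ uniq (map snd (ports true t)), uniq (map snd (ports false t)) &
      perm_eq (map snd (ports true t)) (map snd (ports false t))].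
Proof.
move=> bal; have u b : uniq (map snd (ports b t)).
  by rewrite wires_ports; apply: balanced_uniq bal.
split; rewrite ?u //; apply: uniq_perm; rewrite ?u // => w.
by rewrite !wires_ports (balanced_mem w bal).
Qed.

Lemma ok_inj A s : ok (A, s) -> {in cfree true A ++ cfree false A &, injective s}.
Proof. by case/andP=> _; rewrite /wires /= -map_cat => /uniq_map_in. Qed.

Lemma provable_tens A B s s' g1 g2 : agree (CTens A B) s s' ->
  ok (A, s') -> balanced ((A, s') :: g1) -> balanced ((B, s') :: g2) ->
  balanced ((CTens A B, s) :: g1 ++ g2) ->
  provable ((A, s') :: g1) -> provable ((B, s') :: g2) ->
  provable ((CTens A B, s) :: g1 ++ g2).
Proof.
move=> ag okA bal1 bal2 bal p1 p2 [//|[k c] t] [-> et].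
have [t1 [t2 [e1 et1 et2]]] := map_cat_inv et; subst t; move=> lin.
have wf : cform_wf v (CTens A B) by case/andP: bal.1 => /andP[].
have lin' : linear v ((k, CTens A B) :: map (@item_of I L) t1 ++ map (@item_of I L) t2).
  by move: lin; rewrite /= map_cat.
have [lin1 lin2] := linear_tens lin'.
have d1 := p1 ((k, (A, s')) :: t1); rewrite /= et1 in d1; have {}d1 := d1 erefl lin1.
have d2 := p2 ((k, (B, s')) :: t2); rewrite /= et2 in d2; have {}d2 := d2 erefl lin2.
rewrite [map _ _]/= map_cat; apply: D_tens d1 d2 _.
pose X := [seq ((k, x), s' x) | x <- bound A B].
have -> : tag_ports k (bound A B) = map fst X by rewrite -map_comp.
have q b : perm_eq (ports b ((k, (A, s')) :: t1) ++ ports b ((k, (B, s')) :: t2))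
    (X ++ ports b ((k, (CTens A B, s)) :: t1 ++ t2)).
  have := perm_ports_bound b k (ports b t1 ++ ports b t2) wf ag.
  rewrite !ports_cons ports_cat -/X => p; perm_lia.
have bt1 : balanced (map snd ((k, (A, s')) :: t1)) by rewrite /= et1.
have bt2 : balanced (map snd ((k, (B, s')) :: t2)) by rewrite /= et2.
have bt : balanced (map snd ((k, (CTens A B, s)) :: t1 ++ t2)) by rewrite /= et.
have [uU1 _ eU1] := balanced_wires bt1; have [uU2 _ eU2] := balanced_wires bt2.
have [uU _ _] := balanced_wires bt.
(* Linearity keeps the ports of the two halves apart on each side. Together with [D'] below, this
   puts the upper and the lower end of a bound port in different halves, as [conns_join] asks. *)
have D b x : x \in coccs b A ->
    (k, x) \notin occs b ((k, B) :: map (@item_of I L) t2).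
  move=> xA; have : uniq (occs b ((k, CTens A B) :: map (@item_of I L) t1 ++ map (@item_of I L) t2)).
    by case/and3P: lin' => _; case: (b).
  rewrite !occs_cons occs_cat /= -!/(coccs _ _) => u; apply/negP => xB.
  have : uniq (tag_ports k (coccs b A) ++ occs b ((k, B) :: map (@item_of I L) t2)).
    have : uniq ((tag_ports k (coccs b A) ++ occs b ((k, B) :: map (@item_of I L) t2)) ++
        occs b (map (@item_of I L) t1)).
      rewrite (perm_uniq (_ : perm_eq _ (tag_ports k (coccs b A ++ coccs b B) ++
        occs b (map (@item_of I L) t1) ++ occs b (map (@item_of I L) t2)))) //.
      by rewrite occs_cons tag_ports_cat; perm_lia.
    by rewrite cat_uniq => /andP[].
  by rewrite cat_uniq => /and3P[_ /hasPn/(_ _ xB)]; rewrite /= mem_tag_ports xA.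
have D' b x : x \in coccs b B ->
    (k, x) \notin occs b ((k, A) :: map (@item_of I L) t1).
  move=> xB; have : uniq (occs b ((k, CTens A B) :: map (@item_of I L) t1 ++ map (@item_of I L) t2)).
    by case/and3P: lin' => _; case: (b).
  rewrite !occs_cons occs_cat /= -!/(coccs _ _) => u; apply/negP => xA.
  have : uniq (tag_ports k (coccs b B) ++ occs b ((k, A) :: map (@item_of I L) t1)).
    have : uniq ((tag_ports k (coccs b B) ++ occs b ((k, A) :: map (@item_of I L) t1)) ++
        occs b (map (@item_of I L) t2)).
      rewrite (perm_uniq (_ : perm_eq _ (tag_ports k (coccs b A ++ coccs b B) ++
        occs b (map (@item_of I L) t1) ++ occs b (map (@item_of I L) t2)))) //.
      by rewrite occs_cons tag_ports_cat; perm_lia.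
    by rewrite cat_uniq => /andP[].
  by rewrite cat_uniq => /and3P[_ /hasPn/(_ _ xA)]; rewrite /= mem_tag_ports xB.
apply: conns_join => //.
- rewrite -map_comp map_inj_in_uniq.
    by apply: bound_uniq; case: (wf_sub wf).
  by move=> x y /(bound_free wf) xA /(bound_free wf) yA; apply: (ok_inj okA).
- move=> _ /mapP[x xb ->]; apply/negP => /andP[h1 h2].
  move: xb; rewrite mem_bound => /orP[] /andP[h3 h4].
    by have := D' false x h4; rewrite (ports_occs h2).
  by have := D' true x h3; rewrite (ports_occs h1).
- move=> _ /mapP[x xb ->]; apply/negP => /andP[h1 h2].
  move: xb; rewrite mem_bound => /orP[] /andP[h3 h4].
    by have := D true x h3; rewrite (ports_occs h1).
  by have := D false x h4; rewrite (ports_occs h2).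
Qed.

(** If the wires of the bound indices occur nowhere else, [join_diag] shows that they form the
    self-edges of [D_par]. *)
Lemma provable_par A B s s' g : cform_wf v (CTens A B) -> agree (CTens A B) s s' ->
  balanced ((CPar A B, s) :: g) -> uniq (map s' (bound A B)) ->
  {in bound A B, forall x, s' x \notin all_wires ((CPar A B, s) :: g)} ->
  provable [:: (A, s'), (B, s') & g] -> provable ((CPar A B, s) :: g).
Proof.
move=> wf ag bal us fr p [//|[k c] t] [-> et] lin.
have {p}d := p [:: (k, (A, s')), (k, (B, s')) & t]; rewrite /= et in d.
have {}d := d erefl (linear_par lin).
rewrite [map _ _]/=; apply: D_par; apply: D_perm (perm_refl _) _ d.
pose X := [seq ((k, x), s' x) | x <- bound A B].
have q b : perm_eq (ports b [:: (k, (A, s')), (k, (B, s')) & t])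
    (X ++ ports b ((k, (CPar A B, s)) :: t)).
  have := perm_ports_bound b k (ports b t) wf ag.
  by rewrite !ports_cons.
have eX : tag_ports k (bound A B) = map fst X by rewrite -map_comp.
rewrite eX; apply: (perm_trans (join_perm (q true) (q false))).
have sX : map snd X = map s' (bound A B) by rewrite -map_comp.
have nw b w : w \in map snd X -> w \notin map snd (ports b ((k, (CPar A B, s)) :: t)).
  rewrite sX => /mapP[x xb ->]; rewrite wires_ports.
  have -> : map snd ((k, (CPar A B, s)) :: t) = (CPar A B, s) :: g by rewrite /= et.
  by apply: contra (fr x xb); apply: mem_all_wires.
by apply: join_diag; rewrite ?sX // -sX; apply: nw.
Qed.

End Provability.

(** * Formulas belong to their own interpretation *)

Section Connectives.
Variables (I L : eqType) (v : L -> nat * nat).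
Hypothesis I_inf : infinite_eqType I.
Local Notation form := (cform I L).
Local Notation clo := (form * (I -> I))%type.
Implicit Types (A B : form) (s r : I -> I) (g d e : seq clo) (w x : I)
  (b : bool).
Local Notation ok := (ok v).
Local Notation balanced := (balanced v).
Local Notation pole := (pole v).
Local Notation provable := (provable v).
Local Notation typed := (typed v).
Local Notation gen := (gen v).
Local Notation sem := (sem v).

Lemma fcount_bound b w A B s s' : cform_wf v (CTens A B) ->
  agree (CTens A B) s s' ->
  fcount b w A s' + fcount b w B s' =
  fcount b w (CTens A B) s + count_mem w (map s' (bound A B)).
Proof.
move=> /wf_sub[_ _ u1 u2] ag; rewrite /fcount -count_cat -map_cat.
rewrite (permP (perm_map s' (perm_free_bound b u1 u2))) map_cat count_cat.
congr addn; congr (count_mem w _); apply/eq_in_map => x; exact: ag.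
Qed.

Lemma fresh_env A B s (avoid : seq I) : cform_wf v (CTens A B) ->
  ok (CPar A B, s) -> {subset map s (cfree true (CTens A B) ++ cfree false (CTens A B)) <= avoid} ->
  exists s', [/\ agree (CTens A B) s s', ok (A, s'), ok (B, s'),
    uniq (map s' (bound A B)) & {in bound A B, forall x, s' x \notin avoid}].
Proof.
move=> wf okAB sub; have [wA wB u1 u2] := wf_sub wf.
have ub := bound_uniq u1.
have [f [injf avf]] := fresh_fun avoid I_inf ub.
pose s' x := if x \in bound A B then f x else s x.
have nb b x : x \in cfree b (CTens A B) -> x \notin bound A B.
  have := perm_free_bound b u1 u2 => p xb.
  have : uniq (cfree b A ++ cfree b B).
    rewrite cat_uniq (free_uniq _ wA) (free_uniq _ wB) andbT; apply/hasPn => y; rewrite /= !mem_free.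
    move=> /andP[yB _]; apply/negP => /andP[yA _].
    have : uniq (coccs b A ++ coccs b B) by case: (b).
    by rewrite cat_uniq => /and3P[_ /hasPn/(_ _ yB)]; rewrite /= yA.
  rewrite (perm_uniq p) cat_uniq => /and3P[_ /hasPn d _].
  by apply/negP => /d; rewrite /= xb.
have sb x : x \in bound A B -> s' x = f x by rewrite /s' => ->.
have sf b x : x \in cfree b (CTens A B) -> s' x = s x.
  by move=> /nb; rewrite /s' => /negbTE ->.
pose F := cfree true (CTens A B) ++ cfree false (CTens A B).
have sF x : x \in F -> s' x = s x by rewrite mem_cat => /orP[] /sf.
have inj : {in F ++ bound A B &, injective s'}.
  have ne x y : x \in F -> y \in bound A B -> s' x <> s' y.
    move=> xF yb e; have := avf y yb; rewrite -(sb y yb) -e (sF x xF).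
    by rewrite (sub _ (map_f s xF)).
  move=> x y; rewrite (mem_cat x F) (mem_cat y F) => /orP[xF|xb] /orP[yF|yb].
  - by rewrite (sF x xF) (sF y yF); apply: (ok_inj okAB).
  - by move/(ne x y xF yb).
  - by move/esym/(ne y x yF xb).
  - by rewrite (sb x xb) (sb y yb); apply: injf.
have okC C : cform_wf v C -> (forall b, {subset cfree b C <= F ++ bound A B}) ->
    ok (C, s').
  move=> wC subC; rewrite /ok wC /= /wires -map_cat map_inj_in_uniq /=.
    rewrite cat_uniq !(free_uniq _ wC) andbT; apply/hasPn => x.
    by rewrite /= !mem_free /= => /andP[h _]; rewrite h andbF.
  by move=> x y; rewrite !mem_cat => /orP[] /subC hx /orP[] /subC hy; apply: inj.
exists s'; split.
- by move=> b x; apply: sf.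
- apply: okC => // b x xA; have : x \in cfree b A ++ cfree b B by rewrite mem_cat xA.
  rewrite (perm_mem (perm_free_bound b u1 u2)) [in X in X -> _]mem_cat => /orP[h|h].
    by rewrite !mem_cat; case: (b) h => ->; rewrite ?orbT.
  by rewrite mem_cat h orbT.
- apply: okC => // b x xA; have : x \in cfree b A ++ cfree b B by rewrite mem_cat xA orbT.
  rewrite (perm_mem (perm_free_bound b u1 u2)) [in X in X -> _]mem_cat => /orP[h|h].
    by rewrite !mem_cat; case: (b) h => ->; rewrite ?orbT.
  by rewrite mem_cat h orbT.
- by rewrite map_inj_in_uniq // => x y xb yb; apply: inj; rewrite mem_cat ?xb ?yb orbT.
- by move=> x xb; rewrite sb // avf.
Qed.

Lemma count_all_wires b w g : w \notin all_wires g -> wcount b w g = 0.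
Proof.
move=> nw; apply/count_memPn; apply: contra nw; exact: mem_all_wires.
Qed.

(** The semantic form of expanding identities. Literals and units on the negative side are
    generators, and their duals are tested against these. A tensor is tested against pairs, to which
    [D_tens] applies by induction. For a par, [D_par] exposes the two halves on fresh wires, and the
    halves together are a generator. *)
Lemma sem_self A s : ok (A, s) -> sem false A s [:: (A, s)].
Proof.
elim: A s => [p u l|A IHA B IHB|A IHA B IHB] s okA; have tA := typed_self okA.
- case: p okA tA => [q|q||] okA tA; last 1 first.
  + by apply: (@sem_gen _ _ v (CAtom CBot u l)); split=> //; exists u, l, s.
  + by apply: (@sem_gen _ _ v (CAtom (CPos q) u l)); split=> //; exists u, l, s.
  + split=> // g [_ [u' [l' [s' [-> eu el]]]]]; exact: pole_axiom.
  + split=> // g [_ [u' [l' [s' [-> eu el]]]]]; exact: pole_one.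
- have wf : cform_wf v (CTens A B) by case/andP: okA.
  split=> // g [tg [s' [g1 [g2 [[ag p] okA' okB' v1 v2]]]]].
  have q : perm_eq ((CTens A B, s) :: g1 ++ g2) (g ++ [:: (CTens A B, s)]) by perm_lia.
  apply: (pole_perm q) => bal.
  have b1 := typed_balanced okA' (sem_typed v1).
  have b2 := typed_balanced okB' (sem_typed v2).
  apply: (provable_tens ag okA' b1 b2 bal).
    have := sem_orth v1 (IHA _ okA') => P1.
    by apply: (pole_perm _ P1 b1); rewrite perm_catC.
  have := sem_orth v2 (IHB _ okB') => P2.
  by apply: (pole_perm _ P2 b2); rewrite perm_catC.
have wf : cform_wf v (CTens A B) by case/andP: okA.
have tA' : typed false (CPar A B) s [:: (CPar A B, s)] by [].
split=> // d [td Hd].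
have q : perm_eq ((CPar A B, s) :: d) (d ++ [:: (CPar A B, s)]) by perm_lia.
apply: (pole_perm q) => bal.
have [s' [ag okA' okB' ub fr]] : exists s', [/\ agree (CTens A B) s s', ok (A, s'),
    ok (B, s'), uniq (map s' (bound A B)) &
    {in bound A B, forall x, s' x \notin all_wires ((CPar A B, s) :: d)}].
  apply: fresh_env => // w; rewrite map_cat mem_cat => /orP[] h.
    by apply: (@mem_all_wires _ _ true); rewrite mem_cat; apply/orP; left.
  by apply: (@mem_all_wires _ _ false); rewrite mem_cat; apply/orP; left.
have cb b w := fcount_bound b w wf ag.
have cw w : count_mem w (map s' (bound A B)) <= 1 by apply: count_le1.
have nw w b : 0 < count_mem w (map s' (bound A B)) ->
    wcount b w ((CPar A B, s) :: d) = 0.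
  rewrite -has_count has_pred1 => /mapP[x xb ->].
  by apply: count_all_wires; apply: fr.
have wE b w g : wcount b w [:: (A, s'), (B, s') & g] =
    fcount b w (CPar A B) s + count_mem w (map s' (bound A B)) + wcount b w g.
  by rewrite !wcount_cons1 addnA cb.
apply: (provable_par wf ag bal ub fr).
suff bal' : balanced [:: (A, s'), (B, s') & d].
  have tg : gen (CPar A B) s [:: (A, s'); (B, s')].
    split; last first.
      by exists s', [:: (A, s')], [:: (B, s')]; split=> //; [apply: (IHA s')|apply: (IHB s')].
    split; first by rewrite /= okA' okB'.
    move=> w; rewrite !wE !wcount_nil !addn0 /=.
    have := ok_count w okA; have := cw w; have := nw w true; have := nw w false.
    rewrite !wcount_cons1; lia.
  exact: (Hd _ tg bal').
split; first by rewrite /= okA' okB'; have /andP[] := bal.1.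
move=> w; rewrite !wE; have := bal.2 w; have := cw w; have := nw w true.
have := nw w false; rewrite !wcount_cons1; lia.
Qed.

End Connectives.

(** * Interpretation of the rules for bot *)

Section Bottoms.
Variables (I L : eqType) (v : L -> nat * nat).
Hypothesis I_inf : infinite_eqType I.
Local Notation form := (cform I L).
Local Notation clo := (form * (I -> I))%type.
Implicit Types (A B : form) (s r : I -> I) (g d e : seq clo) (w x : I)
  (b : bool) (G D : seq form) (ps : seq (form * seq clo)).
Local Notation ok := (ok v).
Local Notation balanced := (balanced v).
Local Notation pole := (pole v).
Local Notation provable := (provable v).
Local Notation typed := (typed v).
Local Notation gen := (gen v).
Local Notation sem := (sem v).

Definition ctx_count b w G s := count_mem w (map s (cfree_ctx b G)).

Definition contents ps := flatten (map snd ps).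

(** A substitution instance of a context: the list paired with a formula takes its place in
    [contents], while the single [s] fixes the wires that the formulas share. *)
Definition interprets s ps := forall p, p \in ps -> sem false p.1 s p.2.

Lemma cfree_ctx_cons b A G : cfree_ctx b (A :: G) = cfree b A ++ cfree_ctx b G.
Proof. by []. Qed.

Lemma cfree_ctx_cat b G D : cfree_ctx b (G ++ D) = cfree_ctx b G ++ cfree_ctx b D.
Proof. by rewrite /cfree_ctx map_cat flatten_cat. Qed.

Lemma interprets_count s ps w : interprets s ps ->
  wcount true w (contents ps) + ctx_count false w (map fst ps) s =
  wcount false w (contents ps) + ctx_count true w (map fst ps) s.
Proof.
elim: ps => //= -[A g] ps IH H.
have {}IH : wcount true w (contents ps) + ctx_count false w (map fst ps) s =
  wcount false w (contents ps) + ctx_count true w (map fst ps) s.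
  by apply: IH => p pp; apply: H; rewrite inE pp orbT.
have [_ /(_ w)/and3P[/eqP t _ _]] := sem_typed (H _ (mem_head _ _)).
rewrite /contents /= !wcount_cat /ctx_count !cfree_ctx_cons !map_cat !count_cat.
rewrite -!/(fcount _ _ _ _) -!/(ctx_count _ _ _ _) -!/(contents _).
by move: t IH; rewrite /=; lia.
Qed.

Lemma csequent_count G s w : csequent v G -> ctx_count true w G s = ctx_count false w G s.
Proof.
case=> /[!ccontextE] /and3P[_ u1 u2] e.
by apply/permP/perm_map/uniq_perm.
Qed.

Lemma interprets_typed A s ps : csequent v (A :: map fst ps) -> interprets s ps ->
  all ok (contents ps) -> (forall b w, wcount b w (contents ps) <= 1) ->
  typed true A s (contents ps).
Proof.
move=> cs int okg le; split=> // w; rewrite !le !andbT.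
have := interprets_count w int; have := csequent_count s w cs.
rewrite /ctx_count !cfree_ctx_cons !map_cat !count_cat -!/(fcount _ _ _ _) /=.
by lia.
Qed.

Lemma balanced_catl g d : balanced (g ++ d) ->
  all ok g /\ forall b w, wcount b w g <= 1.
Proof.
case; rewrite all_cat => /andP[okg _] H; split=> // b w.
by have := H w; rewrite !wcount_cat; case: b; lia.
Qed.

Lemma balanced_catr g d : balanced (g ++ d) ->
  all ok d /\ forall b w, wcount b w d <= 1.
Proof.
by move=> bal; apply: (@balanced_catl d g); apply: balanced_perm bal; rewrite perm_catC.
Qed.

Lemma csequent_mem G b x : csequent v G ->
  (x \in cfree_ctx b G) = (x \in cfree_ctx true G).
Proof. by case=> _ e; case: b. Qed.

Lemma csequent_wf G A : csequent v G -> A \in G -> cform_wf v A.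
Proof. by case=> /andP[/allP wf _] _; apply: wf. Qed.

Lemma mem_ctx b G A x : A \in G -> x \in cfree b A -> x \in cfree_ctx b G.
Proof. by move=> AG xA; apply/flatten_mapP; exists A. Qed.

Lemma csequent_sub A G b x : csequent v (A :: G) -> x \in cfree b A ->
  x \in cfree_ctx (~~ b) G.
Proof.
move=> cs xA; have : x \in cfree_ctx (~~ b) (A :: G).
  by rewrite csequent_mem // -(csequent_mem b) // (mem_ctx (mem_head _ _)).
rewrite cfree_ctx_cons mem_cat => /orP[|//].
by move: xA; rewrite !mem_free negbK => /andP[-> ] /negbTE ->; rewrite ?andbF.
Qed.

Lemma csequent_disj A G b x : csequent v (A :: G) -> x \in cfree b A ->
  x \notin cfree_ctx b G.
Proof.
case=> /[!ccontextE] /and3P[_ u1 u2] _ xA.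
have : uniq (cfree_ctx b (A :: G)) by case: (b).
rewrite cfree_ctx_cons cat_uniq => /and3P[_ /hasPn d _].
by apply/negP => /d; rewrite /= xA.
Qed.

Lemma csequent_main A G b x : csequent v (A :: G) -> x \in cfree_ctx b (A :: G) ->
  exists c, x \in cfree_ctx c G.
Proof.
move=> cs; rewrite cfree_ctx_cons mem_cat => /orP[xA|xG]; last by exists b.
by exists (~~ b); apply: csequent_sub cs xA.
Qed.

(** In a sequent every free index of [A] is free in the rest on the opposite side. So a premise has
    no indices beyond those of its context, and injectivity for the conclusion is inherited. *)
Lemma inj_main A G D s : csequent v (A :: G) -> csequent v D ->
  (forall b, {subset cfree_ctx b G <= cfree_ctx b D}) ->
  {in cfree_ctx true D &, injective s} ->
  {in cfree_ctx true (A :: G) &, injective s}.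
Proof.
move=> cA cD sub inj x y /(csequent_main cA)[b xG] /(csequent_main cA)[c yG].
by apply: inj; [rewrite -(csequent_mem b)|rewrite -(csequent_mem c)] => //; apply: sub.
Qed.

Lemma ok_of_inj A s : cform_wf v A ->
  {in cfree true A ++ cfree false A &, injective s} -> ok (A, s).
Proof.
move=> wf inj; rewrite /ok wf /wires /= -map_cat map_inj_in_uniq //.
rewrite cat_uniq !(free_uniq _ wf) andbT; apply/hasPn => x.
by rewrite /= !mem_free /= => /andP[h _]; rewrite h andbF.
Qed.

Lemma ok_in G A s : csequent v G -> A \in G ->
  {in cfree_ctx true G &, injective s} -> ok (A, s).
Proof.
move=> cs AG inj; apply: ok_of_inj; first exact: csequent_wf cs AG.
have m x : x \in cfree true A ++ cfree false A -> x \in cfree_ctx true G.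
  by rewrite mem_cat => /orP[] /(mem_ctx AG) //; rewrite csequent_mem.
by move=> x y /m xG /m yG; apply: inj.
Qed.

Lemma sem_ext b A s s' g : cform_wf v A ->
  (forall c x, x \in cfree c A -> s' x = s x) -> sem b A s g -> sem b A s' g.
Proof.
move=> wf e; have R : represents id A s s' by split=> // x y.
have cid C : cmap id C = C :> form.
  by elim: C => [p u l|C1 e1 C2 e2|C1 e1 C2 e2] /=; rewrite ?map_id ?e1 ?e2.
by have := sem_cmap b g wf R; rewrite cid => ->.
Qed.

Definition rename1 (i j x : I) := if x == j then i else x.

(** As [j] does not occur on the other side, substituting on one side is a renaming of the whole
    formula, to which [sem_cmap] applies. *)
Lemma csubst_cmap b i j A : j \notin coccs (~~ b) A ->
  csubst b i j A = cmap (rename1 i j) A.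
Proof.
have id_map (u : seq I) : j \notin u -> map (rename1 i j) u = u.
  move=> ju; rewrite -[RHS]map_id; apply/eq_in_map => x xu.
  by rewrite /rename1; case: eqP => // e; move: ju; rewrite -e xu.
elim: A => [p u l|A IHA B IHB|A IHA B IHB] /=.
- by case: b => /= /id_map ->.
- by rewrite mem_cat negb_or => /andP[/IHA -> /IHB ->].
- by rewrite mem_cat negb_or => /andP[/IHA -> /IHB ->].
Qed.

Lemma rename1_inj i j A : i \notin cindices A -> {in cindices A &, injective (rename1 i j)}.
Proof.
move=> ni x y xA yA; rewrite /rename1; case: eqP => [->|_]; case: eqP => [->|_] // e.
- by move: ni; rewrite e yA.
- by move: ni; rewrite -e xA.
Qed.

Lemma sem_csubst b c i j A s g : cform_wf v A -> j \in cfree b A ->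
  i \notin cindices A -> sem c (csubst b i j A) s g -> sem c A (s \o rename1 i j) g.
Proof.
move=> wf jA iA; rewrite csubst_cmap; last by move: jA; rewrite mem_free => /andP[].
have R : represents (rename1 i j) A (s \o rename1 i j) s.
  by split=> //; apply: rename1_inj.
by move/(sem_cmap _ _ wf R).
Qed.

Lemma mem_cfree_csubst b c i j A x : j \in cfree b A -> i \notin cindices A ->
  (x \in cfree c (csubst b i j A)) =
  ((c == b) && (x == i)) || ((x != j) && (x \in cfree c A)).
Proof.
move=> jA iA; rewrite csubst_cmap; last by move: jA; rewrite mem_free => /andP[].
rewrite cfree_cmap; last exact: rename1_inj.
apply/mapP/idP => [[y yA ->]|].
  rewrite /rename1; case: (eqVneq y j) => [ey|ne]; last by rewrite ne yA orbT.
  subst y; rewrite eqxx andbT; case: (eqVneq c b) => //= n.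
  have {n} ec : c = ~~ b by move: n; case: (b); case: (c).
  by move: jA yA; rewrite ec !mem_free negbK => /andP[-> _]; rewrite andbF.
case/orP => [/andP[/eqP -> /eqP ->]|/andP[ne xA]].
  by exists j => //; rewrite /rename1 eqxx.
by exists x => //; rewrite /rename1 (negbTE ne).
Qed.

Definition swap (a c x : I) := if x == a then c else if x == c then a else x.

Lemma swapK a c : involutive (swap a c).
Proof.
move=> x; rewrite /swap; case: (eqVneq x a) => [->|na].
  by rewrite eqxx; case: eqP.
by case: (eqVneq x c) => [->|nc]; rewrite ?eqxx // (negbTE na) (negbTE nc).
Qed.

Lemma swap_inj a c : injective (swap a c).
Proof. exact: inv_inj (swapK a c). Qed.

(** The substitution in a bot rule amounts to swapping two wires, and contracting the bot fuses
    them; the swap is then invisible. *)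
Lemma fuse_swap a c : fuse a c \o swap a c = fuse a c.
Proof.
apply/funext => x; rewrite /fuse /swap /=; case: (eqVneq x a) => [_|na].
  by case: eqP.
by case: (x =P c) => [e|_]; rewrite ?eqxx ?(negbTE na).
Qed.

Lemma wcount_swap b w a c g : wcount b w (ren (swap a c) g) = wcount b (swap a c w) g.
Proof. by rewrite -[w in LHS](swapK a c) count_map_inj //; apply: swap_inj. Qed.

Lemma swapE a c w : swap a c w = if w == a then c else if w == c then a else w.
Proof. by []. Qed.

Lemma provable_fuse a c g : (forall b, wcount b a g = 0) -> provable g ->
  provable (ren (fuse a c) g).
Proof.
move=> na; rewrite -{1}[g]ren_id; apply: provable_ren_ext => w wg.
rewrite /fuse; case: eqP => // e; subst w.
have : 0 < wcount true a g + wcount false a g.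
  case/flatten_mapP: wg => c' cg; rewrite mem_cat addn_gt0 -!wcount_mem.
  by case/orP=> h; apply/orP; [left|right]; apply/flatten_mapP; exists c'.
by rewrite !na.
Qed.

Lemma fcount_pos b A s x : x \in cfree b A -> 0 < fcount b (s x) A s.
Proof. by move=> xA; rewrite -has_count has_pred1 map_f. Qed.

Lemma fcount_zero b A s w : (forall x, x \in cfree b A -> s x <> w) ->
  fcount b w A s = 0.
Proof. by move=> n; apply/count_memPn/mapP => -[x /n nx e]; apply: nx. Qed.

(** It suffices to test against the bot atoms, which generate the interpretation of bot. Such an
    atom is contracted by fusing the wires of [i] and [j]. Swapping these wires first turns [a] into
    a replacement for [A], covered by the induction hypothesis, and the fusion does not see the
    swap. *)
Lemma adequacy_bot_up G A i j s ps a : csequent v (A :: G) ->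
  j \in cfree true A -> i \notin cindices A ->
  csequent v [:: CAtom CBot [:: j] [:: i], csubst true i j A & G] ->
  {in cfree_ctx true [:: CAtom CBot [:: j] [:: i], csubst true i j A & G] &, injective s} ->
  map fst ps = G -> interprets s ps -> sem false (csubst true i j A) s a ->
  (forall a', sem false A s a' -> pole (a' ++ contents ps)) ->
  forall e, sem false (CAtom CBot [:: j] [:: i]) s e -> pole (e ++ a ++ contents ps).
Proof.
set A' := csubst true i j A; set bt := CAtom CBot [:: j] [:: i].
move=> cs jA iA cs' inj eG int sa IH e se bal0.
have wfA := csequent_wf cs (mem_head _ _).
have okA' : ok (A', s).
  by apply: ok_in cs' _ inj; rewrite inE mem_head orbT.
have wfb : cform_wf v bt := csequent_wf cs' (mem_head _ _).
have memj : j \in cfree_ctx true [:: bt, A' & G].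
  by apply: mem_ctx (mem_head _ _) _; rewrite (catom_free _ wfb) mem_head.
have memA' b x : x \in cfree b A' -> x \in cfree_ctx true [:: bt, A' & G].
  move=> xA'; rewrite -(csequent_mem b _ cs'); apply: mem_ctx xA'.
  by rewrite inE mem_head orbT.
have iA' : i \in cfree true A' by rewrite mem_cfree_csubst // !eqxx.
have nij : i != j.
  apply: contra iA => /eqP ->; exact: mem_cfree_cindices jA.
have nw : s i != s j.
  by apply/eqP => /inj h; move/eqP: nij; apply; apply: h => //; apply: memA' iA'.
pose r := swap (s i) (s j).
have sra : sem false A s (ren r a).
  have := sem_ren (@swap_inj (s i) (s j)) (swapK (s i) (s j)) (sem_csubst wfA jA iA sa).
  apply: sem_ext => // c x xA; rewrite /= /rename1 /swap; case: (eqVneq x j) => [->|nxj].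
    by rewrite eqxx.
  have xA' : x \in cfree c A' by rewrite mem_cfree_csubst // nxj xA orbT.
  have nxi : x != i by apply: contra iA => /eqP <-; apply: mem_cfree_cindices xA.
  case: (s x =P s i) => [/inj h|_].
    by move/eqP: nxi; case; apply: h; [apply: memA' xA'|apply: memA' iA'].
  case: (s x =P s j) => [/inj h|//].
  by move/eqP: nxj; case; apply: h => //; apply: memA' xA'.
have tA' := sem_typed sa.
(* Because [a] has the interface of [A'], its upper occurrences exceed the lower ones by one at
   [s i] and by none at [s j]. With the balance of the whole list this determines all counts at the
   two wires. *)
have Ti : wcount true (s i) a = (wcount false (s i) a).+1.
  have [_ /(_ (s i))/and3P[/eqP t _ _]] := tA'.
  have := ok_count (s i) okA'; have := fcount_pos s iA'; move: t => /=; clear; lia.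
have Tj : wcount true (s j) a = wcount false (s j) a.
  have [_ /(_ (s j))/and3P[/eqP t _ _]] := tA'.
  have z c : fcount c (s j) A' s = 0.
    apply: fcount_zero => x xA' /inj h.
    have := xA'; rewrite mem_cfree_csubst // h //; last exact: memA' xA'.
    by rewrite eqxx /= orbF [j == i]eq_sym (negbTE nij) andbF.
  by move: t; rewrite /= !z; clear; lia.
have int' : interprets s ((A', a) :: ps).
  by move=> p; rewrite inE => /orP[/eqP ->|/int].
have cont : contents ((A', a) :: ps) = a ++ contents ps by [].
have [okr ler] := balanced_catr bal0.
have sb : sem true bt s (a ++ contents ps).
  split; first by rewrite -cont; apply: interprets_typed; rewrite /= ?eG.
  move=> g [_ [u' [l' [s' [-> eu el]]]]] bal.
  have [j' eu'] : exists j', u' = [:: j'].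
    by case: (u') eu => [|j' []] //; exists j'.
  have [i' el'] : exists i', l' = [:: i'].
    by case: (l') el => [|i' []] //; exists i'.
  subst u' l'; case: eu el => ej [ei].
  have cb w : ((w == s j) + wcount true w (a ++ contents ps) ==
      (w == s i) + wcount false w (a ++ contents ps)) &&
      ((w == s j) + wcount true w (a ++ contents ps) <= 1).
    have := bal.2 w; have /andP[/andP[wf' _] _] := bal.1.
    rewrite !wcount_cat !wcount_cons !wcount_nil /wires /= !(catom_free _ wf') /=.
    by rewrite ej ei ![_ == w]eq_sym !addn0.
  apply: (bot_expand bal); rewrite ei ej.
  have balr : balanced (ren r a ++ contents ps).
    split; first by move: okr; rewrite !all_cat all_ok_ren //; apply: swap_inj.
    move=> w; have := cb w; have := cb (s i); have := cb (s j).
    rewrite !wcount_cat !wcount_swap swapE !eqxx [s j == s i]eq_sym (negbTE nw).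
    by case: (eqVneq w (s i)) => [->|n1]; [|case: (eqVneq w (s j)) => [->|n2]];
      rewrite ?(negbTE nw) ?eqxx /=; clear -Ti Tj; lia.
  have := IH _ sra balr; move/(provable_fuse (a := s i) (c := s j)).
  rewrite !ren_cat ren_comp fuse_swap; apply=> b.
  have := cb (s i); have := cb (s j).
  rewrite !wcount_cat wcount_swap swapE !eqxx [s j == s i]eq_sym (negbTE nw) /=.
  by case: b; clear -Ti Tj; lia.
by apply: (pole_perm _ (sem_orth sb se) bal0); rewrite perm_catC.
Qed.

(** The index [j] is absent from the conclusion, so a fresh wire is given to it in the premise.
    There bot stands for itself and the swapped [a] replaces [A]; [bot_contract] removes the bot
    again. *)
Lemma adequacy_bot_down G A i j s ps a :
  csequent v [:: CAtom CBot [:: j] [:: i], A & G] ->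
  j \in cfree false A -> i \notin cindices A ->
  csequent v (csubst false i j A :: G) ->
  {in cfree_ctx true (csubst false i j A :: G) &, injective s} ->
  map fst ps = G -> interprets s ps -> sem false (csubst false i j A) s a ->
  (forall s' ps' a', {in cfree_ctx true [:: CAtom CBot [:: j] [:: i], A & G] &, injective s'} ->
     map fst ps' = G -> interprets s' ps' -> sem false A s' a' ->
     pole ([:: (CAtom CBot [:: j] [:: i], s')] ++ a' ++ contents ps')) ->
  pole (a ++ contents ps).
Proof.
set A' := csubst false i j A; set bt := CAtom CBot [:: j] [:: i].
move=> cs jA iA cs' inj eG int sa IH bal0.
have wfb : cform_wf v bt := csequent_wf cs (mem_head _ _).
have wfA : cform_wf v A by apply: csequent_wf cs _; rewrite !inE eqxx orbT.
(* The wire for [j] must avoid the images under [s], to keep the new environment injective, and all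
   wires in use, to keep the list balanced. *)
have [wj] := I_inf (map s (cfree_ctx true (A' :: G)) ++ all_wires (a ++ contents ps)).
rewrite mem_cat negb_or => /andP[njs njw].
pose wi := s i; pose s0 x := if x == j then wj else s x.
have jb : j \in cfree true bt by rewrite (catom_free _ wfb) mem_head.
have ib : i \in cfree false bt by rewrite (catom_free _ wfb) mem_head.
have nij : i != j by apply: contra iA => /eqP ->; apply: mem_cfree_cindices jA.
have iA' : i \in cfree false A' by rewrite mem_cfree_csubst // !eqxx.
have cs2 : csequent v [:: A, bt & G].
  by apply: csequent_perm cs; apply/permP => z /=; rewrite addnCA.
have njG b : j \notin cfree_ctx b G.
  case: b; first by have := csequent_disj cs jb; rewrite cfree_ctx_cons mem_cat negb_or => /andP[].
  by have := csequent_disj cs2 jA; rewrite cfree_ctx_cons mem_cat negb_or => /andP[].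
have sub x : x \in cfree_ctx true [:: bt, A & G] -> x != j ->
    x \in cfree_ctx true (A' :: G).
  rewrite cfree_ctx_cons (catom_free _ wfb) mem_cat inE => /orP[-> //|].
  rewrite !cfree_ctx_cons !mem_cat => /orP[xA|->] nx; last by rewrite orbT.
  by rewrite mem_cfree_csubst // nx xA.
have inj0 : {in cfree_ctx true [:: bt, A & G] &, injective s0}.
  move=> x y xG yG; rewrite /s0; case: (eqVneq x j) => [->|nx]; case: (eqVneq y j) => [->|ny] //.
  - by move=> e; move: njs; rewrite e map_f // sub.
  - by move=> e; move: njs; rewrite -e map_f // sub.
  - by apply: inj; apply: sub.
have iG : i \in cfree_ctx true (A' :: G).
  by rewrite -(csequent_mem false _ cs'); apply: mem_ctx (mem_head _ _) iA'.
have nw : wi != wj by apply: contra njs => /eqP <-; apply: map_f.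
pose r := swap wi wj.
have memA' b x : x \in cfree b A' -> x \in cfree_ctx true (A' :: G).
  by move=> xA'; rewrite -(csequent_mem b _ cs'); apply: mem_ctx (mem_head _ _) xA'.
have sra : sem false A s0 (ren r a).
  have := sem_ren (@swap_inj wi wj) (swapK wi wj) (sem_csubst wfA jA iA sa).
  apply: sem_ext => // c x xA; rewrite /s0 /= /rename1 /swap; case: (eqVneq x j) => [_|nxj].
    by rewrite -/wi eqxx.
  have xA' : x \in cfree c A' by rewrite mem_cfree_csubst // nxj xA orbT.
  have nxi : x != i by apply: contra iA => /eqP <-; apply: mem_cfree_cindices xA.
  case: (s x =P wi) => [/inj h|_].
    by move/eqP: nxi; case; apply: h => //; apply: memA' xA'.
  by case: eqP => // e; move: njs; rewrite -e map_f //; apply: memA' xA'.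
have int0 : interprets s0 ps.
  move=> p pp; have pG : p.1 \in G by rewrite -eG map_f.
  apply: sem_ext (int p pp).
    by apply: csequent_wf cs _; rewrite !inE pG !orbT.
  move=> c x xp; rewrite /s0; case: eqP => // e; subst x.
  by move: (njG c); rewrite (mem_ctx pG xp).
have okA' : ok (A', s) by apply: ok_in cs' (mem_head _ _) inj.
have Fi : wcount false wi a = (wcount true wi a).+1.
  have [_ /(_ wi)/and3P[/eqP t _ _]] := sem_typed sa.
  have := ok_count wi okA'; have := fcount_pos s iA'; rewrite -/wi.
  by move: t => /=; clear; lia.
have zj b : wcount b wj (a ++ contents ps) = 0 by apply: count_all_wires.
have [okg leg] := balanced_catl (d := [::]) (eq_ind _ balanced bal0 _ (esym (cats0 _))).
have cb w := bal0.2 w.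
have okb : ok (bt, s0) by apply: ok_in cs (mem_head _ _) inj0.
have balr : balanced ([:: (bt, s0)] ++ ren r a ++ contents ps).
  split.
    by move: okg; rewrite /= okb !all_cat all_ok_ren //; apply: swap_inj.
  move=> w; have := cb w; have := cb wi; have := zj true; have := zj false.
  rewrite !wcount_cat !wcount_swap swapE !wcount_cons !wcount_nil /wires /=.
  rewrite !(catom_free _ wfb) /= !addn0 /s0 eqxx (negbTE nij) -/wi.
  rewrite ![_ == w]eq_sym.
  by case: (eqVneq w wi) => [->|n1]; [|case: (eqVneq w wj) => [->|n2]];
    rewrite ?(negbTE nw) ?eqxx /=; clear -Fi; lia.
have := IH s0 ps (ren r a) inj0 eG int0 sra balr.
move/(bot_contract balr); rewrite /s0 eqxx (negbTE nij) -/wi !ren_cat ren_comp fuse_swap.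
(* Fusing [wi] into the fresh [wj] is injective on the wires that remain, hence only a renaming,
   which can be undone. *)
rewrite -ren_cat; apply: (provable_ren_inj _ _).1.
have nz x : x \in all_wires (a ++ contents ps) -> x != wj.
  by move=> xw; apply: contra njw => /eqP <-.
move=> x y /nz nx /nz ny; rewrite /fuse; case: (eqVneq x wi) => [->|_];
  case: (eqVneq y wi) => [->|_] // e; first by move: ny; rewrite e eqxx.
by move: nx; rewrite e eqxx.
Qed.

End Bottoms.

(** * Adequacy of the interpretation for TTL *)

Section Adequacy.
Variables (I L : eqType) (v : L -> nat * nat).
Hypothesis I_inf : infinite_eqType I.
Local Notation form := (cform I L).
Local Notation clo := (form * (I -> I))%type.
Implicit Types (A B : form) (s r : I -> I) (g d e : seq clo) (w x : I)
  (b : bool) (G D : seq form) (ps : seq (form * seq clo)).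
Local Notation ok := (ok v).
Local Notation balanced := (balanced v).
Local Notation pole := (pole v).
Local Notation provable := (provable v).
Local Notation typed := (typed v).
Local Notation gen := (gen v).
Local Notation sem := (sem v).
Local Notation interprets := (interprets v).

Lemma contents_cat ps ps' : contents (ps ++ ps') = contents ps ++ contents ps'.
Proof. by rewrite /contents map_cat flatten_cat. Qed.

Lemma interprets_cat s ps ps' :
  interprets s (ps ++ ps') -> interprets s ps /\ interprets s ps'.
Proof.
by move=> H; split=> p pp; apply: H; rewrite mem_cat pp ?orbT.
Qed.

Lemma interprets_cons s A g ps : sem false A s g -> interprets s ps ->
  interprets s ((A, g) :: ps).
Proof. by move=> sg int p; rewrite inE => /orP[/eqP ->|/int]. Qed.

Lemma wcount_contents b w ps p : p \in ps -> wcount b w p.2 <= wcount b w (contents ps).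
Proof.
elim: ps => //= q ps IH; rewrite inE /contents /= wcount_cat => /orP[/eqP -> |/IH].
  exact: leq_addr.
by move=> h; apply: leq_trans h _; apply: leq_addl.
Qed.

Lemma adequacy_par G A B s ps c :
  (forall s' ps', {in cfree_ctx true [:: A, B & G] &, injective s'} ->
     map fst ps' = [:: A, B & G] -> interprets s' ps' -> pole (contents ps')) ->
  csequent v [:: A, B & G] -> csequent v (CPar A B :: G) ->
  {in cfree_ctx true (CPar A B :: G) &, injective s} ->
  map fst ps = G -> interprets s ps -> sem false (CPar A B) s c ->
  pole (c ++ contents ps).
Proof.
move=> IH cs cs' inj eG int sc bal0.
have wf : cform_wf v (CTens A B) := csequent_wf cs' (mem_head _ _).
have [wA wB u1 u2] := wf_sub wf.
have [okr ler] := balanced_catr bal0.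
have memAB b x : x \in cfree b (CTens A B) -> x \in cfree_ctx true (CPar A B :: G).
  move=> xAB; rewrite -(csequent_mem b _ cs'); exact: (mem_ctx (mem_head (CPar A B) G)).
have memG b x : x \in cfree_ctx b G -> x \in cfree_ctx true (CPar A B :: G).
  by move=> xG; rewrite -(csequent_mem b _ cs') cfree_ctx_cons mem_cat xG orbT.
suff tG : sem true (CPar A B) s (contents ps).
  by apply: (pole_perm _ (sem_orth tG sc) bal0); rewrite perm_catC.
split; first by apply: interprets_typed; rewrite ?eG.
move=> g [_ [s' [g1 [g2 [[ag p] okA okB v1 v2]]]]] bal.
pose F := cfree true A ++ cfree false A ++ cfree true B ++ cfree false B.
(* On the indices bound by the par the wires are those chosen by [s']; on its free indices [s'] and
   [s] agree. *)
pose s0 x := if x \in F then s' x else s x.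
have FA b x : x \in cfree b A -> x \in F.
  by rewrite /F !mem_cat; case: b => ->; rewrite ?orbT.
have FB b x : x \in cfree b B -> x \in F.
  by rewrite /F !mem_cat; case: b => ->; rewrite ?orbT.
have bnd b x : x \in cfree b A ++ cfree b B -> x \in bound A B \/ x \in cfree b (CTens A B).
  by rewrite (perm_mem (perm_free_bound b u1 u2)) mem_cat => /orP[]; [right|left].
have FC x : x \in F -> x \in bound A B \/ exists b, x \in cfree b (CTens A B).
  move=> xF; have : (x \in cfree true A ++ cfree true B) ||
      (x \in cfree false A ++ cfree false B).
    by move: xF; rewrite /F !mem_cat => h; case/or4P: h => ->; rewrite ?orbT.
  by case/orP=> /bnd[h|h]; [left|right; exists true|left|right; exists false].
have cs2 : csequent v [:: B, A & G].
  by apply: csequent_perm cs; apply/permP => z /=; rewrite addnCA.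
have nbG x b : x \in bound A B -> x \notin cfree_ctx b G.
  have cA b1 y : y \in cfree b1 A -> y \notin cfree_ctx b1 G.
    by move/(csequent_disj cs); rewrite cfree_ctx_cons mem_cat negb_or => /andP[].
  have cB b1 y : y \in cfree b1 B -> y \notin cfree_ctx b1 G.
    by move/(csequent_disj cs2); rewrite cfree_ctx_cons mem_cat negb_or => /andP[].
  case/(bound_sides wf) => c' [/cA xA /cB xB].
  by case: (b) xA xB; case: (c').
have okY : forall p, p \in ps -> ok (p.1, s).
  move=> q qp; apply: ok_in cs' _ inj; rewrite inE -eG; apply/orP; right.
  exact: map_f.
(* The wire of a bound index already occurs as upper in one of [g1], [g2] and as lower in the other.
   A formula of [G] on the same wire would force one more occurrence in its replacement, against the
   balance of the whole list. *)
have clash x y b : x \in bound A B -> y \in cfree_ctx b G -> s' x <> s y.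
  move=> xb /flatten_mapP[Y YG yY] e.
  have [q qp eq] : exists2 q, q \in ps & q.1 = Y by move: YG; rewrite -eG => /mapP[q ? ->]; exists q.
  pose w := s' x.
  have [_ /(_ w)/and3P[/eqP t1 l1 l1']] := sem_typed v1.
  have [_ /(_ w)/and3P[/eqP t2 l2 l2']] := sem_typed v2.
  have [_ /(_ w)/and3P[/eqP tq _ _]] := sem_typed (int q qp).
  have oA := ok_count w okA; have oB := ok_count w okB; have oY := ok_count w (okY q qp).
  have pY : 0 < fcount b w q.1 s by rewrite /w e; apply: fcount_pos; rewrite eq.
  have bb := bal.2 w; rewrite !wcount_cat !(wcount_perm _ _ p) !wcount_cat in bb.
  have cq b' := wcount_contents b' w qp.
  have cqt := cq true; have cqf := cq false.
  have ab : 0 < fcount true w A s' /\ 0 < fcount false w B s' \/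
      0 < fcount false w A s' /\ 0 < fcount true w B s'.
    have [c' [/(fcount_pos s') xA /(fcount_pos s') xB]] := bound_sides wf xb.
    by case: (c') xA xB => xA xB; [left|right].
  move: t1 l1 l1' t2 l2 l2' tq oA oB oY pY bb cqt cqf ab.
  by rewrite /=; clear; case: b => /=; lia.
have inj0 : {in cfree_ctx true [:: A, B & G] &, injective s0}.
  have dec x : x \in cfree_ctx true [:: A, B & G] ->
      x \in F \/ x \notin F /\ exists b, x \in cfree_ctx b G.
    case xF : (x \in F); first by left.
    rewrite !cfree_ctx_cons !mem_cat => /or3P[/FA|/FB|xG]; rewrite ?xF //.
    by right; split=> //; exists true.
  have sF x b : x \in cfree b (CTens A B) -> s' x = s x by apply: ag.
  have injF x y : x \in bound A B -> y \in F -> s' x = s' y -> x = y.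
    move=> xb yF; have [c' [xA xB]] := bound_sides wf xb.
    have {}xA : x \in cfree true A ++ cfree false A.
      by rewrite mem_cat; case: (c') xA => ->; rewrite ?orbT.
    have {}xB : x \in cfree true B ++ cfree false B.
      by rewrite mem_cat; case: (c') xB => ->; rewrite ?orbT.
    move: yF; rewrite /F catA mem_cat => /orP[yA|yB].
      exact: (ok_inj okA).
    exact: (ok_inj okB).
  move=> x y xG yG; rewrite /s0.
  case: (dec x xG) => [xF|[nxF [b xb]]]; case: (dec y yG) => [yF|[nyF [b' yb]]].
  - rewrite xF yF; case: (FC x xF) => [xb|[b xb]]; first exact: injF.
    case: (FC y yF) => [yb|[b' yb]]; first by move=> e; apply/esym/injF.
    by rewrite (sF x b xb) (sF y b' yb); apply: inj; [apply: memAB xb|apply: memAB yb].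
  - rewrite xF (negbTE nyF); case: (FC x xF) => [xb|[b xb]].
      by move/(clash x y b' xb yb).
    by rewrite (sF x b xb); apply: inj; [apply: memAB xb|apply: memG yb].
  - rewrite yF (negbTE nxF); case: (FC y yF) => [yb|[b' yb]].
      by move/esym/(clash y x b yb xb).
    by rewrite (sF y b' yb); apply: inj; [apply: memG xb|apply: memAB yb].
  - by rewrite (negbTE nxF) (negbTE nyF); apply: inj; [apply: memG xb|apply: memG yb].
have int0 : interprets s0 ps.
  move=> q qp; have qG : q.1 \in G by rewrite -eG map_f.
  apply: sem_ext (int q qp).
    by apply: csequent_wf cs _; rewrite !inE qG !orbT.
  move=> b x xq; rewrite /s0; case: ifP => // /FC[xb|[b' xb]]; last exact: ag xb.
  by have := nbG x b xb; rewrite (mem_ctx qG xq).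
have P := IH s0 [:: (A, g1), (B, g2) & ps] inj0.
have q : perm_eq (g1 ++ g2 ++ contents ps) (g ++ contents ps).
  by move: p; rewrite perm_sym => p; rewrite catA perm_cat2r.
apply: (pole_perm q) bal; apply: P; first by rewrite /= eG.
apply: interprets_cons; last apply: interprets_cons => //.
  by apply: sem_ext v1 => // b x /FA xF; rewrite /s0 xF.
by apply: sem_ext v2 => // b x /FB xF; rewrite /s0 xF.
Qed.

(** Environments are kept injective so that distinct indices stay on distinct wires and every
    formula gives an [ok] closure. *)
Lemma adequacy G : TTL v G -> forall s ps, {in cfree_ctx true G &, injective s} ->
  map fst ps = G -> interprets s ps -> pole (contents ps).
Proof.
elim=> {G} [G D p d IH|A isat cs|G D A d1 IH1 d2 IH2 cs|G D A B d1 IH1 d2 IH2 cs|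
    G A B d IH cs|G A i j d IH jA iA cs|G A i j d IH jA iA cs] s ps inj eps int.
- have [ps' pps eps'] : exists2 ps', perm_eq ps' ps & map fst ps' = G.
    by apply: perm_mapP; rewrite eps.
  apply: pole_perm (perm_flatmap snd pps) _; apply: (IH s) => //.
    by move=> x y xG yG; apply: inj; rewrite -(perm_mem (perm_flatmap (cfree true) p)).
  by move=> q; rewrite (perm_mem pps); apply: int.
- case: ps eps int => [|[A1 g1] [|[A2 g2] [|]]] //= [-> ->] int.
  have s1 := int _ (mem_head _ _).
  have s2 : sem false A s g2 by apply: (int (A, g2)); rewrite !inE eqxx orbT.
  have -> : contents [:: (cdual A, g1); (A, g2)] = g1 ++ g2.
    by rewrite /contents /= cats0.
  exact: (sem_orth ((sem_dual v false A s g1).1 s1) s2).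
- have [ps1 [ps2 [e e1 e2]]] := map_cat_inv eps; subst ps.
  have [int1 int2] := interprets_cat int; rewrite contents_cat => bal.
  have csA := TTL_csequent d1; have csB := TTL_csequent d2.
  have inj1 : {in cfree_ctx true (A :: G) &, injective s}.
    by apply: inj_main csA cs _ inj => b x xG; rewrite cfree_ctx_cat mem_cat xG.
  have inj2 : {in cfree_ctx true (cdual A :: D) &, injective s}.
    by apply: inj_main csB cs _ inj => b x xG; rewrite cfree_ctx_cat mem_cat xG orbT.
  have [ok1 le1] := balanced_catl bal.
  (* Cut: by the first premise this context is orthogonal to every replacement of [A]. By duality it
     is itself a replacement of the dual formula and is fed to the second premise. *)
  have tA : sem true A s (contents ps1).
    apply: sem_intro; first by apply: interprets_typed; rewrite ?e1.
    move=> a sa; apply: (IH1 s ((A, a) :: ps1)) => //; first by rewrite /= e1.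
    exact: interprets_cons.
  apply: (IH2 s ((cdual A, contents ps1) :: ps2)) bal => //; first by rewrite /= e2.
  by apply: interprets_cons => //; apply: (sem_dual v false A s _).2.
- case: ps eps int => [//|[C c] ps] [-> eps] int.
  have [ps1 [ps2 [e e1 e2]]] := map_cat_inv eps; subst ps.
  have sc : sem false (CTens A B) s c := int _ (mem_head _ _).
  have {}int : interprets s (ps1 ++ ps2) by move=> q qp; apply: int; rewrite inE qp orbT.
  have [int1 int2] := interprets_cat int => bal.
  have {}bal : balanced (c ++ contents ps1 ++ contents ps2) by rewrite -contents_cat.
  have csA := TTL_csequent d1; have csB := TTL_csequent d2.
  have inj1 : {in cfree_ctx true (A :: G) &, injective s}.
    apply: inj_main csA cs _ inj => b x xG.
    by rewrite cfree_ctx_cons cfree_ctx_cat !mem_cat xG orbT.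
  have inj2 : {in cfree_ctx true (B :: D) &, injective s}.
    apply: inj_main csB cs _ inj => b x xG.
    by rewrite cfree_ctx_cons cfree_ctx_cat !mem_cat xG !orbT.
  have [ok12 le12] := balanced_catr bal.
  have bal12 : balanced ((contents ps1 ++ contents ps2) ++ c).
    by apply: balanced_perm bal; rewrite perm_catC.
  have [ok1 le1] : all ok (contents ps1) /\ forall b w, wcount b w (contents ps1) <= 1.
    by move: bal12; rewrite -catA => /balanced_catl.
  have [ok2 le2] : all ok (contents ps2) /\ forall b w, wcount b w (contents ps2) <= 1.
    by move: bal; rewrite catA => /balanced_catr.
  have tA : sem true A s (contents ps1).
    apply: sem_intro; first by apply: interprets_typed; rewrite ?e1.
    move=> a sa; apply: (IH1 s ((A, a) :: ps1)) => //; first by rewrite /= e1.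
    exact: interprets_cons.
  have tB : sem true B s (contents ps2).
    apply: sem_intro; first by apply: interprets_typed; rewrite ?e2.
    move=> a sa; apply: (IH2 s ((B, a) :: ps2)) => //; first by rewrite /= e2.
    exact: interprets_cons.
  have tAB : gen (CTens A B) s (contents ps1 ++ contents ps2).
    split; first by rewrite -contents_cat; apply: interprets_typed;
      rewrite ?contents_cat ?map_cat ?e1 ?e2.
    exists s, (contents ps1), (contents ps2); split=> //.
      exact: ok_in csA (mem_head _ _) inj1.
    exact: ok_in csB (mem_head _ _) inj2.
  rewrite /contents /= -/(contents _) contents_cat.
  by apply: (pole_perm _ (sem_orth (sem_gen tAB) sc) bal); rewrite perm_catC.
- case: ps eps int => [//|[C c] ps] [-> eps] int.
  apply: (adequacy_par _ (TTL_csequent d) cs inj eps) => //.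
    by move=> q qp; apply: int; rewrite inE qp orbT.
  exact: (int _ (mem_head _ _)).
- case: ps eps int => [//|[C c] [//|[A1 a] ps]] [-> -> eps] int.
  apply: (adequacy_bot_up (TTL_csequent d) jA iA cs inj eps).
  + by move=> q qp; apply: int; rewrite !inE qp !orbT.
  + by apply: (int (_, a)); rewrite !inE eqxx orbT.
  + have wfb : cform_wf v (CAtom CBot [:: j] [:: i] : form) := csequent_wf cs (mem_head _ _).
    have sub x : x \in cfree_ctx true (A :: G) ->
        x \in cfree_ctx true [:: CAtom CBot [:: j] [:: i], csubst true i j A & G].
      rewrite !cfree_ctx_cons (catom_free _ wfb) !mem_cat mem_cfree_csubst // inE.
      by case: (x == j) => //= /orP[] ->; rewrite ?orbT.
    move=> a' sa'; apply: (IH s ((A, a') :: ps)); rewrite /= ?eps //.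
      by move=> x y /sub xG /sub yG; apply: inj.
    by apply: interprets_cons => // q qp; apply: int; rewrite !inE qp !orbT.
  + exact: (int _ (mem_head _ _)).
case: ps eps int => [//|[C a] ps] [-> eps] int.
apply: (adequacy_bot_down I_inf (TTL_csequent d) jA iA cs inj eps).
- by move=> q qp; apply: int; rewrite !inE qp !orbT.
- exact: (int _ (mem_head _ _)).
move=> s' ps' a' inj' eps' int' sa'.
have okb : ok (CAtom CBot [:: j] [:: i], s') := ok_in (TTL_csequent d) (mem_head _ _) inj'.
apply: (IH s' [:: (CAtom CBot [:: j] [:: i], [:: (CAtom CBot [:: j] [:: i], s')]),
    (A, a') & ps']) => //; first by rewrite /= eps'.
by apply: interprets_cons; [apply: sem_self|apply: interprets_cons].
Qed.

Definition tag_context (G : seq form) : seq (nat * form) :=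
  zip (iota 0 (size G)) G.

Definition tag_links b G : seq (nat * I * I) :=
  flatten [seq [seq ((X.1, x), x) | x <- cfree b X.2] | X <- tag_context G].

Definition wiring_of G := join (tag_links true G) (tag_links false G).

Lemma linear_tag G : all (cform_wf v) G -> linear v (tag_context G).
Proof.
rewrite /tag_context; have : uniq (iota 0 (size G)) by apply: iota_uniq.
elim: G (iota 0 _) (size_iota 0 (size G)) => [|A G IH] [|k ks] //= [es].
move=> /andP[nk uk] /andP[wA wG]; have /and3P[w1 u1 u2] := IH ks es uk wG.
have nb b x : (k, x) \notin occs b (zip ks G).
  apply/negP => /flatten_mapP[[k' C] kC /mapP[y _ [ek _]]]; subst k'.
  by move: nk; rewrite -[ks](@unzip1_zip _ _ ks G) ?es // (map_f fst kC).
have d b : uniq (occs b (zip ks G)) -> uniq (occs b ((k, A) :: zip ks G)).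
  move=> u; rewrite occs_cons cat_uniq u tag_ports_uniq (wf_uniq b wA) /= andbT.
  apply/hasPn => p pG; apply/negP => /mapP[x _ ep]; move: pG.
  by rewrite ep (negbTE (nb b x)).
by rewrite /linear (d _ u1) (d _ u2) /= wA w1.
Qed.

(** Adequacy with the identity as environment, each formula being replaced by itself thanks to
    [sem_self]; wires are then index names. *)
Theorem TTL_derivable G : TTL v G -> derivable (tag_context G) (wiring_of G).
Proof.
move=> d; have cs := TTL_csequent d.
pose ps := [seq (A, [:: (A, id : I -> I)]) | A <- G].
have e : map fst ps = G by rewrite -map_comp map_id.
have ce : contents ps = [seq (A, id : I -> I) | A <- G].
  by rewrite /contents -map_comp /=; elim: (G) => //= A G' ->.
have okG A : A \in G -> ok (A, id) by move=> AG; apply: ok_in cs AG _.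
have int : interprets id ps.
  by move=> q /mapP[A AG ->]; apply: sem_self => //; apply: okG.
have P := adequacy d (s := id) (fun x y _ _ => id) e int.
have bal : balanced (contents ps).
  rewrite ce; split; first by rewrite all_map; apply/allP => A /okG.
  have w1 b w : wcount b w [seq (A, id : I -> I) | A <- G] = count_mem w (cfree_ctx b G).
    rewrite /wcount -map_comp; congr (count_mem w (flatten _)).
    by apply: eq_map => A; rewrite /wires /= map_id.
  by move=> w; rewrite !w1; have /csequentP[_ /(_ w)] := cs.
have wfG : all (cform_wf v) G by case/csequentP: cs.
pose t := [seq (X.1, (X.2, id : I -> I)) | X <- tag_context G].
have et : map snd t = contents ps.
  have eG : map snd (tag_context G) = G by apply: unzip2_zip; rewrite size_iota.
  by rewrite ce -[in RHS]eG -!map_comp.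
have ei : map (@item_of I L) t = tag_context G.
  by rewrite -map_comp -[RHS]map_id; apply: eq_map => -[].
have ep b : ports b t = tag_links b G by rewrite /ports -map_comp.
by have := P bal t et; rewrite ei !ep; apply; apply: linear_tag.
Qed.

End Adequacy.

(** * Renaming the two sides of a formula *)

Section Renaming.
Variables (I L : eqType) (v : L -> nat * nat).
Local Notation form := (cform I L).
Implicit Types (A B : form) (f : bool -> I -> I) (b c : bool) (i j x y z w : I).

(** The side is an argument of [f] because ports are named per side: after a split, one port may be
    upper in one half and lower in the other. *)
Fixpoint crename f A : form :=
  match A with
  | CAtom p u l => CAtom p (map (f true) u) (map (f false) l)
  | CTens A B => CTens (crename f A) (crename f B)
  | CPar A B => CPar (crename f A) (crename f B)
  end.

Lemma coccs_crename b f A : coccs b (crename f A) = map (f b) (coccs b A).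
Proof.
by elim: A => [p u l|A IHA B IHB|A IHA B IHB] /=; rewrite ?map_cat ?IHA ?IHB //;
  case: b.
Qed.

Lemma crename_ext f g A : (forall b x, x \in coccs b A -> f b x = g b x) ->
  crename f A = crename g A.
Proof.
elim: A => [p u l|A IHA B IHB|A IHA B IHB] /= e.
- by congr CAtom; apply/eq_in_map => x; [apply: (e true)|apply: (e false)].
- by rewrite IHA ?IHB // => b x xA; apply: e; rewrite mem_cat xA ?orbT.
- by rewrite IHA ?IHB // => b x xA; apply: e; rewrite mem_cat xA ?orbT.
Qed.

Lemma csubst_crename b i j f A : csubst b i j (crename f A) =
  crename (fun c x => if (c == b) && (f c x == j) then i else f c x) A.
Proof.
elim: A => [p u l|A IHA B IHB|A IHA B IHB] /=; rewrite ?IHA ?IHB //.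
by case: b => /=; rewrite -!map_comp; congr CAtom; apply: eq_map => x /=.
Qed.

Lemma crename_id A : crename (fun _ => id) A = A.
Proof. by elim: A => [p u l|A e1 B e2|A e1 B e2] /=; rewrite ?map_id ?e1 ?e2. Qed.

(* f renames the occurrences of A without identifying distinct indices or
   separating the two occurrences of a bound one. *)
Definition faithful f A :=
  (forall b c x y, x \in coccs b A -> y \in coccs c A -> f b x = f c y -> x = y) /\
  (forall x, x \in coccs true A -> x \in coccs false A -> f true x = f false x).

Lemma cfree_crename b f A : faithful f A ->
  cfree b (crename f A) = map (f b) (cfree b A).
Proof.
move=> [inj same]; rewrite /cfree !coccs_crename filter_map; congr map.
apply/eq_in_filter => x xA /=; congr negb; apply/mapP/idP => [[y yA e]|xA'].
  by rewrite (inj _ _ _ _ xA yA e).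
by exists x => //; case: b xA xA' => xA xA'; rewrite ?same // -same.
Qed.

Lemma wf_crename f A : faithful f A -> cform_wf v (crename f A) = cform_wf v A.
Proof.
move=> [inj same]; rewrite /cform_wf !coccs_crename.
rewrite !map_inj_in_uniq; try by move=> x y xA yA; apply: inj; eassumption.
congr andb; elim: A inj same => [p u l|A IHA B IHB|A IHA B IHB] inj same /=; last 2 first.
- rewrite IHA ?IHB //; try by move=> b c x y xA yA; apply: inj; rewrite mem_cat ?xA ?yA ?orbT.
    by move=> x xA yA; apply: same; rewrite mem_cat ?xA ?yA ?orbT.
  by move=> x xA yA; apply: same; rewrite mem_cat ?xA ?yA ?orbT.
- rewrite IHA ?IHB //; try by move=> b c x y xA yA; apply: inj; rewrite mem_cat ?xA ?yA ?orbT.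
    by move=> x xA yA; apply: same; rewrite mem_cat ?xA ?yA ?orbT.
  by move=> x xA yA; apply: same; rewrite mem_cat ?xA ?yA ?orbT.
rewrite !size_map; congr andb; rewrite !cat_uniq.
rewrite !map_inj_in_uniq; last 2 first.
- by move=> x y xA yA; apply: (inj false false).
- by move=> x y xA yA; apply: (inj true true).
congr [&& _, ~~ _ & _]; apply/hasP/hasP => -[x].
  move=> /mapP[y yl ->] /mapP[z zu e]; exists y => //=.
  by rewrite (inj false true _ _ yl zu e).
move=> xl xu; exists (f false x); first exact: map_f.
by rewrite /= -same // map_f.
Qed.

End Renaming.

(* What reading back a wiring requires of a system; with [pol] the polarized
   formulas this covers ITTL as well as TTL. *)
Record model (I L : eqType) (v : L -> nat * nat) (pol : pred (cform I L))
    (J : seq (cform I L) -> Prop) : Prop := Model {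
  pol_crename : forall f A, pol (crename f A) = pol A;
  pol_atom : forall p u l u' l', pol (CAtom p u l) = pol (CAtom p u' l');
  pol_bot : forall u l, pol (CAtom CBot u l);
  pol_tens : forall A B, pol (CTens A B) -> pol A && pol B;
  pol_par : forall A B, pol (CPar A B) -> pol A && pol B;
  model_wf : forall G, J G -> csequent v G /\ all pol G;
  model_perm : forall G D, perm_eq G D -> J G -> J D;
  model_id : forall A, is_catom A -> csequent v [:: cdual A; A] ->
    all pol [:: cdual A; A] -> J [:: cdual A; A];
  model_tens : forall G D A B, J (A :: G) -> J (B :: D) ->
    csequent v (CTens A B :: G ++ D) -> all pol (CTens A B :: G ++ D) ->
    J (CTens A B :: G ++ D);
  model_par : forall G A B, J [:: A, B & G] ->
    csequent v (CPar A B :: G) -> all pol (CPar A B :: G) -> J (CPar A B :: G);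
  model_bot_up : forall G A i j, J (A :: G) -> j \in cfree true A ->
    i \notin cindices A ->
    csequent v [:: CAtom CBot [:: j] [:: i], csubst true i j A & G] ->
    all pol [:: CAtom CBot [:: j] [:: i], csubst true i j A & G] ->
    J [:: CAtom CBot [:: j] [:: i], csubst true i j A & G];
  model_bot_down : forall G A i j,
    J [:: CAtom CBot [:: j] [:: i], A & G] ->
    j \in cfree false A -> i \notin cindices A ->
    csequent v (csubst false i j A :: G) -> all pol (csubst false i j A :: G) ->
    J (csubst false i j A :: G) }.

(** * Reading wirings back *)

Section Links.
Variables (I L : eqType) (v : L -> nat * nat).
Local Notation form := (cform I L).
Implicit Types (A B C : form) (G D R : seq form) (b c : bool) (i j x y z w : I).
Variables (pol : pred form) (J : seq form -> Prop).
Hypothesis M : model v pol J.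
Let pol_crename := pol_crename M.
Let pol_bot := pol_bot M.
Let J_wf := model_wf M.
Let J_perm := model_perm M.
Let J_bot_up := model_bot_up M.
Let J_bot_down := model_bot_down M.

Local Notation bot j i := (CAtom CBot [:: j] [:: i]).

Lemma pol_csubst b i j A : pol (csubst b i j A) = pol A.
Proof. by rewrite -{1}[A]crename_id csubst_crename; exact: pol_crename. Qed.

Lemma wf_csubst b i j A : j \in cfree b A -> i \notin cindices A ->
  cform_wf v (csubst b i j A) = cform_wf v A.
Proof.
move=> jA iA; rewrite csubst_cmap; last by move: jA; rewrite mem_free => /andP[].
by rewrite wf_cmap //; apply: rename1_inj.
Qed.

Lemma count_csubst b c i j A w : cform_wf v A -> j \in cfree b A ->
  i \notin cindices A ->
  count_mem w (cfree c (csubst b i j A)) + (c == b) * (w == j) =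
  count_mem w (cfree c A) + (c == b) * (w == i).
Proof.
move=> wf jA iA; have wf' : cform_wf v (csubst b i j A) by rewrite wf_csubst.
rewrite !count_uniq_mem ?(free_uniq _ wf) ?(free_uniq _ wf') //.
rewrite mem_cfree_csubst //.
have iA' : i \notin cfree c A by apply: contra iA => /mem_cfree_cindices.
have nij : i != j by apply: contra iA => /eqP ->; apply: mem_cfree_cindices jA.
case: (eqVneq c b) => [ec|nc] /=; last first.
  rewrite !mul0n !addn0; case: (eqVneq w j) => [->|//].
  have -> : c = ~~ b by case: (b) (c) nc => -[].
  by move: jA; rewrite mem_free => /andP[_ /negbTE jA]; rewrite mem_free jA.
subst c; case: (eqVneq w i) => [->|nwi]; first by rewrite (negbTE iA') (negbTE nij).
by case: (eqVneq w j) => [->|//]; rewrite jA.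
Qed.

Lemma bot_wf i j : i != j -> cform_wf v (bot j i : form).
Proof. by rewrite /cform_wf /= andbT inE eq_sym => ->. Qed.

Lemma bot_free b i j : i != j -> cfree b (bot j i : form) = [:: if b then j else i].
Proof. by move/bot_wf/(catom_free b) => ->; case: b. Qed.

Lemma csequent_cons A G w : csequent v (A :: G) ->
  (count_mem w (cfree true A) + count_mem w (cfree_ctx true G) ==
   count_mem w (cfree false A) + count_mem w (cfree_ctx false G)) &&
  (count_mem w (cfree true A) + count_mem w (cfree_ctx true G) <= 1).
Proof. by case/csequentP=> _ /(_ w); rewrite !cfree_ctx_cons !count_cat. Qed.

Lemma bot_up G A i j : J (A :: G) -> j \in cfree true A -> i \notin cindices A ->
  i \notin cfree_ctx true G -> J [:: bot j i, csubst true i j A & G].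
Proof.
move=> JA jA iA iG; have [cs /= /andP[pA pG]] := J_wf JA.
have wfA : cform_wf v A := csequent_wf cs (mem_head _ _).
have nij : i != j by apply: contra iA => /eqP ->; apply: mem_cfree_cindices jA.
apply: (J_bot_up JA jA iA); last by rewrite /= pol_bot pol_csubst pA pG.
apply/csequentP; split.
  have /csequentP[/= /andP[_ wG] _] := cs.
  by rewrite /= -!/(cform_wf v _) bot_wf // wf_csubst // wfA wG.
move=> w; have := csequent_cons w cs.
have := count_csubst true w wfA jA iA; have := count_csubst false w wfA jA iA.
have ci : count_mem i (cfree true A) + count_mem i (cfree_ctx true G) = 0.
  apply/eqP; rewrite addn_eq0; apply/andP; split; apply/eqP/count_memPn => //.
  by apply: contra iA => /mem_cfree_cindices.
have cj : 0 < count_mem j (cfree true A) by rewrite -has_count has_pred1.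
have := csequent_cons i cs; have := csequent_cons j cs; move: ci cj.
rewrite !cfree_ctx_cons !count_cat !(bot_free _ nij) /= !addn0 ![_ == w]eq_sym.
case: (eqVneq w i) => [->|n1]; first by rewrite (negbTE nij) /=; clear; lia.
by case: (eqVneq w j) => [->|n2] /=; clear; lia.
Qed.

Lemma bot_down G A i j : J [:: bot j i, A & G] -> j \in cfree false A ->
  i \notin cindices A -> J (csubst false i j A :: G).
Proof.
move=> JA jA iA; have [cs /= /and3P[_ pA pG]] := J_wf JA.
have wfA : cform_wf v A by apply: csequent_wf cs _; rewrite !inE eqxx orbT.
have nij : i != j by apply: contra iA => /eqP ->; apply: mem_cfree_cindices jA.
apply: (J_bot_down JA jA iA); last by rewrite /= pol_csubst pA pG.
apply/csequentP; split.
  have /csequentP[/= /and3P[_ _ wG] _] := cs.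
  by rewrite /= -!/(cform_wf v _) wf_csubst // wfA wG.
move=> w; have := csequent_cons w cs.
have := count_csubst true w wfA jA iA; have := count_csubst false w wfA jA iA.
have ci : count_mem i (cfree false A) = 0.
  by apply/count_memPn; apply: contra iA => /mem_cfree_cindices.
have cj : 0 < count_mem j (cfree false A) by rewrite -has_count has_pred1.
have := csequent_cons i cs; have := csequent_cons j cs; move: ci cj.
rewrite !cfree_ctx_cons !count_cat !(bot_free _ nij) /= !addn0 ![_ == w]eq_sym !eqxx.
case: (eqVneq w i) => [->|n1]; first by rewrite (negbTE nij) /=; clear; lia.
by case: (eqVneq w j) => [->|n2] /=; clear; lia.
Qed.

Lemma bot_neq i j G : J G -> (bot j i : form) \in G -> i != j.
Proof.
case/J_wf=> cs _ /(csequent_wf cs) /and3P[/andP[_ /andP[+ _]] _ _].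
by rewrite inE eq_sym.
Qed.

Lemma lower_neq i j i' j' G : J [:: bot j i, bot j' i' & G] -> i != i' /\ j != j'.
Proof.
move=> JG; have n1 : i != j by apply: bot_neq JG _; rewrite inE eqxx.
have n2 : i' != j' by apply: bot_neq JG _; rewrite !inE eqxx orbT.
have [cs _] := J_wf JG; move: cs => [/[!ccontextE] /and3P[_ u1 u2] _].
move: u1 u2; rewrite !cfree_ctx_cons !(bot_free _ n1) !(bot_free _ n2) /= !inE !negb_or.
by case/andP=> /andP[-> _] _ /andP[/andP[-> _] _].
Qed.

Lemma link_contract u l p q G : u != l -> J [:: bot q u, bot p q, bot l p & G] ->
  J (bot l u :: G).
Proof.
move=> nul JG; have nqp : q != p by apply: bot_neq JG _; rewrite !inE eqxx !orbT.
have nuq : u != q by apply: bot_neq JG _; rewrite !inE eqxx.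
have npl : p != l by apply: bot_neq JG _; rewrite !inE eqxx !orbT.
have nup : u != p.
  have : J [:: bot q u, bot l p, bot p q & G].
    by apply: J_perm JG; perm_lia.
  by case/lower_neq.
have : J (csubst false u q (bot p q) :: bot l p :: G).
  by apply: bot_down JG _ _; rewrite ?(bot_free _ nqp) ?inE ?negb_or ?nup ?nuq.
rewrite /= eqxx => J2.
have : J (csubst false u p (bot l p) :: G).
  by apply: bot_down J2 _ _; rewrite ?(bot_free _ npl) ?inE ?negb_or ?nup ?nul.
by rewrite /= eqxx.
Qed.

(** Serves [D_bot]: the middle bot is the formula introduced, the outer two are the links at its
    ports. Conversely, [link_contract] shortens such a chain after the joins of a tensor. *)
Lemma link_expand u l p q G : p != q -> J (bot l u :: G) ->
  p \notin cfree_ctx true (bot l u :: G) -> q \notin cfree_ctx true (bot l u :: G) ->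
  J [:: bot q u, bot p q, bot l p & G].
Proof.
move=> npq JG np nq; have nul : u != l by apply: bot_neq JG _; rewrite inE eqxx.
have [cs _] := J_wf JG.
have sep z : z \notin cfree_ctx true (bot l u :: G) ->
    [/\ z != l, z != u & z \notin cfree_ctx true G].
  move=> nz; have nz' : z \notin cfree_ctx false (bot l u :: G).
    by rewrite (csequent_mem false z cs).
  move: nz nz'; rewrite !cfree_ctx_cons !(bot_free _ nul) !inE !negb_or.
  by case/andP=> -> -> /andP[-> _].
have [npl npu pG] := sep p np; have [nql nqu qG] := sep q nq.
have : J [:: bot l p, csubst true p l (bot l u) & G].
  by apply: bot_up JG _ _ pG; rewrite ?(bot_free _ nul) ?inE ?negb_or ?npl ?npu.
rewrite /= eqxx => J2.
have J3 : J [:: bot p u, bot l p & G].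
  by apply: J_perm J2; perm_lia.
have nup : u != p by rewrite eq_sym.
have : J [:: bot p q, csubst true q p (bot p u), bot l p & G].
  apply: bot_up J3 _ _ _; rewrite ?(bot_free _ nup) ?inE ?negb_or ?nqu // 1?eq_sym ?npq //.
  by rewrite cfree_ctx_cons (bot_free _ npl) inE negb_or nql.
rewrite /= eqxx => J4.
by apply: J_perm J4; perm_lia.
Qed.

(** A loop is realized by a cyclic pair of bots whose names are immaterial; a cycle created by a
    join can therefore take the names reserved for it. *)
Lemma loop_rename (p q a e : I) G : a != e -> J [:: bot p q, bot q p & G] ->
  a \notin cfree_ctx true [:: bot p q, bot q p & G] ->
  e \notin cfree_ctx true [:: bot p q, bot q p & G] ->
  J [:: bot a e, bot e a & G].
Proof.
move=> nae JG na ne; have nqp : q != p by apply: bot_neq JG _; rewrite inE eqxx.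
have npq : p != q by rewrite eq_sym.
have sep z : z \notin cfree_ctx true [:: bot p q, bot q p & G] ->
    [/\ z != p, z != q & z \notin cfree_ctx true G].
  rewrite !cfree_ctx_cons (bot_free _ nqp) (bot_free _ npq) !inE !negb_or.
  by case/and3P.
have [nap naq aG] := sep a na; have [nep neq eG] := sep e ne.
have : J [:: bot p a, csubst true a p (bot p q), bot q p & G].
  apply: bot_up JG _ _ _; rewrite ?(bot_free _ nqp) ?inE ?negb_or ?nap ?naq //.
  by rewrite cfree_ctx_cons (bot_free _ npq) inE negb_or naq.
rewrite /= eqxx => J2.
have J3 : J [:: bot p a, bot q p, bot a q & G].
  by apply: J_perm J2; perm_lia.
have : J (csubst false a p (bot q p) :: bot a q :: G).
  by apply: bot_down J3 _ _; rewrite ?(bot_free _ npq) ?inE ?negb_or ?nap ?naq.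
rewrite /= eqxx => J4.
have nqa : q != a by rewrite eq_sym.
have : J [:: bot q e, csubst true e q (bot q a), bot a q & G].
  apply: bot_up J4 _ _ _; rewrite ?(bot_free _ naq) ?inE ?negb_or ?neq //.
    by rewrite eq_sym nae.
  by rewrite cfree_ctx_cons (bot_free _ nqa) inE negb_or eq_sym nae.
rewrite /= eqxx => J5.
have J6 : J [:: bot q e, bot a q, bot e a & G].
  by apply: J_perm J5; perm_lia.
have : J (csubst false e q (bot a q) :: bot e a :: G).
  apply: bot_down J6 _ _; rewrite ?(bot_free _ nqa) ?inE ?negb_or ?neq //.
  by rewrite eq_sym nae.
by rewrite /= eqxx.
Qed.

(** The bot between an upper index [p] and a lower index [q] disappears when both receive one common
    new name: [p] is renamed at the cost of a bot, which is merged with the link and then absorbed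
    at [q]. *)
Lemma direct_link X Y p q x G : J [:: X, Y, bot q p & G] ->
  p \in cfree true X -> q \in cfree false Y -> x \notin cindices X ->
  x \notin cindices Y -> x \notin cfree_ctx true (bot q p :: G) ->
  J [:: csubst true x p X, csubst false x q Y & G].
Proof.
move=> JG pX qY xX xY xG; have npq : p != q.
  by apply: bot_neq JG _; rewrite !inE eqxx !orbT.
have nxp : x != p by apply: contra xX => /eqP ->; apply: mem_cfree_cindices pX.
have nxq : x != q by apply: contra xY => /eqP ->; apply: mem_cfree_cindices qY.
have J2 : J [:: bot p x, csubst true x p X, Y, bot q p & G].
  apply: bot_up JG pX xX _; rewrite cfree_ctx_cons mem_cat negb_or xG andbT.
  by apply: contra xY; apply: mem_cfree_cindices.
have J3 : J [:: bot p x, bot q p, csubst true x p X, Y & G].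
  by apply: J_perm J2; perm_lia.
have : J [:: csubst false x p (bot q p), csubst true x p X, Y & G].
  by apply: bot_down J3 _ _; rewrite ?(bot_free _ npq) ?inE ?negb_or ?nxp ?nxq.
rewrite /= eqxx => J4.
have J5 : J [:: bot q x, Y, csubst true x p X & G].
  by apply: J_perm J4; perm_lia.
have J6 := bot_down J5 qY xY.
by apply: J_perm J6; perm_lia.
Qed.

(** New names are introduced only at upper indices. To rename a lower index [w], the name enters
    through the link whose upper index is [w], is passed on to the formula, and [w] is finally
    restored in the link. *)
Lemma split_lower A w u z G : J [:: A, bot w u & G] -> w \in cfree false A ->
  z \notin cindices A -> z != u -> z \notin cfree_ctx true [:: A, bot w u & G] ->
  J [:: bot z w, csubst false z w A, bot w u & G].
Proof.
move=> JG wA zA nzu zG; have nuw : u != w by apply: bot_neq JG _; rewrite !inE eqxx orbT.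
have [cs _] := J_wf JG.
have wfA : cform_wf v A := csequent_wf cs (mem_head _ _).
have nzw : z != w by apply: contra zA => /eqP ->; apply: mem_cfree_cindices wA.
have J1 : J [:: bot w u, A & G].
  by apply: J_perm JG; perm_lia.
have zAG : z \notin cfree_ctx true (A :: G).
  by move: zG; rewrite !cfree_ctx_cons !mem_cat !negb_or => /and3P[-> _ ->].
have : J [:: bot w z, csubst true z w (bot w u), A & G].
  by apply: bot_up J1 _ _ zAG; rewrite ?(bot_free _ nuw) ?inE ?negb_or ?nzu ?nzw.
rewrite /= eqxx => J2.
have J3 : J [:: bot w z, A, bot z u & G].
  by apply: J_perm J2; perm_lia.
have J4 := bot_down J3 wA zA.
have J5 : J [:: bot z u, csubst false z w A & G].
  by apply: J_perm J4; perm_lia.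
have nuz : u != z by rewrite eq_sym.
have wG : w \notin cfree_ctx true (A :: G).
  have [cs1 _] := J_wf J1; apply: (csequent_disj cs1).
  by rewrite (bot_free _ nuw) inE.
have : J [:: bot z w, csubst true w z (bot z u), csubst false z w A & G].
  apply: bot_up J5 _ _ _; rewrite ?(bot_free _ nuz) ?inE ?negb_or //.
    by rewrite eq_sym nzw eq_sym nuw.
  move: wG; rewrite !cfree_ctx_cons !mem_cat !negb_or mem_cfree_csubst // => /andP[+ ->].
  by rewrite andbT /= negb_and orbC => ->.
rewrite /= eqxx => J6.
by apply: J_perm J6; perm_lia.
Qed.

End Links.

(** * Sequents that realize a wiring *)

Section Realization.
Variables (I L : eqType) (v : L -> nat * nat).
Local Notation form := (cform I L).
Local Notation port := (nat * I)%type.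
Local Notation item := (nat * form)%type.
Local Notation wiring := (seq (option (port * port))).
Implicit Types (A B C : form) (R D : seq form) (G : seq item) (b c : bool)
  (i j x y z w : I) (X : item) (S : seq I) (E F : wiring) (ab : seq (I * I)).
Variables (pol : pred form) (J : seq form -> Prop).
Hypothesis M : model v pol J.
Variable n : bool -> port -> I.
Local Notation bot j i := (CAtom CBot [:: j] [:: i]).

(** [S] lists the free indices that already have their own name back; bound indices always keep
    theirs. *)
Definition env S X b x : I :=
  if (x \in cfree b X.2) && (x \notin S) then n b (X.1, x) else x.

Definition real S X : form := crename (env S X) X.2.

Definition link (e : port * port) : form := bot (n false e.2) (n true e.1).

Definition loops ab : seq form :=
  flatten [seq [:: bot q.1 q.2; bot q.2 q.1] | q <- ab].

(** [ab] provides two names for each loop of [E], because a loop has no port to take a name from. *)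
Definition realize G E ab : seq form :=
  map (real [::]) G ++ map link (pmap id E) ++ loops ab.

Definition names G ab : seq I :=
  map (n true) (occs true G) ++ map (n false) (occs false G) ++
  flatten [seq [:: q.1; q.2] | q <- ab].

(** Names avoid the indices of [G], so an index can regain its own name without being captured. *)
Definition naming G ab :=
  uniq (names G ab) && ~~ has (mem (flatten [seq cindices X.2 | X <- G])) (names G ab).

Definition apt X :=
  (forall b c x y, x \in cfree b X.2 -> y \in cfree c X.2 ->
     n b (X.1, x) = n c (X.1, y) -> b = c /\ x = y) /\
  (forall b x, x \in cfree b X.2 -> n b (X.1, x) \notin cindices X.2).

Lemma mem_names b G ab p : p \in occs b G -> n b p \in names G ab.
Proof.
by move=> pG; rewrite !mem_cat; case: b pG => pG; rewrite (map_f _ pG) ?orbT.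
Qed.

Lemma names_inj G ab b c p q : uniq (names G ab) -> p \in occs b G ->
  q \in occs c G -> n b p = n c q -> b = c /\ p = q.
Proof.
rewrite /names !cat_uniq => /and3P[u1 /hasPn d /and3P[u2 _ _]] pb qc e.
have x p1 p2 : p1 \in occs true G -> p2 \in occs false G -> n true p1 <> n false p2.
  move=> h1 h2 e'; have := d (n false p2); rewrite mem_cat map_f //= => /(_ isT).
  by rewrite -e' map_f.
case: b c pb qc e => -[] pb qc e.
- by split=> //; apply: (uniq_map_in u1) e.
- by case: (x p q).
- by case: (x q p).
- by split=> //; apply: (uniq_map_in u2) e.
Qed.

Lemma naming_apt G ab X : naming G ab -> X \in G -> apt X.
Proof.
case/andP=> u /hasPn d XG.
have oc b x : x \in cfree b X.2 -> (X.1, x) \in occs b G.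
  rewrite mem_free => /andP[xb _]; apply/flatten_mapP; exists X => //.
  by rewrite mem_tag_ports.
split=> [b c x y xX yX e|b x xX].
  by case: (names_inj u (oc b x xX) (oc c y yX) e) => -> [->].
apply/negP => h; have := d _ (mem_names ab (oc b x xX)); rewrite /=.
by move/negP; apply; apply/flatten_mapP; exists X.
Qed.

Lemma env_faithful S X : apt X -> faithful (env S X) X.2.
Proof.
move=> [inj raw]; split.
  move=> b c x y xX yX; rewrite /env.
  case: ifP => [/andP[xf _]|_]; case: ifP => [/andP[yf _]|_] // e.
  - by case: (inj _ _ _ _ xf yf e).
  - by have := raw b x xf; rewrite e (mem_cindices yX).
  - by have := raw c y yf; rewrite -e (mem_cindices xX).
by move=> x xt xf; rewrite /env !mem_free xt xf.
Qed.

Lemma mem_real b S X w : apt X -> w \in cfree b (real S X) ->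
  exists2 x, x \in cfree b X.2 & w = env S X b x.
Proof. by move=> ap; rewrite cfree_crename; [case/mapP=> x; exists x|apply: env_faithful]. Qed.

Lemma raw_fresh S X x b : apt X -> x \in cfree b X.2 -> x \notin S ->
  x \notin cindices (real S X).
Proof.
move=> ap xX xS; have [inj raw] := ap.
have h c : x \notin coccs c (real S X).
  rewrite coccs_crename; apply/mapP => -[y yX]; rewrite /env.
  case: ifP => [/andP[yf _] e|yn e].
    by have := raw c y yf; rewrite -e (mem_cfree_cindices xX).
  subst y; move: yn; rewrite xS andbT => /negbT; rewrite mem_free yX negbK => xN.
  by move: xX; rewrite mem_free => /andP[h1 /negP]; apply; case: (b) (c) yX xN h1 => -[].
by rewrite /cindices mem_cat negb_or !h.
Qed.

Lemma real_csubst S X b x : apt X -> x \in cfree b X.2 -> x \notin S ->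
  csubst b x (n b (X.1, x)) (real S X) = real (x :: S) X.
Proof.
move=> ap xX xS; rewrite /real csubst_crename; apply: crename_ext => c y yX.
have [inj _] := env_faithful S ap.
have ex : env S X b x = n b (X.1, x) by rewrite /env xX xS.
have xO : x \in coccs b X.2 by move: xX; rewrite mem_free => /andP[].
case: (eqVneq y x) => [->|nyx]; last first.
  have -> : (c == b) && (env S X c y == n b (X.1, x)) = false.
    by apply/andP => -[_ /eqP]; rewrite -ex => /(inj _ _ _ _ yX xO)/eqP; rewrite (negbTE nyx).
  by rewrite /env inE (negbTE nyx).
rewrite [RHS]/env inE eqxx andbF; case: (eqVneq c b) => [->|nc] /=.
  by rewrite ex eqxx.
rewrite /env; case: ifP => // /andP[xc _].
by move: xX xc; rewrite !mem_free; case: (b) (c) nc => -[] // _ /andP[-> _] /andP[].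
Qed.

Lemma mem_real_old S X b x : apt X -> x \in cfree b X.2 -> x \notin S ->
  n b (X.1, x) \in cfree b (real S X).
Proof.
move=> ap xX xS; rewrite cfree_crename; last exact: env_faithful.
by apply/mapP; exists x => //; rewrite /env xX xS.
Qed.

(* Giving back its own name x to an open port of X leaves a connecting bot. *)
Definition extra X x : form :=
  if x \in cfree true X.2 then bot (n true (X.1, x)) x else bot x (n false (X.1, x)).

Lemma free_raw_neq X b x : apt X -> x \in cfree b X.2 -> x != n b (X.1, x).
Proof.
move=> [_ raw] xX; apply/eqP => e.
by have := raw b x xX; rewrite -e (mem_cfree_cindices xX).
Qed.

Lemma mem_extra X x b w : apt X -> x \in cfree true X.2 ++ cfree false X.2 ->
  w \in cfree true (extra X x) -> w = x \/ exists2 c, x \in cfree c X.2 & w = n c (X.1, x).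
Proof.
move=> ap; rewrite /extra mem_cat; case: ifP => [xt _|_ /= xf].
  rewrite (bot_free v true (free_raw_neq ap xt)) inE => /eqP ->.
  by right; exists true.
have nx : n false (X.1, x) != x by rewrite eq_sym; apply: free_raw_neq.
by rewrite (bot_free v true nx) inE => /eqP ->; left.
Qed.

(** A tensor binds an index only if both halves use the same name for it, so the ports in [S] must
    first get their raw names back: by [bot_up] at upper ports, by [split_lower] and the link ending
    there at lower ones. *)
Lemma open_item X R S : apt X -> cform_wf v X.2 -> uniq S ->
  {subset S <= cfree true X.2 ++ cfree false X.2} ->
  {in S, forall x, x \notin cfree_ctx true R} ->
  {in S, forall x, x \in cfree false X.2 ->
     exists2 u, bot (n false (X.1, x)) u \in R & x != u} ->
  J (real [::] X :: R) -> J (real S X :: map (extra X) S ++ R).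
Proof.
move=> ap wf; elim: S => [//|x S IH] /= /andP[xS uS] sub fr lk JR.
have JS : J (real S X :: map (extra X) S ++ R).
  apply: IH => // y yS; try by apply: sub; rewrite inE yS orbT.
    by apply: fr; rewrite inE yS orbT.
  by apply: lk; rewrite inE yS orbT.
have xX : x \in cfree true X.2 ++ cfree false X.2 by apply: sub; rewrite inE eqxx.
have xI : x \in cindices X.2 by move: xX; rewrite mem_cat => /orP[] /mem_cfree_cindices.
have xR : x \notin cfree_ctx true (map (extra X) S ++ R).
  rewrite cfree_ctx_cat mem_cat negb_or fr ?inE ?eqxx // andbT.
  apply/negP => /flatten_mapP[C /mapP[y yS ->]].
  have yX : y \in cfree true X.2 ++ cfree false X.2 by apply: sub; rewrite inE yS orbT.
  case/(mem_extra true ap yX) => [e|[c yc e]].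
    by move: xS; rewrite e yS.
  by have := ap.2 c y yc; rewrite -e xI.
rewrite /extra; case: ifP => xt.
  have := bot_up M JS (mem_real_old ap xt xS) (raw_fresh ap xt xS) xR.
  by rewrite real_csubst // => J2; apply: (model_perm M) J2; perm_lia.
have xf : x \in cfree false X.2 by move: xX; rewrite mem_cat xt.
have [u uR nxu] := lk x (mem_head _ _) xf.
have [R0 pR] := perm_cons_mem uR.
have J1 : J [:: real S X, bot (n false (X.1, x)) u & map (extra X) S ++ R0].
  by apply: (model_perm M) JS; perm_lia.
have nxC : x \notin cfree_ctx true [:: real S X, bot (n false (X.1, x)) u & map (extra X) S ++ R0].
  have : x \notin cfree_ctx true (real S X :: map (extra X) S ++ R).
    rewrite cfree_ctx_cons mem_cat negb_or xR andbT.
    by apply: contra (raw_fresh ap xf xS); apply: mem_cfree_cindices.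
  rewrite (perm_mem (perm_flatmap (cfree true) (_ : perm_eq _
    [:: real S X, bot (n false (X.1, x)) u & map (extra X) S ++ R0]))) //.
  by perm_lia.
have := split_lower M J1 (mem_real_old ap xf xS) (raw_fresh ap xf xS) nxu nxC.
by rewrite real_csubst // => J2; apply: (model_perm M) J2; perm_lia.
Qed.

Lemma ends_pmap b E : ends b E = [seq if b then e.1 else e.2 | e <- pmap id E].
Proof. by elim: E => //= -[e|] E /= ->. Qed.

Lemma mem_link (es : seq (port * port)) w : w \in cfree_ctx true (map link es) ->
  exists2 e, e \in es & w = n false e.2.
Proof.
case/flatten_mapP=> C /mapP[e ee ->]; rewrite mem_free inE => /andP[/eqP -> _].
by exists e.
Qed.

Lemma mem_loops ab w : w \in cfree_ctx true (loops ab) ->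
  w \in flatten [seq [:: q.1; q.2] | q <- ab].
Proof.
case/flatten_mapP=> C /flatten_mapP[q qab]; rewrite !inE => /orP[] /eqP -> ;
  rewrite mem_free inE => /andP[/eqP -> _]; apply/flatten_mapP; exists q => //.
- by rewrite mem_head.
- by rewrite !inE eqxx orbT.
Qed.

Lemma mem_items G ab w : naming G ab -> w \in cfree_ctx true (map (real [::]) G) ->
  w \in map (n true) (occs true G).
Proof.
move=> nm /flatten_mapP[C /mapP[X XG ->]].
case/(mem_real (naming_apt nm XG)) => x xX ->; rewrite /env xX /=.
apply: map_f; apply/flatten_mapP; exists X => //; rewrite mem_tag_ports.
by move: xX; rewrite mem_free => /andP[].
Qed.

Lemma mem_realize G E ab w : naming G ab -> {subset ends false E <= occs false G} ->
  w \in cfree_ctx true (realize G E ab) -> w \in names G ab.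
Proof.
move=> nm sub; rewrite /realize !cfree_ctx_cat !mem_cat => /or3P[h|h|h].
- by rewrite (mem_items nm h).
- have [e ee ->] := mem_link h; apply/orP; right; apply/orP; left.
  by apply/map_f/sub; rewrite ends_pmap; apply: (map_f (fun e : port * port => e.2)).
- by rewrite (mem_loops h) !orbT.
Qed.

Lemma real_pol S X : pol (real S X) = pol X.2.
Proof. exact: (pol_crename M). Qed.

(** The self-edges in the premise of [D_par] are links between the two halves; [direct_link]
    replaces each by the raw index, which the par then binds. *)
Lemma join_par k A B S R : apt (k, A) -> apt (k, B) -> uniq S ->
  {in S, forall x, exists b, x \in cfree b A /\ x \in cfree (~~ b) B} ->
  {in S, forall x, x \notin cfree_ctx true R} ->
  J [:: real [::] (k, A), real [::] (k, B) &
     map link [seq (p, p) | p <- tag_ports k S] ++ R] ->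
  J [:: real S (k, A), real S (k, B) & R].
Proof.
move=> apA apB; elim: S R => [//|x S IH] R /= /andP[xS uS] sub fr JR.
have [b [xA xB]] := sub x (mem_head _ _).
have fl : exists X, [/\ apt X, X.1 = k, x \in cfree false X.2 &
    {in S, forall y, y \in cindices X.2}].
  case: b xA xB => xA xB; [exists (k, B)|exists (k, A)]; split=> // y yS;
    have [c [yA yB]] : exists b, y \in cfree b A /\ y \in cfree (~~ b) B
      by apply: sub; rewrite inE yS orbT.
    exact: mem_cfree_cindices yB.
  exact: mem_cfree_cindices yA.
have [X [apX eX xX yX]] := fl.
have JS : J [:: real S (k, A), real S (k, B), link ((k, x), (k, x)) & R].
  apply: IH => //; first by move=> y yS; apply: sub; rewrite inE yS orbT.
    move=> y yS; rewrite cfree_ctx_cons mem_cat negb_or fr ?inE ?yS ?orbT // andbT.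
    rewrite mem_free inE negb_and; apply/orP; left; apply/eqP => e.
    by have := apX.2 false x xX; rewrite eX -e yX.
  by apply: (model_perm M) JR; perm_lia.
have xL : x \notin cfree_ctx true (link ((k, x), (k, x)) :: R).
  rewrite cfree_ctx_cons mem_cat negb_or fr ?mem_head // andbT.
  rewrite mem_free inE negb_and -eX; apply/orP; left.
  exact: free_raw_neq xX.
case: b xA xB => /= xA xB.
  have := direct_link M JS (mem_real_old apA xA xS) (mem_real_old apB xB xS)
    (raw_fresh apA xA xS) (raw_fresh apB xB xS) xL.
  by rewrite (real_csubst apA) // (real_csubst apB).
have JS' : J [:: real S (k, B), real S (k, A), link ((k, x), (k, x)) & R].
  by apply: (model_perm M) JS; perm_lia.
have := direct_link M JS' (mem_real_old apB xB xS) (mem_real_old apA xA xS)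
  (raw_fresh apB xB xS) (raw_fresh apA xA xS) xL.
rewrite (real_csubst apB) // (real_csubst apA) // => J2.
by apply: (model_perm M) J2; perm_lia.
Qed.

(** Joins never destroy a loop, so the names supplied for the loops of a tensor cover those of its
    premises. *)
Lemma conns_count ps E F : conns ps E F -> count_mem None E <= count_mem None F.
Proof.
elim: ps E => [|p ps IH] E /=; first by move/permP => ->.
case=> G c /IH; apply: leq_trans; case: c => [R|u l R] /permP -> /permP -> //=.
Qed.

Definition connector (p : port) : form := bot (n true p) (n false p).

(** A join at [p] becomes the contraction of the connector of [p] with the adjacent links. If a
    single link runs from [p] back to [p], connector and link form a cycle, which takes the next
    pair of names in [ab]. *)
Lemma conns_realize ps E F R ab : conns ps E F ->
  count_mem None E + size ab = count_mem None F ->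
  (forall u l, u \in ends true E -> l \in ends false E -> n true u != n false l) ->
  uniq (flatten [seq [:: q.1; q.2] | q <- ab]) ->
  {in flatten [seq [:: q.1; q.2] | q <- ab], forall z,
     z \notin cfree_ctx true (R ++ map link (pmap id E) ++ map connector ps)} ->
  J (R ++ map link (pmap id E) ++ map connector ps) ->
  J (R ++ map link (pmap id F) ++ loops ab).
Proof.
elim: ps E R ab => [|p ps IH] E R ab /=.
  move=> pE; rewrite (permP pE) => /eqP; rewrite -[X in _ == X]addn0 eqn_add2l.
  case: ab => // _ _ _ _ JR; apply: (model_perm M) JR.
  by rewrite /loops /= !cats0 perm_cat2l; apply/perm_map/perm_pmap.
case=> G c cs cnt sep uab fr JR; case: c => [E0|u l E0] pE pG.
  have [[a d] [ab' eab]] : exists q ab', ab = q :: ab'.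
    case: (ab) cnt => [|q ab']; last by exists q, ab'.
    by have := conns_count cs; rewrite (permP pE) (permP pG) /=; lia.
  subst ab; move: uab fr => /= /and3P[]; rewrite inE negb_or => /andP[nad aab] dab uab fr.
  pose R0 := R ++ map link (pmap id E0) ++ map connector ps.
  have pl := perm_map link (perm_pmap id pE); rewrite /= in pl.
  have pJ : perm_eq (R ++ map link (pmap id E) ++ connector p :: map connector ps)
      [:: link (p, p), connector p & R0] by rewrite /R0; perm_lia.
  have J1 := model_perm M pJ JR.
  have fr1 z : z \in flatten [seq [:: q.1; q.2] | q <- (a, d) :: ab'] ->
      z \notin cfree_ctx true [:: link (p, p), connector p & R0].
    by move/fr; rewrite (perm_mem (perm_flatmap _ pJ)).
  have J2 := loop_rename M nad J1 (fr1 a (mem_head _ _)) (fr1 d _).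
  have {}J2 := J2 _; rewrite !inE eqxx orbT in J2; have {}J2 := J2 isT.
  have : J ((bot a d :: bot d a :: R) ++ map link (pmap id F) ++ loops ab').
    have pl2 := perm_map link (perm_pmap id pG); rewrite /= in pl2.
    apply: (IH G) => //.
    - by move: cnt; rewrite (permP pE) (permP pG) /=; lia.
    - move=> u' l' uG lG; apply: sep.
        move: uG; rewrite (perm_mem (perm_ends _ pE)) (perm_mem (perm_ends _ pG)) /= inE.
        by move=> ->; rewrite orbT.
      move: lG; rewrite (perm_mem (perm_ends _ pE)) (perm_mem (perm_ends _ pG)) /= inE.
      by move=> ->; rewrite orbT.
    - move=> z zab.
      have : z \notin cfree_ctx true [:: link (p, p), connector p & R0].
        by apply: fr1; rewrite /= !inE zab !orbT.
      have pz : perm_eq ((bot a d :: bot d a :: R) ++ map link (pmap id G) ++ map connector ps)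
        [:: bot a d, bot d a & R0] by rewrite /R0; perm_lia.
      rewrite (perm_mem (perm_flatmap (cfree true) pz)).
      rewrite -!/(cfree_ctx _ _) !(cfree_ctx_cons true) !mem_cat !negb_or.
      case/and3P=> _ _ ->; rewrite andbT !mem_free !inE !negb_and.
      have -> : z != a by apply: contra aab => /eqP <-.
      by have -> : z != d by apply: contra dab => /eqP <-.
    - by apply: (model_perm M) J2; rewrite /R0; perm_lia.
  by move=> J3; apply: (model_perm M) J3; rewrite /loops /=; perm_lia.
pose R0 := R ++ map link (pmap id E0) ++ map connector ps.
have pl := perm_map link (perm_pmap id pE); rewrite /= in pl.
have pl2 := perm_map link (perm_pmap id pG); rewrite /= in pl2.
have pJ : perm_eq (R ++ map link (pmap id E) ++ connector p :: map connector ps)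
    [:: link (u, p), connector p, link (p, l) & R0] by rewrite /R0; perm_lia.
have J1 := model_perm M pJ JR.
have nul : n true u != n false l.
  apply: sep; rewrite (perm_mem (perm_ends _ pE)) /= !inE eqxx ?orbT //.
have J2 : J (link (u, l) :: R0) := link_contract M nul J1.
have npl : n true p != n false l.
  by apply: (bot_neq M J1); rewrite !inE eqxx !orbT.
apply: (IH G) => //.
- by move: cnt; rewrite (permP pE) (permP pG) /=; lia.
- move=> u' l' uG lG; apply: sep.
    move: uG; rewrite (perm_mem (perm_ends _ pE)) (perm_mem (perm_ends _ pG)) /= !inE.
    by case/orP=> ->; rewrite ?orbT.
  move: lG; rewrite (perm_mem (perm_ends _ pE)) (perm_mem (perm_ends _ pG)) /= !inE.
  by case/orP=> ->; rewrite ?orbT.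
- move=> z /fr; rewrite (perm_mem (perm_flatmap (cfree true) pJ)).
  have pz : perm_eq (R ++ map link (pmap id G) ++ map connector ps) (link (u, l) :: R0).
    by rewrite /R0; perm_lia.
  rewrite (perm_mem (perm_flatmap (cfree true) pz)) -!/(cfree_ctx _ _).
  rewrite !(cfree_ctx_cons true) !mem_cat !negb_or => /and4P[_ _ + ->].
  by rewrite /link /= (bot_free v _ npl) (bot_free v _ nul) !inE andbT.
- by apply: (model_perm M) J2; rewrite /R0; perm_lia.
Qed.

(** The prefix [u1] holds the upper indices that have been renamed already, so that the induction
    can proceed from left to right. *)
Lemma atom_up p u1 (us vs l : seq I) R : size us = size vs -> uniq vs ->
  {in vs, forall z, z \notin u1 ++ us ++ l} ->
  {in vs, forall z, z \notin cfree_ctx true R} ->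
  J (CAtom p (u1 ++ us) l :: R) ->
  J (CAtom p (u1 ++ vs) l :: [seq bot e.2 e.1 | e <- zip vs us] ++ R).
Proof.
elim: us vs u1 R => [|w us IH] [|z vs] u1 R //= [es] /andP[zvs uvs] nvs fr JR.
have [cs _] := model_wf M JR; have wf := csequent_wf cs (mem_head _ _).
have z1 : z \notin u1 ++ (w :: us) ++ l by apply: nvs; rewrite mem_head.
have zw : z != w by move: z1; rewrite mem_cat !inE !negb_or => /and3P[].
have : J [:: bot w z, csubst true z w (CAtom p (u1 ++ w :: us) l) & R].
  apply: (bot_up M JR); first by rewrite (catom_free true wf) mem_cat inE eqxx orbT.
    by rewrite /cindices /= -catA.
  by apply: fr; rewrite mem_head.
rewrite /= map_cat /= eqxx.
have uq : uniq (u1 ++ w :: us) by have := wf_uniq true wf.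
have idm (s : seq I) : w \notin s -> [seq if k == w then z else k | k <- s] = s.
  move=> ws; rewrite -[RHS]map_id; apply/eq_in_map => y ys.
  by case: eqP => // e; move: ws; rewrite -e ys.
move: uq; rewrite cat_uniq /= => /and3P[_ d /andP[wus _]].
have wu1 : w \notin u1 by apply: contra d => h; rewrite /= h.
rewrite !idm // -[u1 ++ z :: us]cat_rcons => J1.
have J2 : J (CAtom p (rcons u1 z ++ us) l :: bot w z :: R).
  by apply: (model_perm M) J1; perm_lia.
have := IH vs (rcons u1 z) (bot w z :: R) es uvs.
rewrite -[u1 ++ z :: vs]cat_rcons => H; apply: (model_perm M) (H _ _ J2); first by perm_lia.
- move=> y yv; have := nvs y; rewrite inE yv orbT => /(_ isT).
  rewrite !mem_cat mem_rcons !inE !mem_cat !negb_or => /and4P[-> _ -> ->].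
  by rewrite !andbT; apply: contra zvs => /eqP <-.
- move=> y yv; rewrite cfree_ctx_cons mem_cat negb_or fr ?inE ?yv ?orbT // andbT.
  rewrite mem_free inE negb_and; have := nvs y; rewrite inE yv orbT => /(_ isT).
  by rewrite !mem_cat !inE !negb_or => /and3P[_ -> _].
Qed.

End Realization.

(** * Names in compound formulas *)

Section Naming.
Variables (I L : eqType) (v : L -> nat * nat).
Local Notation form := (cform I L).
Local Notation port := (nat * I)%type.
Local Notation item := (nat * form)%type.
Local Notation wiring := (seq (option (port * port))).
Implicit Types (A B C : form) (R D : seq form) (G : seq item) (b c : bool)
  (i j x y z w : I) (X : item) (S : seq I) (E F : wiring) (ab : seq (I * I)).
Variables (pol : pred form) (J : seq form -> Prop).
Hypothesis M : model v pol J.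
Variable n : bool -> port -> I.
Local Notation bot j i := (CAtom CBot [:: j] [:: i]).
Local Notation real := (real n).
Local Notation realize := (realize n).
Local Notation link := (@link I L n).
Local Notation names := (@names I L n).
Local Notation naming := (naming n).
Local Notation apt := (apt n).
Local Notation connector := (@connector I L n).

Definition raws G : seq I := flatten [seq cindices X.2 | X <- G].

Lemma naming_mono G G' ab ab' r : naming G ab ->
  perm_eq (names G ab) (names G' ab' ++ r) -> {subset raws G' <= raws G} ->
  naming G' ab'.
Proof.
case/andP=> u /hasPn d p sub; apply/andP; split.
  by move: u; rewrite (perm_uniq p) cat_uniq => /and3P[].
apply/hasPn => z zn; apply: contra (d z _); first exact: sub.
by rewrite (perm_mem p) mem_cat zn.
Qed.

Lemma naming_raw G ab z : naming G ab -> z \in names G ab -> z \notin raws G.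
Proof. by case/andP=> _ /hasPn d /d. Qed.

Lemma env_cons_sub k A B b x : x \in coccs b A ->
  uniq (coccs true A ++ coccs true B) -> uniq (coccs false A ++ coccs false B) ->
  env n (bound A B) (k, A) b x = env n [::] (k, CTens A B) b x.
Proof.
move=> xA u1 u2; rewrite /env /= andbT mem_bound !mem_free /= !mem_cat xA /=.
have : ~~ ((x \in coccs b A) && (x \in coccs b B)).
  apply/negP => /andP[h1 h2]; have : uniq (coccs b A ++ coccs b B) by case: (b).
  by rewrite cat_uniq => /and3P[_ /hasPn/(_ x h2)]; rewrite /= h1.
by case: b xA => /= xA; rewrite !xA; repeat case: (x \in coccs _ _) => //=.
Qed.

Lemma env_cons_subr k A B b x : x \in coccs b B ->
  uniq (coccs true A ++ coccs true B) -> uniq (coccs false A ++ coccs false B) ->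
  env n (bound A B) (k, B) b x = env n [::] (k, CTens A B) b x.
Proof.
move=> xB u1 u2; rewrite /env /= andbT mem_bound !mem_free /= !mem_cat xB /=.
have : ~~ ((x \in coccs b A) && (x \in coccs b B)).
  apply/negP => /andP[h1 h2]; have : uniq (coccs b A ++ coccs b B) by case: (b).
  by rewrite cat_uniq => /and3P[_ /hasPn/(_ x h2)]; rewrite /= h1.
by case: b xB => /= xB; rewrite !xB; repeat case: (x \in coccs _ _) => //=.
Qed.

(** Once the bound indices have their raw names back, the ports that still carry assigned names in
    the halves are exactly the free ports of the compound. *)
Lemma real_tens k A B : cform_wf v (CTens A B) ->
  CTens (real (bound A B) (k, A)) (real (bound A B) (k, B)) = real [::] (k, CTens A B).
Proof.
move=> /wf_sub[_ _ u1 u2]; congr CTens; apply: crename_ext => b x xA.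
  exact: env_cons_sub.
exact: env_cons_subr.
Qed.

Lemma real_par k A B : cform_wf v (CTens A B) ->
  CPar (real (bound A B) (k, A)) (real (bound A B) (k, B)) = real [::] (k, CPar A B).
Proof. by move/(real_tens k) => [e1 e2]; congr CPar. Qed.

Lemma csequent_par A B R : cform_wf v (CTens A B) -> csequent v [:: A, B & R] ->
  csequent v (CPar A B :: R).
Proof.
move=> wf /csequentP[/= /and3P[_ _ wR] H]; apply/csequentP; split.
  by rewrite /= wR andbT; exact: wf.
have [_ _ u1 u2] := wf_sub wf.
move=> w; have := H w; rewrite !cfree_ctx_cons !catA !count_cat.
have := permP (perm_free_bound true u1 u2) (pred1 w).
have := permP (perm_free_bound false u1 u2) (pred1 w).
have e b : cfree b (CPar A B) = cfree b (CTens A B) by [].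
by rewrite !e !count_cat; clear; lia.
Qed.

Lemma csequent_tens A B H1 H2 : cform_wf v (CTens A B) ->
  csequent v (A :: H1) -> csequent v (B :: H2) ->
  (forall w, w \in cfree_ctx true (A :: H1) -> w \in cfree_ctx true (B :: H2) ->
     w \in bound A B) ->
  csequent v (CTens A B :: H1 ++ H2).
Proof.
move=> wf cA cB d; have [_ _ u1 u2] := wf_sub wf.
have /csequentP[/= /andP[_ w1] _] := cA; have /csequentP[/= /andP[_ w2] _] := cB.
apply/csequentP; split; first by rewrite /= all_cat w1 w2 -!/(cform_wf v _) !andbT; exact: wf.
move=> w; have := csequent_cons w cA; have := csequent_cons w cB.
have := permP (perm_free_bound true u1 u2) (pred1 w).
have := permP (perm_free_bound false u1 u2) (pred1 w).
have := d w; rewrite !cfree_ctx_cons !cfree_ctx_cat !count_cat.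
rewrite -!has_pred1 !has_count !count_cat.
move: (count_mem w (cfree true A)) (count_mem w (cfree true B)) => a1 a2.
move: (count_mem w (cfree false A)) (count_mem w (cfree false B)) => a3 a4.
move: (count_mem w (cfree true (CTens A B))) (count_mem w (cfree false (CTens A B))) => a5 a6.
move: (count_mem w (bound A B)) (count_mem w (cfree_ctx true H1)) => a7 a8.
move: (count_mem w (cfree_ctx false H1)) (count_mem w (cfree_ctx false H2)) => a9 a10.
move: (count_mem w (cfree_ctx true H2)) => a11.
clear; case: (posnP (a1 + a8)) => [e1|e1]; case: (posnP (a2 + a11)) => [e2|e2];
  rewrite ?e1 ?e2 => /=; try lia; move=> /(_ isT isT); lia.
Qed.

Lemma occs_sub b G E : derivable G E -> linear v G -> {subset ends b E <= occs b G}.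
Proof.
move=> d lin p; rewrite (perm_mem (derivable_ends b d lin)).
case/flatten_mapP=> X XG /mapP[x xX ->]; apply/flatten_mapP; exists X => //.
by rewrite mem_tag_ports; move: xX; rewrite mem_free => /andP[].
Qed.

(** Opening both halves at [x] leaves one bot between [x] and its upper name and one between [x] and
    its lower name. Their common index [x] is eliminated, and the connector remains. *)
Lemma contract_extras k A B S Q : cform_wf v (CTens A B) ->
  apt (k, A) -> apt (k, B) -> {subset S <= bound A B} ->
  (forall x, x \in S -> n true (k, x) != n false (k, x)) ->
  J (Q ++ map (extra n (k, A)) S ++ map (extra n (k, B)) S) ->
  J (Q ++ map connector (tag_ports k S)).
Proof.
move=> wf apA apB; elim: S Q => [|x S IH] Q //= sub ne JQ.
have {}JQ : J ([:: extra n (k, A) x, extra n (k, B) x & Q] ++ map (extra n (k, A)) S ++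
    map (extra n (k, B)) S).
  by apply: (model_perm M) JQ; perm_lia.
have {JQ IH} := IH _ _ _ JQ => J1.
have {J1} := J1 (fun y yS => sub y (mem_behead (s := x :: S) yS))
   (fun y yS => ne y (mem_behead (s := x :: S) yS)) => J1.
have [b [xA xB]] := bound_sides wf (sub x (mem_head _ _)).
have exA : extra n (k, A) x = if b then bot (n true (k, x)) x else bot x (n false (k, x)).
  rewrite /extra /=; case: b xA {xB} => [->//|]; rewrite !mem_free /= => /andP[h1 h2].
  by rewrite h1 andbF.
have exB : extra n (k, B) x = if b then bot x (n false (k, x)) else bot (n true (k, x)) x.
  rewrite /extra /=; case: b xB {xA exA} => [|->//]; rewrite !mem_free /= => /andP[h1 h2].
  by rewrite h1 andbF.
have J2 : J [:: bot x (n false (k, x)), bot (n true (k, x)) x &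
    Q ++ map connector (tag_ports k S)].
  by apply: (model_perm M) J1; rewrite exA exB; case: (b); perm_lia.
have n1 := ne x (mem_head _ _).
have n2 : n false (k, x) != x by apply: (bot_neq M J2); rewrite mem_head.
have n3 : x != n true (k, x) by apply: (bot_neq M J2); rewrite !inE eqxx orbT.
have : J (csubst false (n false (k, x)) x (bot (n true (k, x)) x) ::
    Q ++ map connector (tag_ports k S)).
  apply: (bot_down M J2); first by rewrite (bot_free v _ n3) inE.
  by rewrite /cindices /= !inE negb_or n2 eq_sym n1.
by rewrite /= eqxx => J3; apply: (model_perm M) J3; rewrite /connector; perm_lia.
Qed.

End Naming.

(** * Reading back a wired derivation *)

Section Reading.
Variables (I L : eqType) (v : L -> nat * nat).
Local Notation form := (cform I L).
Local Notation port := (nat * I)%type.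
Local Notation item := (nat * form)%type.
Local Notation wiring := (seq (option (port * port))).
Implicit Types (A B C : form) (R D : seq form) (G : seq item) (b c : bool)
  (i j x y z w : I) (X : item) (S : seq I) (E F : wiring) (ab : seq (I * I)).
Variables (pol : pred form) (J : seq form -> Prop).
Hypothesis M : model v pol J.
Variable n : bool -> port -> I.
Local Notation bot j i := (CAtom CBot [:: j] [:: i]).
Local Notation real := (real n).
Local Notation realize := (realize n).
Local Notation link := (@link I L n).
Local Notation names := (@names I L n).
Local Notation naming := (naming n).
Local Notation apt := (apt n).
Local Notation connector := (@connector I L n).
Local Notation loops := (@loops I L).

Lemma realize_perm G G' E E' ab : perm_eq G G' -> perm_eq E E' ->
  perm_eq (realize G E ab) (realize G' E' ab).
Proof.
move=> pG pE; apply: perm_cat; first exact: perm_map.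
by rewrite perm_cat2r; apply/perm_map/perm_pmap.
Qed.

Lemma raws_cons X G z : (z \in raws (X :: G)) = (z \in cindices X.2) || (z \in raws G).
Proof. by rewrite /raws /= mem_cat. Qed.

Lemma real_atom k p (u l : seq I) : cform_wf v (CAtom p u l) ->
  real [::] (k, CAtom p u l) =
  CAtom p (map (n true) (tag_ports k u)) (map (n false) (tag_ports k l)).
Proof.
move=> wf; rewrite /real /= -!map_comp.
congr CAtom; apply/eq_in_map => x xu;
  by rewrite /env andbT (catom_free _ wf) xu.
Qed.

Lemma links_zip (s t : seq port) : map link (pmap id [seq Some e | e <- zip s t]) =
  [seq bot e.2 e.1 | e <- zip (map (n true) s) (map (n false) t)].
Proof. by elim: s t => [|p s IH] [|q t] //=; rewrite IH. Qed.

(** In the starting axiom the upper indices of each atom are the lower names of the other. Giving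
    the upper ports their own names by [atom_up] leaves precisely the links of [D_ax]. *)
Lemma realize_ax k k' q (u l u' l' : seq I)
  (X := (k, CAtom (CPos q) u l)) (X' := (k', CAtom (CNeg q) u' l')) :
  size u = size l' -> size u' = size l -> linear v [:: X; X'] ->
  pol X.2 -> pol X'.2 -> naming [:: X; X'] [::] ->
  J (realize [:: X; X'] (axiom_edges k u k' l' ++ axiom_edges k' u' k l) [::]).
Proof.
move=> s1 s2 /and3P[/and3P[/= w1 w2 _] _ _] p1 p2 /andP[un _].
rewrite /realize /= !real_atom // pmap_cat map_cat cats0.
rewrite /axiom_edges !links_zip /tag_ports !map_rev -!/(tag_ports _ _).
move: un; rewrite /names /occs /= !cats0 !map_cat.
set U := map _ (tag_ports k u); set Lo := map _ (tag_ports k l).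
set U' := map _ (tag_ports k' u'); set Lo' := map _ (tag_ports k' l') => un.
have sU : size U = size Lo' by rewrite !size_map.
have sU' : size U' = size Lo by rewrite !size_map.
have sl : size Lo = size l by rewrite !size_map.
have sl' : size Lo' = size l' by rewrite !size_map.
have [uU uU' uLo uLo'] : [/\ uniq U, uniq U', uniq Lo & uniq Lo'].
  by move: un; rewrite !cat_uniq => /and3P[/and3P[-> _ ->] _ /and3P[-> _ ->]].
have dis z : (z \in U) + (z \in U') + (z \in Lo) + (z \in Lo') <= 1.
  have := count_le1 z un; rewrite !count_cat !count_uniq_mem //; clear; lia.
pose A : form := CAtom (CNeg q) (rev Lo) Lo'.
have eA : cdual A = CAtom (CPos q) ([::] ++ rev Lo') Lo by rewrite /= revK.
have wA : cform_wf v A.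
  rewrite /cform_wf /= size_rev sl sl' -s2; have /and3P[/andP[-> _] _ _] := w2.
  rewrite rev_uniq uLo uLo' cat_uniq rev_uniq uLo uLo' /= !andbT.
  by apply/hasPn => z zl; rewrite /= mem_rev; have := dis z; rewrite zl; clear; lia.
have wdA : cform_wf v (cdual A) by rewrite wf_dual.
have J0 : J [:: cdual A; A].
  apply: (model_id M) => //; last first.
    rewrite /= andbT (pol_atom M _ _ _ u l) /= p1.
    by rewrite (pol_atom M _ _ _ u' l').
  apply/csequentP; split; first by rewrite /= -!/(cform_wf v _) wA [cform_wf v _]wdA.
  move=> w; rewrite !cfree_ctx_cons eA in wdA *.
  rewrite !(catom_free _ wdA) !(catom_free _ wA) /= !cats0 !count_cat !count_rev.
  rewrite !count_uniq_mem //; have := dis w; clear; lia.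
rewrite eA in J0.
have J1 : J (CAtom (CPos q) ([::] ++ U) Lo ::
    [seq bot e.2 e.1 | e <- zip U (rev Lo')] ++ [:: A]).
  apply: (atom_up M _ uU _ _ J0); first by rewrite size_rev.
    move=> z zU; rewrite /= mem_cat mem_rev; have := dis z; rewrite zU; clear; lia.
  move=> z zU; rewrite cfree_ctx_cons (catom_free _ wA) cats0 mem_rev.
  by have := dis z; rewrite zU; clear; lia.
have J2 : J (CAtom (CNeg q) ([::] ++ rev Lo) Lo' :: CAtom (CPos q) U Lo ::
    [seq bot e.2 e.1 | e <- zip U (rev Lo')]).
  by apply: (model_perm M) J1; perm_lia.
have J3 : J (CAtom (CNeg q) ([::] ++ U') Lo' :: [seq bot e.2 e.1 | e <- zip U' (rev Lo)] ++
    CAtom (CPos q) U Lo :: [seq bot e.2 e.1 | e <- zip U (rev Lo')]).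
  apply: (atom_up M _ uU' _ _ J2); first by rewrite size_rev.
    move=> z zU; rewrite /= mem_cat mem_rev; have := dis z; rewrite zU; clear; lia.
  move=> z zU; rewrite cfree_ctx_cons mem_cat negb_or mem_free negb_and /=.
  apply/andP; split; first by have := dis z; rewrite zU; clear; lia.
  apply/flatten_mapP => -[C /mapP[e ee ->]]; rewrite mem_free inE => /andP[/eqP ez _].
  have : z \in rev Lo'.
    rewrite ez; have : e.2 \in map snd (zip U (rev Lo')) by apply: map_f.
    by rewrite -/(unzip2 _) unzip2_zip // size_rev sU.
  by rewrite mem_rev; have := dis z; rewrite zU; clear; lia.
by apply: (model_perm M) J3; rewrite /=; perm_lia.
Qed.

Lemma size_split ab a1 a2 : a1 + a2 <= size ab -> exists ab1 ab2 ab3,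
  [/\ ab = ab1 ++ ab2 ++ ab3, size ab1 = a1 & size ab2 = a2].
Proof.
move=> h; exists (take a1 ab), (take a2 (drop a1 ab)), (drop a2 (drop a1 ab)).
rewrite !cat_take_drop !size_takel //; last by lia.
by rewrite size_drop; lia.
Qed.

(** The quantification over [ab] is inside the induction because the names for loops change: a bot
    may turn its own two names into a pair, and a tensor distributes the pairs over its premises. *)
Theorem derivable_realize G E : derivable G E -> linear v G ->
  all (fun X => pol X.2) G -> forall ab, naming G ab ->
  size ab = count_mem None E -> J (realize G E ab).
Proof.
elim=> {G E} [G G' E E' pG pE _ IH|k k' q u l u' l' e1 e2|k i j|
    k i j G E F c d IH|k A B G E d IH|k A B G1 G2 E1 E2 E d1 IH1 d2 IH2 c] lin pl ab nm sz.
- apply: (model_perm M (realize_perm ab pG pE)); apply: IH.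
  + by rewrite (linear_perm v pG).
  + by rewrite (perm_all _ pG).
  + have p (b : bool) : perm_eq (occs b G') (occs b G).
      by apply: perm_flatmap; rewrite perm_sym.
    apply: (naming_mono (r := [::]) nm).
      by rewrite cats0; apply: perm_cat; [|apply: perm_cat => //]; apply: perm_map.
    by move=> z; rewrite (perm_mem (perm_flatmap (fun X => cindices X.2) pG)).
  + by rewrite sz; apply/esym/permP.
- case/and3P: pl => p1 p2 _.
  have e : ab = [::].
    have z (s : seq (port * port)) : count_mem None [seq Some e | e <- s] = 0.
      by elim: s.
    by apply: size0nil; rewrite sz count_cat !z.
  by rewrite e in nm *; apply: realize_ax.
- have e : ab = [::] by apply: size0nil.
  subst ab; have [/= /andP[w _] _ _] := and3P lin; case/andP: pl => p _.
  rewrite /realize /= real_atom //= /link /=.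
  pose A : form := CAtom COne [:: n true (k, i)] [:: n false (k, j)].
  have nij : n true (k, i) != n false (k, j).
    by case/andP: nm => /=; rewrite inE => /andP[].
  have wA : cform_wf v A by rewrite /cform_wf /= inE nij.
  have wdA : cform_wf v (cdual A) by rewrite wf_dual.
  have J0 : J [:: cdual A; A].
    apply: (model_id M) => //; last first.
      by rewrite /= andbT (pol_bot M) (pol_atom M _ _ _ [:: i] [:: j]).
    apply/csequentP; split; first by rewrite /= -!/(cform_wf v _) wA [cform_wf v _]wdA.
    move=> x; rewrite !cfree_ctx_cons !(catom_free _ wA).
    rewrite (catom_free true wdA) (catom_free false wdA) /= !addn0.
    move: nij; case: (eqVneq (n true (k, i)) x) => [->|_]; last by case: (_ == x).
    by rewrite eq_sym => /negbTE ->.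
  by apply: (model_perm M) J0; rewrite /=; perm_lia.
- have lin' := linear_cons lin; case/andP: pl => p pl.
  have /and3P[/andP[w _] _ _] := lin; have rb := real_atom k w.
  set pn := n true (k, j); set qn := n false (k, i).
  have un : uniq (names ((k, bot j i) :: G) ab) by case/andP: nm.
  have eb : real [::] (k, bot j i) = bot pn qn := rb.
  have pnm : perm_eq (names ((k, bot j i) :: G) ab) (names G ab ++ [:: pn; qn]).
    by rewrite /names !occs_cons /= -/pn -/qn; perm_lia.
  have sub : {subset raws G <= raws ((k, bot j i) :: G)}.
    by move=> z zG; rewrite raws_cons zG orbT.
  have [npq fp fq] : [/\ pn != qn, pn \notin names G ab & qn \notin names G ab].
    move: un; rewrite (perm_uniq pnm) cat_uniq => /and3P[_ /hasPn nd /andP[+ _]].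
    by rewrite inE => ->; split=> //; apply: nd; rewrite !inE eqxx ?orbT.
  have nm' : naming G ab := naming_mono nm pnm sub.
  (* If the bot closes a loop, the formula and the edge between its ports form a cyclic pair
     carrying its two port names. Otherwise the bot is the middle of a chain of three. *)
  case: c => [R|u0 l0 R] pE pF.
    have J1 : J (realize G F ((pn, qn) :: ab)).
      apply: IH => //; last by rewrite /= sz (permP pE) (permP pF).
      apply: (naming_mono (r := [::]) nm) => //; rewrite cats0.
      by apply: (perm_trans pnm); rewrite /names /=; perm_lia.
    apply: (model_perm M) J1.
    have q1 := perm_map link (perm_pmap id pE).
    have q2 := perm_map link (perm_pmap id pF).
    by rewrite /realize /= eb; rewrite /= in q1 q2; rewrite /loops /=; perm_lia.
  have := IH lin' pl ab nm' _; rewrite sz (permP pE) (permP pF) => /(_ erefl) J1.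
  have q1 := perm_map link (perm_pmap id pE).
  have q2 := perm_map link (perm_pmap id pF).
  have fr z : z \notin names G ab -> z \notin cfree_ctx true (realize G F ab).
    by apply: contra; apply: (mem_realize nm'); apply: (occs_sub d lin').
  pose R0 := map (real [::]) G ++ map link (pmap id R) ++ loops ab.
  have q3 : perm_eq (realize G F ab) (link (u0, l0) :: R0).
    by rewrite /realize /R0; rewrite /= in q2; perm_lia.
  have J2 : J (link (u0, l0) :: R0) := model_perm M q3 J1.
  have fr' z : z \notin names G ab -> z \notin cfree_ctx true (link (u0, l0) :: R0).
    move/fr; apply: contra; rewrite /cfree_ctx.
    by rewrite (perm_mem (perm_flatmap (cfree true) q3)).
  have J3 := link_expand M npq J2 (fr' _ fp) (fr' _ fq); apply: (model_perm M) J3.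
  by rewrite /realize /= eb /R0; rewrite /= in q1; perm_lia.
- have := lin; case/and3P=> /andP[w _] _ _; have [_ _ u1 u2] := wf_sub w.
  case/andP: pl => p pl; have /andP[pA pB] := pol_par M p.
  have occE (b : bool) : occs b ((k, CPar A B) :: G) = occs b [:: (k, A), (k, B) & G].
    by rewrite !occs_cons /= tag_ports_cat catA; case: b.
  have nm1 : naming [:: (k, A), (k, B) & G] ab.
    apply: (naming_mono (r := [::]) nm).
      by rewrite cats0 /names !occE.
    move=> z; rewrite !raws_cons /cindices /= !mem_cat.
    by repeat case: (z \in coccs _ _) => //=.
  pose es := [seq Some (p, p) | p <- tag_ports k (bound A B)] : wiring.
  have lin1 := linear_par lin.
  have J1 : J (realize [:: (k, A), (k, B) & G] (es ++ E) ab).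
    apply: IH => //; first by rewrite /= pA pB.
    by rewrite sz count_cat /es; elim: (tag_ports k _).
  pose R := map (real [::]) G ++ map link (pmap id E) ++ loops ab.
  have pes : map link (pmap id es) = map link [seq (p, p) | p <- tag_ports k (bound A B)].
    by rewrite /es; elim: (tag_ports k _) => //= q s ->.
  have J2 : J [:: real [::] (k, A), real [::] (k, B) &
      map link [seq (p, p) | p <- tag_ports k (bound A B)] ++ R].
    apply: (model_perm M) J1; rewrite /realize pmap_cat map_cat pes /R /=; perm_lia.
  have apA := naming_apt nm1 (mem_head _ _).
  have apB : apt (k, B) by apply: (naming_apt nm1); rewrite !inE eqxx orbT.
  have frR x : x \in bound A B -> x \notin cfree_ctx true R.
    move=> xb; apply/negP => xR.
    have : x \in names [:: (k, A), (k, B) & G] ab.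
      apply: (mem_realize (E := es ++ E) nm1); first exact: occs_sub d lin1.
      rewrite /realize pmap_cat map_cat [map (real [::]) _]/= -[_ :: _]/([:: _, _ & _]).
      have -> : forall (s1 s2 s3 s4 : seq form) (X Y : form), cfree_ctx true ([:: X, Y & s1] ++ (s2 ++ s3) ++ s4) =
        cfree true X ++ cfree true Y ++ cfree_ctx true s1 ++ cfree_ctx true s2 ++
        cfree_ctx true s3 ++ cfree_ctx true s4.
        by move=> *; rewrite !cfree_ctx_cat !cfree_ctx_cons -!catA.
      move: xR; rewrite /R !cfree_ctx_cat.
      move: (cfree_ctx _ _) (cfree_ctx _ (map link (pmap id E))) (cfree_ctx _ (loops ab)).
      by move=> s1 s3 s4; rewrite !mem_cat => /or3P[] ->; rewrite ?orbT.
    move/(naming_raw nm1)/negP; apply; rewrite raws_cons.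
    by have := bound_free w xb; rewrite mem_cat => /orP[] /mem_cfree_cindices ->.
  have J3 := join_par M apA apB (bound_uniq u1) (fun x xb => bound_sides w xb) frR J2.
  have wpar : CPar (real (bound A B) (k, A)) (real (bound A B) (k, B)) =
    real [::] (k, CPar A B) := real_par n k w.
  have apAB : apt (k, CPar A B) := naming_apt nm (mem_head _ _).
  have J4 : J (CPar (real (bound A B) (k, A)) (real (bound A B) (k, B)) :: R).
    have [cs pR] := model_wf M J3; apply: (model_par M J3).
      apply: csequent_par cs; rewrite (real_tens n k w).
      by rewrite /real wf_crename //; apply: (@env_faithful _ _ n [::] (k, CTens A B)).
    by rewrite /= in pR *; case/and3P: pR => _ _ ->; rewrite wpar (real_pol M) p.
  by move: J4; rewrite wpar.
have := lin; case/and3P=> /andP[w _] _ _; have [_ _ u1 u2] := wf_sub w.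
move: pl; rewrite /= all_cat => /and3P[p pl1 pl2]; have /andP[pA pB] := pol_tens M p.
have [lin1 lin2] := linear_tens lin.
have cnt := conns_count c; rewrite -sz count_cat in cnt.
(* [ab1] and [ab2] name the loops of the premises, [ab3] those created by the joins of this
   tensor. *)
have [ab1 [ab2 [ab3 [eab sz1 sz2]]]] := size_split cnt.
have occE (b : bool) : perm_eq (occs b ((k, CTens A B) :: G1 ++ G2))
    (occs b ((k, A) :: G1) ++ occs b ((k, B) :: G2)).
  by rewrite !occs_cons occs_cat /= tag_ports_cat; case: b; perm_lia.
have namesE : perm_eq (names ((k, CTens A B) :: G1 ++ G2) ab)
    (names ((k, A) :: G1) ab1 ++ names ((k, B) :: G2) ab2 ++
     flatten [seq [:: q.1; q.2] | q <- ab3]).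
  rewrite /names eab !map_cat !flatten_cat.
  have := perm_map (n true) (occE true); have := perm_map (n false) (occE false).
  by rewrite !map_cat => q1 q2; perm_lia.
have nm1 : naming ((k, A) :: G1) ab1.
  apply: (naming_mono nm namesE) => z; rewrite !raws_cons /raws map_cat flatten_cat mem_cat.
  by move=> /orP[|->]; rewrite ?orbT // /cindices /= !mem_cat => /orP[] ->; rewrite ?orbT.
have nm2 : naming ((k, B) :: G2) ab2.
  have q : perm_eq (names ((k, CTens A B) :: G1 ++ G2) ab) (names ((k, B) :: G2) ab2 ++
      (names ((k, A) :: G1) ab1 ++ flatten [seq [:: q.1; q.2] | q <- ab3])) by perm_lia.
  apply: (naming_mono nm q) => z; rewrite !raws_cons /raws map_cat flatten_cat mem_cat.
  by move=> /orP[|->]; rewrite ?orbT // /cindices /= !mem_cat => /orP[] ->; rewrite ?orbT.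
have J1 : J (realize ((k, A) :: G1) E1 ab1) by apply: IH1 => //=; rewrite pA.
have J2 : J (realize ((k, B) :: G2) E2 ab2) by apply: IH2 => //=; rewrite pB.
set S := bound A B in c *.
have uS : uniq S := bound_uniq u1.
have apA : apt (k, A) := naming_apt nm1 (mem_head _ _).
have apB : apt (k, B) := naming_apt nm2 (mem_head _ _).
have rawS x : x \in S -> x \in cindices A /\ x \in cindices B.
  by case/(bound_sides w) => b [/mem_cfree_cindices ? /mem_cfree_cindices].
have inA x : x \in S -> x \in cfree true A ++ cfree false A.
  by case/(bound_sides w) => -[] [h _]; rewrite mem_cat h ?orbT.
have inB x : x \in S -> x \in cfree true B ++ cfree false B.
  by case/(bound_sides w) => -[] [_ h]; rewrite mem_cat h ?orbT.
pose half C H F bc := map (real [::]) H ++ map link (pmap id F) ++ loops bc.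
(* Common preparation of both premises for the tensor rule: every index to be bound regains its raw
   name. The link required at a lower port exists by [derivable_ends]. *)
have opened C H F bc : derivable ((k, C) :: H) F -> linear v ((k, C) :: H) ->
    naming ((k, C) :: H) bc -> J (realize ((k, C) :: H) F bc) ->
    {in S, forall x, x \in cfree true C ++ cfree false C} ->
    J (real S (k, C) :: map (extra n (k, C)) S ++ half C H F bc).
  move=> d linC nmC JC sub; have wC : cform_wf v C by case/and3P: linC => /andP[].
  have fr x : x \in S -> x \notin cfree_ctx true (realize ((k, C) :: H) F bc).
    move=> xS; apply/negP => /(mem_realize nmC (occs_sub d linC))/(naming_raw nmC).
    rewrite raws_cons; have := sub x xS; rewrite mem_cat.
    by case/orP=> /mem_cfree_cindices ->.
  apply: (open_item M (X := (k, C))) => //; first exact: naming_apt nmC (mem_head _ _).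
    move=> x /fr; apply: contra.
    by rewrite /realize [map _ _ ++ _]/= cfree_ctx_cons mem_cat => ->; rewrite orbT.
  move=> x xS xC; have : (k, x) \in ends false F.
    rewrite (perm_mem (derivable_ends false d linC)) frees_cons mem_cat.
    by rewrite mem_tag_ports xC.
  case/mem_ends => u uF; exists (n true u).
    rewrite /half mem_cat mem_cat; apply/orP; right; apply/orP; left.
    apply: (map_f link (x := (u, (k, x)))); rewrite mem_pmap.
    by apply/mapP; exists (Some (u, (k, x))).
  apply/eqP => e; have : n true u \in names ((k, C) :: H) bc.
    apply/mem_names/(occs_sub d linC).
    rewrite ends_pmap; apply: (map_f (fun e : port * port => e.1) (x := (u, (k, x)))).
    by rewrite mem_pmap; apply/mapP; exists (Some (u, (k, x))).
  move/(naming_raw nmC); rewrite raws_cons -e; have := sub x xS; rewrite mem_cat.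
  by case/orP=> /mem_cfree_cindices ->.
have O1 := opened A G1 E1 ab1 d1 lin1 nm1 J1 inA.
have O2 := opened B G2 E2 ab2 d2 lin2 nm2 J2 inB.
have wAB : CTens (real S (k, A)) (real S (k, B)) = real [::] (k, CTens A B) := real_tens n k w.
have apAB : apt (k, CTens A B) := naming_apt nm (mem_head _ _).
set K1 := map (extra n (k, A)) S ++ _ in O1; set K2 := map (extra n (k, B)) S ++ _ in O2.
have O : J (CTens (real S (k, A)) (real S (k, B)) :: K1 ++ K2).
  have [cs1 ps1] := model_wf M O1; have [cs2 ps2] := model_wf M O2.
  apply: (model_tens M O1 O2); last first.
    move: ps1 ps2 => /= /andP[_ ps1] /andP[_ ps2].
    by rewrite all_cat ps1 ps2 wAB (real_pol M) p.
  apply: csequent_tens cs1 cs2 _.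
    rewrite wAB /real wf_crename //; exact: (env_faithful [::] apAB).
  have ctx C H F bc z : derivable ((k, C) :: H) F -> linear v ((k, C) :: H) ->
      naming ((k, C) :: H) bc -> {in S, forall x, x \in cfree true C ++ cfree false C} ->
      z \in cfree_ctx true (real S (k, C) :: map (extra n (k, C)) S ++ half C H F bc) ->
      z \in S \/ z \in names ((k, C) :: H) bc.
    move=> d linC nmC sub; have apC := naming_apt nmC (mem_head _ _).
    have nmem (b : bool) x : x \in cfree b C -> n b (k, x) \in names ((k, C) :: H) bc.
      move=> xC; apply: mem_names; rewrite occs_cons mem_cat mem_tag_ports.
      by move: xC; rewrite mem_free => /andP[->].
    rewrite cfree_ctx_cons cfree_ctx_cat mem_cat => /orP[h|]; last first.
      rewrite mem_cat => /orP[|h]; last first.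
        right; apply: (mem_realize nmC (occs_sub d linC)).
        by rewrite /realize [map (real [::]) _]/= cfree_ctx_cons mem_cat h orbT.
      case/flatten_mapP => D /mapP[x xS ->].
      by case/(mem_extra v true apC (sub x xS)) => [->|[b xC ->]]; [left|right; apply: nmem].
    have [x xC ->] := mem_real apC h; rewrite /env xC /=.
    by case: (boolP (x \in S)) => [xS|_] /=; [left|right; apply: nmem].
  move=> z /(ctx _ _ _ _ _ d1 lin1 nm1 inA) zA /(ctx _ _ _ _ _ d2 lin2 nm2 inB) zB.
  (* The assigned names of the two premises are disjoint parts of one duplicate-free list, so only a
     raw bound index can occur in both. *)
  have zS : z \in S.
    case: zA => // zA; case: zB => // zB; exfalso.
    have : uniq (names ((k, CTens A B) :: G1 ++ G2) ab) by case/andP: nm.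
    rewrite (perm_uniq namesE) cat_uniq => /and3P[_ /hasPn/(_ z)].
    by rewrite mem_cat zB /= zA => /(_ isT).
  have raw (b : bool) x : x \in S -> env n S (k, A) b x = x /\ env n S (k, B) b x = x.
    by move=> xS; rewrite /env xS !andbF.
  rewrite mem_bound !coccs_crename.
  have mf (b : bool) C x : x \in S -> x \in coccs b C ->
      (C = A \/ C = B) -> x \in map (env n S (k, C) b) (coccs b C).
    move=> xS xC [] e; subst C; apply/mapP; exists x => //;
      by rewrite ?(raw b x xS).1 ?(raw b x xS).2.
  have : z \in bound A B := zS; rewrite mem_bound => /orP[] /andP[h1 h2].
    by rewrite (mf true A) ?(mf false B) //; [right|left].
  by rewrite (mf true B) ?(mf false A) ?orbT //; [left|right].
rewrite wAB in O.
pose R := real [::] (k, CTens A B) :: map (real [::]) G1 ++ map (real [::]) G2 ++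
  loops ab1 ++ loops ab2.
pose Q := R ++ map link (pmap id (E1 ++ E2)).
have O3 : J (Q ++ map (extra n (k, A)) S ++ map (extra n (k, B)) S).
  apply: (model_perm M) O; rewrite /Q /R /K1 /K2 /half pmap_cat map_cat; perm_lia.
have sep u l : u \in ends true (E1 ++ E2) -> l \in ends false (E1 ++ E2) ->
    n true u != n false l.
  move=> uE lE; apply/eqP => e.
  have un : uniq (names ((k, CTens A B) :: G1 ++ G2) ab) by case/andP: nm.
  have sub (b : bool) : {subset ends b (E1 ++ E2) <= occs b ((k, CTens A B) :: G1 ++ G2)}.
    move=> q; rewrite ends_cat mem_cat (perm_mem (occE b)) mem_cat.
    by case/orP=> [/(occs_sub d1 lin1)|/(occs_sub d2 lin2)] ->; rewrite ?orbT.
  by have [] := names_inj un (sub true _ uE) (sub false _ lE) e.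
have O4 : J (Q ++ map connector (tag_ports k S)).
  apply: (contract_extras M w apA apB _ _ O3) => // x xS.
  have [b [xA xB]] := bound_sides w xS.
  have nA : n b (k, x) \in names ((k, A) :: G1) ab1.
    apply: mem_names; rewrite occs_cons mem_cat mem_tag_ports.
    by move: xA; rewrite mem_free => /andP[->].
  have nB : n (~~ b) (k, x) \in names ((k, B) :: G2) ab2.
    apply: mem_names; rewrite occs_cons mem_cat mem_tag_ports.
    by move: xB; rewrite mem_free => /andP[->].
  have : uniq (names ((k, CTens A B) :: G1 ++ G2) ab) by case/andP: nm.
  rewrite (perm_uniq namesE) cat_uniq => /and3P[_ /hasPn d _].
  apply/eqP => e; have := d (n (~~ b) (k, x)); rewrite mem_cat nB => /(_ isT)/negP; apply.
  by move: nA; rewrite /= -/(mem _); case: (b) e => /= e; rewrite ?e // -e.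
have O5 : J (R ++ map link (pmap id E) ++ loops ab3).
  apply: (conns_realize M c _ sep) => //.
  - by rewrite count_cat -sz1 -sz2 -sz eab !size_cat; clear; lia.
  - have : uniq (names ((k, CTens A B) :: G1 ++ G2) ab) by case/andP: nm.
    by rewrite (perm_uniq namesE) !cat_uniq => /and5P[_ _ _ _].
  - move=> z zab; apply/negP; rewrite /R.
    pose G := (k, CTens A B) :: G1 ++ G2.
    have q : perm_eq (names G ab) (names G (ab1 ++ ab2) ++ flatten [seq [:: q.1; q.2] | q <- ab3]).
      by rewrite /names eab !map_cat !flatten_cat; perm_lia.
    have nm3 : naming G (ab1 ++ ab2) := naming_mono nm q (fun _ => id).
    have q1 : perm_eq ((real [::] (k, CTens A B) :: map (real [::]) G1 ++ map (real [::]) G2 ++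
        loops ab1 ++ loops ab2) ++ map link (pmap id (E1 ++ E2)) ++ map connector (tag_ports k S))
        (realize G (E1 ++ E2) (ab1 ++ ab2) ++ map connector (tag_ports k S)).
      have eL : loops (ab1 ++ ab2) = loops ab1 ++ loops ab2.
        by rewrite /loops map_cat flatten_cat.
      have eG : map (real [::]) G = real [::] (k, CTens A B) :: map (real [::]) G1 ++ map (real [::]) G2.
        by rewrite /G /= map_cat.
      by rewrite /realize eL eG; perm_lia.
    have sub q' : q' \in ends false (E1 ++ E2) -> q' \in occs false G.
      rewrite ends_cat mem_cat (perm_mem (occE false)) mem_cat.
      by case/orP=> [/(occs_sub d1 lin1)|/(occs_sub d2 lin2)] ->; rewrite ?orbT.
    have un : uniq (names G ab) by case/andP: nm.
    have nz : z \notin names G (ab1 ++ ab2).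
      apply/negP => zn; move: un; rewrite (perm_uniq q) cat_uniq => /and3P[_ /hasPn/(_ z zab)].
      by rewrite /= zn.
    rewrite /cfree_ctx (perm_mem (perm_flatmap (cfree true) q1)) -/(cfree_ctx _ _) cfree_ctx_cat.
    rewrite mem_cat => /orP[/(mem_realize nm3 sub)|]; first exact/negP.
    case/flatten_mapP => D /mapP[p0 /mapP[x xS ->] ->]; rewrite mem_free inE => /andP[/eqP ez _].
    move: nz; rewrite ez mem_names // (perm_mem (occE true)) mem_cat !occs_cons !mem_cat.
    rewrite !mem_tag_ports; have : x \in bound A B := xS.
    by rewrite mem_bound => /orP[] /andP[-> _]; rewrite ?orbT.
  - by move: O4; rewrite /Q -catA.
apply: (model_perm M) O5; rewrite /realize /R.
have eL : loops ab = loops ab1 ++ loops ab2 ++ loops ab3.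
  by rewrite eab /loops !map_cat !flatten_cat.
have eG : map (real [::]) ((k, CTens A B) :: G1 ++ G2) =
  real [::] (k, CTens A B) :: map (real [::]) G1 ++ map (real [::]) G2 by rewrite /= map_cat.
rewrite eL eG; perm_lia.
Qed.

End Reading.

(** * Restoring the original indices *)

Section Closing.
Variables (I L : eqType) (v : L -> nat * nat).
Local Notation form := (cform I L).
Local Notation port := (nat * I)%type.
Local Notation item := (nat * form)%type.
Local Notation wiring := (seq (option (port * port))).
Implicit Types (A B C : form) (R : seq item) (b c : bool)
  (i j x y z w : I) (X Y Z : item) (S : seq I) (es : seq (port * port)).
Variables (pol : pred form) (J : seq form -> Prop).
Hypothesis M : model v pol J.
Local Notation bot j i := (CAtom CBot [:: j] [:: i]).

Section Names.
Variable n : bool -> port -> I.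
Variable T : seq item.
Hypothesis nm : naming n T [::].
Hypothesis unT : forall b, uniq (flatten [seq cfree b X.2 | X <- T]).

Lemma real_eq S S' X : S =i S' -> real n S X = real n S' X.
Proof. by move=> e; apply: crename_ext => b x _; rewrite /env e. Qed.

Lemma real_notin S X x : (forall b, x \notin cfree b X.2) ->
  real n (x :: S) X = real n S X.
Proof.
move=> xX; apply: crename_ext => b y _; rewrite /env inE.
by case: (eqVneq y x) => // ->; rewrite (negbTE (xX b)).
Qed.

Lemma free_one b X Y R x : perm_eq T [:: X, Y & R] -> x \in cfree b X.2 ->
  x \notin flatten [seq cfree b Z.2 | Z <- Y :: R].
Proof.
move=> p xX; have := unT b; rewrite (perm_uniq (perm_flatmap (fun Z => cfree b Z.2) p)).
by rewrite /= cat_uniq => /and3P[_ /hasPn d _]; apply/negP => /d /=; rewrite xX.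
Qed.

(** The index [x] of a link is new to the realized sequent, since names avoid all indices and [S]
    holds those restored earlier; so [direct_link] can put it back at both ends. By [unT] these are
    the only free ports with that index. *)
Lemma close_links es S :
  uniq (map (fun e : port * port => e.1.2) es ++ S) ->
  (forall e, e \in es -> [/\ e.1.2 = e.2.2, e.1 \in frees true T & e.2 \in frees false T]) ->
  J (map (real n S) T ++ map (@link I L n) es) ->
  J (map (real n (map (fun e => e.1.2) es ++ S)) T).
Proof.
elim: es S => [|e es IH] S /=; first by rewrite cats0.
case/andP=> xS us H JS; have [ee e1 e2] := H e (mem_head _ _).
have He e' : e' \in es -> [/\ e'.1.2 = e'.2.2, e'.1 \in frees true T & e'.2 \in frees false T].
  by move=> h; apply: H; rewrite inE h orbT.
case: e ee e1 e2 xS H JS => -[k x] [k' x'] /= ex; subst x' => e1 e2 xS H JS.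
have xS' : x \notin S by move: xS; rewrite mem_cat negb_or => /andP[].
case/flatten_mapP: (e1) => X XT /mapP[x0 xX [ek ex]]; subst x0 k.
case/flatten_mapP: (e2) => Y YT /mapP[x0 xY [ek' ex']]; subst x0 k'.
have [R pT] : exists R, perm_eq T [:: X, Y & R].
  have [R1 p1] := perm_cons_mem XT; move: YT; rewrite (perm_mem p1) inE.
  case/orP=> [/eqP eY|/perm_cons_mem[R p]]; last by exists R; perm_lia.
  by subst; move: xX xY; rewrite !mem_free => /andP[_ h1] /andP[h2 _]; rewrite h2 in h1.
have pT' : perm_eq T [:: Y, X & R] by perm_lia.
have nxR b Z : Z \in R -> x \notin cfree b Z.2.
  move=> ZR; apply/negP => xZ; case: b xZ => xZ.
    have := free_one pT xX; rewrite /= mem_cat negb_or => /andP[_ /negP]; apply.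
    by apply/flatten_mapP; exists Z.
  have := free_one pT' xY; rewrite /= mem_cat negb_or => /andP[_ /negP]; apply.
  by apply/flatten_mapP; exists Z.
have ap Z : Z \in T -> apt n Z by apply: naming_apt nm.
have xraw : x \in raws T.
  by apply/flatten_mapP; exists X => //; apply: mem_cfree_cindices xX.
have frn b p : p \in frees b T -> n b p != x.
  move=> pT1; apply/eqP => ep; have : n b p \in names n T [::].
    apply: mem_names; case/flatten_mapP: pT1 => Z ZT /mapP[y].
    rewrite mem_free => /andP[yZ _] ->; apply/flatten_mapP; exists Z => //.
    by rewrite mem_tag_ports.
  by move/(naming_raw nm); rewrite ep xraw.
have XT' : X \in T by rewrite (perm_mem pT) mem_head.
have YT' : Y \in T by rewrite (perm_mem pT') mem_head.
pose p := n true (X.1, x); pose q := n false (Y.1, x).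
have J1 : J [:: real n S X, real n S Y, bot q p & map (real n S) R ++ map (@link I L n) es].
  have q1 := perm_map (real n S) pT; rewrite /= in q1.
  by apply: (model_perm M) JS; rewrite /= /link /=; perm_lia.
have JJ : J [:: real n (x :: S) X, real n (x :: S) Y & map (real n S) R ++ map (@link I L n) es].
  have := direct_link M J1 (mem_real_old (ap X XT') xX xS') (mem_real_old (ap Y YT') xY xS')
    (raw_fresh (ap X XT') xX xS') (raw_fresh (ap Y YT') xY xS').
  rewrite (real_csubst (ap X XT')) // (real_csubst (ap Y YT')) //; apply.
  rewrite cfree_ctx_cons cfree_ctx_cat !mem_cat !negb_or; apply/and3P; split.
  - by rewrite mem_free inE negb_and eq_sym frn.
  - apply/negP => /flatten_mapP[C /mapP[Z ZR ->]].
    have ZT : Z \in T by rewrite (perm_mem pT) !inE ZR !orbT.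
    case/(mem_real (ap Z ZT)) => y yZ; rewrite /env yZ /=; case: ifP => yS e.
      have : n true (Z.1, y) != x.
        by apply: frn; apply/flatten_mapP; exists Z => //; rewrite mem_tag_ports.
      by rewrite -e eqxx.
    by move: yS; rewrite -e (negbTE xS').
  apply/negP => /mem_link[e' /He[_ _ h]] e; have := frn false _ h.
  by rewrite -e eqxx.
have -> : map (real n (x :: map (fun e : port * port => e.1.2) es ++ S)) T =
    map (real n (map (fun e : port * port => e.1.2) es ++ x :: S)) T.
  by apply: eq_map => Z; apply: real_eq => y; rewrite !(inE, mem_cat); case: (y == x); rewrite ?orbT.
apply: (IH (x :: S)) => //.
  rewrite (perm_uniq (_ : perm_eq _ (x :: map (fun e : port * port => e.1.2) es ++ S))) /=.
    by rewrite xS us.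
  by perm_lia.
apply: (model_perm M) JJ.
have e0 : map (real n S) R = map (real n (x :: S)) R.
  by apply/eq_in_map => Z ZR; rewrite real_notin // => b; apply: nxR.
have q1 := perm_map (real n (x :: S)) pT; rewrite /= in q1.
by rewrite e0; perm_lia.
Qed.

End Names.

Lemma join_names (U V : seq (port * I)) :
  (forall u, u \in U -> u.1.2 = u.2 /\ count_mem u.2 (map snd V) = 1) ->
  map (fun e : port * port => e.1.2) (pmap id (join U V)) = map snd U.
Proof.
elim: U => //= u U IH H; rewrite /join /= pmap_cat map_cat -/(join U V) IH; last first.
  by move=> u' u'U; apply: H; rewrite inE u'U orbT.
have [eu c] := H u (mem_head _ _).
rewrite -cat1s; congr (_ ++ _).
have {c} : size [seq l <- V | l.2 == u.2] = 1 by rewrite size_filter -c count_map.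
by case: filter => [|l [|]] //= _; rewrite eu.
Qed.

(** In the wiring of a sequent the links correspond one to one to its free indices. After reading
    back under fresh names, closing all of them returns the sequent itself. *)
Theorem derivable_model (G : seq form) : infinite_eqType I ->
  derivable (tag_context G) (wiring_of G) -> csequent v G -> all pol G -> J G.
Proof.
move=> inf d cs pG; set T := tag_context G in d.
have eT : map snd T = G by apply: unzip2_zip; rewrite size_iota.
have [wf cnt] := (csequentP v G).1 cs.
have lin : linear v T := linear_tag wf.
have eC b : flatten [seq cfree b X.2 | X <- T] = cfree_ctx b G.
  by rewrite -[in RHS]eT /cfree_ctx -map_comp.
have uG b : uniq (cfree_ctx b G).
  by have [] := cs; rewrite ccontextE => /and3P[_ u1 u2] _; case: b.
have et b : map snd (tag_links b G) = cfree_ctx b G.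
  rewrite -eC /tag_links map_flatten -!map_comp; congr flatten; apply: eq_map => X /=.
  by rewrite -map_comp map_id.
have mt b u : u \in tag_links b G -> u.1.2 = u.2 /\ u.1 \in frees b T.
  case/flatten_mapP=> X XT /mapP[x xX ->]; split=> //.
  by apply/flatten_mapP; exists X => //; rewrite mem_tag_ports.
pose bp : seq (bool * port) := map (pair true) (occs true T) ++ map (pair false) (occs false T).
have ub : uniq bp.
  have /and3P[_ u1 u2] := lin.
  rewrite cat_uniq !map_inj_uniq ?u1 ?u2 ?andbT; try by move=> ? ? [].
  by apply/hasPn => _ /mapP[p _ ->]; apply/mapP => -[].
have [f [fi fa]] := fresh_fun (raws T) inf ub.
pose n b p := f (b, p).
have en : names n T [::] = map f bp by rewrite /names /= cats0 map_cat -!map_comp.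
have nm : naming n T [::].
  apply/andP; rewrite en; split; first by rewrite map_inj_in_uniq.
  by apply/hasPn => _ /mapP[p pb ->]; apply: fa.
(* A wiring obtained by [join] has no loops, so the empty list of loop names will do. *)
have n0 : count_mem None (wiring_of G) = 0.
  apply/eqP; rewrite -leqn0 leqNgt -has_count has_pred1; apply/negP.
  by case/flatten_mapP=> u _ /mapP[l _].
have pT : all (fun X => pol X.2) T by rewrite -(all_map snd) eT.
have := derivable_realize M d lin pT nm (esym n0); rewrite /realize /loops /= cats0 => J1.
set es := pmap id (wiring_of G) in J1.
have ees : map (fun e : port * port => e.1.2) es = cfree_ctx true G.
  rewrite -et join_names // => u uU; split; first by case: (mt _ _ uU).
  rewrite et count_uniq_mem //; have [_ <-] := cs.
  by rewrite -et map_f.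
have J2 : J (map (real n (map (fun e : port * port => e.1.2) es ++ [::])) T).
  apply: (close_links nm) => //; first by move=> b; rewrite eC; apply: uG.
    by rewrite cats0 ees; apply: uG.
  move=> e; rewrite mem_pmap => /mapP[_ /flatten_mapP[u uU /mapP[l lV ->]] [->]] /=.
  move: lV; rewrite mem_filter => /andP[/eqP el lV].
  by have [-> ->] := mt _ _ uU; have [-> ->] := mt _ _ lV.
suff <- : map (real n (map (fun e : port * port => e.1.2) es ++ [::])) T = G by [].
rewrite -[RHS]eT; apply/eq_in_map => X XT; rewrite -[RHS]crename_id.
apply: crename_ext => b x _; rewrite /env cats0 ees.
case: ifP => // /andP[xX /negP[]]; rewrite -(csequent_mem b _ cs).
by apply: mem_ctx xX; rewrite -eT map_f.
Qed.

End Closing.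

(** * ITTL as a fragment of TTL *)

Section Intuitionistic.
Variables (I L : eqType) (v : L -> nat * nat).
Local Notation cf := (cform I L).
Local Notation jf := (iform I L).
Implicit Types (A B C : jf) (X Y Z : cf) (G D : seq jf) (H K : seq cf) (b c : bool)
  (i j x y : I).

(** The classical reading of linear implication. Dualizing hypotheses turns [1] on the left into
    bot, the formula that the rules of TTL manipulate. *)
Fixpoint pos A : cf :=
  match A with
  | IAtom (ILit q) u l => CAtom (CPos q) u l
  | IAtom IOne u l => CAtom COne u l
  | ITens A B => CTens (pos A) (pos B)
  | ILolli A B => CPar (cdual (pos A)) (pos B)
  end.

Definition neg A : cf := cdual (pos A).
Arguments neg : simpl never.

Definition translation G A : seq cf := pos A :: map neg G.

Lemma neg_lolli A B : neg (ILolli A B) = CTens (neg B) (pos A).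
Proof. by rewrite /neg /= cdualK. Qed.

Lemma perm_coccs_pos b A : perm_eq (coccs b (pos A)) (ioccs b A).
Proof.
elim: A b => [[q|] u l|A IHA B IHB|A IHA B IHB] b //=; apply: perm_cat => //.
by apply: (perm_trans (perm_coccs_dual _ _)).
Qed.

Lemma perm_coccs_neg b A : perm_eq (coccs b (neg A)) (ioccs (~~ b) A).
Proof. exact: (perm_trans (perm_coccs_dual _ _) (perm_coccs_pos _ _)). Qed.

Lemma cindices_pos A : cindices (pos A) =i iindices A.
Proof.
by move=> x; rewrite !mem_cat; congr orb; apply: perm_mem; apply: perm_coccs_pos.
Qed.

Lemma cindices_neg A : cindices (neg A) =i iindices A.
Proof.
move=> x; rewrite !mem_cat orbC; congr orb; apply: perm_mem;
  exact: perm_coccs_neg.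
Qed.

Lemma mem_free_pos b A : cfree b (pos A) =i ifree b A.
Proof. by move=> x; rewrite !mem_filter !(perm_mem (perm_coccs_pos _ _)). Qed.

Lemma mem_free_neg b A : cfree b (neg A) =i ifree (~~ b) A.
Proof. by move=> x; rewrite !mem_filter !(perm_mem (perm_coccs_neg _ _)). Qed.

Lemma catoms_wf_dual X : catoms_wf v (cdual X) = catoms_wf v X.
Proof.
elim: X => [p u l|X IHX Y IHY|X IHX Y IHY] /=; last 2 first.
- by rewrite IHX IHY andbC.
- by rewrite IHX IHY andbC.
rewrite !size_rev -rev_cat rev_uniq; congr andb.
by case: p => [q|q||] /=; try case: (v q) => a b; rewrite !xpair_eqE andbC.
Qed.

Lemma catoms_wf_pos A : catoms_wf v (pos A) = iatoms_wf v A.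
Proof.
by elim: A => [[q|] u l|A IHA B IHB|A IHA B IHB] //=; rewrite ?catoms_wf_dual ?IHA ?IHB.
Qed.

Lemma wf_pos A : cform_wf v (pos A) = iform_wf v A.
Proof.
by rewrite /cform_wf /iform_wf catoms_wf_pos !(perm_uniq (perm_coccs_pos _ _)).
Qed.

Lemma wf_neg A : cform_wf v (neg A) = iform_wf v A.
Proof. by rewrite wf_dual wf_pos. Qed.

Lemma csubst_dual b i j X : csubst b i j (cdual X) = cdual (csubst (~~ b) i j X).
Proof.
elim: X => [p u l|X IHX Y IHY|X IHX Y IHY] /=; rewrite ?IHX ?IHY //.
by case: b => /=; rewrite map_rev.
Qed.

Lemma csubst_pos b i j A : csubst b i j (pos A) = pos (isubst b i j A).
Proof.
elim: A b => [[q|] u l|A IHA B IHB|A IHA B IHB] b /=; try by case: b.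
  by rewrite IHA IHB.
by rewrite csubst_dual IHA IHB.
Qed.

Lemma csubst_neg b i j A : csubst b i j (neg A) = neg (isubst (~~ b) i j A).
Proof. by rewrite /neg csubst_dual csubst_pos. Qed.

Lemma disjoint_seqE (T : eqType) (s t s' t' : seq T) : s =i s' -> t =i t' ->
  disjoint_seq s t = disjoint_seq s' t'.
Proof.
move=> es et; rewrite /disjoint_seq; congr negb; rewrite (eq_has_r et).
by apply: eq_has => x /=; apply: es.
Qed.

Lemma disjoint_flatten (U T : eqType) (f : U -> seq T) (s : seq U) (t : seq T) :
  disjoint_seq (flatten (map f s)) t = all (fun a => disjoint_seq t (f a)) s.
Proof.
rewrite /disjoint_seq has_sym; elim: s => //= a s IH.
by rewrite has_cat negb_or IH.
Qed.

Lemma isequentE G A : isequent v G A <-> csequent v (translation G A).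
Proof.
have eT b : cfree_ctx b (translation G A) =i ifree b A ++ ifree_ctx (~~ b) G.
  move=> x; rewrite cfree_ctx_cons !mem_cat mem_free_pos; congr orb.
  apply/flatten_mapP/flatten_mapP => [[_ /mapP[B BG ->]]|[B BG xB]].
    by rewrite mem_free_neg; exists B.
  by exists (neg B); rewrite ?map_f ?mem_free_neg.
have eC : ccontext v (translation G A) = [&& icontext v G, iform_wf v A,
    disjoint_seq (ifree_ctx true G) (ifree false A) &
    disjoint_seq (ifree_ctx false G) (ifree true A)].
  rewrite /ccontext /= wf_pos all_map (eq_all (a2 := iform_wf v)); last by move=> B /=; rewrite wf_neg.
  rewrite all_map pairwise_map /icontext !disjoint_flatten.
  have -> : all (preim neg (fun Y => disjoint_seq (cfree true (pos A)) (cfree true Y) &&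
      disjoint_seq (cfree false (pos A)) (cfree false Y))) G =
    all (fun B => disjoint_seq (ifree true A) (ifree false B)) G &&
    all (fun B => disjoint_seq (ifree false A) (ifree true B)) G.
    rewrite -all_predI; apply: eq_all => B /=.
    by congr andb; (apply: disjoint_seqE; [apply: mem_free_pos|apply: mem_free_neg]).
  have ep (r r' : rel jf) : r =2 r' -> pairwise r G = pairwise r' G.
    by move=> e; apply: (eq_pairwise e G).
  rewrite (ep _ (fun A B => disjoint_seq (ifree true A) (ifree true B) &&
                       disjoint_seq (ifree false A) (ifree false B))); last first.
    by move=> B C /=; rewrite andbC; congr andb; apply: disjoint_seqE => x; rewrite mem_free_neg.
  case: (iform_wf v A); case: (all (iform_wf v) G); rewrite ?andbF //=.
  case: (all (fun B => disjoint_seq (ifree true A) (ifree false B)) G) => /=;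
  case: (all (fun B => disjoint_seq (ifree false A) (ifree true B)) G) => //=;
  by case: (pairwise _ _).
rewrite /csequent eC; split.
  case=> -> -> -> -> e; split=> // x; rewrite !eT.
  by have := e x; rewrite !mem_cat => e'; rewrite /= orbC -e' orbC.
case=> /and4P[h1 h2 h3 h4] e; split=> // x.
by have := e x; rewrite !eT !mem_cat /= => e'; rewrite orbC -e' orbC.
Qed.

Lemma ITTL_isequent G A : ITTL v G A -> isequent v G A.
Proof.
elim=> // G' D A' p _ /isequentE cs; apply/isequentE; apply: csequent_perm cs.
by rewrite perm_cons perm_map.
Qed.

(** Rule by rule; the left and right versions of a rule for [1] become one bot rule, applied to a
    dualized hypothesis or to the conclusion. *)
Lemma ITTL_TTL G A : ITTL v G A -> TTL v (translation G A).
Proof.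
elim=> {G A}; rewrite /translation.
- by move=> G D A p _; apply: TTL_perm; rewrite perm_cons perm_map.
- move=> A aA /isequentE cs; have p : perm_eq [:: cdual (pos A); pos A] (translation [:: A] A).
    by rewrite /translation /=; perm_lia.
  apply: (TTL_perm p); apply: TTL_id; first by case: A aA {cs p} => [[q|] u l|A1 A2|A1 A2] //.
  by apply: csequent_perm cs; rewrite perm_sym.
- move=> G D A B _ dA _ dB /isequentE cs.
  have p : perm_eq (map neg G ++ pos B :: map neg D) (translation (G ++ D) B).
    by rewrite /translation map_cat; perm_lia.
  apply: (TTL_perm p); apply: TTL_cut dA _ _.
    by apply: TTL_perm dB; rewrite /=; perm_lia.
  by apply: csequent_perm cs; rewrite perm_sym.
- move=> G D A B C _ dA _ dB /isequentE cs.
  have p : perm_eq (CTens (neg B) (pos A) :: (pos C :: map neg D) ++ map neg G)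
      (translation (ILolli A B :: G ++ D) C).
    by rewrite /translation /= map_cat neg_lolli; perm_lia.
  apply: (TTL_perm p); apply: TTL_tens _ dA _.
    by apply: TTL_perm dB; rewrite /=; perm_lia.
  by apply: csequent_perm cs; rewrite perm_sym.
- move=> G A B _ d /isequentE cs; apply: TTL_par => //.
  by apply: TTL_perm d; rewrite /=; perm_lia.
- move=> G A B C _ d /isequentE cs.
  have p : perm_eq (CPar (neg B) (neg A) :: pos C :: map neg G) (translation (ITens A B :: G) C).
    by rewrite /translation /=; perm_lia.
  apply: (TTL_perm p); apply: TTL_par.
    by apply: TTL_perm d; rewrite /=; perm_lia.
  by apply: csequent_perm cs; rewrite perm_sym.
- move=> G D A B _ dA _ dB /isequentE cs; rewrite map_cat.
  by apply: TTL_tens => //; rewrite -map_cat.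
- move=> G A B i j _ d jA iA /isequentE cs.
  have p : perm_eq [:: CAtom CBot [:: j] [:: i], csubst true i j (neg A) & pos B :: map neg G]
      (translation [:: isubst false i j A, IAtom IOne [:: i] [:: j] & G] B).
    by rewrite /translation csubst_neg /=; perm_lia.
  apply: (TTL_perm p); apply: TTL_bot_up.
  + by apply: TTL_perm d; rewrite /=; perm_lia.
  + by rewrite mem_free_neg.
  + by rewrite cindices_neg.
  + by apply: csequent_perm cs; rewrite perm_sym.
- move=> G A i j _ d jA iA /isequentE cs.
  have p : perm_eq [:: CAtom CBot [:: j] [:: i], csubst true i j (pos A) & map neg G]
      (translation (IAtom IOne [:: i] [:: j] :: G) (isubst true i j A)).
    by rewrite /translation csubst_pos /=; perm_lia.
  apply: (TTL_perm p); apply: TTL_bot_up => //.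
  + by rewrite mem_free_pos.
  + by rewrite cindices_pos.
  + by apply: csequent_perm cs; rewrite perm_sym.
- move=> G A B i j _ d jA iA /isequentE cs.
  have p : perm_eq (csubst false i j (neg A) :: pos B :: map neg G)
      (translation (isubst true i j A :: G) B).
    by rewrite /translation csubst_neg /=; perm_lia.
  apply: (TTL_perm p); apply: TTL_bot_down.
  + by apply: TTL_perm d; rewrite /=; perm_lia.
  + by rewrite mem_free_neg.
  + by rewrite cindices_neg.
  + by apply: csequent_perm cs; rewrite perm_sym.
- move=> G A i j _ d jA iA /isequentE cs.
  rewrite -csubst_pos; apply: TTL_bot_down.
  + by apply: TTL_perm d; rewrite /=; perm_lia.
  + by rewrite mem_free_pos.
  + by rewrite cindices_pos.
  + by rewrite csubst_pos.
Qed.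

(* polar true holds of the translations of conclusions, polar false of those of
   hypotheses. *)
Fixpoint polar (o : bool) X : bool :=
  match X with
  | CAtom (CPos _) _ _ | CAtom COne _ _ => o
  | CAtom (CNeg _) _ _ | CAtom CBot _ _ => ~~ o
  | CTens X Y => polar o X && polar true Y
  | CPar X Y => polar false X && polar o Y
  end.

(** Excludes the compounds without intuitionistic counterpart, such as a tensor of two hypotheses or
    a par of two conclusions. *)
Definition polarized X := polar true X || polar false X.

Lemma polar_excl o X : polar o X -> polar (~~ o) X = false.
Proof.
elim: X o => [[q|q||] u l|X IHX Y IHY|X IHX Y IHY] o /=; try by case: o.
  by move=> /andP[/IHX -> _].
by move=> /andP[_ /IHY ->]; rewrite andbF.
Qed.

Lemma polar_dual o X : polar o (cdual X) = polar (~~ o) X.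
Proof.
elim: X o => [[q|q||] u l|X IHX Y IHY|X IHX Y IHY] o /=; rewrite ?negbK //;
  by rewrite IHX IHY andbC.
Qed.

Lemma polar_pos A : polar true (pos A).
Proof.
by elim: A => [[q|] u l|A IHA B IHB|A IHA B IHB] //=; rewrite ?polar_dual ?IHA ?IHB.
Qed.

Lemma polar_neg A : polar false (neg A).
Proof. by rewrite polar_dual polar_pos. Qed.

Lemma pos_inj : injective pos.
Proof.
elim=> [[q|] u l|A IHA B IHB|A IHA B IHB] [[q'|] u' l'|A' B'|A' B'] //=.
- by case=> -> -> ->.
- by case=> -> ->.
- by case=> /IHA -> /IHB ->.
- by case=> /(can_inj (@cdualK I L))/IHA -> /IHB ->.
Qed.

Lemma neg_inj : injective neg.
Proof. by move=> A B /(can_inj (@cdualK I L))/pos_inj. Qed.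

Lemma pos_neg A B : pos A <> neg B.
Proof. by move=> e; have := polar_excl (polar_pos A); rewrite e polar_neg. Qed.

(** Polarity singles out the conclusion: no translated conclusion equals a translated hypothesis. *)
Lemma translation_inj G A D B : perm_eq (translation G A) (translation D B) ->
  A = B /\ perm_eq G D.
Proof.
rewrite /translation => p; have : pos A \in pos B :: map neg D by rewrite -(perm_mem p) mem_head.
rewrite inE => /orP[/eqP/pos_inj e|/mapP[C _ /pos_neg] //].
by subst; split=> //; rewrite perm_cons in p; have := perm_map_inj neg_inj p.
Qed.

Definition ITTLc H : Prop := exists G A, perm_eq H (translation G A) /\ ITTL v G A.

Lemma ITTLc_cons X H : ITTLc (X :: H) ->
  (exists C G, [/\ X = pos C, perm_eq H (map neg G) & ITTL v G C]) \/
  (exists B C G, [/\ X = neg B, perm_eq H (pos C :: map neg G) & ITTL v (B :: G) C]).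
Proof.
case=> G [A [p d]]; have : X \in translation G A by rewrite -(perm_mem p) mem_head.
rewrite inE => /orP[/eqP e|/mapP[B BG e]]; subst X.
  by left; exists A, G; split=> //; rewrite -(perm_cons (pos A)).
have [G1 p1] := perm_cons_mem BG.
right; exists B, A, G1; split=> //; last exact: ITTL_perm d.
by have := perm_map neg p1; rewrite /translation in p; rewrite /= => p2; perm_lia.
Qed.

Lemma ITTLc_intro H G A : perm_eq H (translation G A) ->
  (isequent v G A -> ITTL v G A) -> csequent v H -> ITTLc H.
Proof.
move=> p d cs; exists G, A; split=> //; apply: d; apply/isequentE.
exact: csequent_perm cs.
Qed.

Lemma polarized_pos A : polarized (pos A).
Proof. by rewrite /polarized polar_pos. Qed.

Lemma polarized_neg A : polarized (neg A).
Proof. by rewrite /polarized polar_neg orbT. Qed.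

(** A model need not admit Cut, so all formulas stay polarized, and the polarity of the components
    selects the intuitionistic rule. Polarity rules out a tensor whose second component is a
    hypothesis and a par whose first component is the conclusion. *)
Theorem ITTL_model : model v polarized ITTLc.
Proof.
have pN A : polar true (neg A) = false := polar_excl (polar_neg A).
have pP A : polar false (pos A) = false := polar_excl (polar_pos A).
split.
- move=> f X; have e o : polar o (crename f X) = polar o X.
    by elim: X o => [[q|q||] u l|X IHX Y IHY|X IHX Y IHY] o //=; rewrite IHX IHY.
  by rewrite /polarized !e.
- by move=> [].
- by [].
- move=> X Y; rewrite /polarized /=.
  by move=> /orP[]/andP[-> ->]; rewrite ?orbT.
- move=> X Y; rewrite /polarized /=.
  by move=> /orP[]/andP[-> ->]; rewrite ?orbT.
- move=> H [G [A [p d]]]; split.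
    have := (isequentE G A).1 (ITTL_isequent d); apply: csequent_perm.
    by rewrite perm_sym.
  rewrite (perm_all _ p) /= polarized_pos all_map.
  by apply/allP => B _; apply: polarized_neg.
- move=> H K p [G [A [q d]]]; exists G, A; split=> //.
  by rewrite perm_sym in p; apply: perm_trans q.
- move=> X aX cs _.
  have [[A eA]|[A eA]] : (exists A, X = pos A) \/ (exists A, X = neg A).
    case: X aX {cs} => // -[q|q||] u l _; [left|right|left|right].
    + by exists (IAtom (ILit q) u l).
    + by exists (IAtom (ILit q) (rev l) (rev u)); rewrite /neg /= !revK.
    + by exists (IAtom IOne u l).
    + by exists (IAtom IOne (rev l) (rev u)); rewrite /neg /= !revK.
  + subst; have aA : is_iatom A by case: A aX {cs} => [[q|] u l|A1 A2|A1 A2].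
    by apply: (ITTLc_intro _ (ITTL_id aA) cs); rewrite /translation /neg /=; perm_lia.
  subst; have aA : is_iatom A by case: A aX {cs} => [[q|] u l|A1 A2|A1 A2].
  by apply: (ITTLc_intro _ (ITTL_id aA) cs); rewrite /translation /neg /= cdualK.
- move=> H K X Y /ITTLc_cons[[A [G [eX pH dA]]]|[B [C [G [eX pH dA]]]]]
    /ITTLc_cons[[A' [D [eY pK dB]]]|[B' [C' [D [eY pK dB]]]]] cs /andP[pol _]; subst.
  + apply: (ITTLc_intro _ (ITTL_tensR dA dB) cs).
    by rewrite /translation map_cat /=; perm_lia.
  + by move: pol; rewrite /polarized /= !pN ?andbF.
  + apply: (ITTLc_intro _ (ITTL_lolliL dB dA) cs).
    by rewrite /translation /= neg_lolli map_cat; perm_lia.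
  + by move: pol; rewrite /polarized /= !pN ?andbF.
- move=> H X Y JH cs /andP[pol _].
  have [[A [G [eX pH d]]]|[B [C [G [eX pH d]]]]] := ITTLc_cons JH; subst X.
    by move: pol; rewrite /polarized /= pP.
  have : pos C \in Y :: H by rewrite (perm_mem pH) mem_head.
  (* [X] is a hypothesis. If [Y] is the conclusion, the par is an implication on the right;
     otherwise [Y] is another hypothesis and the par is a tensor on the left. *)
  rewrite inE => /orP[/eqP eY|CH].
    subst Y; have {}pH : perm_eq H (map neg G) by rewrite perm_cons in pH.
    apply: (ITTLc_intro _ (ITTL_lolliR d) cs).
    by rewrite /translation /=; perm_lia.
  have [H1 pH1] := perm_cons_mem CH.
  have : Y \in map neg G.
    have : Y \in pos C :: map neg G by rewrite -(perm_mem pH) mem_head.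
    rewrite inE => /orP[/eqP eY|//]; subst Y.
    have := perm_mem pH; have p2 : perm_eq (pos C :: H1) (map neg G).
      by rewrite -(perm_cons (pos C)); perm_lia.
    by have : pos C \in map neg G by rewrite -(perm_mem p2) mem_head.
  case/mapP=> A AG eY; subst Y; have [G1 p1] := perm_cons_mem AG.
  have d' : ITTL v [:: A, B & G1] C by apply: ITTL_perm d; perm_lia.
  apply: (ITTLc_intro _ (ITTL_tensL d') cs).
  have := perm_map neg p1; rewrite /translation /= => p2.
  have -> : neg (ITens A B) = CPar (neg B) (neg A) by [].
  by perm_lia.
- move=> H X i j JH jX iX cs _.
  have eb : neg (IAtom IOne [:: i] [:: j]) = CAtom CBot [:: j] [:: i] by [].
  have [[A [G [eX pH d]]]|[B [C [G [eX pH d]]]]] := ITTLc_cons JH; subst X.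
    rewrite mem_free_pos in jX; rewrite cindices_pos in iX.
    apply: (ITTLc_intro _ (ITTL_oneR_in d jX iX) cs).
    by rewrite csubst_pos /translation /= eb; perm_lia.
  rewrite mem_free_neg in jX; rewrite cindices_neg in iX.
  apply: (ITTLc_intro _ (ITTL_oneL_in d jX iX) cs).
  by rewrite csubst_neg /translation /= eb; perm_lia.
move=> H X i j JH jX iX cs _.
have eb : neg (IAtom IOne [:: i] [:: j]) = CAtom CBot [:: j] [:: i] by [].
have [[A [G [eX _ _]]]|[B [C [G [eX pH d]]]]] := ITTLc_cons JH.
  by case: A eX => [[q|] u l|A1 A2|A1 A2].
rewrite -eb in eX; move/neg_inj: eX => eX; subst B.
have : X \in pos C :: map neg G by rewrite -(perm_mem pH) mem_head.
rewrite inE => /orP[/eqP eX|/mapP[A AG eX]]; subst X.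
  rewrite mem_free_pos in jX; rewrite cindices_pos in iX.
  apply: (ITTLc_intro _ (ITTL_oneR_out d jX iX) cs).
  by rewrite csubst_pos /translation /=; rewrite perm_cons in pH; perm_lia.
have [G1 p1] := perm_cons_mem AG.
rewrite mem_free_neg in jX; rewrite cindices_neg in iX.
have d' : ITTL v [:: IAtom IOne [:: i] [:: j], A & G1] C by apply: ITTL_perm d; perm_lia.
apply: (ITTLc_intro _ (ITTL_oneL_out d' jX iX) cs).
by have := perm_map neg p1; rewrite csubst_neg /translation /= => p2; perm_lia.
Qed.

Theorem TTL_model (Lp : eqType) (vp : Lp -> nat * nat) : model vp predT (@TTL I Lp vp).
Proof.
split=> //.
- by move=> G d; split; [apply: TTL_csequent|apply/allP].
- exact: TTL_perm.
- by move=> A aA cs _; apply: TTL_id.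
- by move=> G D A B dA dB cs _; apply: TTL_tens.
- by move=> G A B d cs _; apply: TTL_par.
- by move=> G A i j d jA iA cs _; apply: TTL_bot_up.
- by move=> G A i j d jA iA cs _; apply: TTL_bot_down.
Qed.

Hypothesis inf : infinite_eqType I.

Theorem ITTL_derivable G A : isequent v G A ->
  (ITTL v G A <-> derivable (tag_context (translation G A)) (wiring_of (translation G A))).
Proof.
move=> /isequentE cs; split=> [d|d]; first exact: TTL_derivable (ITTL_TTL d).
have [|G' [A' [p d']]] := derivable_model ITTL_model inf d cs.
  by rewrite /= polarized_pos all_map; apply/allP => B _; apply: polarized_neg.
by have [-> q] := translation_inj p; apply: ITTL_perm d'; rewrite perm_sym.
Qed.

End Intuitionistic.

Theorem TTL_derivableE (I Lp : eqType) (vp : Lp -> nat * nat) (G : seq (cform I Lp)) :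
  infinite_eqType I -> csequent vp G ->
  (TTL vp G <-> derivable (tag_context G) (wiring_of G)).
Proof.
move=> inf cs; split=> [d|d]; first exact: (TTL_derivable inf d).
by apply: (derivable_model (TTL_model I vp) inf d cs); apply/allP.
Qed.

(** * Renaming symbols *)

Section Relabel.
Variables (I I' L L' : eqType) (h : I -> I') (g : L -> option L').
Implicit Types (A B : cform I L) (G : seq (nat * cform I L)) (b : bool).
Local Notation edge J := (option ((nat * J) * (nat * J))).

(** [g] is partial so that it can be the inverse of a naming of literals: the set of literals may be
    empty, and then no default value exists. The units stand in where [g] is undefined. *)
Definition relabel_prop (p : cprop L) : cprop L' :=
  match p with
  | CPos q => if g q is Some q' then CPos q' else COne
  | CNeg q => if g q is Some q' then CNeg q' else CBot
  | COne => COne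
  | CBot => CBot
  end.

Fixpoint relabel A : cform I' L' :=
  match A with
  | CAtom p u l => CAtom (relabel_prop p) (map h u) (map h l)
  | CTens A B => CTens (relabel A) (relabel B)
  | CPar A B => CPar (relabel A) (relabel B)
  end.

Definition relabel_item (X : nat * cform I L) := (X.1, relabel X.2).
Definition relabel_port (p : nat * I) : nat * I' := (p.1, h p.2).
Definition relabel_edge (e : edge I) : edge I' :=
  omap (fun e => (relabel_port e.1, relabel_port e.2)) e.

Definition labels G : seq L := flatten [seq clits X.2 | X <- G].

Lemma coccs_relabel b A : coccs b (relabel A) = map h (coccs b A).
Proof.
by elim: A => [p u l|A IHA B IHB|A IHA B IHB] /=; rewrite ?map_cat ?IHA ?IHB //; case: b.
Qed.

Lemma mem_map_in (s t : seq I) x : {in s &, injective h} -> x \in s -> {subset t <= s} ->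
  (h x \in map h t) = (x \in t).
Proof.
move=> inj xs ts; apply/mapP/idP => [[y yt e]|xt]; last by exists x.
by rewrite (inj _ _ xs (ts _ yt) e).
Qed.

Lemma cfree_relabel b A : {in cindices A &, injective h} ->
  cfree b (relabel A) = map h (cfree b A).
Proof.
move=> inj; rewrite /cfree !coccs_relabel filter_map; congr map.
apply/eq_in_filter => x xA /=; rewrite (mem_map_in inj) ?(mem_cindices xA) //.
by move=> y; apply: mem_cindices.
Qed.

Lemma bound_relabel A B : {in cindices A ++ cindices B &, injective h} ->
  bound (relabel A) (relabel B) = map h (bound A B).
Proof.
move=> inj; rewrite /bound !coccs_relabel map_cat !filter_map.
have sA b : {subset coccs b A <= cindices A ++ cindices B}.
  by move=> y yA; rewrite mem_cat (mem_cindices yA).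
have sB b : {subset coccs b B <= cindices A ++ cindices B}.
  by move=> y yA; rewrite mem_cat (mem_cindices yA) orbT.
congr (map h _ ++ map h _); apply/eq_in_filter => x xA /=;
  rewrite (mem_map_in inj) //; by [apply: sA xA|apply: sB xA].
Qed.

Lemma conn_relabel p q (E F : seq (edge I)) : conn p q E F ->
  conn (relabel_port p) (relabel_port q) (map relabel_edge E) (map relabel_edge F).
Proof.
case=> [R|u l R] /(perm_map relabel_edge) pE /(perm_map relabel_edge) pF.
  exact: (conn_loop pE pF).
exact: (conn_edge pE pF).
Qed.

Lemma conns_relabel ps (E F : seq (edge I)) : conns ps E F ->
  conns (map relabel_port ps) (map relabel_edge E) (map relabel_edge F).
Proof.
elim: ps E => [|p ps IH] E /=; first exact: perm_map.
by case=> H /conn_relabel c /IH cs; exists (map relabel_edge H).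
Qed.

Lemma tag_ports_relabel k s : tag_ports k (map h s) = map relabel_port (tag_ports k s).
Proof. by rewrite /tag_ports -!map_comp. Qed.

Lemma axiom_edges_relabel k k' u l : axiom_edges k (map h u) k' (map h l) =
  map relabel_edge (axiom_edges k u k' l).
Proof.
rewrite /axiom_edges -map_rev !tag_ports_relabel.
by elim: (tag_ports k u) (tag_ports k' (rev l)) => [|p s IH] [|q t] //=; rewrite IH.
Qed.

(** Edges are simply mapped; injectivity on indices is needed because [bound] compares them.
    Literals only have to stay literals, as an axiom maps both of its atoms by the same [g]. *)
Theorem derivable_relabel G E : derivable G E -> {in raws G &, injective h} ->
  all g (labels G) -> derivable (map relabel_item G) (map relabel_edge E).
Proof.
elim=> {G E} [G G' E E' pG pE _ IH|k k' q u l u' l' e1 e2|k i j|k i j G E F c d IH|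
    k A B G E d IH|k A B G1 G2 E1 E2 E d1 IH1 d2 IH2 c] inj lit.
- apply: (D_perm (perm_map _ pG) (perm_map _ pE)); apply: IH.
    have e := perm_mem (perm_flatmap (fun X => cindices X.2) pG).
    by move=> x y xG yG; apply: inj; rewrite /raws -e.
  by rewrite (perm_all _ (perm_flatmap (fun X => clits X.2) pG)).
- move: lit; rewrite /= /relabel_item /=; case: (g q) => // q' _.
  by rewrite map_cat -!axiom_edges_relabel; apply: D_ax; rewrite !size_map.
- exact: D_one.
- apply: D_bot (conn_relabel c) _; apply: IH => // x y xG yG.
  by apply: inj; rewrite /raws /= !inE -/(raws G) ?xG ?yG !orbT.
- have sub x : x \in raws [:: (k, A), (k, B) & G] -> x \in raws ((k, CPar A B) :: G).
    rewrite /raws /= !mem_cat; by repeat case: (x \in coccs _ _) => //=.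
  apply: D_par; rewrite bound_relabel; last first.
    by move=> x y xA yA; apply: inj; apply: sub; rewrite /raws /= catA mem_cat ?xA ?yA.
  rewrite tag_ports_relabel.
  have := IH _ _; rewrite map_cat -!map_comp; apply.
    by move=> x y xG yG; apply: inj; apply: sub.
  by move: lit; rewrite /labels /= catA.
rewrite /= map_cat; have sub1 x : x \in raws ((k, A) :: G1) -> x \in raws ((k, CTens A B) :: G1 ++ G2).
  rewrite /raws /= map_cat flatten_cat !mem_cat.
  by move=> /orP[|->]; rewrite ?orbT // => /orP[] ->; rewrite ?orbT.
have sub2 x : x \in raws ((k, B) :: G2) -> x \in raws ((k, CTens A B) :: G1 ++ G2).
  rewrite /raws /= map_cat flatten_cat !mem_cat.
  by move=> /orP[|->]; rewrite ?orbT // => /orP[] ->; rewrite ?orbT.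
have cs := conns_relabel c; rewrite map_cat -tag_ports_relabel -bound_relabel in cs; last first.
  move=> x y xA yA; apply: inj; rewrite /raws /=.
    by move: xA; rewrite !mem_cat => /orP[] /orP[] ->; rewrite ?orbT.
  by move: yA; rewrite !mem_cat => /orP[] /orP[] ->; rewrite ?orbT.
move: lit; rewrite /labels /= map_cat flatten_cat !all_cat => /andP[/andP[lA lB] /andP[l1 l2]].
apply: (D_tens _ _ cs); [apply: IH1|apply: IH2]; rewrite ?/labels /= ?all_cat ?lA ?lB //.
  by move=> x y xG yG; apply: inj; apply: sub1.
by move=> x y xG yG; apply: inj; apply: sub2.
Qed.

Lemma tag_context_relabel (H : seq (cform I L)) :
  tag_context (map relabel H) = map relabel_item (tag_context H).
Proof.
rewrite /tag_context size_map; elim: H (iota 0 (size H)) => [|A H IH] [|k ks] //=.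
by rewrite IH.
Qed.

Lemma wiring_relabel (H : seq (cform I L)) :
  {in flatten (map (@cindices I L) H) &, injective h} ->
  wiring_of (map relabel H) = map relabel_edge (wiring_of H).
Proof.
move=> inj; pose f (u : nat * I * I) := (relabel_port u.1, h u.2).
have sub b u : u \in tag_links b H -> u.2 \in flatten (map (@cindices I L) H).
  case/flatten_mapP=> X XH /mapP[x xX ->] /=; apply/flatten_mapP; exists X.2.
    have <- : map snd (tag_context H) = H by apply: unzip2_zip; rewrite size_iota.
    exact: map_f.
  exact: mem_cfree_cindices xX.
have e b : tag_links b (map relabel H) = map f (tag_links b H).
  rewrite /tag_links tag_context_relabel -map_comp map_flatten -map_comp.
  congr flatten; apply/eq_in_map => X XH /=; rewrite cfree_relabel; first by rewrite -!map_comp.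
  move=> x y xX yX; apply: inj; apply/flatten_mapP; exists X.2 => //.
    have <- : map snd (tag_context H) = H by apply: unzip2_zip; rewrite size_iota.
    exact: map_f.
  have <- : map snd (tag_context H) = H by apply: unzip2_zip; rewrite size_iota.
  exact: map_f.
have sU := sub true; have sV := sub false.
rewrite /wiring_of !e; move: (tag_links true H) (tag_links false H) sU sV => U V sU sV.
rewrite /join -map_comp (map_flatten relabel_edge) -map_comp; congr flatten.
apply/eq_in_map => u uU /=; rewrite filter_map -!map_comp.
have -> : [seq x <- V | preim f (fun l => l.2 == h u.2) x] = [seq l <- V | l.2 == u.2].
  apply/eq_in_filter => l lV /=; apply/eqP/eqP => [el|-> //].
  by apply: inj el; [apply: sV|apply: sU].
by apply: eq_map.
Qed.

End Relabel.

Lemma relabelK (I I' L L' : eqType) (h : I -> I') (h' : I' -> I) (g : L -> L')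
    (g' : L' -> option L) (A : cform I L) :
  {in cindices A, cancel h h'} -> {in clits A, forall q, g' (g q) = Some q} ->
  relabel h' g' (relabel h (Some \o g) A) = A.
Proof.
elim: A => [p u l|A IHA B IHB|A IHA B IHB] /= hK gK.
- congr CAtom.
  + by case: p gK {hK} => [q|q||] //= ->; rewrite ?mem_head.
  + rewrite -map_comp map_id_in // => x xu; apply: hK.
    by apply: (mem_cindices (b := true)).
  rewrite -map_comp map_id_in // => x xu; apply: hK.
  by apply: (mem_cindices (b := false)).
- rewrite IHA ?IHB //.
  + by move=> x xA; apply: hK; move: xA; rewrite /cindices /= !mem_cat => /orP[] ->; rewrite ?orbT.
  + by move=> x xA; apply: gK; rewrite mem_cat xA orbT.
  + by move=> x xA; apply: hK; move: xA; rewrite /cindices /= !mem_cat => /orP[] ->; rewrite ?orbT.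
  + by move=> x xA; apply: gK; rewrite mem_cat xA.
rewrite IHA ?IHB //.
+ by move=> x xA; apply: hK; move: xA; rewrite /cindices /= !mem_cat => /orP[] ->; rewrite ?orbT.
+ by move=> x xA; apply: gK; rewrite mem_cat xA orbT.
+ by move=> x xA; apply: hK; move: xA; rewrite /cindices /= !mem_cat => /orP[] ->; rewrite ?orbT.
+ by move=> x xA; apply: gK; rewrite mem_cat xA.
Qed.

Lemma cindices_relabel (I I' L L' : eqType) (h : I -> I') (g : L -> option L')
    (A : cform I L) : cindices (relabel h g A) = map h (cindices A).
Proof. by rewrite /cindices !coccs_relabel map_cat. Qed.

Lemma clits_relabel (I I' L L' : eqType) (h : I -> I') (g : L -> L') (A : cform I L) :
  clits (relabel h (Some \o g) A) = map g (clits A).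
Proof.
by elim: A => [[q|q||] u l|A IHA B IHB|A IHA B IHB] //=; rewrite map_cat IHA IHB.
Qed.

(** Both directions are instances of [derivable_relabel], the second along inverses of the
    namings. *)
Theorem derivable_names (I L : eqType) (nI : I -> nat) (nL : L -> nat)
    (H : seq (cform I L)) (H' := map (relabel nI (Some \o nL)) H) :
  inhabited I -> {in flatten (map (@cindices I L) H) &, injective nI} ->
  {in flatten (map (@clits I L) H) &, injective nL} ->
  derivable (tag_context H) (wiring_of H) <-> derivable (tag_context H') (wiring_of H').
Proof.
case=> x0 injI injL; have eT : map snd (tag_context H) = H.
  by apply: unzip2_zip; rewrite size_iota.
have eR : raws (tag_context H) = flatten (map (@cindices I L) H).
  by rewrite -[in RHS]eT /raws -map_comp.
have eL : labels (tag_context H) = flatten (map (@clits I L) H).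
  by rewrite -[in RHS]eT /labels -map_comp.
split=> d.
  have := derivable_relabel (h := nI) (g := Some \o nL) d.
  rewrite -tag_context_relabel -(wiring_relabel (Some \o nL) injI); apply; first by rewrite eR.
  exact/allP.
set xs := flatten (map (@cindices I L) H) in injI; set ls := flatten (map (@clits I L) H) in injL.
(* The inverses look a name up in the finite list of occurring symbols; on names in use the defaults
   are never reached. *)
pose h' y := head x0 [seq x <- xs | nI x == y].
pose g' y := ohead [seq q <- ls | nL q == y].
have hK : {in xs, cancel nI h'}.
  move=> x xI; have : x \in [seq y <- xs | nI y == nI x] by rewrite mem_filter eqxx.
  rewrite /h'; case e : [seq y <- xs | _] => [|y ys] //= _.
  have : y \in [seq y <- xs | nI y == nI x] by rewrite e mem_head.
  by rewrite mem_filter => /andP[/eqP ey yI]; apply: injI.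
have gK : {in ls, forall q, g' (nL q) = Some q}.
  move=> q qls; have : q \in [seq r <- ls | nL r == nL q] by rewrite mem_filter eqxx.
  rewrite /g'; case e : [seq r <- ls | _] => [|r rs] //= _; congr Some.
  have : r \in [seq r <- ls | nL r == nL q] by rewrite e mem_head.
  by rewrite mem_filter => /andP[/eqP er rls]; apply: injL.
have eHH : map (relabel h' g') H' = H.
  rewrite -[RHS]map_id /H' -map_comp; apply/eq_in_map => A AH /=; apply: relabelK.
    by move=> x xA; apply: hK; apply/flatten_mapP; exists A.
  by move=> q qA; apply: gK; apply/flatten_mapP; exists A.
have fI : flatten (map (@cindices nat nat) H') = map nI xs.
  by rewrite map_flatten -!map_comp; congr flatten; apply: eq_map => A /=; apply: cindices_relabel.
have fL : flatten (map (@clits nat nat) H') = map nL ls.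
  by rewrite map_flatten -!map_comp; congr flatten; apply: eq_map => A /=; apply: clits_relabel.
have eT' : map snd (tag_context H') = H' by apply: unzip2_zip; rewrite size_iota.
have inj' : {in flatten (map (@cindices nat nat) H') &, injective h'}.
  move=> y z; rewrite fI => /mapP[a ai ->] /mapP[b bi ->].
  by rewrite !hK // => ->.
have := derivable_relabel (h := h') (g := g') d.
rewrite -tag_context_relabel -(wiring_relabel g' inj') eHH; apply.
  have -> // : raws (tag_context H') = flatten (map (@cindices nat nat) H').
  by rewrite -[in RHS]eT' /raws -map_comp.
have -> : labels (tag_context H') = flatten (map (@clits nat nat) H').
  by rewrite -[in RHS]eT' /labels -map_comp.
by rewrite fL; apply/allP => _ /mapP[q qls ->]; rewrite gK.
Qed.

(** * Renaming intuitionistic sequents *)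

Section IRelabel.
Variables (I L : eqType) (nI : I -> nat) (nL : L -> nat).

Fixpoint irelabel (A : iform I L) : iform nat nat :=
  match A with
  | IAtom (ILit q) u l => IAtom (ILit (nL q)) (map nI u) (map nI l)
  | IAtom IOne u l => IAtom IOne (map nI u) (map nI l)
  | ITens A B => ITens (irelabel A) (irelabel B)
  | ILolli A B => ILolli (irelabel A) (irelabel B)
  end.

Lemma cdual_relabel (A : cform I L) :
  cdual (relabel nI (Some \o nL) A) = relabel nI (Some \o nL) (cdual A).
Proof.
elim: A => [p u l|A IHA B IHB|A IHA B IHB] /=; rewrite ?IHA ?IHB //.
by case: p => [q|q||]; rewrite /= !map_rev.
Qed.

Lemma pos_irelabel A : pos (irelabel A) = relabel nI (Some \o nL) (pos A).
Proof.
by elim: A => [[q|] u l|A IHA B IHB|A IHA B IHB] //=; rewrite -?cdual_relabel ?IHA ?IHB.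
Qed.

Lemma translation_irelabel G A : translation (map irelabel G) (irelabel A) =
  map (relabel nI (Some \o nL)) (translation G A).
Proof.
rewrite /translation /= pos_irelabel -!map_comp; congr cons; apply: eq_map => B /=.
by rewrite /neg pos_irelabel cdual_relabel.
Qed.

Lemma mem_clits_dual (A : cform I L) : clits (cdual A) =i clits A.
Proof.
elim: A => [[q|q||] u l|A IHA B IHB|A IHA B IHB] x //=;
  by rewrite !mem_cat IHA IHB orbC.
Qed.

Lemma mem_clits_pos (A : iform I L) : clits (pos A) =i ilits A.
Proof.
elim: A => [[q|] u l|A IHA B IHB|A IHA B IHB] x //=;
  by rewrite !mem_cat ?mem_clits_dual IHA IHB.
Qed.

Lemma mem_translation (G : seq (iform I L)) A :
  flatten (map (@cindices I L) (translation G A)) =i flatten (map (@iindices I L) (A :: G)) /\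
  flatten (map (@clits I L) (translation G A)) =i flatten (map (@ilits I L) (A :: G)).
Proof.
have e (T : eqType) (f : cform I L -> seq T) (f' : iform I L -> seq T) :
    (forall B, f (pos B) =i f' B) -> (forall B, f (neg B) =i f' B) ->
    flatten (map f (translation G A)) =i flatten (map f' (A :: G)).
  move=> e1 e2 x /=; rewrite !mem_cat e1; congr orb; elim: (G) => //= B G' IH.
  by rewrite !mem_cat e2 IH.
split; apply: e => B x; rewrite ?cindices_pos ?cindices_neg ?mem_clits_dual ?mem_clits_pos //.
Qed.

End IRelabel.

Lemma enc_relabel (I L : eqType) (nI : I -> nat) (nL : L -> nat) (A : cform I L) :
  enc_cform nI nL A = enc_cform id id (relabel nI (Some \o nL) A).
Proof.
have e (s : seq I) : enc_seq (fun k => enc_nat (nI k)) s = enc_seq enc_nat (map nI s).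
  by elim: s => //= x s ->.
elim: A => [p u l|A IHA B IHB|A IHA B IHB] /=; rewrite ?IHA ?IHB ?e //.
by case: p.
Qed.

Lemma enc_irelabel (I L : eqType) (nI : I -> nat) (nL : L -> nat) (A : iform I L) :
  enc_iform nI nL A = enc_iform id id (irelabel nI nL A).
Proof.
have e (s : seq I) : enc_seq (fun k => enc_nat (nI k)) s = enc_seq enc_nat (map nI s).
  by elim: s => //= x s ->.
elim: A => [p u l|A IHA B IHB|A IHA B IHB] /=; rewrite ?IHA ?IHB ?e //.
by case: p.
Qed.

Lemma enc_seq_map (T U : Type) (f : T -> U) (enc : U -> lterm) s :
  enc_seq enc (map f s) = enc_seq (enc \o f) s.
Proof. by elim: s => //= x s ->. Qed.

(** * Proof search *)

Section Choices.
Variable T : eqType.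
Implicit Types (x : T) (s t : seq T).

Fixpoint picks (X : Type) (s : seq X) : seq (X * seq X) :=
  if s is x :: s' then (x, s') :: [seq (y.1, x :: y.2) | y <- picks s'] else [::].

Fixpoint splits (X : Type) (s : seq X) : seq (seq X * seq X) :=
  if s is x :: s' then
    [seq (x :: y.1, y.2) | y <- splits s'] ++ [seq (y.1, x :: y.2) | y <- splits s']
  else [:: ([::], [::])].

Lemma perm_picks s x t : (x, t) \in picks s -> perm_eq s (x :: t).
Proof.
elim: s x t => //= y s IH x t; rewrite inE => /orP[/eqP[-> ->] //|].
by case/mapP=> -[x' t'] /= /IH p [-> ->]; perm_lia.
Qed.

Lemma picks_perm s x t : perm_eq s (x :: t) ->
  exists2 t', (x, t') \in picks s & perm_eq t t'.
Proof.
elim: s t => [|y s IH] t p; first by have := perm_size p.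
have [exy|nxy] := eqVneq y x.
  subst; exists s; rewrite ?mem_head // perm_sym; by rewrite perm_cons in p.
have [r p1 p2] := perm_cons2 p nxy; have [t' xt' p'] := IH _ p1.
exists (y :: t'); last by perm_lia.
by rewrite inE; apply/orP; right; apply: (map_f (fun y' => (y'.1, y :: y'.2)) xt').
Qed.

Lemma perm_splits s t1 t2 : (t1, t2) \in splits s -> perm_eq s (t1 ++ t2).
Proof.
elim: s t1 t2 => [|x s IH] t1 t2 /=; first by rewrite inE => /eqP[-> ->].
rewrite mem_cat => /orP[] /mapP[[r1 r2] /= /IH p [-> ->]]; perm_lia.
Qed.

Lemma splits_perm s t1 t2 : perm_eq s (t1 ++ t2) ->
  exists r1 r2, [/\ (r1, r2) \in splits s, perm_eq t1 r1 & perm_eq t2 r2].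
Proof.
elim: s t1 t2 => [|x s IH] t1 t2 p.
  exists [::], [::]; move: p => /perm_size /esym/eqP; rewrite size_cat addn_eq0.
  by case: t1 t2 => [|? ?] [|? ?].
rewrite perm_sym in p; have [[t p1 p2]|[t p1 p2]] := perm_cat_cons p.
  have [r1 [r2 [m q1 q2]]] := IH _ _ p2; exists (x :: r1), r2; split=> //; last by perm_lia.
  by rewrite /= mem_cat (map_f (fun y => (x :: y.1, y.2)) m).
have [r1 [r2 [m q1 q2]]] := IH _ _ p2; exists r1, (x :: r2); split=> //; last by perm_lia.
by rewrite /= mem_cat (map_f (fun y => (y.1, x :: y.2)) m) orbT.
Qed.

End Choices.

Definition form := cform nat nat.
Definition port := (nat * nat)%type.
Definition item := (nat * form)%type.
Definition edge := option (port * port).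
Definition goal := (seq item * seq edge)%type.

(** The search is written with case operators and concrete equality tests instead of pattern
    matching and generic equality, since these are the pieces for which lambda-terms are constructed
    later. *)
Definition cprop_case (X : Type) (f g : nat -> X) (x y : X) (p : cprop nat) : X :=
  match p with CPos q => f q | CNeg q => g q | COne => x | CBot => y end.

Definition cform_case (X : Type) (f : cprop nat -> seq nat -> seq nat -> X)
    (g h : form -> form -> X) (A : form) : X :=
  match A with CAtom p u l => f p u l | CTens A B => g A B | CPar A B => h A B end.

Definition edge_case (X : Type) (x : X) (f : port -> port -> X) (e : edge) : X :=
  if e is Some e' then f e'.1 e'.2 else x.

Definition eqport (p q : port) : bool := eqn p.1 q.1 && eqn p.2 q.2.

Definition eqedge (e f : edge) : bool :=
  edge_case (edge_case true (fun u l => false) f)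
    (fun u l => edge_case false (fun u' l' => eqport u u' && eqport l l') f) e.

Definition eqwiring (E F : seq edge) : bool :=
  all (fun e => eqn (size (filter (eqedge e) E)) (size (filter (eqedge e) F))) (E ++ F).

Definition mkedge (u l : port) : edge := Some (u, l).

Definition edges (s t : seq port) : seq edge := map Some (zip s t).

(* The wirings E with [conn p p E F]. *)
Definition unconn (p : port) (F : seq edge) : seq (seq edge) :=
  map (fun y => edge_case (mkedge p p :: y.2)
         (fun u l => mkedge p l :: mkedge u p :: y.2) y.1) (picks F).

Definition unconns (ps : seq port) (F : seq edge) : seq (seq edge) :=
  foldr (fun p Fs => flatten (map (unconn p) Fs)) [:: F] ps.

(* The wirings F with [conn p q E F]. *)
Definition rewire (p q : port) (E : seq edge) : seq (seq edge) :=
  flatten (map (fun y => edge_case [::]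
    (fun u l => if eqport u p then
       (if eqport l q then [:: None :: y.2] else [::]) ++
       flatten (map (fun z => edge_case [::]
         (fun u' l' => if eqport l' q then [:: mkedge u' l :: z.2] else [::]) z.1)
         (picks y.2))
     else [::]) y.1) (picks E)).

Definition is_axiom k q (u l : seq nat) (E : seq edge) (Y : item) : bool :=
  cform_case (fun p u' l' => cprop_case (fun r => false)
      (fun q' => eqn q q' && (eqn (size u) (size l') && (eqn (size u') (size l) &&
         eqwiring (edges (map (pair k) u) (map (pair Y.1) (rev l')) ++
                   edges (map (pair Y.1) u') (map (pair k) (rev l))) E)))
      false false p)
    (fun A B => false) (fun A B => false) Y.2.

(** The outer list holds alternatives, each inner list the subgoals that must all be solved. Hence
    [[:: [::]]] is success and [[::]] failure. *)
Definition done_if (b : bool) : seq (seq goal) := if b then [:: [::]] else [::].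

Definition atom_step k (p : cprop nat) (u l : seq nat) (G : seq item) (E : seq edge) :
    seq (seq goal) :=
  cprop_case
    (fun q => done_if (eqn (size G) 1 && has (is_axiom k q u l E) G))
    (* No step starts from a negative literal: an axiom is found when its positive atom is
       picked. *)
    (fun q => [::])
    (done_if (eqn (size G) 0 && (eqn (size u) 1 && (eqn (size l) 1 &&
       eqwiring (edges (map (pair k) u) (map (pair k) l)) E))))
    (if eqn (size u) 1 && eqn (size l) 1 then
       flatten (map (fun j => flatten (map (fun i =>
         map (fun F => [:: (G, F)]) (rewire (k, j) (k, i) E)) l)) u)
     else [::]) p.

Definition bindings k (A B : form) : seq port := map (pair k) (bound A B).

(** The context is distributed, the joins are undone, and the edges are distributed. Undoing a join
    cuts an edge or opens a loop that is present, which leaves finitely many choices. *)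
Definition tens_step k (A B : form) (G : seq item) (E : seq edge) : seq (seq goal) :=
  flatten (map (fun H => flatten (map (fun F =>
    map (fun F' => [:: ((k, A) :: H.1, F'.1); ((k, B) :: H.2, F'.2)]) (splits F))
    (unconns (bindings k A B) E))) (splits G)).

Definition par_step k (A B : form) (G : seq item) (E : seq edge) : seq (seq goal) :=
  [:: [:: ((k, A) :: (k, B) :: G, edges (bindings k A B) (bindings k A B) ++ E)]].

Definition step (X : item) (G : seq item) (E : seq edge) : seq (seq goal) :=
  cform_case (fun p u l => atom_step X.1 p u l G E)
    (fun A B => tens_step X.1 A B G E) (fun A B => par_step X.1 A B G E) X.2.

Definition expand (g : goal) : seq (seq goal) :=
  flatten (map (fun y => step y.1 y.2 g.2) (picks g.1)).

Definition search (n : nat) : goal -> bool :=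
  iter n (fun r g => has (all r) (expand g)) (fun g => false).

(** The extra unit makes the premise of a par lighter than its conclusion although both halves
    remain. *)
Fixpoint weight (A : form) : nat :=
  match A with CAtom _ _ _ => 1 | CTens A B | CPar A B => (weight A + weight B).+1 end.

Definition size_ctx (G : seq item) : nat := foldr (fun X m => weight X.2 + m) 0 G.

Lemma eqportE p q : eqport p q = (p == q).
Proof. by case: p q => [a b] [c d]; rewrite xpair_eqE. Qed.

Lemma eqedgeE e f : eqedge e f = (e == f).
Proof. by case: e f => [[u l]|] [[u' l']|] //=; rewrite /eqedge /= !eqportE. Qed.

Lemma eqwiringE E F : eqwiring E F = perm_eq E F.
Proof.
apply: eq_all => e /=; rewrite eqnE !size_filter.
by congr (_ == _); apply: eq_count => f; rewrite eqedgeE eq_sym.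
Qed.

Lemma edgesE s : edges s s = [seq Some (p, p) | p <- s].
Proof. by rewrite /edges; elim: s => //= p s ->. Qed.

Lemma unconnP p E F : E \in unconn p F -> conn p p E F.
Proof.
case/mapP=> -[[[u l]|] R] /perm_picks pF ->; first by apply: conn_edge pF.
by apply: conn_loop pF.
Qed.

Lemma conn_unconn p E F : conn p p E F -> exists2 E', E' \in unconn p F & perm_eq E E'.
Proof.
case=> [R|u l R] pE /picks_perm[R' m pR].
  exists (mkedge p p :: R'); last by rewrite /mkedge; perm_lia.
  by apply/mapP; exists (None, R').
exists (mkedge p l :: mkedge u p :: R'); last by rewrite /mkedge; perm_lia.
by apply/mapP; exists (Some (u, l), R').
Qed.

Lemma unconnsP ps E F : E \in unconns ps F -> conns ps E F.
Proof.
elim: ps E => [|p ps IH] E /=; first by rewrite inE => /eqP ->.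
by case/flatten_mapP=> H /IH cs /unconnP c; exists H.
Qed.

Lemma conns_unconns ps E F : conns ps E F -> exists2 E', E' \in unconns ps F & perm_eq E E'.
Proof.
elim: ps E => [|p ps IH] E /=; first by move=> pE; exists F; rewrite ?inE.
case=> H c /IH[H' m pH]; have c' : conn p p E H' by apply: conn_perm c.
have [E' m' pE] := conn_unconn c'; exists E' => //.
by apply/flatten_mapP; exists H'.
Qed.

Lemma rewireP p q E F : F \in rewire p q E -> conn p q E F.
Proof.
case/flatten_mapP=> -[[[u l]|] R] //= /perm_picks pE.
rewrite /edge_case /= eqportE; case: eqP => // eu; subst u.
rewrite mem_cat => /orP[|/flatten_mapP[[[[u' l']|] S] //= /perm_picks pR]].
  rewrite eqportE; case: eqP => // el; subst l; rewrite inE => /eqP ->.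
  exact: conn_loop pE _.
rewrite eqportE; case: eqP => // el; subst l'; rewrite inE => /eqP ->.
by apply: (@conn_edge _ _ _ _ _ u' l S) => //; perm_lia.
Qed.

Lemma conn_rewire p q E F : conn p q E F -> exists2 F', F' \in rewire p q E & perm_eq F F'.
Proof.
case=> [R|u l R] /picks_perm[R' m pR] pF.
  exists (None :: R'); last by perm_lia.
  apply/flatten_mapP; exists (Some (p, q), R') => //.
  by rewrite /edge_case /= !eqportE !eqxx mem_cat mem_head.
rewrite perm_sym in pR; have [S mS pS] := picks_perm pR.
exists (mkedge u l :: S); last by rewrite /mkedge; perm_lia.
apply/flatten_mapP; exists (Some (p, l), R') => //.
rewrite /edge_case /= !eqportE eqxx mem_cat; apply/orP; right.
apply/flatten_mapP; exists (Some (u, q), S) => //.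
by rewrite /= eqportE eqxx mem_head.
Qed.

Lemma is_axiomP k q u l E Y : is_axiom k q u l E Y -> derivable [:: (k, CAtom (CPos q) u l); Y] E.
Proof.
case: Y => k' [[|q'||] u' l'|A B|A B] //=; rewrite /is_axiom /= !eqnE.
case/and4P=> /eqP -> /eqP s1 /eqP s2; rewrite eqwiringE => pE.
by apply: (D_perm (perm_refl _) pE); apply: D_ax.
Qed.

Lemma size1 (s : seq nat) : size s == 1 -> exists x, s = [:: x].
Proof. by case: s => [|x []] //; exists x. Qed.

Lemma atom_stepP k p u l G E gs : gs \in atom_step k p u l G E ->
  (forall g, g \in gs -> derivable g.1 g.2) -> derivable ((k, CAtom p u l) :: G) E.
Proof.
case: p => [q|q||] //=; rewrite /done_if !eqnE.
- case: ifP => //; case: G => [|Y []] //=; rewrite orbF => /is_axiomP.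
  by [].
- case: ifP => // /and4P[/nilP -> /size1[i ->] /size1[j ->]].
  rewrite eqwiringE => pE _ _; apply: (D_perm (perm_refl _) pE).
  exact: D_one.
case: ifP => // /andP[/size1[j ->] /size1[i ->]] /=; rewrite !cats0.
case/mapP=> F /rewireP c -> H; apply: D_bot c _.
exact: (H (G, F) (mem_head _ _)).
Qed.

Lemma stepP X G E gs : gs \in step X G E ->
  (forall g, g \in gs -> derivable g.1 g.2) -> derivable (X :: G) E.
Proof.
case: X => k [p u l|A B|A B] /=; first exact: atom_stepP.
  case/flatten_mapP=> -[G1 G2] /perm_splits pG /flatten_mapP[F /unconnsP cs].
  case/mapP=> -[E1 E2] /perm_splits pF -> H.
  apply: (@D_perm _ _ ((k, CTens A B) :: G1 ++ G2) _ E _); rewrite ?perm_cons 1?perm_sym //.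
  apply: (@D_tens _ _ k A B G1 G2 E1 E2).
  - exact: (H ((k, A) :: G1, E1) (mem_head _ _)).
  - by apply: (H ((k, B) :: G2, E2)); rewrite !inE eqxx orbT.
  - exact: conns_perm cs.
rewrite inE => /eqP -> H; apply: D_par.
by rewrite -edgesE; apply: (H (_, _) (mem_head _ _)).
Qed.

Theorem search_sound n g : search n g -> derivable g.1 g.2.
Proof.
elim: n g => //= n IH g /hasP[gs /flatten_mapP[[X G] m m'] /allP H].
apply: (D_perm _ (perm_refl _) (stepP m' _)); first by rewrite perm_sym; apply: perm_picks.
by move=> g' /H /IH.
Qed.

Lemma size_ctx_cat G H : size_ctx (G ++ H) = size_ctx G + size_ctx H.
Proof. by elim: G => //= X G ->; rewrite addnA. Qed.

Lemma perm_size_ctx G H : perm_eq G H -> size_ctx G = size_ctx H.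
Proof.
have e K : size_ctx K = sumn (map (fun X : item => weight X.2) K) by elim: K => //= X K ->.
by move=> p; rewrite !e; apply/perm_sumn/perm_map.
Qed.

Lemma search_step n X G E gs : (X, G) \in picks (gs.1 : seq item) ->
  gs.2 = E -> forall g, g \in step X G E -> all (search n) g -> search n.+1 gs.
Proof.
move=> m <- g mg ag; apply/hasP; exists g => //.
by apply/flatten_mapP; exists (X, G).
Qed.

(** Every logical rule lowers the weight, so fuel above the weight cannot run out. The
    generalization over permuted lists absorbs [D_perm] and the order in which [picks] and [splits]
    enumerate. *)
Theorem search_complete G E : derivable G E -> forall n G' E', perm_eq G G' ->
  perm_eq E E' -> size_ctx G < n -> search n (G', E').
Proof.
elim=> {G E} [G G1 E E1 pG pE _ IH|k k' q u l u' l' e1 e2|k i j|k i j G E F c d IH|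
    k A B G E d IH|k A B G1 G2 E1 E2 E d1 IH1 d2 IH2 c] [//|n] G' E' pG' pE' sz.
- apply: IH; last by rewrite (perm_size_ctx pG).
    exact: perm_trans pG'.
  exact: perm_trans pE'.
- rewrite perm_sym in pG'; have [H m pH] := picks_perm pG'.
  apply: (search_step (gs := (G', E')) m erefl (g := [::])) => //.
  have -> : H = [:: (k', CAtom (CNeg q) u' l')] by apply: perm_small_eq; rewrite // perm_sym.
  rewrite /step /cform_case /= /atom_step /= orbF /is_axiom /= !eqnE e1 e2 !eqxx /=.
  rewrite eqwiringE; move: pE'; rewrite /axiom_edges /tag_ports /edges => ->.
  by rewrite mem_head.
- rewrite perm_sym in pG'; have [H m pH] := picks_perm pG'.
  apply: (search_step (gs := (G', E')) m erefl (g := [::])) => //.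
  have -> : H = [::] by apply: perm_small_eq; rewrite // perm_sym.
  by rewrite /step /cform_case /= /atom_step /= eqwiringE pE' mem_head.
- rewrite perm_sym in pG'; have [H m pH] := picks_perm pG'.
  have c' : conn (k, j) (k, i) E' F by apply: conn_perm c.
  have [F' mF pF] := conn_rewire c'.
  apply: (search_step (gs := (G', E')) m erefl (g := [:: (H, F')])).
    by rewrite /step /cform_case /= /atom_step /= !cats0; apply/mapP; exists F'.
  rewrite /= andbT; apply: IH => //.
- rewrite perm_sym in pG'; have [H m pH] := picks_perm pG'.
  apply: (search_step (gs := (G', E')) m erefl (g := _) (mem_head _ _)).
  rewrite /= andbT; apply: IH; first by perm_lia.
    by rewrite edgesE perm_cat2l.
  by move: sz; rewrite /= addnA; lia.
rewrite perm_sym in pG'; have [H m pH] := picks_perm pG'.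
rewrite perm_sym in pH; have [H1 [H2 [mH p1 p2]]] := splits_perm pH.
have c' : conns (tag_ports k (bound A B)) (E1 ++ E2) E' by apply: conns_perm c.
have [F mF pF] := conns_unconns c'.
rewrite perm_sym in pF; have [F1 [F2 [mF' q1 q2]]] := splits_perm pF.
apply: (search_step (gs := (G', E')) m erefl
  (g := [:: ((k, A) :: H1, F1); ((k, B) :: H2, F2)])).
  apply/flatten_mapP; exists (H1, H2) => //; apply/flatten_mapP; exists F => //.
  by apply/mapP; exists (F1, F2).
have sz' := sz; rewrite /= size_ctx_cat in sz'.
rewrite /= andbT; apply/andP; split; [apply: IH1|apply: IH2] => //=;
  rewrite ?perm_cons //; move: sz'; clear; lia.
Qed.

Definition decide (G : seq form) : bool :=
  search (size_ctx (tag_context G)).+1 (tag_context G, wiring_of G).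

Theorem decideP G : decide G <-> derivable (tag_context G) (wiring_of G).
Proof. by split=> [/search_sound //|d]; apply: (search_complete d). Qed.

(** * Functions computed by lambda-terms *)

Lemma lbound_mono k k' t : k <= k' -> lbound k t -> lbound k' t.
Proof.
elim: t k k' => [n|t1 IH1 t2 IH2|t IH] k k' le /=.
- by move=> h; apply: leq_trans le.
- by case/andP=> h1 h2; rewrite (IH1 _ _ le h1) (IH2 _ _ le h2).
- by apply: IH.
Qed.

Lemma lclosed_bound k t : lclosed t -> lbound k t.
Proof. exact: lbound_mono. Qed.

Lemma lsubst_bound k t u : lbound k t -> lsubst t k u = t.
Proof.
elim: t k => [n|t1 IH1 t2 IH2|t IH] k /=.
- by move=> lt; rewrite ltn_eqF.
- by case/andP=> h1 h2; rewrite IH1 ?IH2.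
- by move=> h; rewrite IH.
Qed.

Lemma lsubst_closed k t u : lclosed t -> lsubst t k u = t.
Proof. by move=> cl; apply/lsubst_bound/lclosed_bound. Qed.

Definition value t := (if t is LLam _ then true else false) && lclosed t.

Lemma value_closed t : value t -> lclosed t.
Proof. by case/andP. Qed.

Lemma leval_value t : value t -> leval t t.
Proof. by case: t => // t _; apply: leval_lam. Qed.

Lemma leval_lamI b w : leval (LLam b) w -> w = LLam b.
Proof. by move=> e; inversion e. Qed.

Lemma leval_is_lam t w : leval t w -> exists b, w = LLam b.
Proof. by elim=> // b; exists b. Qed.

Lemma leval_det t w w' : leval t w -> leval t w' -> w = w'.
Proof.
move=> e; elim: e w' => {t w} [b w' /leval_lamI -> //|t1 t2 b u w e1 IH1 e2 IH2 e3 IH3 w' e'].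
inversion_clear e'; case: (IH1 _ H) => eb; subst.
by rewrite -(IH2 _ H0) in H1; apply: IH3.
Qed.

(** Unlike evaluation this relation is symmetric, transitive and a congruence for application, so
    reductions can be chained as equations. *)
Definition coeval t t' := forall w, leval t w <-> leval t' w.

Lemma coeval_refl t : coeval t t. Proof. by []. Qed.

Lemma coeval_sym t t' : coeval t t' -> coeval t' t.
Proof. by move=> r w; split=> /r. Qed.

Lemma coeval_trans t1 t2 t3 : coeval t1 t2 -> coeval t2 t3 -> coeval t1 t3.
Proof. by move=> r1 r2 w; split=> [/r1/r2|/r2/r1]. Qed.

Lemma coeval_app t t' u u' : coeval t t' -> coeval u u' ->
  coeval (LApp t u) (LApp t' u').
Proof.
move=> r1 r2 w; split=> e; inversion_clear e.
  exact: leval_app ((r1 _).1 H) ((r2 _).1 H0) H1.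
exact: leval_app ((r1 _).2 H) ((r2 _).2 H0) H1.
Qed.

Lemma coeval_beta b u : value u -> coeval (LApp (LLam b) u) (lsubst b 0 u).
Proof.
move=> /leval_value eu w; split=> e; last exact: leval_app (leval_lam _) eu e.
inversion_clear e; case: (leval_lamI H) => eb; subst.
by rewrite (leval_det eu H0).
Qed.

Lemma coeval_leval t v : leval t v -> coeval t v.
Proof.
move=> e w; have [b eb] := leval_is_lam e; subst v; split=> [/(leval_det e) <-|/leval_lamI -> //].
exact: leval_lam.
Qed.

(* A logical relation: a value represents a function when it maps values
   representing an argument to a value representing the result. *)
Class Rep (X : Type) := { rep : X -> lterm -> Prop; rep_value : forall x t, rep x t -> value t }.

Arguments rep {X _} x t : simpl never.

Definition computable X {RX : Rep X} (x : X) := exists t, rep x t.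

Section RepFun.
Context {A B : Type} {RA : Rep A} {RB : Rep B}.
Definition rep_fun (f : A -> B) t := value t /\
  forall a u, rep a u -> exists2 w, leval (LApp t u) w & rep (f a) w.
Lemma rep_fun_value f t : rep_fun f t -> value t. Proof. by case. Qed.
Global Instance Rep_fun : Rep (A -> B) := Build_Rep rep_fun_value.

Lemma rep_app (f : A -> B) t a u : rep f t -> rep a u ->
  exists2 w, leval (LApp t u) w & rep (f a) w.
Proof. by case=> _; apply. Qed.

Lemma rep_lam (f : A -> B) b : lclosed (LLam b) ->
  (forall a u, rep a u -> exists2 t', coeval (lsubst b 0 u) t' & rep (f a) t') ->
  rep f (LLam b).
Proof.
move=> cl H; split=> // a u ra; have [t' r rt] := H a u ra; exists t' => //.
by apply: (coeval_beta b (rep_value ra) _).2; apply/(r _).2/leval_value/(rep_value rt).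
Qed.
End RepFun.

Ltac closed_terms :=
  repeat match goal with
  | H : rep ?x ?t |- _ =>
      lazymatch goal with
      | _ : is_true (value t) |- _ => fail
      | _ => move: (rep_value H) => ?
      end
  end.

(** Representing terms are values, hence closed, and substitution leaves them unchanged; this takes
    care of the de Bruijn indices. *)
Ltac simpl_terms :=
  cbn -[value lclosed rep]; closed_terms;
  repeat match goal with
  | H : is_true (value ?t) |- context [lsubst ?t ?k ?u] =>
      rewrite (lsubst_closed k u (value_closed H))
  | H : is_true (value ?t) |- context [lbound ?k ?t] =>
      rewrite (lclosed_bound k (value_closed H))
  end.

Ltac closed_goal := rewrite /lclosed; simpl_terms; done.

Ltac is_value := first [assumption | by rewrite /value; closed_goal | closed_goal].

(** Follows call by value: both parts of an application are normalized first, then a beta step or a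
    hypothesis giving the value of the application is used. *)
Ltac normalize :=
  lazymatch goal with
  | |- coeval (LApp _ _) _ =>
      eapply coeval_trans; [eapply coeval_app; [normalize|normalize] |
        first [eapply coeval_trans; [apply: coeval_beta; is_value | simpl_terms; normalize]
              |eapply coeval_leval; eassumption
              |apply: coeval_refl]]
  | |- _ => apply: coeval_refl
  end.

Ltac lam a u ru := apply: rep_lam; [closed_goal | move=> a u ru; simpl_terms].

Ltac ret := eexists; [apply: coeval_refl|].

(** * Closure properties of computable functions *)

Section Combinators.
Context {A B C : Type} {RA : Rep A} {RB : Rep B} {RC : Rep C}.

Lemma computable_id : computable (fun x : A => x).
Proof. exists (LLam (LVar 0)); lam a u ru; by exists u. Qed.

Lemma computable_const (c : B) : computable c -> computable (fun _ : A => c).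
Proof. by case=> t rt; exists (LLam t); lam a u ru; exists t. Qed.

(** The combinator S; with identity and constants it gives bracket abstraction, by which an
    expression is compiled from its parts. *)
Lemma computable_app (f : A -> B -> C) (g : A -> B) : computable f -> computable g ->
  computable (fun x => f x (g x)).
Proof.
case=> tf rf [tg rg]; exists (LLam (LApp (LApp tf (LVar 0)) (LApp tg (LVar 0)))).
lam a u ru; have [w1 e1 r1] := rep_app rf ru; have [w2 e2 r2] := rep_app rg ru.
have [w3 e3 r3] := rep_app r1 r2; exists w3 => //; closed_terms; normalize.
Qed.

Lemma computable_apply (f : A -> B) (a : A) : computable f -> computable a -> computable (f a).
Proof. by case=> tf rf [ta ra]; have [w e r] := rep_app rf ra; exists w. Qed.
End Combinators.

Section Pairs.
Context {A B C : Type} {RA : Rep A} {RB : Rep B} {RC : Rep C}.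

Definition rep_pair (x : A * B) t := exists t1 t2,
  [/\ rep x.1 t1, rep x.2 t2 & t = scott 1 0 [:: t1; t2]].
Lemma rep_pair_value x t : rep_pair x t -> value t.
Proof. by move=> [t1 [t2 [r1 r2 ->]]]; closed_terms; is_value. Qed.
Global Instance Rep_pair : Rep (A * B) := Build_Rep rep_pair_value.

Lemma computable_pair : computable (@pair A B).
Proof.
exists (LLam (LLam (LLam (LApp (LApp (LVar 0) (LVar 2)) (LVar 1))))).
lam a u ru; ret; lam b w rw; ret; by exists u, w.
Qed.

Lemma computable_fst : computable (@fst A B).
Proof.
exists (LLam (LApp (LVar 0) (LLam (LLam (LVar 1))))).
lam x u ru; case: ru => t1 [t2 [r1 r2 ->]]; exists t1 => //; closed_terms.
rewrite /scott; simpl_terms; normalize.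
Qed.

Lemma computable_snd : computable (@snd A B).
Proof.
exists (LLam (LApp (LVar 0) (LLam (LLam (LVar 0))))).
lam x u ru; case: ru => t1 [t2 [r1 r2 ->]]; exists t2 => //; closed_terms.
rewrite /scott; simpl_terms; normalize.
Qed.

(** Nested abstractions are reduced to a single one over a pair, so that bracket abstraction deals
    with one variable at a time. *)
Lemma computable_curry (f : A -> B -> C) : computable (fun x : A * B => f x.1 x.2) ->
  computable (fun a b => f a b).
Proof.
case=> t rt; exists (LLam (LLam (LApp t (LLam (LApp (LApp (LVar 0) (LVar 2)) (LVar 1)))))).
lam a u ru; ret; lam b w rw.
have rp : rep (a, b) (LLam (LApp (LApp (LVar 0) u) w)) by exists u, w.
have [z e r] := rep_app rt rp; exists z => //; closed_terms; normalize.
Qed.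
End Pairs.

Ltac equate := eapply coeval_trans; [normalize|apply: coeval_sym; normalize].

Section Bool.
Definition rep_bool b t := t = enc_bool b.
Lemma rep_bool_value b t : rep_bool b t -> value t.
Proof. by move=> ->; case: b. Qed.
Global Instance Rep_bool : Rep bool := Build_Rep rep_bool_value.

Lemma computable_bool (b : bool) : computable b. Proof. by exists (enc_bool b). Qed.

Context {A B : Type} {RA : Rep A} {RB : Rep B}.

(** Both branches are evaluated before the choice, which is harmless because represented functions
    are total. *)
Lemma computable_cond : computable (fun (b : bool) (x y : A) => if b then x else y).
Proof.
exists (LLam (LLam (LLam (LApp (LApp (LVar 2) (LVar 1)) (LVar 0))))).
lam b tb rb; ret; lam x tx rx; ret; lam y ty ry.
have -> : tb = enc_bool b := rb; exists (if b then tx else ty); last by case: (b).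
by closed_terms; case: (b); rewrite /enc_bool /scott; simpl_terms; normalize.
Qed.

End Bool.

Section Nat.
Definition rep_nat n t := t = enc_nat n.
Lemma rep_nat_value n t : rep_nat n t -> value t.
Proof.
move=> ->; elim: n => // n IH.
by rewrite /value /lclosed /= (lclosed_bound _ (value_closed IH)).
Qed.
Global Instance Rep_nat : Rep nat := Build_Rep rep_nat_value.

Lemma rep_enc_nat n : rep n (enc_nat n). Proof. exact: erefl. Qed.

Lemma computable_nat (n : nat) : computable n. Proof. by exists (enc_nat n). Qed.

Lemma computable_S : computable S.
Proof.
exists (LLam (LLam (LLam (LApp (LVar 0) (LVar 2))))).
lam n t rn; ret; have -> : t = enc_nat n := rn; exact: erefl.
Qed.

Definition nat_fold A (z : A) (f : nat -> A -> A) : nat -> A :=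
  fix F n := if n is m.+1 then f m (F m) else z.

(* Recursion by self-application: nat_step takes itself as first argument. *)
Definition nat_step : lterm :=
  LLam (LLam (LLam (LLam (LApp (LApp (LVar 0) (LVar 2))
    (LLam (LApp (LApp (LVar 2) (LVar 0))
      (LApp (LApp (LApp (LApp (LVar 4) (LVar 4)) (LVar 3)) (LVar 2)) (LVar 0)))))))).

(** The outer abstraction makes the loop a value, as [rep] demands of a term representing a
    function. *)
Definition nat_loop z f : lterm :=
  LLam (LApp (LApp (LApp (LApp nat_step nat_step) z) f) (LVar 0)).

Lemma value_nat_loop z f : value z -> value f -> value (nat_loop z f).
Proof. move=> vz vf; rewrite /nat_loop; is_value. Qed.

Lemma nat_loop0 z f : value z -> value f -> coeval (LApp (nat_loop z f) (scott 2 0 [::])) z.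
Proof. move=> vz vf; rewrite /nat_loop /scott; simpl_terms; normalize. Qed.

Lemma nat_loopS z f t : value z -> value f -> value t ->
  coeval (LApp (nat_loop z f) (scott 2 1 [:: t])) (LApp (LApp f t) (LApp (nat_loop z f) t)).
Proof. move=> vz vf vt; rewrite /nat_loop /scott; simpl_terms; equate. Qed.

Context {A : Type} {RA : Rep A}.

Lemma computable_nat_fold : computable (@nat_fold A).
Proof.
(* [nat_loop] contributes one more abstraction, so [z] and [f] are the variables 2 and 1 inside
   it. *)
exists (LLam (LLam (nat_loop (LVar 2) (LVar 1)))).
lam z tz rz; ret; lam f tf rf; exists (nat_loop tz tf); first exact: coeval_refl.
closed_terms; split; first exact: value_nat_loop.
move=> n u ru; have -> : u = enc_nat n := ru; elim: n {u ru} => [|n [w e r]] /=.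
  by exists tz => //; apply/(nat_loop0 _ _ _)/leval_value.
have [w1 e1 r1] := rep_app rf (rep_enc_nat n).
have [w2 e2 r2] := rep_app r1 r; exists w2 => //.
have vn := rep_value (rep_enc_nat n).
apply: (nat_loopS (rep_value rz) (rep_value rf) vn _).2.
exact: (coeval_app (coeval_leval e1) (coeval_leval e) w2).2.
Qed.
End Nat.

Section Seq.
Context {A B : Type} {RA : Rep A} {RB : Rep B}.

Fixpoint rep_seq (s : seq A) t : Prop :=
  if s is x :: s' then exists t1 t2, [/\ rep x t1, rep_seq s' t2 & t = scott 2 1 [:: t1; t2]]
  else t = scott 2 0 [::].

Lemma rep_seq_value s t : rep_seq s t -> value t.
Proof.
elim: s t => [|x s IH] t /=; first by move=> ->.
case=> t1 [t2 [r1 /IH v2 ->]]; closed_terms; rewrite /scott; is_value.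
Qed.
Global Instance Rep_seq : Rep (seq A) := Build_Rep rep_seq_value.

Lemma rep_enc_seq (enc : A -> lterm) : (forall x t, rep x t <-> t = enc x) ->
  forall s t, rep s t <-> t = enc_seq enc s.
Proof.
move=> e; elim=> [|x s IH] t; first by [].
split=> [[t1 [t2 [/e -> /(IH t2).1 -> ->]]] //|->].
by exists (enc x), (enc_seq enc s); split=> //; [apply/e|apply: (IH _).2].
Qed.

Lemma computable_nil : computable (@nil A).
Proof. by exists (scott 2 0 [::]). Qed.

Lemma computable_cons : computable (@cons A).
Proof.
exists (LLam (LLam (LLam (LLam (LApp (LApp (LVar 0) (LVar 3)) (LVar 2)))))).
lam x t rx; ret; lam s u rs; ret; by exists t, u.
Qed.

(** [f] also receives the tail, so this is primitive recursion and not mere iteration; [picks] needs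
    it. *)
Definition seq_fold (z : B) (f : A -> seq A -> B -> B) : seq A -> B :=
  fix F s := if s is x :: s' then f x s' (F s') else z.

Definition seq_step : lterm :=
  LLam (LLam (LLam (LLam (LApp (LApp (LVar 0) (LVar 2))
    (LLam (LLam (LApp (LApp (LApp (LVar 3) (LVar 1)) (LVar 0))
      (LApp (LApp (LApp (LApp (LVar 5) (LVar 5)) (LVar 4)) (LVar 3)) (LVar 0))))))))).

Definition seq_loop z f : lterm :=
  LLam (LApp (LApp (LApp (LApp seq_step seq_step) z) f) (LVar 0)).

Lemma value_seq_loop z f : value z -> value f -> value (seq_loop z f).
Proof. move=> vz vf; rewrite /seq_loop; is_value. Qed.

Lemma seq_loop0 z f : value z -> value f -> coeval (LApp (seq_loop z f) (scott 2 0 [::])) z.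
Proof. move=> vz vf; rewrite /seq_loop /scott; simpl_terms; normalize. Qed.

Lemma seq_loopS z f t u : value z -> value f -> value t -> value u ->
  coeval (LApp (seq_loop z f) (scott 2 1 [:: t; u]))
    (LApp (LApp (LApp f t) u) (LApp (seq_loop z f) u)).
Proof. move=> vz vf vt vu; rewrite /seq_loop /scott; simpl_terms; equate. Qed.

Lemma computable_seq_fold : computable seq_fold.
Proof.
exists (LLam (LLam (seq_loop (LVar 2) (LVar 1)))).
lam z tz rz; ret; lam f tf rf; exists (seq_loop tz tf); first exact: coeval_refl.
closed_terms; split; first exact: value_seq_loop.
elim=> [|x s IH] u.
  by move=> -> /=; exists tz => //; apply: (seq_loop0 _ _ _).2 => //; apply: leval_value.
case=> t1 [t2 [r1 r2 ->]] /=; have [w e r] := IH _ r2.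
have [w1 e1 q1] := rep_app rf r1; have [w2 e2 q2] := rep_app q1 r2.
have [w3 e3 q3] := rep_app q2 r; exists w3 => //.
apply: (seq_loopS _ _ (rep_value r1) (rep_value r2) _).2 => //.
have c := coeval_app (coeval_leval e1) (coeval_refl t2).
have {}c := coeval_trans c (coeval_leval e2).
exact: (coeval_app c (coeval_leval e) w3).2.
Qed.
End Seq.

Section Option.
Context {A B : Type} {RA : Rep A} {RB : Rep B}.

Definition rep_option (x : option A) t : Prop :=
  if x is Some y then exists2 u, rep y u & t = scott 2 1 [:: u] else t = scott 2 0 [::].
Lemma rep_option_value x t : rep_option x t -> value t.
Proof.
case: x => [y [u ru ->]|-> //]; closed_terms; rewrite /scott; is_value.
Qed.
Global Instance Rep_option : Rep (option A) := Build_Rep rep_option_value.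

Lemma computable_None : computable (@None A).
Proof. by exists (scott 2 0 [::]). Qed.

Lemma computable_Some : computable (@Some A).
Proof.
exists (LLam (LLam (LLam (LApp (LVar 0) (LVar 2))))).
by lam x t rx; ret; exists t.
Qed.

Definition option_case (z : B) (f : A -> B) (x : option A) : B :=
  if x is Some y then f y else z.

Lemma computable_option_case : computable option_case.
Proof.
exists (LLam (LLam (LLam (LApp (LApp (LVar 0) (LVar 2)) (LVar 1))))).
lam z tz rz; ret; lam f tf rf; ret; lam x tx rx; closed_terms.
case: x rx => [y [u ru ->]|->]; last first.
  exists tz => //; rewrite /scott; simpl_terms; normalize.
have [w e r] := rep_app rf ru; exists w => //; closed_terms; rewrite /scott; simpl_terms.
normalize.
Qed.
End Option.

Section Symbols.
Context {A : Type} {RA : Rep A}.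

Definition rep_cprop (p : cprop nat) t := t = enc_cprop id p.
Lemma rep_cprop_value p t : rep_cprop p t -> value t.
Proof.
by move=> ->; case: p => [q|q||] //=; have := rep_value (rep_enc_nat q) => v;
  rewrite /scott; is_value.
Qed.
Global Instance Rep_cprop : Rep (cprop nat) := Build_Rep rep_cprop_value.

Definition rep_iprop (p : iprop nat) t := t = enc_iprop id p.
Lemma rep_iprop_value p t : rep_iprop p t -> value t.
Proof.
by move=> ->; case: p => [q|] //=; have := rep_value (rep_enc_nat q) => v;
  rewrite /scott; is_value.
Qed.
Global Instance Rep_iprop : Rep (iprop nat) := Build_Rep rep_iprop_value.

Lemma computable_CPos : computable (@CPos nat).
Proof.
exists (LLam (LLam (LLam (LLam (LLam (LApp (LVar 3) (LVar 4))))))).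
by lam q t rq; ret; have -> : t = enc_nat q := rq; apply: erefl.
Qed.

Lemma computable_CNeg : computable (@CNeg nat).
Proof.
exists (LLam (LLam (LLam (LLam (LLam (LApp (LVar 2) (LVar 4))))))).
by lam q t rq; ret; have -> : t = enc_nat q := rq; apply: erefl.
Qed.

Lemma computable_cprop (p : cprop nat) : computable p.
Proof. by exists (enc_cprop id p). Qed.

Definition iprop_case (f : nat -> A) (x : A) (p : iprop nat) : A :=
  if p is ILit q then f q else x.

Lemma computable_cprop_case : computable (@cprop_case A).
Proof.
exists (LLam (LLam (LLam (LLam (LLam (LApp (LApp (LApp (LApp (LVar 0) (LVar 4)) (LVar 3))
  (LVar 2)) (LVar 1))))))).
lam f tf rf; ret; lam g tg rg; ret; lam x tx rx; ret; lam y ty ry; ret; lam p tp rp.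
have -> : tp = enc_cprop id p := rp; case: p {rp} => [q|q||] /=; closed_terms; last 2 first.
- by exists tx => //; rewrite /scott; simpl_terms; normalize.
- by exists ty => //; rewrite /scott; simpl_terms; normalize.
- have v := rep_value (rep_enc_nat q); have [w e r] := rep_app rf (rep_enc_nat q).
  by exists w => //; rewrite /scott; simpl_terms; normalize.
have v := rep_value (rep_enc_nat q); have [w e r] := rep_app rg (rep_enc_nat q).
by exists w => //; rewrite /scott; simpl_terms; normalize.
Qed.

Lemma computable_iprop_case : computable iprop_case.
Proof.
exists (LLam (LLam (LLam (LApp (LApp (LVar 0) (LVar 2)) (LVar 1))))).
lam f tf rf; ret; lam x tx rx; ret; lam p tp rp.
have -> : tp = enc_iprop id p := rp; case: p {rp} => [q|] /=; closed_terms; last first.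
  by exists tx => //; rewrite /scott; simpl_terms; normalize.
have v := rep_value (rep_enc_nat q); have [w e r] := rep_app rf (rep_enc_nat q).
by exists w => //; rewrite /scott; simpl_terms; normalize.
Qed.
End Symbols.

Lemma rep_seq_nat (s : seq nat) t : rep s t <-> t = enc_seq enc_nat s.
Proof. by apply: rep_enc_seq. Qed.

(** * Recursion on formulas *)

Section Tree.
(** Classical and intuitionistic formulas are both encoded with one ternary and two binary
    constructors in the same positions, so one loop serves for both. *)
Definition tree_step : lterm :=
  LLam (LLam (LLam (LLam (LLam (LApp (LApp (LApp (LVar 0) (LVar 3))
    (LLam (LLam (LApp (LApp (LApp (LApp (LVar 4) (LVar 1)) (LVar 0))
      (LApp (LApp (LApp (LApp (LApp (LVar 6) (LVar 6)) (LVar 5)) (LVar 4)) (LVar 3)) (LVar 1)))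
      (LApp (LApp (LApp (LApp (LApp (LVar 6) (LVar 6)) (LVar 5)) (LVar 4)) (LVar 3)) (LVar 0))))))
    (LLam (LLam (LApp (LApp (LApp (LApp (LVar 3) (LVar 1)) (LVar 0))
      (LApp (LApp (LApp (LApp (LApp (LVar 6) (LVar 6)) (LVar 5)) (LVar 4)) (LVar 3)) (LVar 1)))
      (LApp (LApp (LApp (LApp (LApp (LVar 6) (LVar 6)) (LVar 5)) (LVar 4)) (LVar 3)) (LVar 0)))))))))).

Definition tree_loop a g h : lterm :=
  LLam (LApp (LApp (LApp (LApp (LApp tree_step tree_step) a) g) h) (LVar 0)).

Variables a g h : lterm.
Hypotheses (va : value a) (vg : value g) (vh : value h).

Lemma value_tree_loop : value (tree_loop a g h).
Proof. rewrite /tree_loop; is_value. Qed.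

Lemma tree_loop0 p u l : value p -> value u -> value l ->
  coeval (LApp (tree_loop a g h) (scott 3 0 [:: p; u; l])) (LApp (LApp (LApp a p) u) l).
Proof. move=> vp vu vl; rewrite /tree_loop /scott; simpl_terms; equate. Qed.

Lemma tree_loop1 t u : value t -> value u ->
  coeval (LApp (tree_loop a g h) (scott 3 1 [:: t; u]))
    (LApp (LApp (LApp (LApp g t) u) (LApp (tree_loop a g h) t)) (LApp (tree_loop a g h) u)).
Proof. move=> vt vu; rewrite /tree_loop /scott; simpl_terms; equate. Qed.

Lemma tree_loop2 t u : value t -> value u ->
  coeval (LApp (tree_loop a g h) (scott 3 2 [:: t; u]))
    (LApp (LApp (LApp (LApp h t) u) (LApp (tree_loop a g h) t)) (LApp (tree_loop a g h) u)).
Proof. move=> vt vu; rewrite /tree_loop /scott; simpl_terms; equate. Qed.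
End Tree.

Section Forms.
Context {A : Type} {RA : Rep A}.
Local Notation form := (cform nat nat).
Local Notation jform := (iform nat nat).

Definition rep_cform (X : form) t := t = enc_cform id id X.
Definition rep_iform (X : jform) t := t = enc_iform id id X.

Lemma value_enc_seq (s : seq nat) : value (enc_seq enc_nat s).
Proof. by apply: (rep_value (x := s)); apply/rep_seq_nat. Qed.

Lemma rep_cform_value X t : rep_cform X t -> value t.
Proof.
move=> ->; elim: X => [p u l|X IHX Y IHY|X IHX Y IHY] /=.
- have vp : value (enc_cprop id p) by apply: (@rep_value _ _ p).
  have vu := value_enc_seq u; have vl := value_enc_seq l.
  rewrite -!/(enc_seq enc_nat _) /scott; is_value.
- rewrite /scott; is_value.
- rewrite /scott; is_value.
Qed.
Global Instance Rep_cform : Rep form := Build_Rep rep_cform_value.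

Lemma rep_iform_value X t : rep_iform X t -> value t.
Proof.
move=> ->; elim: X => [p u l|X IHX Y IHY|X IHX Y IHY] /=.
- have vp : value (enc_iprop id p) by apply: (@rep_value _ _ p).
  have vu := value_enc_seq u; have vl := value_enc_seq l.
  rewrite -!/(enc_seq enc_nat _) /scott; is_value.
- rewrite /scott; is_value.
- rewrite /scott; is_value.
Qed.
Global Instance Rep_iform : Rep jform := Build_Rep rep_iform_value.

Definition cform_fold (a : cprop nat -> seq nat -> seq nat -> A)
    (g h : form -> form -> A -> A -> A) : form -> A :=
  fix F X := match X with
  | CAtom p u l => a p u l
  | CTens X Y => g X Y (F X) (F Y)
  | CPar X Y => h X Y (F X) (F Y)
  end.

Definition iform_fold (a : iprop nat -> seq nat -> seq nat -> A)
    (g h : jform -> jform -> A -> A -> A) : jform -> A :=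
  fix F X := match X with
  | IAtom p u l => a p u l
  | ITens X Y => g X Y (F X) (F Y)
  | ILolli X Y => h X Y (F X) (F Y)
  end.

Lemma tree_node T (RT : Rep T) (f : T -> T -> A -> A -> A) x y a b tf t u v w w1 w2 :
  rep f tf -> rep x t -> rep y u -> rep a v -> rep b w ->
  leval w1 v -> leval w2 w ->
  exists2 z, leval (LApp (LApp (LApp (LApp tf t) u) w1) w2) z & rep (f x y a b) z.
Proof.
move=> rf rx ry ra rb l1 l2.
have [z1 e1 r1] := rep_app rf rx; have [z2 e2 r2] := rep_app r1 ry.
have [z3 e3 r3] := rep_app r2 ra; have [z4 e4 r4] := rep_app r3 rb.
exists z4 => //; have c1 := coeval_trans (coeval_app (coeval_leval e1) (coeval_refl u)) (coeval_leval e2).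
have c2 := coeval_trans (coeval_app c1 (coeval_leval l1)) (coeval_leval e3).
exact: (coeval_app c2 (coeval_leval l2) z4).2.
Qed.

Lemma tree_leaf P (RP : Rep P) (f : P -> seq nat -> seq nat -> A) p u l tf t :
  rep f tf -> rep p t ->
  exists2 z, leval (LApp (LApp (LApp tf t) (enc_seq enc_nat u)) (enc_seq enc_nat l)) z &
    rep (f p u l) z.
Proof.
move=> rf rp; have ru := (rep_seq_nat u _).2 erefl; have rl := (rep_seq_nat l _).2 erefl.
have [z1 e1 r1] := rep_app rf rp; have [z2 e2 r2] := rep_app r1 ru.
have [z3 e3 r3] := rep_app r2 rl; exists z3 => //.
have c1 := coeval_trans (coeval_app (coeval_leval e1) (coeval_refl _)) (coeval_leval e2).
exact: (coeval_app c1 (coeval_refl _) z3).2.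
Qed.

Lemma computable_cform_fold : computable cform_fold.
Proof.
exists (LLam (LLam (LLam (tree_loop (LVar 3) (LVar 2) (LVar 1))))).
lam a ta ra; ret; lam g tg rg; ret; lam h th rh; exists (tree_loop ta tg th).
  exact: coeval_refl.
closed_terms; split; first exact: value_tree_loop.
move=> X u ru; have -> : u = enc_cform id id X := ru; elim: X {u ru} => [p u l|X IHX Y IHY|X IHX Y IHY] /=.
- have rp : rep p (enc_cprop id p) by [].
  have [z e r] := tree_leaf u l ra rp; exists z => //.
  have vu := value_enc_seq u; have vl := value_enc_seq l.
  by apply: (tree_loop0 _ _ _ (rep_value rp) vu vl z).2.
- have [w1 e1 r1] := IHX; have [w2 e2 r2] := IHY.
  have rX : rep X (enc_cform id id X) by []; have rY : rep Y (enc_cform id id Y) by [].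
  have [z e r] := tree_node rg rX rY r1 r2 e1 e2; exists z => //.
  by apply: (tree_loop1 _ _ _ (rep_value rX) (rep_value rY) z).2.
have [w1 e1 r1] := IHX; have [w2 e2 r2] := IHY.
have rX : rep X (enc_cform id id X) by []; have rY : rep Y (enc_cform id id Y) by [].
have [z e r] := tree_node rh rX rY r1 r2 e1 e2; exists z => //.
by apply: (tree_loop2 _ _ _ (rep_value rX) (rep_value rY) z).2.
Qed.

Lemma computable_iform_fold : computable iform_fold.
Proof.
exists (LLam (LLam (LLam (tree_loop (LVar 3) (LVar 2) (LVar 1))))).
lam a ta ra; ret; lam g tg rg; ret; lam h th rh; exists (tree_loop ta tg th).
  exact: coeval_refl.
closed_terms; split; first exact: value_tree_loop.
move=> X u ru; have -> : u = enc_iform id id X := ru; elim: X {u ru} => [p u l|X IHX Y IHY|X IHX Y IHY] /=.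
- have rp : rep p (enc_iprop id p) by [].
  have [z e r] := tree_leaf u l ra rp; exists z => //.
  have vu := value_enc_seq u; have vl := value_enc_seq l.
  by apply: (tree_loop0 _ _ _ (rep_value rp) vu vl z).2.
- have [w1 e1 r1] := IHX; have [w2 e2 r2] := IHY.
  have rX : rep X (enc_iform id id X) by []; have rY : rep Y (enc_iform id id Y) by [].
  have [z e r] := tree_node rg rX rY r1 r2 e1 e2; exists z => //.
  by apply: (tree_loop1 _ _ _ (rep_value rX) (rep_value rY) z).2.
have [w1 e1 r1] := IHX; have [w2 e2 r2] := IHY.
have rX : rep X (enc_iform id id X) by []; have rY : rep Y (enc_iform id id Y) by [].
have [z e r] := tree_node rh rX rY r1 r2 e1 e2; exists z => //.
by apply: (tree_loop2 _ _ _ (rep_value rX) (rep_value rY) z).2.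
Qed.

Lemma computable_CAtom : computable (@CAtom nat nat).
Proof.
exists (LLam (LLam (LLam (LLam (LLam (LLam (LApp (LApp (LApp (LVar 2) (LVar 5)) (LVar 4)) (LVar 3)))))))).
lam p tp rp; ret; lam u tu ru; ret; lam l tl rl; ret.
have -> : tp = enc_cprop id p := rp.
by rewrite ((rep_seq_nat u tu).1 ru) ((rep_seq_nat l tl).1 rl).
Qed.

Lemma computable_CTens : computable (@CTens nat nat).
Proof.
exists (LLam (LLam (LLam (LLam (LLam (LApp (LApp (LVar 1) (LVar 4)) (LVar 3))))))).
lam X tX rX; ret; lam Y tY rY; ret.
by have -> : tX = enc_cform id id X := rX; have -> : tY = enc_cform id id Y := rY.
Qed.

Lemma computable_CPar : computable (@CPar nat nat).
Proof.
exists (LLam (LLam (LLam (LLam (LLam (LApp (LApp (LVar 0) (LVar 4)) (LVar 3))))))).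
lam X tX rX; ret; lam Y tY rY; ret.
by have -> : tX = enc_cform id id X := rX; have -> : tY = enc_cform id id Y := rY.
Qed.
End Forms.

Lemma computable_test (A B : Type) (RA : Rep A) (RB : Rep B) (b : A -> bool) (x y : A -> B) :
  computable b -> computable x -> computable y ->
  computable (fun a => if b a then x a else y a).
Proof.
move=> cb cx cy.
apply: (computable_app (f := fun a z => if b a then x a else z) _ cy).
apply: (computable_app (f := fun a y z => if b a then y else z) _ cx).
apply: (computable_app (f := fun a (b : bool) y z => if b then y else z) _ cb).
exact/computable_const/computable_cond.
Qed.

(* Compilation of expressions *)
Create HintDb comp.
#[export] Hint Resolve computable_bool computable_nat computable_S computable_pair computable_fst
  computable_snd computable_nat_fold computable_nil computable_cons computable_seq_fold
  computable_None computable_Some computable_option_case computable_CPos computable_CNeg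
  computable_cprop computable_cprop_case computable_iprop_case computable_cform_fold
  computable_iform_fold computable_CAtom computable_CTens computable_CPar : comp.

Ltac comp_leaf := solve [simple apply computable_id | auto 1 with comp nocore | assumption].

(** Bracket abstraction directed by syntax: inner abstractions are uncurried, applications split by
    [computable_app], and named functions looked up among the hints. *)
Ltac comp :=
  lazymatch goal with
  | |- computable (fun x => x) => apply: computable_id
  | |- computable (fun _ => ?c) => apply: computable_const; comp
  | |- computable (fun x y => _) => apply: computable_curry; cbv beta; comp
  | |- computable (fun x : ?T => ?h (@?a1 x)) =>
      let f := eval cbv beta in (fun x : T => h) in
      refine (@computable_app _ _ _ _ _ _ f a1 _ _); comp
  | |- computable (fun x : ?T => ?h (@?a1 x) (@?a2 x)) =>
      let f := eval cbv beta in (fun x : T => h (a1 x)) in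
      refine (@computable_app _ _ _ _ _ _ f a2 _ _); comp
  | |- computable (fun x : ?T => ?h (@?a1 x) (@?a2 x) (@?a3 x)) =>
      let f := eval cbv beta in (fun x : T => h (a1 x) (a2 x)) in
      refine (@computable_app _ _ _ _ _ _ f a3 _ _); comp
  | |- computable (fun x : ?T => ?h (@?a1 x) (@?a2 x) (@?a3 x) (@?a4 x)) =>
      let f := eval cbv beta in (fun x : T => h (a1 x) (a2 x) (a3 x)) in
      refine (@computable_app _ _ _ _ _ _ f a4 _ _); comp
  | |- computable (fun x : ?T => ?h (@?a1 x) (@?a2 x) (@?a3 x) (@?a4 x) (@?a5 x)) =>
      let f := eval cbv beta in (fun x : T => h (a1 x) (a2 x) (a3 x) (a4 x)) in
      refine (@computable_app _ _ _ _ _ _ f a5 _ _); comp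
  | |- computable (fun x : ?T => ?h (@?a1 x) (@?a2 x) (@?a3 x) (@?a4 x) (@?a5 x) (@?a6 x)) =>
      let f := eval cbv beta in (fun x : T => h (a1 x) (a2 x) (a3 x) (a4 x) (a5 x)) in
      refine (@computable_app _ _ _ _ _ _ f a6 _ _); comp
  | |- computable (fun x : ?T => ?h (@?a1 x) (@?a2 x) (@?a3 x) (@?a4 x) (@?a5 x) (@?a6 x) (@?a7 x)) =>
      let f := eval cbv beta in (fun x : T => h (a1 x) (a2 x) (a3 x) (a4 x) (a5 x) (a6 x)) in
      refine (@computable_app _ _ _ _ _ _ f a7 _ _); comp
  | |- computable (fun x => _) => apply: computable_test; comp
  | |- computable (?f ?a) => first [comp_leaf | refine (@computable_apply _ _ _ _ f a _ _); comp]
  | |- _ => comp_leaf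
  end.

(** Recursive functions are handled by first replacing them, up to extensionality, by an expression
    built from folds. *)
Lemma computable_ext (A : Type) (RA : Rep A) (x y : A) : x = y -> computable y -> computable x.
Proof. by move->. Qed.

Section Lists.
Context {A B C : Type} {RA : Rep A} {RB : Rep B} {RC : Rep C}.

Lemma computable_negb : computable negb.
Proof. apply: (computable_ext (y := fun b => if b then false else true)) => //; comp. Qed.

Lemma computable_andb : computable andb.
Proof. apply: (computable_ext (y := fun b c => if b then c else false)) => //; comp. Qed.

Lemma computable_foldr : computable (@foldr A B).
Proof.
apply: (computable_ext (y := fun f z s => seq_fold z (fun x t r => f x r) s)); last by comp.
by apply/funext => f; apply/funext => z; apply/funext; elim=> //= x s ->.
Qed.

End Lists.
#[export] Hint Resolve computable_negb computable_andb computable_foldr : comp.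

Section Maps.
Context {A B C : Type} {RA : Rep A} {RB : Rep B} {RC : Rep C}.

Lemma computable_map : computable (@map A B).
Proof.
apply: (computable_ext (y := fun f s => foldr (fun x r => f x :: r) [::] s)); last by comp.
by apply/funext => f; apply/funext; elim=> //= x s ->.
Qed.

Lemma computable_cat : computable (@cat A).
Proof.
apply: (computable_ext (y := fun s t => foldr (fun x r => x :: r) t s)); last by comp.
by apply/funext => s; apply/funext => t; elim: s => //= x s ->.
Qed.

Lemma computable_filter : computable (@filter A).
Proof.
apply: (computable_ext (y := fun p s => foldr (fun x r => if p x then x :: r else r) [::] s)); last by comp.
by apply/funext => p; apply/funext; elim=> //= x s ->.
Qed.

Lemma computable_has : computable (@has A).
Proof.
apply: (computable_ext (y := fun p s => foldr (fun x r => if p x then true else r) false s)); last by comp.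
by apply/funext => p; apply/funext; elim=> //= x s ->.
Qed.

Lemma computable_all : computable (@all A).
Proof.
apply: (computable_ext (y := fun p s => foldr (fun x r => if p x then r else false) true s)); last by comp.
by apply/funext => p; apply/funext; elim=> //= x s ->.
Qed.

Lemma computable_size : computable (@size A).
Proof.
apply: (computable_ext (y := fun s => foldr (fun x r => r.+1) 0 s)); last by comp.
by apply/funext; elim=> //= x s ->.
Qed.

Lemma computable_iter : computable (@iter A).
Proof.
apply: (computable_ext (y := fun n f x => nat_fold x (fun m r => f r) n)); last by comp.
by apply/funext => n; apply/funext => f; apply/funext => x; elim: n => //= n ->.
Qed.

Lemma computable_zip : computable (@zip A B).
Proof.
(* Recursion on the first list yields a function of the second; equality of numerals and [iota] are
   treated in the same way. *)
apply: (computable_ext (y := fun s => seq_fold (fun _ => [::])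
    (fun x s' r t => seq_fold [::] (fun y t' q => (x, y) :: r t') t) s)); last by comp.
by apply/funext => s; apply/funext; elim: s => [|x s IH] [|y t] //=; rewrite IH.
Qed.
End Maps.
#[export] Hint Resolve computable_map computable_cat computable_filter computable_has
  computable_all computable_size computable_iter computable_zip : comp.

Section Enumerations.
Context {A B C : Type} {RA : Rep A} {RB : Rep B} {RC : Rep C}.

Lemma computable_flatten : computable (@flatten A).
Proof. apply: (computable_ext (y := fun s => foldr cat [::] s)) => //; comp. Qed.

Lemma computable_rev : computable (@rev A).
Proof.
apply: (computable_ext (y := fun s => foldr (fun x r => r ++ [:: x]) [::] s)); last by comp.
by apply/funext; elim=> //= x s IH; rewrite rev_cons IH cats1.
Qed.

Lemma computable_addn : computable addn.
Proof.
apply: (computable_ext (y := fun m n => iter m S n)); last by comp.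
by apply/funext => m; apply/funext => n; rewrite iter_succn addnC.
Qed.

Lemma computable_eqn : computable eqn.
Proof.
apply: (computable_ext (y := fun m => nat_fold (fun n => nat_fold true (fun _ _ => false) n)
    (fun m' r n => nat_fold false (fun n' q => r n') n) m)); last by comp.
by apply/funext => m; apply/funext; elim: m => [|m IH] [|n] //=.
Qed.

Lemma computable_iota : computable iota.
Proof.
apply: (computable_ext (y := fun m n => nat_fold (fun _ => [::]) (fun n' r m => m :: r m.+1) n m)); last by comp.
by apply/funext => m; apply/funext => n; elim: n m => //= n IH m; rewrite IH.
Qed.

Lemma computable_picks : computable (@picks A).
Proof.
apply: (computable_ext (y := fun s => seq_fold [::]
    (fun x s' r => (x, s') :: map (fun y => (y.1, x :: y.2)) r) s)); last by comp.
by apply/funext; elim=> //= x s ->.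
Qed.

Lemma computable_splits : computable (@splits A).
Proof.
apply: (computable_ext (y := fun s => foldr (fun x r =>
    map (fun y => (x :: y.1, y.2)) r ++ map (fun y => (y.1, x :: y.2)) r)
    [:: ([::], [::])] s)); last by comp.
by apply/funext; elim=> //= x s ->.
Qed.
End Enumerations.
#[export] Hint Resolve computable_flatten computable_rev computable_addn computable_eqn
  computable_iota computable_picks computable_splits : comp.

(** * Computability of the search *)

Lemma computable_edge_case (A : Type) (RA : Rep A) : computable (@edge_case A).
Proof.
apply: (computable_ext (y := fun x f e => option_case x (fun e' => f e'.1 e'.2) e)) => //; comp.
Qed.

Lemma computable_cform_case (A : Type) (RA : Rep A) : computable (@cform_case A).
Proof.
apply: (computable_ext (y := fun f g h X => cform_fold f (fun Y Z a b => g Y Z)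
  (fun Y Z a b => h Y Z) X)); last by comp.
by apply/funext => f; apply/funext => g; apply/funext => h; apply/funext; case.
Qed.

#[export] Hint Resolve computable_edge_case computable_cform_case : comp.

Lemma computable_eqport : computable eqport.
Proof. by rewrite /eqport; comp. Qed.
#[export] Hint Resolve computable_eqport : comp.

Lemma computable_eqedge : computable eqedge.
Proof. by rewrite /eqedge; comp. Qed.
#[export] Hint Resolve computable_eqedge : comp.

Lemma computable_eqwiring : computable eqwiring.
Proof. by rewrite /eqwiring; comp. Qed.

Lemma computable_mkedge : computable mkedge.
Proof. by rewrite /mkedge; comp. Qed.

Lemma computable_edges : computable edges.
Proof. by rewrite /edges; comp. Qed.
#[export] Hint Resolve computable_eqwiring computable_mkedge computable_edges : comp.

Lemma computable_unconn : computable unconn.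
Proof. by rewrite /unconn; comp. Qed.
#[export] Hint Resolve computable_unconn : comp.

Lemma computable_unconns : computable unconns.
Proof. by rewrite /unconns; comp. Qed.

Lemma computable_rewire : computable rewire.
Proof. by rewrite /rewire; comp. Qed.

Lemma computable_is_axiom : computable is_axiom.
Proof. by rewrite /is_axiom; comp. Qed.

Lemma computable_done_if : computable done_if.
Proof. by rewrite /done_if; comp. Qed.
#[export] Hint Resolve computable_unconns computable_rewire computable_is_axiom computable_done_if : comp.

Lemma computable_atom_step : computable atom_step.
Proof. by rewrite /atom_step; comp. Qed.
#[export] Hint Resolve computable_atom_step : comp.

Lemma computable_coccs : computable (@coccs nat nat).
Proof.
apply: (computable_ext (y := fun b A => cform_fold (fun p u l => if b then u else l)
  (fun X Y s t => s ++ t) (fun X Y s t => s ++ t) A)); last by comp.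
by apply/funext => b; apply/funext; elim=> //= A -> B ->.
Qed.
#[export] Hint Resolve computable_coccs : comp.

(** Generic membership rests on the equality of an eqType, to which [comp] does not apply; this
    version and those below for free indices and wirings use [eqn] on numerals. *)
Definition memn (s : seq nat) (x : nat) : bool := has (eqn x) s.

Lemma memnE s x : memn s x = (x \in s).
Proof. by elim: s => //= y s IH; rewrite inE -IH eqnE. Qed.

Lemma computable_memn : computable memn.
Proof. by rewrite /memn; comp. Qed.
#[export] Hint Resolve computable_memn : comp.

Definition cfree_nat b (A : form) : seq nat :=
  filter (fun i => ~~ memn (coccs (~~ b) A) i) (coccs b A).

Lemma cfree_natE b A : cfree b A = cfree_nat b A.
Proof. by apply: eq_filter => i; rewrite memnE. Qed.

Lemma computable_cfree : computable cfree_nat.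
Proof. by rewrite /cfree_nat; comp. Qed.
#[export] Hint Resolve computable_cfree : comp.

Lemma computable_bindings : computable bindings.
Proof.
apply: (computable_ext (y := fun k A B => map (pair k)
  (filter (memn (coccs false B)) (coccs true A) ++
   filter (memn (coccs false A)) (coccs true B)))); last by comp.
apply/funext => k; apply/funext => A; apply/funext => B.
by rewrite /bindings /bound; congr (map _ (_ ++ _)); apply: eq_filter => x; rewrite memnE.
Qed.
#[export] Hint Resolve computable_bindings : comp.

Lemma computable_tens_step : computable tens_step.
Proof. by rewrite /tens_step; comp. Qed.

Lemma computable_par_step : computable par_step.
Proof. by rewrite /par_step; comp. Qed.
#[export] Hint Resolve computable_tens_step computable_par_step : comp.

Lemma computable_step : computable step.
Proof. by rewrite /step; comp. Qed.
#[export] Hint Resolve computable_step : comp.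

Lemma computable_expand : computable expand.
Proof. by rewrite /expand; comp. Qed.
#[export] Hint Resolve computable_expand : comp.

Lemma computable_search : computable search.
Proof. by rewrite /search; comp. Qed.
#[export] Hint Resolve computable_search : comp.

Definition context_nat (G : seq form) : seq item := zip (iota 0 (size G)) G.

Lemma computable_context : computable context_nat.
Proof. by rewrite /context_nat; comp. Qed.
#[export] Hint Resolve computable_context : comp.

Definition links_nat b (G : seq form) : seq (port * nat) :=
  flatten (map (fun X => map (fun x => ((X.1, x), x)) (cfree_nat b X.2)) (context_nat G)).

Lemma computable_links : computable links_nat.
Proof. by rewrite /links_nat; comp. Qed.
#[export] Hint Resolve computable_links : comp.

Definition wiring_nat (G : seq form) : seq edge :=
  flatten (map (fun u => map (fun l => mkedge u.1 l.1)
    (filter (fun l => eqn l.2 u.2) (links_nat false G))) (links_nat true G)).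

Lemma computable_wiring : computable wiring_nat.
Proof. by rewrite /wiring_nat; comp. Qed.
#[export] Hint Resolve computable_wiring : comp.

Lemma wiring_natE G : wiring_of G = wiring_nat G.
Proof.
have e b : tag_links b G = links_nat b G.
  by congr flatten; apply: eq_map => X; rewrite cfree_natE.
by rewrite /wiring_of !e.
Qed.

Lemma computable_weight : computable weight.
Proof.
apply: (computable_ext (y := fun A => cform_fold (fun p u l => 1)
  (fun X Y m n => (m + n).+1) (fun X Y m n => (m + n).+1) A)); last by comp.
by apply/funext; elim=> //= A -> B ->.
Qed.
#[export] Hint Resolve computable_weight : comp.

Lemma computable_size_ctx : computable size_ctx.
Proof. by rewrite /size_ctx; comp. Qed.
#[export] Hint Resolve computable_size_ctx : comp.

Theorem computable_decide : computable decide.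
Proof.
apply: (computable_ext (y := fun G => search (size_ctx (context_nat G)).+1
  (context_nat G, wiring_nat G))); last by comp.
by apply/funext => G; rewrite /decide wiring_natE.
Qed.
#[export] Hint Resolve computable_decide : comp.

Lemma computable_cdual : computable (@cdual nat nat).
Proof.
apply: (computable_ext (y := fun A => cform_fold
  (fun p u l => CAtom (cprop_case (@CNeg nat) (@CPos nat) CBot COne p) (rev l) (rev u))
  (fun X Y (A B : form) => CPar B A) (fun X Y (A B : form) => CTens B A) A)); last by comp.
by apply/funext; elim=> [[q|q||] u l|A IHA B IHB|A IHA B IHB] //=; rewrite IHA IHB.
Qed.
#[export] Hint Resolve computable_cdual : comp.

Definition pos_nat : iform nat nat -> form :=
  iform_fold (fun p u l => CAtom (iprop_case (@CPos nat) COne p) u l)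
    (fun X Y (A B : form) => CTens A B) (fun X Y (A B : form) => CPar (cdual A) B).

Lemma computable_pos : computable pos_nat.
Proof. by rewrite /pos_nat; comp. Qed.
#[export] Hint Resolve computable_pos : comp.

Lemma pos_natE A : pos A = pos_nat A.
Proof. by elim: A => [[q|] u l|A IHA B IHB|A IHA B IHB] //=; rewrite IHA IHB. Qed.

Theorem computable_idecide :
  computable (fun S : seq (iform nat nat) * iform nat nat =>
    decide (pos_nat S.2 :: map (fun A => cdual (pos_nat A)) S.1)).
Proof. comp. Qed.

(** * Decision on codes of sequents *)

Lemma infinite_inhabited (I : eqType) : infinite_eqType I -> inhabited I.
Proof. by case/(_ [::]) => x _; split. Qed.

(** The code of a sequent under a naming is literally the encoding of the sequent renamed to
    numerals, so one term serves for all sets of indices and literals. *)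
Lemma rep_ccode (I L : eqType) (nI : I -> nat) (nL : L -> nat) (G : seq (cform I L)) :
  rep (map (relabel nI (Some \o nL)) G) (enc_seq (enc_cform nI nL) G).
Proof.
apply/(rep_enc_seq (enc := enc_cform id id)) => //.
by rewrite enc_seq_map; elim: G => //= A G ->; rewrite -enc_relabel.
Qed.

Lemma rep_icode (I L : eqType) (nI : I -> nat) (nL : L -> nat) (G : seq (iform I L)) A :
  rep (map (irelabel nI nL) G, irelabel nI nL A)
    (scott 1 0 [:: enc_seq (enc_iform nI nL) G; enc_iform nI nL A]).
Proof.
exists (enc_seq (enc_iform nI nL) G), (enc_iform nI nL A); split=> //.
  apply/(rep_enc_seq (enc := enc_iform id id)) => //.
  by rewrite enc_seq_map; elim: G => //= B G ->; rewrite -enc_irelabel.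
by rewrite enc_irelabel.
Qed.

Lemma decide_names (I L : eqType) (nI : I -> nat) (nL : L -> nat) (G : seq (cform I L)) :
  inhabited I -> {in flatten (map (@cindices I L) G) &, injective nI} ->
  {in flatten (map (@clits I L) G) &, injective nL} ->
  decide (map (relabel nI (Some \o nL)) G) <-> derivable (tag_context G) (wiring_of G).
Proof.
move=> i injI injL; apply: iff_trans (decideP _) _.
exact: iff_sym (derivable_names i injI injL).
Qed.

Theorem corollary6p6
    (Ind : eqType) (Ind_inf : infinite_eqType Ind)
    (Lp : eqType) (vp : Lp -> nat * nat)
    (L : eqType) (v : L -> nat * nat) :
  L_decidable (@ccodes Ind Lp)
    (fun G : seq (cform Ind Lp) => csequent vp G)
    (fun G : seq (cform Ind Lp) => TTL vp G) /\
  L_decidable (@icodes Ind L)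
    (fun S : seq (iform Ind L) * iform Ind L => isequent v S.1 S.2)
    (fun S : seq (iform Ind L) * iform Ind L => ITTL v S.1 S.2).
Proof.
have inh := infinite_inhabited Ind_inf; split.
  have [t rt] := computable_decide; exists t; first exact: value_closed (rep_value rt).
  move=> G c cs [nI [nL [injI injL ->]]].
  have [w e r] := rep_app rt (rep_ccode nI nL G).
  exists (decide (map (relabel nI (Some \o nL)) G)); last first.
    by have <- : w = enc_bool (decide (map (relabel nI (Some \o nL)) G)) := r.
  (* Only wired derivability is transported to numerals. It does not mention valencies, so none have
     to be assigned to the names of literals. *)
  apply: iff_trans (TTL_derivableE Ind_inf cs) _.
  exact: iff_sym (decide_names inh injI injL).
have [t rt] := computable_idecide; exists t; first exact: value_closed (rep_value rt).
move=> [G A] c cs [nI [nL [/= injI injL ->]]].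
have [w e r] := rep_app rt (rep_icode nI nL G A).
exists (decide (map (relabel nI (Some \o nL)) (translation G A))); last first.
  rewrite -translation_irelabel.
  have <- // : w = enc_bool (decide (translation (map (irelabel nI nL) G) (irelabel nI nL A))).
  have {}r : w = enc_bool (decide (pos_nat (irelabel nI nL A) ::
    map (fun B => cdual (pos_nat B)) (map (irelabel nI nL) G))) := r.
  rewrite r /translation pos_natE; congr (enc_bool (decide (_ :: _))).
  by apply: eq_map => B; rewrite /neg pos_natE.
apply: iff_trans (ITTL_derivable Ind_inf cs) _; apply: iff_sym; apply: decide_names => //.
  by have [e1 _] := mem_translation G A => x y; rewrite !e1; apply: injI.
by have [_ e2] := mem_translation G A => x y; rewrite !e2; apply: injL.
Qed.
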